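(* Let $\mathcal{K}$ be the Andersson--Samuelsson Koppelman integral operator from $X'$ to $X$ on the $A_1$-singularity (as defined in the context), and let $\frac{4}{3}<p\le\infty$ and $q\in\{1,2\}$. Then: (i) $\mathcal{K}$ gives a bounded linear operator from $L^p_{0,q}(X')$ to $L^p_{0,q-1}(X)$. (ii) $\mathcal{K}$ gives a continuous linear operator from $L^\infty_{0,q}(X')$ to $C^0_{0,q-1}(X)$.
   Context: Spaces. Fix $\epsilon>0$, let $D=B_1(0)$ and $D'=B_{1+\epsilon}(0)$ be balls in $\mathbb{C}^3$, and let $X=\{\zeta\in D:\zeta_1\zeta_2-\zeta_3^2=0\}$, $X'=\{\zeta\in D':\zeta_1\zeta_2-\zeta_3^2=0\}$; the only singular point is $0$. $X\setminus\{0\}$ and $X'\setminus\{0\}$ carry the Hermitian metric induced from $\mathbb{C}^3$ and the induced volume form. $L^p_{0,q}(X)$ is the space of (classes of) measurable $(0,q)$-forms $\varphi$ on $X\setminus\{0\}$ whose pointwise norm $|\varphi|$ is in $L^p$ with respect to the induced volume ($\{0\}$ is a null set); similarly for $X'$. A $(0,q)$-form $\varphi$ on $X$ is continuous at a point $a\in X$ if it has a representation $\varphi=\sum_{|I|=q}\varphi_I\,d\bar z_I$ (with $d\bar z_I$ restricted from $\mathbb{C}^3$) in which all coefficient functions $\varphi_I$ on $X$ are continuous at $a$. $C^0_{0,q}(X)$ is the space of $(0,q)$-forms continuous at every point of $X$, with the Fréchet topology given by the seminorms $\|\cdot\|_{L^\infty,K_j}$ for a compact exhaustion $K_1\subset K_2\subset\cdots$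 of $X$. Operator. Let $\zeta\in X'$, $z\in X$, $\eta=\zeta-z$, $d\eta=d\eta_1\wedge d\eta_2\wedge d\eta_3$, and let $\chi=\chi(\zeta)$ be a smooth cut-off function with compact support in $D'$ and $\chi\equiv1$ in a neighborhood of $\overline D$. Put $$h=\tfrac12\big((\zeta_2+z_2)d\eta_1+(\zeta_1+z_1)d\eta_2\big)-(\zeta_3+z_3)d\eta_3,\quad s=\frac{\sum_j\bar\eta_j d\eta_j}{2\pi i\|\eta\|^2},\quad \sigma=\frac{\sum_j\bar\zeta_j d\eta_j}{2\pi i(\|\zeta\|^2-\sum_j\bar\zeta_j z_j)}.$$ With $\bar\partial$ acting in $(\zeta,z)$, let $\tilde K(\zeta,z)$ be the form of degree one in $d\bar\zeta_j,d\bar z_j$ determined by $$d\eta\wedge\tilde K=h\wedge\big(\chi\, s\wedge\bar\partial s-\bar\partial\chi\wedge\sigma\wedge s\big).$$ Let $\omega_{X'}=\frac{d\zeta_1\wedge d\zeta_2}{-2\zeta_3}\big|_{X'}$, $K(\zeta,z)=\omega_{X'}(\zeta)\wedge\tilde K(\zeta,z)$ and $$(\mathcal{K}\varphi)(z)=\int_{X'}K(\zeta,z)\wedge\varphi(\zeta),$$ which takes $(0,q)$-forms on $X'$ to $(0,q-1)$-forms on $X$. *)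

(* Defs.v *)
From HB Require Import structures.
From mathcomp Require Import all_boot all_order all_algebra.
From mathcomp Require Import complex.
From mathcomp Require Import ring zify.
From mathcomp Require Import all_classical all_reals all_analysis.
From mathcomp Require Import measurable_realfun.

Set Implicit Arguments.
Unset Strict Implicit.
Unset Printing Implicit Defensive.

Import Order.TTheory GRing.Theory Num.Theory.
Import numFieldNormedType.Exports.

Local Open Scope classical_set_scope.
Local Open Scope complex_scope.
Local Open Scope ring_scope.

(** * Exterior algebras

    An element of [ext R n] is a complex exterior form on [n] generators
    [e_0, ..., e_(n-1)]: the coefficient at [I : {set 'I_n}] is that of the
    wedge of the [e_i], [i] in [I], in increasing order. *)

Notation ext R n := {ffun {set 'I_n} -> (complex R)^o}.

Section Exterior.
Variable R : realType.

Definition inversions n (I J : {set 'I_n}) : nat :=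
  #|[set p : 'I_n * 'I_n | [&& p.1 \in I, p.2 \in J & (p.2 < p.1)%N]]%SET|.

Definition wedge n (a b : ext R n) : ext R n :=
  [ffun K : {set 'I_n} => \sum_(I : {set 'I_n} | I \subset K)
     (-1) ^+ inversions I (K :\: I)%SET * a I * b (K :\: I)%SET].

Definition monom n (I : {set 'I_n}) : ext R n := [ffun J => (J == I)%:R].

Definition gen n (i : 'I_n) : ext R n := monom [set i]%SET.

(* The algebra morphism determined by [e_i |-> f i]. *)
Definition ext_subst m n (f : 'I_m -> ext R n) (a : ext R m) : ext R n :=
  \sum_(I : {set 'I_m})
     a I *: \big[@wedge n / monom finset.set0]_(i <- enum I) f i.

Definition homogeneous n (q : nat) (a : ext R n) : Prop :=
  forall I : {set 'I_n}, #|I| != q -> a I = 0.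

End Exterior.

(** * Points of C, C^2 and C^3

    C is carried by the real plane, so that C^2 and C^3 inherit their topology,
    Borel sets and Lebesgue measure from products of the real line;
    [toC] and [crd] give the complex coordinates. *)

Notation plane R := (measurableTypeR R * measurableTypeR R)%type.
Notation C2 R := (plane R * plane R)%type.
Notation C3 R := (plane R * plane R * plane R)%type.

Section Spaces.
Variable R : realType.

Definition toC (x : plane R) : R[i] := x.1 +i* x.2.
Definition fromC (c : R[i]) : plane R := (complex.Re c, complex.Im c).

Definition cabs2 (c : R[i]) : R := complex.Re c ^+ 2 + complex.Im c ^+ 2.

Definition crd (x : C3 R) (j : 'I_3) : R[i] :=
  [:: toC x.1.1; toC x.1.2; toC x.2]`_j.

Definition z1 (x : C3 R) : R[i] := toC x.1.1.
Definition z2 (x : C3 R) : R[i] := toC x.1.2.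
Definition z3 (x : C3 R) : R[i] := toC x.2.

Definition norm2 (x : C3 R) : R := \sum_j cabs2 (crd x j).

Definition ball0 (r : R) : set (C3 R) := [set x | Num.sqrt (norm2 x) < r].

Definition cone : set (C3 R) := [set x | z1 x * z2 x - z3 x ^+ 2 = 0].

(* X is [Xball 1] and X' is [Xball (1 + eps)]. *)
Definition Xball (r : R) : set (C3 R) := ball0 r `&` cone.

End Spaces.

(** * Integration on the regular part of the cone

    [cover] is a two-sheeted unramified covering of the regular part of [cone]
    by C^2 minus the origin ([cover_cone], [cover_surj], [cover_fiber]), so
    integrals over the cone are half of the integrals of the pull-backs. *)

Lemma product_sigma_finite d1 d2 (T1 : measurableType d1)
    (T2 : measurableType d2) (R : realType)
    (m1 : {sigma_finite_measure set T1 -> \bar R})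
    (m2 : {sigma_finite_measure set T2 -> \bar R}) :
  sigma_finite setT (m1 \x m2)%E.
Proof.
have /sigma_finiteP[F [TF ndF Foo]] := sigma_finiteT m1.
have /sigma_finiteP[G [TG ndG Goo]] := sigma_finiteT m2.
exists (fun n => F n `*` G n).
  rewrite -setXTT TF TG predeqE => -[x y]; split.
    move=> [/= [n _ Fnx] [k _ Gky]]; exists (maxn n k) => //; split.
    - by move: x Fnx; exact/subsetPset/ndF/leq_maxl.
    - by move: y Gky; exact/subsetPset/ndG/leq_maxr.
  by move=> [n _ []/= ? ?]; split; exists n.
move=> k; have [? ?] := Foo k; have [? ?] := Goo k.
split; first exact: measurableX.
by rewrite product_measure1E// lte_mul_pinfty// ge0_fin_numE.
Qed.

Section Integration.
Variable R : realType.

Definition leb2 : set (plane R) -> \bar R :=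
  (@lebesgue_measure R \x @lebesgue_measure R)%E.
HB.instance Definition _ := Measure.on leb2.
HB.instance Definition _ :=
  Measure_isSigmaFinite.Build _ _ _ leb2 (product_sigma_finite _ _).

Definition leb4 : set (C2 R) -> \bar R := (leb2 \x leb2)%E.
HB.instance Definition _ := Measure.on leb4.
HB.instance Definition _ :=
  Measure_isSigmaFinite.Build _ _ _ leb4 (product_sigma_finite _ _).

Definition w1 (w : C2 R) : R[i] := toC w.1.
Definition w2 (w : C2 R) : R[i] := toC w.2.

Definition cover (w : C2 R) : C3 R :=
  (fromC (w1 w ^+ 2), fromC (w2 w ^+ 2), fromC (w1 w * w2 w)).

Lemma toCK : cancel (@toC R) (@fromC R).
Proof. by case. Qed.

Lemma fromCK : cancel (@fromC R) (@toC R).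
Proof. by case. Qed.

Lemma cover_cone w : cone (cover w).
Proof. by rewrite /cone /= /z1 /z2 /z3 !fromCK exprMn subrr. Qed.

Lemma cover_surj z : cone z -> exists w, cover w = z.
Proof.
case: z => -[a b] c; rewrite /cone /= /z1 /z2 /z3 /= => /eqP.
rewrite subr_eq0 => /eqP h.
pose u := sqrtc (toC a); pose v := sqrtc (toC b).
have hu : u ^+ 2 = toC a by exact: sqr_sqrtc.
have hv : v ^+ 2 = toC b by exact: sqr_sqrtc.
have : (u * v) ^+ 2 == toC c ^+ 2 by rewrite exprMn hu hv h.
rewrite eqf_sqr => /orP[] /eqP uvc.
  exists (fromC u, fromC v).
  by rewrite /cover /w1 /w2 /= !fromCK hu hv uvc !toCK.
exists (fromC u, fromC (- v)).
by rewrite /cover /w1 /w2 /= !fromCK sqrrN mulrN hu hv uvc opprK !toCK.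
Qed.

Lemma cover_fiber w w' : cover w = cover w' <-> w' = w \/ w' = - w.
Proof.
have NC (x : plane R) : toC (- x) = - toC x by [].
have toC_inj := can_inj toCK.
split; last first.
  by case=> -> //; rewrite /cover /w1 /w2 /= !NC !sqrrN mulrNN.
case: w w' => [a b] [a' b'] h.
have /eqP := congr1 (fun x : C3 R => toC x.1.1) h.
have /eqP := congr1 (fun x : C3 R => toC x.1.2) h.
have := congr1 (fun x : C3 R => toC x.2) h.
rewrite /= !fromCK /w1 /w2 /= => hab; rewrite !eqf_sqr => hb ha.
have [a0|a0] := eqVneq (toC a) 0.
  have a'0 : toC a' = 0.
    by move: ha; rewrite a0 => /orP[/eqP <- //|/eqP e]; rewrite -[toC a']opprK -e oppr0.
  have aa' : a = a' by apply: toC_inj; rewrite a0 a'0.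
  have a'N : a' = - a by apply: toC_inj; rewrite NC a'0 a0 oppr0.
  case/orP: hb => /eqP hb; [left|right].
    by rewrite aa' (toC_inj _ _ hb).
  by rewrite a'N; congr pair; apply: toC_inj; rewrite NC hb opprK.
case/orP: ha => /eqP ha; [left|right].
  have /toC_inj -> : toC b' = toC b.
    by apply: (mulfI a0); rewrite hab ha.
  by rewrite (toC_inj _ _ ha).
have -> : a' = - a by apply: toC_inj; rewrite NC ha opprK.
congr pair; apply: toC_inj; rewrite NC; apply: (mulfI a0).
by rewrite {1}ha mulNr -hab mulrN.
Qed.

(* The columns are the derivatives of [cover] in [w1] and [w2]. *)
Definition cover_jac (w : C2 R) : 'M[R[i]]_(3, 2) :=
  \matrix_(j < 3, k < 2)
    (nth [::] [:: [:: 2 * w1 w; 0]; [:: 0; 2 * w2 w]; [:: w2 w; w1 w]] j)`_k.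

Definition gram (w : C2 R) : R :=
  complex.Re (\det ((map_mx conjc (cover_jac w))^T *m cover_jac w)).

Lemma gramE w :
  gram w = 4 * cabs2 (w1 w) ^+ 2 + 4 * cabs2 (w2 w) ^+ 2
           + 16 * (cabs2 (w1 w) * cabs2 (w2 w)).
Proof.
rewrite /gram (expand_det_row _ ord0) !big_ord_recl big_ord0 /cofactor !det_mx11.
rewrite !mxE !big_ord_recl !big_ord0 !mxE /= /w1 /w2 /toC /cabs2.
case: w => -[a b] [c d] /=; move: a b c d.
rewrite -[measurableTypeR R]/(R : Type) => a b c d.
ring.
Qed.

Lemma gram_ge0 w : 0 <= gram w.
Proof.
rewrite gramE /cabs2.
by rewrite !addr_ge0 ?mulr_ge0 ?addr_ge0 ?exprn_even_ge0 ?sqr_ge0 ?ler0n.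
Qed.

Let m11 : measurable_fun setT (fun w : C2 R => w.1.1 : R).
Proof. exact: (measurableT_comp measurable_fst measurable_fst). Qed.
Let m12 : measurable_fun setT (fun w : C2 R => w.1.2 : R).
Proof. exact: (measurableT_comp measurable_snd measurable_fst). Qed.
Let m21 : measurable_fun setT (fun w : C2 R => w.2.1 : R).
Proof. exact: (measurableT_comp measurable_fst measurable_snd). Qed.
Let m22 : measurable_fun setT (fun w : C2 R => w.2.2 : R).
Proof. exact: (measurableT_comp measurable_snd measurable_snd). Qed.

Lemma measurable_gram : measurable_fun setT gram.
Proof.
have -> : gram = (fun w : C2 R =>
    4 * (w.1.1 ^+ 2 + w.1.2 ^+ 2) ^+ 2 + 4 * (w.2.1 ^+ 2 + w.2.2 ^+ 2) ^+ 2
    + 16 * ((w.1.1 ^+ 2 + w.1.2 ^+ 2) * (w.2.1 ^+ 2 + w.2.2 ^+ 2)) : R).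
  by apply/funext => w; rewrite gramE.
have n1 : measurable_fun setT (fun w : C2 R => w.1.1 ^+ 2 + w.1.2 ^+ 2 : R).
  by apply: measurable_funD; exact: measurable_funX.
have n2 : measurable_fun setT (fun w : C2 R => w.2.1 ^+ 2 + w.2.2 ^+ 2 : R).
  by apply: measurable_funD; exact: measurable_funX.
apply: measurable_funD; [apply: measurable_funD|];
  apply: measurable_funM => //.
- exact: measurable_funX.
- exact: measurable_funX.
- exact: measurable_funM.
Qed.

Lemma measurable_cover : measurable_fun setT cover.
Proof.
have -> : cover = (fun w : C2 R =>
    ((w.1.1 * w.1.1 - w.1.2 * w.1.2 : R, w.1.1 * w.1.2 + w.1.2 * w.1.1 : R),
     (w.2.1 * w.2.1 - w.2.2 * w.2.2 : R, w.2.1 * w.2.2 + w.2.2 * w.2.1 : R),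
     (w.1.1 * w.2.1 - w.1.2 * w.2.2 : R, w.1.1 * w.2.2 + w.1.2 * w.2.1 : R))).
  by [].
apply: measurable_fun_pair; [apply: measurable_fun_pair|];
  apply: measurable_fun_pair;
  (apply: measurable_funB || apply: measurable_funD); exact: measurable_funM.
Qed.

(* The volume induced by the Euclidean metric of C^3: the volume form of the
   cone pulls back to [gram w] times the Lebesgue measure of C^2. *)
Definition vol (E : set (C3 R)) : \bar R :=
  (\int[leb4]_(w in cover @^-1` E) (2^-1 * gram w)%:E)%E.

Let vol0 : vol set0 = 0%E.
Proof. by rewrite /vol preimage_set0 integral_set0. Qed.

Let dens_ge0 w : (0 <= (2^-1 * gram w)%:E)%E.
Proof. by rewrite lee_fin mulr_ge0 ?invr_ge0 ?ler0n ?gram_ge0. Qed.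

Let vol_ge0 E : (0 <= vol E)%E.
Proof. exact: integral_ge0. Qed.

Let vol_sigma_additive : semi_sigma_additive vol.
Proof.
move=> F mF tF mUF; rewrite /vol preimage_bigcup ge0_integral_bigcup //=.
- apply: is_cvg_ereal_nneg_natsum_cond => n _ _; exact: integral_ge0.
- by move=> k; rewrite -[X in measurable X]setTI; exact: measurable_cover.
- apply/measurable_EFinP; apply: measurable_funTS.
  by apply: measurable_funM => //; exact: measurable_gram.
- by move=> i j _ _ [w [wi wj]]; apply: tF => //; exists (cover w).
Qed.

HB.instance Definition _ := isMeasure.Build _ _ _ vol
  vol0 vol_ge0 vol_sigma_additive.

Definition pullback (w : C2 R) (a : ext R (3 + 3)) : ext R (2 + 2) :=
  ext_subst (fun i : 'I_(3 + 3) =>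
    match fintype.split i with
    | inl j => \sum_(k < 2) cover_jac w j k *: gen R (lshift 2 k)
    | inr j => \sum_(k < 2) conjc (cover_jac w j k) *: gen R (rshift 2 k)
    end) a.

(* dw_1 dw_2 d(bar w_1) d(bar w_2) is 4 times the Lebesgue measure of C^2 with
   its complex orientation. *)
Definition pulled_density (al : C3 R -> ext R (3 + 3)) (w : C2 R) : R[i] :=
  4 * pullback w (al (cover w)) finset.setT.

Definition form_integrable (A : set (C3 R)) (al : C3 R -> ext R (3 + 3)) : Prop :=
  leb4.-integrable (cover @^-1` A)
    (EFin \o (fun w => complex.Re (pulled_density al w))) /\
  leb4.-integrable (cover @^-1` A)
    (EFin \o (fun w => complex.Im (pulled_density al w))).

Definition form_integral (A : set (C3 R)) (al : C3 R -> ext R (3 + 3)) : R[i] :=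
  2^-1 * ((\int[leb4]_(w in cover @^-1` A) complex.Re (pulled_density al w)) +i*
          (\int[leb4]_(w in cover @^-1` A) complex.Im (pulled_density al w))).

End Integration.

(** * (0,q)-forms on subsets of the cone

    A field [phi : C3 R -> ext R 3] stands for the (0,q)-form
    sum_I phi_I d(bar z_I) restricted to the cone; two fields define the same
    form at [z] when they agree on the Zariski tangent space of the cone at [z],
    which is all of C^3 at the origin. *)

Section Forms.
Variable R : realType.
Implicit Types (z : C3 R) (a b : ext R 3) (phi psi : C3 R -> ext R 3).

Definition tangent m z (V : 'M[R[i]]_(3, m)) : Prop :=
  forall k, z2 z * V 0 k + z1 z * V 1 k - 2 * z3 z * V 2 k = 0.

Lemma cover_jac_tangent (w : C2 R) : tangent (cover w) (cover_jac w).
Proof.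
move=> k; rewrite !mxE /= /z1 /z2 /z3 /= !fromCK.
by case: k => -[|[|//]] kP /=; ring.
Qed.

(* The pull-back of sum_I a_I d(bar z_I) by the linear map [V] from C^m to C^3. *)
Definition restrict_form m (V : 'M[R[i]]_(3, m)) a : ext R m :=
  ext_subst (fun j => \sum_(k < m) conjc (V j k) *: gen R k) a.

Definition form_eq z a b : Prop :=
  forall V : 'M[R[i]]_3, tangent z V -> restrict_form V a = restrict_form V b.

Definition orthonormal m (V : 'M[R[i]]_(3, m)) : Prop :=
  (map_mx conjc V)^T *m V = 1%:M.

(* The norm is computed in an orthonormal frame [V] of the tangent plane; for
   [z] regular it does not depend on [V] and the set below is a singleton. *)
Definition form_norm z a : R :=
  reals.sup [set r : R | exists V : 'M[R[i]]_(3, 2),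
    [/\ tangent z V, orthonormal V &
        r = Num.sqrt (\sum_J cabs2 (restrict_form V a J))]].

Definition measurable_form (D : set (C3 R)) phi : Prop :=
  exists psi, (forall z, D z -> z <> 0 -> form_eq z (phi z) (psi z)) /\
    forall I, measurable_fun D (fun z => complex.Re (psi z I)) /\
              measurable_fun D (fun z => complex.Im (psi z I)).

Definition Lp_norm (D : set (C3 R)) (p : \bar R) phi : \bar R :=
  Lnorm (@vol R) p ((fun z => (form_norm z (phi z))%:E) \_ D).

Definition Lp_form (D : set (C3 R)) (p : \bar R) (q : nat) phi : Prop :=
  [/\ forall z, D z -> z <> 0 -> homogeneous q (phi z),
      measurable_form D phi & (Lp_norm D p phi < +oo)%E].

Definition ae_form_eq (D : set (C3 R)) phi psi : Prop :=
  {ae @vol R, forall z, D z -> form_eq z (phi z) (psi z)}.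

Definition continuous_form_at (D : set (C3 R)) (q : nat) phi (x : C3 R) : Prop :=
  exists psi,
    (forall z, D z -> homogeneous q (psi z) /\ form_eq z (phi z) (psi z)) /\
    forall I,
      (fun z => complex.Re (psi z I) : R) @ within D (nbhs x)
        --> (complex.Re (psi x I) : R) /\
      (fun z => complex.Im (psi z I) : R) @ within D (nbhs x)
        --> (complex.Im (psi x I) : R).

Definition C0_form (D : set (C3 R)) (q : nat) phi : Prop :=
  forall x, D x -> continuous_form_at D q phi x.

Definition form_operator := (C3 R -> ext R 3) -> C3 R -> ext R 3.

Definition bounded_linear_Lp (A B : set (C3 R)) (p : \bar R) (q q' : nat)
    (T : form_operator) : Prop :=
  [/\ forall phi, Lp_form A p q phi -> Lp_form B p q' (T phi),
      forall phi psi, Lp_form A p q phi -> Lp_form A p q psi ->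
        ae_form_eq A phi psi -> ae_form_eq B (T phi) (T psi),
      forall (c : R[i]) phi psi, Lp_form A p q phi -> Lp_form A p q psi ->
        ae_form_eq B (T (fun z => c *: phi z + psi z))
                     (fun z => c *: T phi z + T psi z) &
      exists M : R, forall phi, Lp_form A p q phi ->
        (Lp_norm B p (T phi) <= M%:E * Lp_norm A p phi)%E].

(* The topology of C^0 forms is that of the seminorms [Lp_norm K +oo], [K]
   compact in [B]; the elements of a compact exhaustion are cofinal among
   these [K]. *)
Definition continuous_linear_Linfty_C0 (A B : set (C3 R)) (q q' : nat)
    (T : form_operator) : Prop :=
  [/\ forall phi, Lp_form A +oo%E q phi -> C0_form B q' (T phi),
      forall phi psi, Lp_form A +oo%E q phi -> Lp_form A +oo%E q psi ->
        ae_form_eq A phi psi ->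
        forall z, B z -> form_eq z (T phi z) (T psi z),
      forall (c : R[i]) phi psi, Lp_form A +oo%E q phi -> Lp_form A +oo%E q psi ->
        forall z, B z -> form_eq z (T (fun z => c *: phi z + psi z) z)
                                   (c *: T phi z + T psi z) &
      forall phi, Lp_form A +oo%E q phi ->
        forall K, compact K -> K `<=` B -> forall e : R, 0 < e ->
        exists2 d : R, 0 < d & forall psi, Lp_form A +oo%E q psi ->
          (Lp_norm A +oo%E (fun z => psi z - phi z)%R < d%:E)%E ->
          (Lp_norm K +oo%E (fun z => T psi z - T phi z)%R < e%:E)%E].

End Forms.

Section Kernel.
Variable R : realType.

(* Forms in [x = (zeta, z)] are expanded in the coframe d(eta_j), d(zeta_j),
   d(bar zeta_j), d(bar z_j), in this order, where eta = zeta - z. *)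
Definition de (j : 'I_3) : ext R 12 := gen R (inord j).
Definition dzeta (j : 'I_3) : ext R 12 := gen R (inord (3 + j)).
Definition dzetabar (j : 'I_3) : ext R 12 := gen R (inord (6 + j)).
Definition dzbar (j : 'I_3) : ext R 12 := gen R (inord (9 + j)).

Implicit Types (x : C3 R * C3 R).

Definition real_deriv (f : C3 R * C3 R -> R[i]) x v : R[i] :=
  ('D_v (fun y => complex.Re (f y) : R) x) +i*
  ('D_v (fun y => complex.Im (f y) : R) x).

Definition axis (j : 'I_3) (u : plane R) : C3 R :=
  (if j == 0 then u else 0, if j == 1 then u else 0, if j == 2 then u else 0).

Definition dbar_zeta (j : 'I_3) (f : C3 R * C3 R -> R[i]) x : R[i] :=
  2^-1 * (real_deriv f x (axis j (1, 0), 0)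
          + (0 +i* 1) * real_deriv f x (axis j (0, 1), 0)).

Definition dbar_z (j : 'I_3) (f : C3 R * C3 R -> R[i]) x : R[i] :=
  2^-1 * (real_deriv f x (0, axis j (1, 0))
          + (0 +i* 1) * real_deriv f x (0, axis j (0, 1))).

Definition dbar (a : C3 R * C3 R -> ext R 12) x : ext R 12 :=
  \sum_(I : {set 'I_12}) \sum_(j < 3)
    (dbar_zeta j (fun y => a y I) x *: wedge (dzetabar j) (monom R I)
     + dbar_z j (fun y => a y I) x *: wedge (dzbar j) (monom R I)).

Definition eta x (j : 'I_3) : R[i] := crd x.1 j - crd x.2 j.

Definition twopii : R[i] := 0 +i* (2 * pi).

Definition hform x : ext R 12 :=
  2^-1 *: ((z2 x.1 + z2 x.2) *: de 0 + (z1 x.1 + z1 x.2) *: de 1)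
  - (z3 x.1 + z3 x.2) *: de 2.

Definition sform x : ext R 12 :=
  (twopii * \sum_j eta x j * conjc (eta x j))^-1 *:
    \sum_j conjc (eta x j) *: de j.

Definition sigmaform x : ext R 12 :=
  (twopii * (\sum_j crd x.1 j * conjc (crd x.1 j)
             - \sum_j conjc (crd x.1 j) * crd x.2 j))^-1 *:
    \sum_j conjc (crd x.1 j) *: de j.

Definition chiform (chi : C3 R -> R) x : ext R 12 :=
  (chi x.1)%:C *: monom R finset.set0.

Definition deta : ext R 12 := wedge (wedge (de 0) (de 1)) (de 2).

Definition kernel_rhs (chi : C3 R -> R) x : ext R 12 :=
  wedge (hform x)
    ((chi x.1)%:C *: wedge (sform x) (dbar sform x)
     - wedge (wedge (dbar (chiform chi) x) (sigmaform x)) (sform x)).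

Definition bars : {set 'I_12} := [set i : 'I_12 | (6 <= i)%N]%SET.
Definition etas : {set 'I_12} := [set i : 'I_12 | (i < 3)%N]%SET.

(* The coefficients of the solution of d(eta) /\ Ktilde = kernel_rhs that has
   degree one in the d(bar zeta_j), d(bar z_j); see [KtildeP]. *)
Definition Ktilde (chi : C3 R -> R) x : ext R 12 :=
  \sum_(i in bars) kernel_rhs chi x (etas :|: [set i])%SET *: gen R i.

(* The structure form, as an ambient representative in [zeta]. *)
Definition omega (zeta : C3 R) : ext R 12 :=
  (- 2 * z3 zeta)^-1 *: wedge (dzeta 0) (dzeta 1).

Definition Kform (chi : C3 R -> R) zeta z : ext R 12 :=
  wedge (omega zeta) (Ktilde chi (zeta, z)).

(* The factor in d(zeta), d(bar zeta) of d(bar z_J) in [a]; it is written to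
   the left of d(bar z_J). *)
Definition zeta_part (J : {set 'I_3}) (a : ext R 12) : ext R (3 + 3) :=
  [ffun I : {set 'I_(3 + 3)} =>
     a ([set inord (3 + i) | i : 'I_(3 + 3) in I] :|:
        [set inord (9 + j) | j : 'I_3 in J])%SET].

Definition integrand (chi : C3 R -> R) (phi : C3 R -> ext R 3) z
    (J : {set 'I_3}) (zeta : C3 R) : ext R (3 + 3) :=
  zeta_part J (wedge (Kform chi zeta z) (ext_subst dzetabar (phi zeta))).

Definition koppelman_integrable (eps : R) (chi : C3 R -> R) phi z : Prop :=
  forall J, form_integrable (Xball (1 + eps)) (integrand chi phi z J).

Definition koppelman (eps : R) (chi : C3 R -> R) : form_operator R :=
  fun phi z =>
    [ffun J => form_integral (Xball (1 + eps)) (integrand chi phi z J)].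

Fixpoint Cn (n : nat) (f : C3 R -> R) : Prop :=
  if n is n'.+1 then
    (forall u, differentiable f u) /\ forall v, Cn n' (fun u => 'D_v f u)
  else continuous f.

Definition smooth (f : C3 R -> R) : Prop := forall n, Cn n f.

Definition cutoff (eps : R) (chi : C3 R -> R) : Prop :=
  [/\ smooth chi,
      compact (closure [set zeta | chi zeta != 0]),
      closure [set zeta | chi zeta != 0] `<=` ball0 (1 + eps) &
      exists U, [/\ open U, closure (ball0 (1 : R)) `<=` U &
                    forall zeta, U zeta -> chi zeta = 1]].

End Kernel.


Section KtildeTheory.
Variable R : realType.
Implicit Types (x : C3 R * C3 R) (chi : C3 R -> R).

Lemma inversions0 n (I J : {set 'I_n}) :
  (forall i j, i \in I -> j \in J -> (i <= j)%N) -> inversions I J = 0%N.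
Proof.
move=> h; apply/eqP; rewrite cards_eq0 -finset.subset0; apply/fintype.subsetP.
move=> -[i j]; rewrite !finset.inE /= => /and3P[iI jJ].
by rewrite ltnNge h.
Qed.

Lemma wedge_monoml n (I : {set 'I_n}) (b : ext R n) K :
  wedge (monom R I) b K =
  if I \subset K then (-1) ^+ inversions I (K :\: I)%SET * b (K :\: I)%SET else 0.
Proof.
rewrite ffunE; case: ifP => IK.
  rewrite (bigD1 I) //= ffunE eqxx mulr1 big1 ?addr0 // => J /andP[_ /negPf JI].
  by rewrite ffunE JI mulr0 mul0r.
rewrite big1 // => J JK; rewrite ffunE; case: eqP => [JI|]; last first.
  by rewrite mulr0 mul0r.
by rewrite JI IK in JK.
Qed.

Lemma wedge_monom n (I J : {set 'I_n}) :
  (forall i j, i \in I -> j \in J -> (i < j)%N) ->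
  wedge (monom R I) (monom R J) = monom R (I :|: J)%SET.
Proof.
move=> h; apply/ffunP => K; rewrite wedge_monoml !ffunE.
have dIJ : (I :&: J)%SET = finset.set0.
  apply/eqP; rewrite -finset.subset0; apply/fintype.subsetP => i.
  by rewrite finset.inE => /andP[iI iJ]; have := h _ _ iI iJ; rewrite ltnn.
have [->|KIJ] := eqVneq K (I :|: J)%SET.
  rewrite finset.subsetUl finset.setDUl finset.setDv finset.set0U.
  have -> : (J :\: I)%SET = J.
    by apply/finset.setDidPl; rewrite -finset.setI_eq0 finset.setIC dIJ.
  rewrite eqxx mulr1 inversions0 ?expr0 // => i j iI jJ.
  exact: ltnW (h _ _ iI jJ).
case: ifP => // IK; case: eqP => [KJ|]; last by rewrite mulr0.
by case/eqP: KIJ; rewrite -KJ -{1}(finset.setIidPr IK) finset.setID.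
Qed.

Lemma deta_monom : deta R = monom R etas.
Proof.
have v (j : nat) : (j < 12)%N -> nat_of_ord (inord j : 'I_12) = j by exact: inordK.
rewrite /deta /de /gen wedge_monom; last first.
  by move=> i j /finset.set1P -> /finset.set1P ->; rewrite !v.
rewrite wedge_monom; last first.
  move=> i j /finset.setUP[] /finset.set1P -> /finset.set1P ->; by rewrite !v.
congr monom; apply/finset.setP => i; rewrite !finset.inE -!val_eqE /= !v //.
by case: i => -[|[|[|m]]].
Qed.

(* Degree [a] in the d(eta_j), [b] in the barred generators, 0 in the d(zeta_j). *)
Definition bidegree (a b : nat) (al : ext R 12) : Prop :=
  forall I, al I != 0 ->
    [/\ #|I :&: etas|%SET = a, #|I :&: bars|%SET = b & #|I| = (a + b)%N].

Lemma bidegreeD a b al be : bidegree a b al -> bidegree a b be ->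
  bidegree a b (al + be).
Proof.
move=> h1 h2 I; rewrite ffunE; have [->|/h1 //] := eqVneq (al I) 0.
by rewrite add0r => /h2.
Qed.

Lemma bidegreeZ a b (c : R[i]) al : bidegree a b al -> bidegree a b (c *: al).
Proof.
move=> h I; rewrite ffunE; have [->|/h //] := eqVneq (al I) 0.
by rewrite scaler0 eqxx.
Qed.

Lemma bidegreeN a b al : bidegree a b al -> bidegree a b (- al).
Proof. by rewrite -scaleN1r; exact: bidegreeZ. Qed.

Lemma bidegree_sum a b (I : finType) (F : I -> ext R 12) :
  (forall i, bidegree a b (F i)) -> bidegree a b (\sum_i F i).
Proof.
move=> h; apply: big_ind => //; last by move=> *; exact: bidegreeD.
by move=> J; rewrite ffunE eqxx.
Qed.

Lemma bidegree_wedge a b a' b' al be : bidegree a b al -> bidegree a' b' be ->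
  bidegree (a + a') (b + b') (wedge al be).
Proof.
move=> h1 h2 K; rewrite ffunE => /eqP nz.
have [I /andP[IK]] : exists I : {set 'I_12}, (I \subset K) &&
    ((-1) ^+ inversions I (K :\: I)%SET * al I * be (K :\: I)%SET != 0).
  apply/existsP; apply: contra_notT nz => /existsPn h; apply: big1 => I IK.
  by have := h I; rewrite IK /= negbK => /eqP.
rewrite !mulf_eq0 !negb_or => /andP[/andP[_ /h1[e1 e2 e3]] /h2[f1 f2 f3]].
have E (A : {set 'I_12}) :
    #|K :&: A|%SET = (#|I :&: A|%SET + #|(K :\: I) :&: A|%SET)%N.
  rewrite -(cardsID I (K :&: A)); congr (_ + _)%N; apply: eq_card => i;
    rewrite !finset.inE.
    by have := fintype.subsetP IK i; case: (i \in I) => [->|_] //=; rewrite ?andbT ?andbF.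
  by rewrite andbA.
split; rewrite ?E ?e1 ?f1 ?e2 ?f2 //.
rewrite -[K]finset.setIT E !finset.setIT e3 f3.
by rewrite addnACA.
Qed.

Lemma bidegree_gen (i : 'I_12) : ((i < 3) || (6 <= i))%N ->
  bidegree (i < 3)%N (6 <= i)%N (gen R i).
Proof.
move=> hi I; rewrite ffunE; have [-> _|] := eqVneq I [set i]%SET; last by rewrite eqxx.
have E (A : {set 'I_12}) : #|[set i] :&: A|%SET = (i \in A).
  case: (boolP (i \in A)) => iA.
    by rewrite (finset.setIidPl _) ?finset.sub1set // cards1.
  apply/eqP; rewrite cards_eq0 finset.setI_eq0 finset.disjoints1.
  by rewrite iA.
rewrite !E cards1 !finset.inE; split=> //.
by move: hi; case: i {E} => i /= _; case: ltnP => // h; rewrite ltnNge; lia.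
Qed.

Lemma bidegree_de j : bidegree 1 0 (de R j).
Proof.
have h : (j < 12)%N by rewrite (leq_trans (ltn_ord j)).
have j3 := ltn_ord j; have := @bidegree_gen (inord j).
by rewrite inordK // j3 leqNgt (leq_trans j3 (_ : 3 <= 6)%N) //=; apply.
Qed.

Lemma bidegree_bar (i : nat) : (6 <= i < 12)%N -> bidegree 0 1 (gen R (inord i : 'I_12)).
Proof.
move=> /andP[h1 h2]; have := @bidegree_gen (inord i).
by rewrite inordK // h1 ltnNge (leq_trans (_ : 3 <= 6)%N h1) //=; apply.
Qed.

Lemma bidegree_dzetabar j : bidegree 0 1 (dzetabar R j).
Proof. by apply: bidegree_bar; have := ltn_ord j; lia. Qed.

Lemma bidegree_dzbar j : bidegree 0 1 (dzbar R j).
Proof. by apply: bidegree_bar; have := ltn_ord j; lia. Qed.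

Lemma real_deriv0 x v : real_deriv (fun=> 0 : R[i]) x v = 0.
Proof. by rewrite /real_deriv /= derive_cst. Qed.

Lemma bidegree_dbar a b (al : C3 R * C3 R -> ext R 12) x :
  (forall y, bidegree a b (al y)) -> bidegree a b.+1 (dbar al x).
Proof.
move=> h; apply: bidegree_sum => I; apply: bidegree_sum => j.
have [[y yI]|nz] := pselect (exists y, al y I != 0).
  have hI : bidegree a b (monom R I).
    move=> K; rewrite ffunE; have [->|] := eqVneq K I; last by rewrite eqxx.
    by move=> _; exact: (h y).
  apply: bidegreeD; apply: bidegreeZ; rewrite -[a]add0n -[b.+1]add1n;
    apply: bidegree_wedge => //.
    exact: bidegree_dzetabar.
  exact: bidegree_dzbar.
have -> : (fun y => al y I : R[i]) = (fun=> 0).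
  apply/funext => y; apply/eqP/negPn/negP => yI; apply: nz; by exists y.
rewrite /dbar_zeta /dbar_z !real_deriv0 !mulr0 addr0 mulr0 !scale0r addr0.
by move=> K; rewrite ffunE eqxx.
Qed.

Lemma bidegree_hform x : bidegree 1 0 (hform x).
Proof.
apply: bidegreeD; last by apply/bidegreeN/bidegreeZ/bidegree_de.
by apply: bidegreeZ; apply: bidegreeD; apply/bidegreeZ/bidegree_de.
Qed.

Lemma bidegree_sform x : bidegree 1 0 (sform x).
Proof.
by apply: bidegreeZ; apply: bidegree_sum => j; apply/bidegreeZ/bidegree_de.
Qed.

Lemma bidegree_sigmaform x : bidegree 1 0 (sigmaform x).
Proof.
by apply: bidegreeZ; apply: bidegree_sum => j; apply/bidegreeZ/bidegree_de.
Qed.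

Lemma bidegree_chiform chi x : bidegree 0 0 (chiform chi x).
Proof.
apply: bidegreeZ => I; rewrite ffunE; have [->|] := eqVneq I finset.set0; last by rewrite eqxx.
by rewrite !finset.set0I cards0.
Qed.

Lemma bidegree_kernel_rhs chi x : bidegree 3 1 (kernel_rhs chi x).
Proof.
rewrite -[3%N]/(1 + 2)%N -[1%N in X in bidegree _ X]/(0 + 1)%N.
apply: bidegree_wedge; first exact: bidegree_hform.
apply: bidegreeD; [apply: bidegreeZ|apply: bidegreeN].
  apply: (@bidegree_wedge 1 0 1 1); first exact: bidegree_sform.
  by apply: bidegree_dbar; exact: bidegree_sform.
apply: (@bidegree_wedge 1 1 1 0); last exact: bidegree_sform.
apply: (@bidegree_wedge 0 1 1 0); last exact: bidegree_sigmaform.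
by apply: bidegree_dbar; exact: bidegree_chiform.
Qed.

Lemma bidegree31P (al : ext R 12) I : bidegree 3 1 al -> al I != 0 ->
  exists2 i, i \in bars & I = (etas :|: [set i])%SET.
Proof.
move=> h /h[h1 h2 h3].
have ce : #|etas| = 3%N.
  by rewrite -sum1dep_card -(big_mkord (fun i => (i < 3)%N) (fun=> 1%N)) unlock.
have eI : etas \subset I.
  by apply/finset.setIidPr/eqP; rewrite eqEcard finset.subsetIr h1 ce.
have : #|I :\: etas|%SET == 1%N by rewrite finset.cardsD h1 h3.
case/cards1P => i Ii; exists i; last first.
  by rewrite -Ii -{1}(finset.setIidPr eI) finset.setID.
have : (#|I :&: bars| > 0)%SET%N by rewrite h2.
case/card_gt0P => k; rewrite finset.inE => /andP[kI kb].
have : k \in (I :\: etas)%SET.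
  rewrite finset.inE kI andbT; move: kb; rewrite !finset.inE => kb.
  by rewrite -leqNgt (leq_trans _ kb).
by rewrite Ii finset.inE => /eqP <-.
Qed.

Lemma etasU_bar i : i \in bars -> ((etas :|: [set i]) :\: etas = [set i])%SET.
Proof.
rewrite finset.inE => hi; rewrite finset.setDUl finset.setDv finset.set0U.
apply/finset.setDidPl; rewrite finset.disjoints1 finset.inE -leqNgt.
exact: leq_trans hi.
Qed.

Lemma bar_sum (c : 'I_12 -> R[i]) i : i \in bars ->
  (\sum_(k in bars) c k *: gen R k : ext R 12) [set i]%SET = c i.
Proof.
move=> hi; rewrite sum_ffunE (bigD1 i) //= !ffunE eqxx big1 ?addr0.
  exact: mulr1.
move=> k /andP[_ /negPf ki]; rewrite !ffunE.
by rewrite (inj_eq finset.set1_inj) eq_sym ki scaler0.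
Qed.

Lemma wedge_deta_bar (b : ext R 12) i : i \in bars ->
  wedge (deta R) b (etas :|: [set i])%SET = b [set i]%SET.
Proof.
move=> hi; rewrite deta_monom wedge_monoml finset.subsetUl (etasU_bar hi).
rewrite inversions0 ?expr0 ?mul1r // => j k; rewrite !finset.inE => hj /eqP ->.
by move: hi; rewrite finset.inE => hi; apply: ltnW; apply: leq_trans hj (leq_trans _ hi).
Qed.

Theorem KtildeP chi x : wedge (deta R) (Ktilde chi x) = kernel_rhs chi x.
Proof.
have hb : bidegree 3 1 (wedge (deta R) (Ktilde chi x)).
  apply: (@bidegree_wedge 3 0 0 1).
    apply: (@bidegree_wedge 2 0 1 0); last exact: bidegree_de.
    by apply: (@bidegree_wedge 1 0 1 0); exact: bidegree_de.
  rewrite /Ktilde big_mkcond /=; apply: bidegree_sum => i; case: ifP => hi.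
    apply: bidegreeZ; move: hi; rewrite finset.inE => hi.
    by have := @bidegree_bar i; rewrite inord_val; apply; rewrite hi ltn_ord.
  by move=> K; rewrite ffunE eqxx.
have E i : i \in bars -> wedge (deta R) (Ktilde chi x) (etas :|: [set i])%SET
                         = kernel_rhs chi x (etas :|: [set i])%SET.
  by move=> hi; rewrite wedge_deta_bar // bar_sum.
apply/ffunP => I.
have [nz|nz] := eqVneq (kernel_rhs chi x I) 0; last first.
  by have [i hi eI] := bidegree31P (@bidegree_kernel_rhs chi x) nz; rewrite eI E.
rewrite nz; apply/eqP/negPn/negP => nz'.
have [i hi eI] := bidegree31P hb nz'.
by move: nz'; rewrite eI E // -eI nz eqxx.
Qed.

Theorem Ktilde_unique chi x (c : 'I_12 -> R[i]) :
  wedge (deta R) (\sum_(k in bars) c k *: gen R k) = kernel_rhs chi x ->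
  \sum_(k in bars) c k *: gen R k = Ktilde chi x.
Proof.
move=> h; apply: eq_bigr => i hi.
by rewrite -h wedge_deta_bar // bar_sum.
Qed.

End KtildeTheory.

(* Main.v *)
(** Pull everything back by [cover], w |-> (w1^2, w2^2, w1 w2). There |cover w| is
    comparable to |w|^2, the volume to |w|^4 dw, and |cover w - cover v| is at
    least |w - v| |w + v| / 2. Since |h| <= |zeta| + |z|, |s| <= 1/|eta| and
    |dbar s| <= 2/|eta|^2, the pulled-back integrand at (w, z) is bounded by
    [majorant w z] |phi|, where [majorant w z] = |w|^2 (|zeta| + |z|) / |eta|^3; for
    z = cover v it is at most 8 |w| / min(|w - v|, |w + v|)^3, an integrable
    singularity in R^4.

    Hoelder's inequality with the weight |w|^(-2/(p-1)) turns the kernel into a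
    bounded operator on L^p(|w|^4 dw): the weighted integral of the kernel is
    O(|v|^(-2/(p-1))) as long as 2/(p-1) < 6, that is p > 4/3, and
    |v|^2 majorant(w, v) = |w|^2 majorant(v, w) makes Tonelli's theorem reduce the rest to
    the unweighted integral. For bounded forms, the kernel is uniformly small
    in L^1 near the diagonal, so the operator is a uniform limit of operators with
    truncated kernels, which are continuous by dominated convergence. *)

Require Import Defs.
From mathcomp Require Import all_boot all_order all_algebra.
From mathcomp Require Import complex.
From mathcomp Require Import ring lra zify.
From mathcomp Require Import all_classical all_reals all_analysis.
From mathcomp Require Import measurable_realfun.

Set Implicit Arguments.
Unset Strict Implicit.
Unset Printing Implicit Defensive.

Import Order.TTheory GRing.Theory Num.Theory.
Import numFieldNormedType.Exports.

Local Open Scope classical_set_scope.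
Local Open Scope ring_scope.

(** The factor |w|^2 of the majorant comes from counting differentials. The structure form has a
    pole along zeta_3 = w1 w2 = 0, but d(zeta_1) d(zeta_2) pulls back to 4 w1 w2 dw_1 dw_2, so the
    two cancel to a constant; the two barred differentials left cost one factor |w| each, whether
    they come from the kernel or from phi. The same factor explains why the weight may be almost as
    singular as |w|^(-6) in R^4: for |w| small against |v| the kernel is O(|w|^2 / |v|^4). The term
    with sigma is harmless because chi is 1 on a whole collar |zeta| < 1 + c: its denominator only
    matters where |zeta| - |z| >= c. A second obstacle is that forms are given up to equality on
    tangent planes, with a norm that is a supremum over frames. Each form is replaced by a
    measurable representative vanishing outside X', whose norm in one explicit tangent frame is
    measurable and at most [form_norm]; monotonicity of integrals of nonnegative functions, which
    requires no measurability, makes the link with [form_norm]. *)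

Local Notation cover := Defs.cover.

(** * Exterior forms in coordinates indexed by bit sequences *)

Section ExteriorCalculus.
Variable R : realType.
Local Notation C := (complex R).

Lemma ext_addE n (a b : ext R n) I : (a + b) I = a I + b I.
Proof. by rewrite ffunE. Qed.

Lemma ext_oppE n (a : ext R n) I : (- a) I = - a I.
Proof. by rewrite ffunE. Qed.

Lemma ext_scaleE n (k : C) (a : ext R n) I : (k *: a) I = k * a I.
Proof. by rewrite ffunE. Qed.

Lemma wedgeDl n (a b c : ext R n) : wedge (a + b) c = wedge a c + wedge b c.
Proof.
apply/ffunP => K; rewrite !ffunE -big_split /=; apply: eq_bigr => I _.
by rewrite ffunE; ring.
Qed.

Lemma wedgeDr n (a b c : ext R n) : wedge a (b + c) = wedge a b + wedge a c.
Proof.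
apply/ffunP => K; rewrite !ffunE -big_split /=; apply: eq_bigr => I _.
by rewrite ffunE; ring.
Qed.

Lemma wedgeZl n (k : C) (a b : ext R n) : wedge (k *: a) b = k *: wedge a b.
Proof.
apply/ffunP => K; rewrite !ffunE /GRing.scale /= big_distrr /=.
by apply: eq_bigr => I _; rewrite ffunE /GRing.scale /=; ring.
Qed.

Lemma wedgeZr n (k : C) (a b : ext R n) : wedge a (k *: b) = k *: wedge a b.
Proof.
apply/ffunP => K; rewrite !ffunE /GRing.scale /= big_distrr /=.
by apply: eq_bigr => I _; rewrite ffunE /GRing.scale /=; ring.
Qed.

Lemma wedge0l n (b : ext R n) : wedge 0 b = 0.
Proof. by rewrite -(scale0r (0 : ext R n)) wedgeZl !scale0r. Qed.

Lemma wedge0r n (b : ext R n) : wedge b 0 = 0.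
Proof. by rewrite -(scale0r (0 : ext R n)) wedgeZr !scale0r. Qed.

Lemma wedge_suml n (I : finType) (P : pred I) (F : I -> ext R n) (b : ext R n) :
  wedge (\sum_(i | P i) F i) b = \sum_(i | P i) wedge (F i) b.
Proof.
by apply: (big_rec2 (fun x y => wedge x b = y)) => [|i x y _ <-];
  rewrite ?wedgeDl ?wedge0l.
Qed.

Lemma wedge_sumr n (I : finType) (P : pred I) (F : I -> ext R n) (b : ext R n) :
  wedge b (\sum_(i | P i) F i) = \sum_(i | P i) wedge b (F i).
Proof.
by apply: (big_rec2 (fun x y => wedge b x = y)) => [|i x y _ <-];
  rewrite ?wedgeDr ?wedge0r.
Qed.

(* Subsets of ['I_n] encoded by bit sequences, on which wedge products with
   generators compute. *)
Definition setb n (s : seq bool) : {set 'I_n} := [set i : 'I_n | nth false s i]%SET.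

Lemma in_setb n s (i : 'I_n) : (i \in setb n s) = nth false s i.
Proof. by rewrite finset.inE. Qed.

Lemma setb_inj n (s t : seq bool) : size s = n -> size t = n ->
  (setb n s == setb n t) = (s == t).
Proof.
move=> hs ht; apply/eqP/eqP => [h|-> //].
apply: (@eq_from_nth _ false); first by rewrite hs ht.
move=> i; rewrite hs => lti.
by have := congr1 (fun A : {set 'I_n} => Ordinal lti \in A) h; rewrite !in_setb.
Qed.

Lemma setb_eta n (A : {set 'I_n}) : A = setb n [seq i \in A | i <- enum 'I_n].
Proof.
apply/finset.setP => i; rewrite in_setb (nth_map i) ?size_enum_ord //.
by rewrite nth_ord_enum.
Qed.

Lemma set1_setb n k : (k < n.+1)%N ->
  [set (inord k : 'I_n.+1)]%SET = setb n.+1 [seq k == i | i <- iota 0 n.+1].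
Proof.
move=> kn; apply/finset.setP => i; rewrite in_setb finset.inE.
by rewrite (nth_map 0%N) ?size_iota // nth_iota // add0n -val_eqE /= inordK // eq_sym.
Qed.

Lemma count_take k (s : seq bool) :
  count id (take k s) = (\sum_(j < k) nth false s j)%N.
Proof.
elim: k s => [|k IH] [|b s] //=; rewrite ?big_ord0 //.
  by rewrite big1 // => i _; rewrite nth_nil.
by rewrite big_ord_recl /= IH.
Qed.

(** Moving [e_k] into increasing position passes exactly the generators of smaller index that are
    present, so the sign of a product with a generator is read off a prefix of the bit sequence. *)
Lemma inversions1 n k s : (k < n.+1)%N ->
  inversions [set (inord k : 'I_n.+1)]%SET (setb n.+1 s) = count id (take k s).
Proof.
move=> kn; rewrite /inversions.
pose f (j : 'I_n.+1) : 'I_n.+1 * 'I_n.+1 := (inord k, j).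
have -> : [set p : 'I_n.+1 * 'I_n.+1 | [&& p.1 \in [set inord k]%SET,
             p.2 \in setb n.+1 s & (p.2 < p.1)%N]]%SET
    = (f @: [set j : 'I_n.+1 | nth false s j && (j < k)%N])%SET.
  apply/finset.setP => -[i j]; rewrite finset.inE /=; apply/and3P/finset.imsetP.
    rewrite finset.inE => -[/eqP -> ]; rewrite in_setb => h1 h2.
    by exists j => //; rewrite finset.inE h1 /=; move: h2; rewrite inordK.
  case=> j' ; rewrite finset.inE => /andP[h1 h2] [-> ->].
  by rewrite finset.inE eqxx in_setb inordK.
rewrite finset.card_imset; last by move=> i j [].
rewrite -sum1_card count_take.
under eq_bigl => i do rewrite finset.inE.
rewrite -(big_mkord xpredT (fun j => nth false s j : nat)).
rewrite (big_nat_widen _ _ _ _ _ (ltnW kn)) big_mkord big_mkcond [RHS]big_mkcond /=.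
by apply: eq_bigr => i _; case: (nth false s i); case: (i < k)%N.
Qed.

Lemma wedge_gen_setb n k (b : ext R n.+1) s : (k < n.+1)%N ->
  wedge (gen R (inord k)) b (setb n.+1 s) =
  if nth false s k then
    (-1) ^+ count id (take k s) * b (setb n.+1 (set_nth false s k false))
  else 0.
Proof.
move=> kn; rewrite wedge_monoml finset.sub1set in_setb inordK //.
case: ifP => // h.
have -> : (setb n.+1 s :\: [set inord k])%SET = setb n.+1 (set_nth false s k false).
  apply/finset.setP => i; rewrite finset.inE !in_setb nth_set_nth /= finset.inE.
  by rewrite -val_eqE /= inordK //; case: eqP.
rewrite inversions1 //; congr (_ ^+ _ * _).
(* Clearing bit [k] leaves the prefix of length [k] unchanged. *)
elim: s k {kn h} => [|c s IH] [|k] //=; last by rewrite IH.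
by elim: k => //= k ->.
Qed.

Lemma gen_setb n k s : (k < n.+1)%N -> size s = n.+1 ->
  gen R (inord k) (setb n.+1 s) = (s == [seq k == i | i <- iota 0 n.+1])%:R.
Proof.
by move=> kn hs; rewrite ffunE set1_setb // setb_inj // size_map size_iota.
Qed.

Lemma monom0_setb n s : size s = n ->
  monom R finset.set0 (setb n s) = (s == nseq n false)%:R.
Proof.
move=> hs; rewrite ffunE; congr (_%:R).
have -> : finset.set0 = setb n (nseq n false).
  by apply/finset.setP => i; rewrite in_setb finset.inE nth_nseq if_same.
by rewrite setb_inj // size_nseq.
Qed.

End ExteriorCalculus.

(** * Products of monomials and restriction of forms to frames, on bit sequences *)

Section Density.
Variable R : realType.
Local Notation C := (complex R).

(** Inclusion, difference and inversion count as structural recursions: on concrete bit lists a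
    wedge product with a monomial then reduces by [/=]. *)
Fixpoint subb (s t : seq bool) : bool :=
  match s, t with
  | b :: s', c :: t' => (b ==> c) && subb s' t'
  | _, _ => true
  end.

Fixpoint diffb (t s : seq bool) : seq bool :=
  match t, s with
  | c :: t', b :: s' => (c && ~~ b) :: diffb t' s'
  | _, _ => t
  end.

Fixpoint invb (s t : seq bool) : nat :=
  match s, t with
  | b :: s', c :: t' => (c * count id s' + invb s' t')%N
  | _, _ => 0%N
  end.

Lemma subb_setb n (s t : seq bool) : size s = n -> size t = n ->
  (setb n s \subset setb n t) = subb s t.
Proof.
move=> hs ht; transitivity ([forall i : 'I_n, nth false s i ==> nth false t i]).
  apply/fintype.subsetP/forallP => h i.
    by have := h i; rewrite !in_setb => h'; apply/implyP.
  by rewrite !in_setb; apply/implyP.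
elim: n s t hs ht => [|n IH] [|b s] [|c t] //= => [_ _|[hs] [ht]].
  by apply/forallP => -[].
rewrite -IH //; apply/forallP/andP => [h|[h1 /forallP h2] i].
  split; first exact: (h ord0).
  by apply/forallP => i; exact: (h (lift ord0 i)).
by case: (unliftP ord0 i) => [j|] -> //=; exact: h2.
Qed.

Lemma diffb_setb n (s t : seq bool) : size s = n -> size t = n ->
  (setb n t :\: setb n s)%SET = setb n (diffb t s).
Proof.
move=> hs ht; apply/finset.setP => i; rewrite finset.inE !in_setb andbC.
case: i => i /= ltin; elim: n s t hs ht i ltin => [|n IH] [|b s] [|c t] //= [hs] [ht].
by case=> [|i] //= ltin; exact: IH.
Qed.

Lemma size_diffb n (s t : seq bool) : size s = n -> size t = n ->
  size (diffb t s) = n.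
Proof. by elim: n s t => [|n IH] [|b s] [|c t] //= [hs] [ht]; rewrite IH. Qed.

Lemma invb_setb n (s t : seq bool) : size s = n -> size t = n ->
  inversions (setb n s) (setb n t) = invb s t.
Proof.
move=> hs ht; rewrite /inversions -sum1dep_card.
transitivity (\sum_(i < n) \sum_(j < n | [&& nth false s i, nth false t j & (j < i)%N]) 1)%N.
  rewrite pair_big_dep /=; apply: eq_bigl => -[i j] /=.
  by rewrite !in_setb.
elim: n s t hs ht => [|n IH] [|b s] [|c t] //= => [_ _|[hs] [ht]].
  by rewrite big_ord0.
rewrite big_ord_recl /= [X in (X + _)%N]big1 ?add0n; last by move=> j; rewrite ltn0 !andbF.
have -> : count id s = count id (take n s) by rewrite -hs take_size.
rewrite -IH // count_take big_distrr -big_split /=; apply: eq_bigr => i _.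
rewrite big_mkcond big_ord_recl /= -big_mkcond /= ; congr (_ + _)%N.
by case: (nth false s i); case: c.
Qed.

(** The parity of [invb] as a boolean, so that a concrete sign reduces to a case split instead of a
    power of -1. *)
Fixpoint sgnb (s t : seq bool) : bool :=
  match s, t with
  | b :: s', c :: t' => (c && foldr addb false s') (+) sgnb s' t'
  | _, _ => false
  end.

Lemma sgnbE s t : sgnb s t = odd (invb s t).
Proof.
have e u : odd (count id u) = foldr addb false u.
  by elim: u => //= b u IH; rewrite oddD oddb IH.
elim: s t => [|b s IH] [|c t] //=.
by rewrite oddD oddM oddb e IH.
Qed.

Lemma wedge_monom_setb n (s t : seq bool) (b : ext R n) :
  size s = n -> size t = n ->
  wedge (monom R (setb n s)) b (setb n t) =
  if subb s t then
    if sgnb s (diffb t s) then - b (setb n (diffb t s)) else b (setb n (diffb t s))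
  else 0.
Proof.
move=> hs ht; rewrite wedge_monoml subb_setb // diffb_setb //.
rewrite (invb_setb hs (size_diffb hs ht)) -signr_odd -sgnbE.
by case: sgnb; rewrite ?expr0 ?expr1 ?mulN1r ?mul1r.
Qed.

Lemma sum_set3 (V : nmodType) (F : {set 'I_3} -> V) : \sum_I F I =
  \sum_(t : bool * bool * bool) F (setb 3 [:: t.1.1; t.1.2; t.2]).
Proof.
rewrite (reindex (fun t : bool * bool * bool => setb 3 [:: t.1.1; t.1.2; t.2])) //=.
apply: onW_bij; exists (fun A : {set 'I_3} => (ord0 \in A, inord 1 \in A, inord 2 \in A)).
  by case=> -[a b] c; rewrite !in_setb /= !inordK.
move=> A /=; rewrite [RHS]setb_eta; congr setb.
have -> : inord 1 = lift ord0 ord0 :> 'I_3 by apply: val_inj; rewrite /= inordK.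
have -> : inord 2 = lift ord0 (lift ord0 ord0) :> 'I_3.
  by apply: val_inj; rewrite /= inordK.
by rewrite !enum_ordSl (size0nil (size_enum_ord 0)).
Qed.

Lemma sum_bool3 (V : nmodType) (F : bool * bool * bool -> V) : \sum_t F t =
  F (true, true, true) + F (true, true, false) + F (true, false, true)
  + F (true, false, false) + F (false, true, true) + F (false, true, false)
  + F (false, false, true) + F (false, false, false).
Proof.
have -> : \sum_t F t = \sum_t \sum_c F (t, c).
  by rewrite [RHS]pair_bigA; apply: eq_bigr => -[].
have -> : \sum_t \sum_c F (t, c) = \sum_a \sum_b \sum_c F (a, b, c).
  by rewrite [RHS]pair_bigA; apply: eq_bigr => -[].
by rewrite !big_bool /= !addrA.
Qed.

Lemma enum_setb n s : enum (setb n.+1 s) = [seq inord k | k <- iota 0 n.+1 & nth false s k].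
Proof.
rewrite -val_enum_ord filter_map -map_comp -[LHS]map_id.
have -> : enum (setb n.+1 s) = [seq i <- enum 'I_n.+1 | nth false s (val i)].
  by rewrite [in RHS]enumT; apply: eq_filter => i; exact: in_setb.
by apply: eq_map => i /=; rewrite inord_val.
Qed.

(* The coefficient at [setb _ s] of the wedge product of the one-forms whose
   coefficient sequences are listed in [l]. *)
Fixpoint wedge_coef (l : seq (seq C)) (s : seq bool) : C :=
  match l with
  | [::] => (s == nseq (size s) false)%:R
  | v :: l' => foldr (fun k acc =>
      (if nth false s k then
         v`_k * ((-1) ^+ count id (take k s) *
                 wedge_coef l' (set_nth false s k false))
       else 0) + acc) 0 (iota 0 (size s))
  end.

Lemma bigwedge_coef n (T : Type) (f : T -> ext R n.+1) (v : T -> seq C)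
    (l : seq T) (s : seq bool) :
  (forall j, f j = \sum_(k < n.+1) (v j)`_k *: gen R k) -> size s = n.+1 ->
  (\big[@wedge R n.+1 / monom R finset.set0]_(j <- l) f j) (setb n.+1 s)
  = wedge_coef (map v l) s.
Proof.
move=> fv; elim: l s => [|j l IH] s hs.
  by rewrite big_nil monom0_setb // /= hs.
rewrite big_cons fv wedge_suml sum_ffunE /= hs.
transitivity (\sum_(0 <= k < n.+1) (if nth false s k then
   (v j)`_k * ((-1) ^+ count id (take k s) *
                 wedge_coef (map v l) (set_nth false s k false)) else 0)).
  rewrite big_mkord; apply: eq_bigr => k _; rewrite wedgeZl ext_scaleE.
  rewrite -{2}[k]inord_val wedge_gen_setb //; case: ifP => h; last exact: mulr0.
  by rewrite IH // size_set_nth hs; apply/maxn_idPr.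
by rewrite /index_iota subn0; elim: (iota 0 n.+1) => [|k r IHr];
  rewrite ?big_nil // big_cons IHr.
Qed.

Lemma restrict_formE m (V : 'M[C]_(3, m.+1)) (a : ext R 3) s : size s = m.+1 ->
  restrict_form V a (setb m.+1 s) = \sum_(t : bool * bool * bool)
     a (setb 3 [:: t.1.1; t.1.2; t.2]) *
     wedge_coef [seq [seq conjc (V (inord k) (inord j)) | j <- iota 0 m.+1] |
       k <- iota 0 3 & nth false [:: t.1.1; t.1.2; t.2] k] s.
Proof.
move=> hs; rewrite /restrict_form /ext_subst sum_set3 sum_ffunE.
apply: eq_bigr => t _; rewrite ext_scaleE enum_setb; congr (_ * _).
rewrite (bigwedge_coef (v := fun i => [seq conjc (V i (inord j)) | j <- iota 0 m.+1])) //.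
  by rewrite -map_comp.
move=> j; apply: eq_bigr => k _.
by rewrite (nth_map 0%N) ?size_iota // nth_iota // add0n inord_val.
Qed.

(** Coefficient of the top barred monomial in the restriction of d(bar z_i) d(bar z_j) to the frame
    [V]; the entries are conjugated because the differentials are barred. *)
Definition minor (V : 'M[C]_(3, 2)) (i j : nat) : C :=
  conjc (V (inord i) (inord 0)) * conjc (V (inord j) (inord 1))
  - conjc (V (inord i) (inord 1)) * conjc (V (inord j) (inord 0)).

Lemma setT_setb n : finset.setT = setb n (nseq n true).
Proof. by apply/finset.setP => i; rewrite in_setb finset.inE nth_nseq ltn_ord. Qed.

Lemma restrict_form_top (V : 'M[C]_(3, 2)) (a : ext R 3) :
  restrict_form V a finset.setT =
  a (setb 3 [:: true; true; false]) * minor V 0 1 +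
  a (setb 3 [:: true; false; true]) * minor V 0 2 +
  a (setb 3 [:: false; true; true]) * minor V 1 2.
Proof.
rewrite setT_setb restrict_formE // sum_bool3 /minor /=.
ring.
Qed.

End Density.

(** * Top-degree coefficient of the pull-back by the covering *)

Section PullbackTop.
Variable R : realType.
Local Notation C := (complex R).

Lemma split_inord_l k : (k < 3)%N -> fintype.split (inord k : 'I_(3 + 3)) = inl (inord k).
Proof.
move=> k3; have -> : (inord k : 'I_(3 + 3)) = lshift 3 (inord k).
  by apply: val_inj; rewrite /= !inordK // (leq_trans k3).
exact: (unsplitK (inl _)).
Qed.

Lemma split_inord_r k : (k < 3)%N -> fintype.split (inord (3 + k) : 'I_(3 + 3)) = inr (inord k).
Proof.
move=> k3; have -> : (inord (3 + k) : 'I_(3 + 3)) = rshift 3 (inord k).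
  by apply: val_inj; rewrite /= !inordK // ltn_add2l.
exact: (unsplitK (inr _)).
Qed.

(** The four slots are dw_1, dw_2, d(bar w_1), d(bar w_2): an unbarred differential fills only the
    first two, a barred one only the last two. *)
Definition pull_row (V : 'M[C]_(3, 2)) (i : 'I_(3 + 3)) : seq C :=
  match fintype.split i with
  | inl j => [:: V j (inord 0); V j (inord 1); 0; 0]
  | inr j => [:: 0; 0; conjc (V j (inord 0)); conjc (V j (inord 1))]
  end.

Lemma ext_subst_monom m n (f : 'I_m -> ext R n) I :
  ext_subst f (monom R I) = \big[@wedge R n / monom R finset.set0]_(i <- enum I) f i.
Proof.
rewrite /ext_subst (bigD1 I) // big1 => [|J /negPf hJ].
  by rewrite Monoid.mulm1 [monom R I I]ffunE eqxx scale1r.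
by rewrite ffunE hJ scale0r.
Qed.

Lemma ext_subst_sum m n (f : 'I_m -> ext R n) a :
  ext_subst f a = \sum_I a I *: ext_subst f (monom R I).
Proof. by apply: eq_bigr => I _; rewrite ext_subst_monom. Qed.

Lemma pullback_monom (w : C2 R) s : size s = 6%N ->
  pullback w (monom R (setb 6 s)) finset.setT =
  wedge_coef [seq pull_row (cover_jac w) (inord k) | k <- iota 0 6 & nth false s k]
    [:: true; true; true; true].
Proof.
move=> hs; rewrite /pullback ext_subst_monom setT_setb enum_setb.
rewrite (@bigwedge_coef R 3 _ _ (pull_row (cover_jac w))) //; first by rewrite -map_comp.
have o2 (G : 'I_2 -> ext R 4) : \sum_(k < 2) G k = G (inord 0) + G (inord 1).
  rewrite big_ord_recl big_ord1.
  by congr (G _ + G _); apply: val_inj; rewrite /= inordK.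
have o4' (G : 'I_4 -> ext R 4) :
    \sum_(k < 4) G k = G (inord 0) + G (inord 1) + G (inord 2) + G (inord 3).
  rewrite 3!big_ord_recl big_ord1 !addrA.
  by congr (G _ + G _ + G _ + G _); apply: val_inj; rewrite /= inordK.
have o4 (v : seq C) : \sum_(k < 4) v`_k *: gen R k = v`_0 *: gen R (inord 0)
    + v`_1 *: gen R (inord 1) + v`_2 *: gen R (inord 2) + v`_3 *: gen R (inord 3).
  rewrite o4'.
  rewrite !inordK //.
have e k : (k < 2)%N -> (lshift 2 (inord k : 'I_2) = inord k :> 'I_4) *
    (rshift 2 (inord k : 'I_2) = inord (2 + k) :> 'I_4).
  by move=> k2; split; apply: val_inj; rewrite /= !inordK // (leq_trans k2).
move=> i; rewrite /pull_row; case: (fintype.split i) => j.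
  rewrite o2 (o4 [:: _; _; _; _]).
  rewrite /=.
  rewrite !(scale0r (gen R _ : ext R 4)) 2!(addr0 (_ : ext R 4)).
  by rewrite !e.
rewrite o2 (o4 [:: _; _; _; _]).
rewrite /=.
rewrite !(scale0r (gen R _ : ext R 4)).
rewrite (add0r (0 : ext R 4)).
rewrite (add0r (_ : ext R 4)).
by rewrite !e.
Qed.

Lemma pullback_sum (w : C2 R) (a : ext R (3 + 3)) :
  pullback w a finset.setT = \sum_I a I * pullback w (monom R I) finset.setT.
Proof.
rewrite {1}/pullback ext_subst_sum sum_ffunE; apply: eq_bigr => I _.
by rewrite ext_scaleE.
Qed.

(** The derivatives of zeta_1 = w1^2 and zeta_2 = w2^2 form the diagonal block with entries 2 w1 and
    2 w2, whence 4 w1 w2. The barred part must have degree exactly two to fill the remaining slots,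
    and then contributes a minor. *)
Lemma pullback_monom_top (w : C2 R) a b c :
  pullback w (monom R (setb 6 [:: true; true; false; a; b; c])) finset.setT =
  4 * (w1 w * w2 w) * match a, b, c with
    | true, true, false => minor (cover_jac w) 0 1
    | true, false, true => minor (cover_jac w) 0 2
    | false, true, true => minor (cover_jac w) 1 2
    | _, _, _ => 0
    end.
Proof.
have p0 : pull_row (cover_jac w) (inord 0) = [:: 2 * w1 w; 0; 0; 0].
  by rewrite /pull_row split_inord_l // !mxE !inordK.
have p1 : pull_row (cover_jac w) (inord 1) = [:: 0; 2 * w2 w; 0; 0].
  by rewrite /pull_row split_inord_l // !mxE !inordK.
have p3 k : (k < 3)%N -> pull_row (cover_jac w) (inord (3 + k)) =
    [:: 0; 0; conjc (cover_jac w (inord k) (inord 0));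
       conjc (cover_jac w (inord k) (inord 1))].
  by move=> k3; rewrite /pull_row split_inord_r.
have p30 := p3 0%N isT; have p31 := p3 1%N isT; have p32 := p3 2%N isT.
rewrite pullback_monom // /minor.
rewrite -[iota 0 6]/[:: 0; 1; 2; 3 + 0; 3 + 1; 3 + 2]%N.
case: a; case: b; case: c;
  rewrite [[seq _ | _ <- _ & _]]/= ?p0 ?p1 ?p30 ?p31 ?p32 /=; ring.
Qed.

(** The hypothesis says that every monomial present contains d(zeta_1) d(zeta_2) and not d(zeta_3),
    which is what the structure form imposes on the integrand. Only the three barred bits remain
    free. *)
Lemma pullback_top (w : C2 R) (a : ext R (3 + 3)) :
  (forall b0 b1 b2 b3 b4 b5,
    a (setb 6 [:: b0; b1; b2; b3; b4; b5]) != 0 -> [&& b0, b1 & ~~ b2]) ->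
  pullback w a finset.setT =
  (4 * (w1 w * w2 w)) *
  (a (setb 6 [:: true; true; false; true; true; false]) * minor (cover_jac w) 0 1 +
   a (setb 6 [:: true; true; false; true; false; true]) * minor (cover_jac w) 0 2 +
   a (setb 6 [:: true; true; false; false; true; true]) * minor (cover_jac w) 1 2).
Proof.
move=> ha; rewrite pullback_sum.
pose S (t : bool * bool * bool) : {set 'I_6} :=
  setb 6 [:: true; true; false; t.1.1; t.1.2; t.2].
have Sinj : injective S.
  move=> [[a1 a2] a3] [[b1 b2] b3] /eqP; rewrite /S setb_inj //.
  by move=> /eqP[-> -> ->].
transitivity (\sum_t a (S t) * pullback w (monom R (S t)) finset.setT).
  have /= <- := @big_imset _ _ _ _ _ S predT
    (fun I => a I * pullback w (monom R I) finset.setT) (fun x y _ _ => @Sinj x y).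
  rewrite [RHS]big_mkcond; apply: eq_bigr => I _.
  case: ifP => // /negbT hI; rewrite [I]setb_eta.
  move: (setb_eta I) hI; rewrite !enum_ordSl (size0nil (size_enum_ord 0)) /=.
  set l := [:: _; _; _; _; _; _] => -> hI.
  have [->|nz] := eqVneq (a (setb 6 l)) 0; first by rewrite mul0r.
  have /and3P[h0 h1 h2] := ha _ _ _ _ _ _ nz.
  case/negP: hI; apply/finset.imsetP; rewrite /l h0 h1 (negPf h2).
  by eexists (_, _, _); last reflexivity.
transitivity (\sum_t a (S t) * (4 * (w1 w * w2 w) * match t.1.1, t.1.2, t.2 with
    | true, true, false => minor (cover_jac w) 0 1
    | true, false, true => minor (cover_jac w) 0 2
    | false, true, true => minor (cover_jac w) 1 2
    | _, _, _ => 0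
    end)).
  by apply: eq_bigr => t _; congr (_ * _); exact: pullback_monom_top.
rewrite sum_bool3 /S; cbv beta iota delta [fst snd].
ring.
Qed.

End PullbackTop.

(** * Embedding of the form phi into the exterior algebra on twelve generators *)

Section Integrand.
Variable R : realType.
Local Notation C := (complex R).

Let h (j : 'I_3) : 'I_12 := inord (6 + j).

Let h_val j : h j = (6 + j)%N :> nat.
Proof. by rewrite inordK // -[12%N]/(6 + 6)%N ltn_add2l (leq_trans (ltn_ord j)). Qed.

Let h_inj : injective h.
Proof. by move=> i j /(congr1 val) /=; rewrite !h_val => /addnI /val_inj. Qed.

(** The index map [h] is increasing, so the generators are already in order and no sign appears. *)
Lemma dzetabar_monom (I : {set 'I_3}) :
  ext_subst (@dzetabar R) (monom R I) = monom R (h @: I)%SET.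
Proof.
rewrite ext_subst_monom.
have -> : (h @: I)%SET = [set i in map h (enum I)]%SET.
  apply/finset.setP => i; rewrite finset.inE; apply/finset.imsetP/mapP => -[j jI ->];
    by exists j => //; move: jI; rewrite mem_enum.
have : sorted ltn (map val (enum I)).
  have -> : enum I = [seq x <- enum 'I_3 | x \in I] by rewrite [in RHS]enumT.
  apply: (subseq_sorted ltn_trans (s2 := map val (enum 'I_3))).
    exact/map_subseq/filter_subseq.
  by rewrite val_enum_ord iota_ltn_sorted.
elim: (enum I) => [_|i l IH /=].
  by rewrite big_nil; congr monom; apply/finset.setP => j; rewrite !finset.inE.
move=> pil; rewrite big_cons IH; last exact: path_sorted pil.
rewrite /dzetabar /gen wedge_monom.
  by congr monom; apply/finset.setP => j; rewrite !finset.inE.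
move=> a b; rewrite !finset.inE => /eqP -> /mapP[j jl ->].
rewrite h_val -/(h i) h_val ltn_add2l.
have /allP := order_path_min ltn_trans pil; apply.
exact: map_f.
Qed.

Lemma dzetabar_coef (phi : ext R 3) u0 u1 u2 u3 u4 u5 v0 v1 v2 x0 x1 x2 :
  ext_subst (@dzetabar R) phi
    (setb 12 [:: u0; u1; u2; u3; u4; u5; v0; v1; v2; x0; x1; x2]) =
  if has id [:: u0; u1; u2; u3; u4; u5; x0; x1; x2] then 0
  else phi (setb 3 [:: v0; v1; v2]).
Proof.
set u := [:: u0, u1 & _].
rewrite ext_subst_sum sum_ffunE.
transitivity (\sum_I phi I * (setb 12 u == (h @: I)%SET)%:R).
  by apply: eq_bigr => I _; rewrite ext_scaleE dzetabar_monom ffunE.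
have hb (I : {set 'I_3}) (i : 'I_12) : (i \in (h @: I)%SET) -> (6 <= i < 9)%N.
  case/finset.imsetP => j _ ->; rewrite h_val.
  by case: j => -[|[|[|]]].
case: ifPn => [|nh].
  move=> hu; apply: big1 => I _; case: eqP => [e|]; last by rewrite mulr0.
  have out k : (k < 12)%N -> ~~ (6 <= k < 9)%N -> nth false u k = false.
    move=> k12 hk; apply: contraNF hk => hk.
    have := hb I (inord k); rewrite inordK //; apply.
    by rewrite -e in_setb inordK.
  move: hu; rewrite /= (out 0%N isT isT : u0 = false) (out 1%N isT isT : u1 = false)
    (out 2 isT isT : u2 = false) (out 3 isT isT : u3 = false) (out 4 isT isT : u4 = false)
    (out 5 isT isT : u5 = false) (out 9 isT isT : x0 = false) (out 10 isT isT : x1 = false)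
    (out 11 isT isT : x2 = false).
  by [].
have e : setb 12 u = (h @: (setb 3 [:: v0; v1; v2]))%SET.
  apply/finset.setP => i; rewrite in_setb; apply/idP/finset.imsetP.
    move: nh; rewrite /= !negb_or => /and4P[/negPf n0 /negPf n1 /negPf n2].
    move=> /and4P[/negPf n3 /negPf n4 /negPf n5] /and4P[/negPf n6 /negPf n7 /negPf n8 _] ui.
    have i6 : (6 <= i < 9)%N.
      move: ui; rewrite /u n0 n1 n2 n3 n4 n5 n6 n7 n8.
      by case: i => -[|[|[|[|[|[|[|[|[|[|[|[|]]]]]]]]]]]].
    exists (inord (i - 6)); last first.
      by apply: ord_inj; rewrite h_val inordK; lia.
    rewrite in_setb inordK; last lia.
    case/andP: i6 => i6 i9; rewrite -[nat_of_ord i](subnKC i6) in ui.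
    by have : (i - 6 < 3)%N by [lia]; move: ui; case: (i - 6)%N => [|[|[|]]].
  case=> j; rewrite in_setb => hj ->; rewrite h_val.
  by move: hj; case: j => -[|[|[|]]].
rewrite (bigD1 (setb 3 [:: v0; v1; v2])) //= e eqxx mulr1 big1 ?addr0 // => I /negPf hI.
by rewrite (inj_eq (finset.imset_inj h_inj)) eq_sym hI mulr0.
Qed.

End Integrand.

(** * Pull-back of the integrand to C^2 *)

Section DensityFormula.
Variable R : realType.
Local Notation C := (complex R).

Lemma zeta_part_setb (a : ext R 12) b0 b1 b2 b3 b4 b5 j0 j1 j2 :
  zeta_part (setb 3 [:: j0; j1; j2]) a (setb 6 [:: b0; b1; b2; b3; b4; b5]) =
  a (setb 12 [:: false; false; false; b0; b1; b2; b3; b4; b5; j0; j1; j2]).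
Proof.
rewrite ffunE; congr (a _); apply/finset.setP => i; rewrite in_setb finset.inE.
apply/orP/idP => [[]/finset.imsetP[k]|].
- rewrite in_setb => + ->; rewrite inordK; last by case: k => k /= k6; lia.
  by case: k => -[|[|[|[|[|[|]]]]]].
- rewrite in_setb => + ->; rewrite inordK; last by case: k => k /= k6; lia.
  by case: k => -[|[|[|]]].
move=> hi; have i12 := ltn_ord i.
have i3 : (3 <= i)%N by move: hi; case: i {i12} => -[|[|[|i]]].
have [i9|i9] := ltnP i 9; [left|right]; apply/finset.imsetP.
  exists (inord (i - 3)); last by apply: ord_inj; rewrite !inordK; lia.
  rewrite in_setb inordK; last lia.
  move: hi; rewrite -[nat_of_ord i](subnKC i3); have : (i - 3 < 6)%N by lia.
  by rewrite addKn; case: (i - 3)%N => [|[|[|[|[|[|]]]]]].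
exists (inord (i - 9)); last by apply: ord_inj; rewrite !inordK; lia.
rewrite in_setb inordK; last lia.
move: hi; rewrite -[nat_of_ord i](subnKC i9); have : (i - 9 < 3)%N by lia.
by rewrite addKn; case: (i - 9)%N => [|[|[|]]].
Qed.

Lemma bars_sum (V : nmodType) (F : 'I_12 -> V) :
  \sum_(i in bars) F i = \sum_(k <- iota 6 6) F (inord k).
Proof.
rewrite big_mkcond /= (eq_bigr (fun i : 'I_12 => if (6 <= i)%N then F (inord i) else 0));
  last by move=> i _; rewrite finset.inE inord_val.
rewrite -(big_mkord xpredT (fun k => if (6 <= k)%N then F (inord k) else 0)).
rewrite (big_cat_nat _ (n := 6)) // big_nat big1; last first.
  by move=> i /andP[_ i6]; rewrite leqNgt i6.
rewrite Monoid.mul1m.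
by apply: eq_big_seq => k; rewrite mem_index_iota => /andP[-> _].
Qed.

Lemma monom34 : wedge (dzeta R 0) (dzeta R 1) =
  monom R (setb 12 [seq (k == 3) || (k == 4) | k <- iota 0 12]).
Proof.
rewrite /dzeta /gen wedge_monom; last first.
  by move=> i j; rewrite !finset.inE => /eqP -> /eqP ->; rewrite !inordK.
congr monom; apply/finset.setP => i; rewrite in_setb !finset.inE -!val_eqE /= !inordK //.
by case: i => -[|[|[|[|[|[|[|[|[|[|[|[|]]]]]]]]]]]].
Qed.

Lemma monom34_gen k : (6 <= k < 12)%N ->
  wedge (monom R (setb 12 [seq (k == 3) || (k == 4) | k <- iota 0 12])) (gen R (inord k)) =
  monom R (setb 12 [seq [|| (i == 3), (i == 4) | (i == k)] | i <- iota 0 12]).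
Proof.
move=> /andP[k6 k12]; rewrite /gen wedge_monom; last first.
  move=> i j; rewrite in_setb finset.inE => hi /eqP ->; rewrite inordK //.
  apply: leq_trans k6.
  by move: hi; case: i => -[|[|[|[|[|[|[|[|[|[|[|[|]]]]]]]]]]]].
congr monom; apply/finset.setP => i; rewrite finset.inE !in_setb finset.inE.
rewrite !(nth_map 0%N) ?size_iota // !nth_iota // -val_eqE /= inordK //.
by rewrite -orbA add0n.
Qed.

(** The index follows the coframe: 6, 7, 8 are the d(bar zeta_j), and 9, 10, 11 are the d(bar
    z_j). *)
Definition kernel_coef (chi : C3 R -> R) (x : C3 R * C3 R) (k : nat) : C :=
  kernel_rhs chi x (etas :|: [set inord k])%SET.

Lemma Kform_wedge chi zeta z (Phi : ext R 12) s : size s = 12%N ->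
  wedge (Kform chi zeta z) Phi (setb 12 s) =
  (- 2 * z3 zeta)^-1 * \sum_(k <- iota 6 6) kernel_coef chi (zeta, z) k *
    (let m := [seq [|| (i == 3), (i == 4) | (i == k)] | i <- iota 0 12] in
     if subb m s then
       if sgnb m (diffb s m) then - Phi (setb 12 (diffb s m)) else Phi (setb 12 (diffb s m))
     else 0).
Proof.
move=> hs; rewrite /Kform /omega monom34 wedgeZl wedgeZl ext_scaleE; congr (_ * _).
rewrite /Ktilde wedge_sumr wedge_suml sum_ffunE bars_sum.
apply: eq_big_seq => k; rewrite mem_iota => hk.
rewrite wedgeZr wedgeZl ext_scaleE; congr (_ * _).
by rewrite monom34_gen // wedge_monom_setb.
Qed.

Definition density chi phi z J (w : C2 R) := pulled_density (integrand chi phi z J) w.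

(** 16 is the factor 4 of [pulled_density] times the Jacobian factor 4 of d(zeta_1) d(zeta_2); the
    inverse is that of the structure form. The value is -8 off the axes and, as the inverse of 0 is
    0, it is 0 where w1 w2 = 0. *)
Definition unitfactor (w : C2 R) : C := 16 * (w1 w * w2 w) * (- 2 * (w1 w * w2 w))^-1.

Lemma z3_cover w : z3 (cover w) = w1 w * w2 w :> C.
Proof. by rewrite /z3 /cover /= fromCK. Qed.

(** The kernel has degree one in the barred differentials. Either it contributes a d(bar zeta_k),
    which is paired with the (0,1)-part of [phi], or a d(bar z_k), and then [phi] has to supply both
    barred differentials in zeta; nothing is left for [J] with two or more elements. *)
Lemma densityE chi phi z (w : C2 R) j0 j1 j2 :
  density chi phi z (setb 3 [:: j0; j1; j2]) w =
  let c := kernel_coef chi (cover w, z) in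
  let f a b c := phi (cover w) (setb 3 [:: a; b; c]) in
  let m := minor (cover_jac w) in
  unitfactor w *
  match j0, j1, j2 with
  | false, false, false =>
      (c 6%N * f false true false - c 7%N * f true false false) * m 0%N 1%N +
      (c 6%N * f false false true - c 8%N * f true false false) * m 0%N 2%N +
      (c 7%N * f false false true - c 8%N * f false true false) * m 1%N 2%N
  | true, false, false => c 9%N * restrict_form (cover_jac w) (phi (cover w)) finset.setT
  | false, true, false => c 10%N * restrict_form (cover_jac w) (phi (cover w)) finset.setT
  | false, false, true => c 11%N * restrict_form (cover_jac w) (phi (cover w)) finset.setT
  | _, _, _ => 0
  end.
Proof.
rewrite /density /pulled_density /integrand pullback_top; last first.
  move=> b0 b1 b2 b3 b4 b5; rewrite zeta_part_setb Kform_wedge // mulf_eq0 negb_or.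
  case/andP=> _; apply: contraNT => nb; rewrite big1_seq // => k; rewrite mem_iota.
  case/andP=> _ hk; apply/eqP; rewrite mulf_eq0; apply/orP; right.
  move: hk; rewrite -(mem_iota 6 6) [iota 6 6]/= !inE.
  by case/orP=> [/eqP->|/orP[/eqP->|/orP[/eqP->|/orP[/eqP->|/orP[/eqP->|/eqP->]]]]];
    rewrite /= !dzetabar_coef; case: b0 nb => //=; case: b1 => //=; case: b2 => //= _;
    rewrite ?oppr0 ?if_same.
rewrite !zeta_part_setb !Kform_wedge // z3_cover /unitfactor restrict_form_top.
set c := kernel_coef _ _.
rewrite [iota 6 6]/= !big_cons !big_nil.
by case: j0; case: j1; case: j2; rewrite /= !dzetabar_coef /=;
  set u := (_ * _)^-1; clearbody u c; ring.
Qed.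

End DensityFormula.

(** * Coefficients of the kernel *)

Section KernelCoefficients.
Variable R : realType.
Local Notation C := (complex R).
Implicit Types (x y : C3 R * C3 R) (chi : C3 R -> R).

Lemma wedge_monomr_setb n (s t : seq bool) (b : ext R n) :
  size s = n -> size t = n ->
  wedge b (monom R (setb n s)) (setb n t) =
  if subb s t then
    if sgnb (diffb t s) s then - b (setb n (diffb t s)) else b (setb n (diffb t s))
  else 0.
Proof.
move=> hs ht; rewrite ffunE; case: ifPn => hst.
  have hsub : setb n s \subset setb n t by rewrite subb_setb.
  have e1 : (setb n t :\: (setb n t :\: setb n s) = setb n s)%SET.
    by rewrite finset.setDDr finset.setDv finset.set0U; apply/finset.setIidPr.
  rewrite (bigD1 (setb n t :\: setb n s)%SET) ?finset.subsetDl //=.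
  rewrite big1 => [|I /andP[It /eqP hI]]; last first.
    rewrite ffunE; case: eqP => [e|]; last by rewrite mulr0.
    case: hI; rewrite -e finset.setDDr finset.setDv finset.set0U.
    by apply/esym/finset.setIidPr.
  rewrite e1 Monoid.mulm1 ffunE eqxx mulr1 diffb_setb //.
  rewrite (invb_setb (size_diffb hs ht) hs) -signr_odd -sgnbE.
  by case: sgnb; rewrite ?expr0 ?expr1 ?mulN1r ?mul1r.
rewrite big1 // => I It; rewrite ffunE; case: eqP => [e|]; last by rewrite mulr0.
case/negP: hst; rewrite -(subb_setb hs ht) -e; exact: finset.subsetDl.
Qed.

Definition form3 (v : nat -> C) : ext R 12 :=
  v 0%N *: gen R (inord 0) + v 1%N *: gen R (inord 1) + v 2%N *: gen R (inord 2).

Lemma wedge_form3l v (b : ext R 12) b0 b1 b2 t :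
  wedge (form3 v) b (setb 12 [:: b0, b1, b2 & t]) =
  (if b0 then v 0%N * b (setb 12 [:: false, b1, b2 & t]) else 0) +
  (if b1 then v 1%N * ((-1) ^+ b0 * b (setb 12 [:: b0, false, b2 & t])) else 0) +
  (if b2 then v 2%N * ((-1) ^+ (b0 + b1) * b (setb 12 [:: b0, b1, false & t])) else 0).
Proof.
rewrite /form3 2!wedgeDl 3!wedgeZl 2!ext_addE 3!ext_scaleE.
rewrite !wedge_gen_setb //= !addn0 expr0 mul1r.
by case: b0; case: b1; case: b2; rewrite /= ?mulr0.
Qed.

Lemma wedge_form3r v (b : ext R 12) t : size t = 12%N ->
  wedge b (form3 v) (setb 12 t) =
  \sum_(k <- iota 0 3) v k *
    (let s := [seq k == i | i <- iota 0 12] in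
     if subb s t then
       if sgnb (diffb t s) s then - b (setb 12 (diffb t s)) else b (setb 12 (diffb t s))
     else 0).
Proof.
move=> ht; rewrite /form3 2!wedgeDr 3!wedgeZr 2!ext_addE 3!ext_scaleE.
rewrite /gen !set1_setb // !wedge_monomr_setb //.
by rewrite !big_cons big_nil addr0 addrA.
Qed.

Lemma form3_setb v t : size t = 12%N ->
  form3 v (setb 12 t) = \sum_(k <- iota 0 3) v k * (t == [seq k == i | i <- iota 0 12])%:R.
Proof.
by move=> ht; rewrite /form3 2!ext_addE 3!ext_scaleE !gen_setb // !big_cons big_nil addr0 addrA.
Qed.

Lemma sum_wedge_gen_setb n (c : {set 'I_n.+1} -> C) k s : (k < n.+1)%N ->
  (\sum_I c I *: wedge (gen R (inord k)) (monom R I)) (setb n.+1 s) =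
  if nth false s k then
    (-1) ^+ count id (take k s) * c (setb n.+1 (set_nth false s k false))
  else 0.
Proof.
move=> kn; rewrite sum_ffunE.
under eq_bigr => I _ do rewrite ext_scaleE wedge_gen_setb //.
case: ifP => h; last by rewrite big1 // => I _; rewrite mulr0.
set K := setb _ _; rewrite (bigD1 K) //= big1.
  by rewrite ffunE eqxx Monoid.mulm1 mulr1 mulrC.
by move=> I /negPf hI; rewrite ffunE eq_sym hI !mulr0.
Qed.

(** Each term of [dbar] adjoins one barred generator, so the coefficient at [t] collects signed
    derivatives of the coefficients obtained by erasing one barred bit of [t]. *)
Lemma dbar_setb (al : C3 R * C3 R -> ext R 12) x t :
  dbar al x (setb 12 t) = \sum_(j < 3)
   ((if nth false t (6 + j) then (-1) ^+ count id (take (6 + j) t) *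
      dbar_zeta j (fun y => al y (setb 12 (set_nth false t (6 + j) false))) x else 0) +
    (if nth false t (9 + j) then (-1) ^+ count id (take (9 + j) t) *
      dbar_z j (fun y => al y (setb 12 (set_nth false t (9 + j) false))) x else 0)).
Proof.
rewrite /dbar exchange_big sum_ffunE; apply: eq_bigr => j _.
rewrite big_split [LHS]ext_addE.
have j6 : (6 + j < 12)%N by rewrite -[12%N]/(6 + 6)%N ltn_add2l (leq_trans (ltn_ord j)).
have j9 : (9 + j < 12)%N by rewrite -[12%N]/(9 + 3)%N ltn_add2l.
have /= <- := sum_wedge_gen_setb (fun I => dbar_zeta j (fun y => al y I) x) t j6.
by have /= <- := sum_wedge_gen_setb (fun I => dbar_z j (fun y => al y I) x) t j9.
Qed.

Definition hcoef x (a : nat) : C :=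
  [:: 2^-1 * (z2 x.1 + z2 x.2); 2^-1 * (z1 x.1 + z1 x.2); - (z3 x.1 + z3 x.2)]`_a.

Definition etan x (a : nat) : C := eta x (inord a).

Definition eta2 x : C := \sum_j eta x j * conjc (eta x j).

Definition scoef (a : nat) x : C := (twopii R * eta2 x)^-1 * conjc (etan x a).

Definition sigcoef (a : nat) x : C :=
  (twopii R * (\sum_j crd x.1 j * conjc (crd x.1 j)
             - \sum_j conjc (crd x.1 j) * crd x.2 j))^-1 * conjc (crd x.1 (inord a)).

Let v3 k : (k < 3)%N -> nat_of_ord (inord k : 'I_3) = k.
Proof. exact: inordK. Qed.

Lemma sum_ord3 (V : nmodType) (F : 'I_3 -> V) :
  \sum_(j < 3) F j = F (inord 0) + F (inord 1) + F (inord 2).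
Proof.
rewrite 2!big_ord_recl big_ord1 addrA.
by congr (F _ + F _ + F _); apply: val_inj; rewrite /= inordK.
Qed.

Lemma hformE x : hform x = form3 (hcoef x).
Proof.
have d0 : de R 0 = gen R (inord 0) by [].
have d1 : de R 1 = gen R (inord 1) by [].
have d2 : de R 2 = gen R (inord 2) by [].
by rewrite /hform /form3 d0 d1 d2 scalerDr !scalerA -scaleNr.
Qed.

Lemma sformE x : sform x = form3 (scoef^~ x).
Proof.
rewrite /sform (sum_ord3 (fun j => conjc (eta x j) *: de R j)) /de !v3 //.
by rewrite !scalerDr !scalerA.
Qed.

Lemma sigmaformE x : sigmaform x = form3 (sigcoef^~ x).
Proof.
rewrite /sigmaform (sum_ord3 (fun j => conjc (crd x.1 j) *: de R j)) /de !v3 //.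
by rewrite !scalerDr !scalerA.
Qed.

(** The 3 by 3 determinant with rows [h], [s], [t]: the coefficient of d(eta_1) d(eta_2) d(eta_3) in
    the product of three one-forms in the d(eta_j). *)
Definition det3 (h s t : nat -> C) : C :=
  h 0%N * (s 1%N * t 2%N - s 2%N * t 1%N)
  - h 1%N * (s 0%N * t 2%N - s 2%N * t 0%N)
  + h 2%N * (s 0%N * t 1%N - s 1%N * t 0%N).

Lemma etasU_setb k : (k < 12)%N -> (etas :|: [set inord k])%SET =
  setb 12 [seq (i < 3)%N || (k == i) | i <- iota 0 12].
Proof.
move=> k12; apply/finset.setP => i; rewrite in_setb !finset.inE -val_eqE /= inordK //.
by case: i => -[|[|[|[|[|[|[|[|[|[|[|[|]]]]]]]]]]]] //= _; rewrite eq_sym ?orbF.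
Qed.

(** The minus sign comes from moving d(bar z_j) past d(eta_k) into increasing order. *)
Lemma dbar_sform_zbar x j k : (k < 3)%N -> (j < 3)%N ->
  dbar (@sform R) x (setb 12 [seq (k == i) || (9 + j == i)%N | i <- iota 0 12]) =
  - dbar_z (inord j) (scoef k) x.
Proof.
move=> k3 j3; rewrite dbar_setb sum_ord3 !inordK //.
have E : (fun y => sform y (setb 12 [seq (k == i) | i <- iota 0 12])) = scoef k.
  apply/funext => y; rewrite sformE form3_setb // !big_cons big_nil.
  by case: k k3 => [|[|[|//]]] _ /=; rewrite ?mulr1 ?mulr0 ?addr0 ?add0r.
rewrite -E.
case: k k3 {E} => [|[|[|//]]] _; case: j j3 => [|[|[|//]]] _ /=;
  by rewrite ?addr0 ?add0r /= expr1 mulN1r.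
Qed.

Lemma dbar_sform_zetabar x j k : (k < 3)%N -> (j < 3)%N ->
  dbar (@sform R) x (setb 12 [seq (k == i) || (6 + j == i)%N | i <- iota 0 12]) =
  - dbar_zeta (inord j) (scoef k) x.
Proof.
move=> k3 j3; rewrite dbar_setb sum_ord3 !inordK //.
have E : (fun y => sform y (setb 12 [seq (k == i) | i <- iota 0 12])) = scoef k.
  apply/funext => y; rewrite sformE form3_setb // !big_cons big_nil.
  by case: k k3 => [|[|[|//]]] _ /=; rewrite ?mulr1 ?mulr0 ?addr0 ?add0r.
rewrite -E.
case: k k3 {E} => [|[|[|//]]] _; case: j j3 => [|[|[|//]]] _ /=;
  by rewrite ?addr0 ?add0r /= expr1 mulN1r.
Qed.

End KernelCoefficients.

(** * The kernel coefficients as determinants *)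

Section KernelFormulas.
Variable R : realType.
Local Notation C := (complex R).
Implicit Types (x y : C3 R * C3 R) (chi : C3 R -> R).

Lemma derive_fst (g : C3 R -> R) x (v u : C3 R) :
  'D_(v, u) (fun y : C3 R * C3 R => g y.1 : R) x = 'D_v g x.1.
Proof. by rewrite /derive. Qed.

Lemma derive_v0 (g : C3 R -> R) (a : C3 R) : 'D_0 g a = 0.
Proof.
rewrite /derive /= (_ : (fun h : R => _) = cst 0) ?lim_cst //.
by apply/funext => h /=; rewrite scaler0 add0r subrr scaler0.
Qed.

Definition dchi chi (j : nat) (zeta : C3 R) : C :=
  2^-1 * (('D_(axis (inord j) (1, 0)) chi zeta : R)%:C%C
          + (0 +i* 1)%C * ('D_(axis (inord j) (0, 1)) chi zeta : R)%:C%C).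

Lemma real_deriv_chi chi x v u :
  real_deriv (fun y => (chi y.1)%:C%C) x (v, u) = ('D_v chi x.1)%:C%C.
Proof.
rewrite /real_deriv /= (derive_fst chi x v u); congr (_ +i* _)%C.
exact: (derive_fst (fun=> 0) x v u) || exact: derive_cst.
Qed.

Lemma dbar_zeta_chi chi x j :
  dbar_zeta (inord j) (fun y => (chi y.1)%:C%C) x = dchi chi j x.1.
Proof. by rewrite /dbar_zeta !real_deriv_chi. Qed.

Lemma dbar_z_chi chi x j : dbar_z j (fun y => (chi y.1)%:C%C) x = 0.
Proof. by rewrite /dbar_z !real_deriv_chi !derive_v0 mulr0 addr0 mulr0. Qed.

Lemma dbar_chiform_z chi x j : (j < 3)%N ->
  dbar (chiform chi) x (setb 12 [seq (9 + j == i)%N | i <- iota 0 12]) = 0.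
Proof.
move=> j3; rewrite dbar_setb sum_ord3 !inordK //.
have E : (fun y => chiform chi y (setb 12 (nseq 12 false))) = (fun y => (chi y.1)%:C%C).
  by apply/funext => y; rewrite /chiform ext_scaleE monom0_setb // eqxx mulr1.
by case: j j3 => [|[|[|//]]] _ /=; rewrite E dbar_z_chi ?mulr0 !addr0.
Qed.

Lemma dbar_chiform_zeta chi x j : (j < 3)%N ->
  dbar (chiform chi) x (setb 12 [seq (6 + j == i)%N | i <- iota 0 12]) = dchi chi j x.1.
Proof.
move=> j3; rewrite dbar_setb sum_ord3 !inordK //.
have E : (fun y => chiform chi y (setb 12 (nseq 12 false))) = (fun y => (chi y.1)%:C%C).
  by apply/funext => y; rewrite /chiform ext_scaleE monom0_setb // eqxx mulr1.
by case: j j3 => [|[|[|//]]] _ /=; rewrite E dbar_zeta_chi ?addr0 ?add0r expr0 mul1r.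
Qed.

(** The tail [t] contains an odd number of generators beyond the d(eta_j). A right factor d(eta_k)
    crosses all of them, and this is the sign by which the formula differs from the one for a left
    factor. *)
Lemma wedge_form3r_prefix v (b : ext R 12) b0 b1 b2 t :
  size t = 9%N -> foldr addb false t ->
  wedge b (form3 v) (setb 12 [:: b0, b1, b2 & t]) =
  (if b0 then v 0%N * ((-1) ^+ (~~ (b1 (+) b2)) * b (setb 12 [:: false, b1, b2 & t])) else 0) +
  (if b1 then v 1%N * ((-1) ^+ (~~ b2) * b (setb 12 [:: b0, false, b2 & t])) else 0) +
  (if b2 then v 2%N * - b (setb 12 [:: b0, b1, false & t]) else 0).
Proof.
move=> ht par; have ht' : size [:: b0, b1, b2 & t] = 12%N by rewrite /= ht.
have d0 n s : size s = n -> diffb s (nseq n false) = s.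
  by elim: n s => [|n IH] [|c s] //= [/IH ->]; rewrite andbT.
have s0 n s : sgnb s (nseq n false) = false.
  by elim: n s => [|n IH] [|c s] //=.
have u0 n s : subb (nseq n false) s by elim: n s => [|n IH] [|c s] //=.
rewrite wedge_form3r //.
have -> : iota 0 3 = [:: 0; 1; 2]%N by [].
rewrite !big_cons big_nil addr0 addrA.
rewrite -[[seq 0%N == i | i <- _]]/[:: true, false, false & nseq 9 false].
rewrite -[[seq 1%N == i | i <- _]]/[:: false, true, false & nseq 9 false].
rewrite -[[seq 2%N == i | i <- _]]/[:: false, false, true & nseq 9 false].
set Z := nseq 9 false; have dZ : diffb t Z = t := d0 _ _ ht.
have sZ : sgnb t Z = false := s0 _ _.
have uZ : subb Z t := u0 _ _.
clearbody Z.
rewrite /= dZ sZ uZ par !andbT !andbF !addbF /=.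
by move: ht' => _; case: b0; case: b1; case: b2; rewrite /= ?mulr0 ?expr0 ?expr1 ?mulN1r ?mul1r.
Qed.

(** Moving the odd monomial [t] of [X] to the right past two one-forms costs no sign, which leaves
    the determinant of the three one-forms. *)
Lemma wedge_form3_mid h u v (X : ext R 12) t : size t = 9%N -> foldr addb false t ->
  wedge (form3 h) (wedge (wedge X (form3 u)) (form3 v)) (setb 12 [:: true, true, true & t]) =
  X (setb 12 [:: false, false, false & t]) * det3 h u v.
Proof.
move=> ht par; have P w b b0 b1 b2 := @wedge_form3r_prefix w b b0 b1 b2 t ht par.
have Q b0 b1 b2 := P u X b0 b1 b2.
have {}P b0 b1 b2 := P v (wedge X (form3 u)) b0 b1 b2.
move: P; rewrite wedge_form3l; move: (wedge (wedge _ _) _) => Y P.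
rewrite !P; move: {Y P} Q; move: (wedge X _) => Y Q; rewrite !Q /det3 {Q}.
cbv beta iota delta [addb negb nat_of_bool].
ring.
Qed.

Lemma chi_part chi x t : size t = 9%N -> foldr addb false t ->
  wedge (hform x) (wedge (wedge (dbar (chiform chi) x) (sigmaform x)) (sform x))
    (setb 12 [:: true, true, true & t]) =
  dbar (chiform chi) x (setb 12 [:: false, false, false & t])
   * det3 (hcoef x) (fun a => sigcoef a x) (fun a => scoef a x).
Proof. by move=> ht par; rewrite hformE sformE sigmaformE wedge_form3_mid. Qed.

(** Treats both kinds of barred generators at once, selected by the tail [t]: [c] is the
    corresponding coefficient of dbar chi, and [D k] that of dbar s at d(eta_k). *)
Lemma kernel_rhs_setb chi x t (c : C) (D : nat -> C) :
  size t = 9%N -> foldr addb false t ->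
  dbar (chiform chi) x (setb 12 [:: false, false, false & t]) = c ->
  (forall k, (k < 3)%N ->
     dbar (@sform R) x (setb 12 [:: 0 == k, 1 == k, 2 == k & t]) = D k) ->
  kernel_rhs chi x (setb 12 [:: true, true, true & t]) =
  (chi x.1)%:C%C * det3 (hcoef x) (fun a => scoef a x) D
  - c * det3 (hcoef x) (fun a => sigcoef a x) (fun a => scoef a x).
Proof.
move=> ht par hc hD.
rewrite -{1}hc -(chi_part chi x ht par) /kernel_rhs wedgeDr wedgeZr ext_addE ext_scaleE.
rewrite -[in X in _ + X]scaleN1r wedgeZr scaleN1r ext_oppE.
apply: (f_equal2 (fun a b : C => (chi x.1)%:C%C * a - b)) => //.
rewrite hformE sformE.
have D0 := hD 0%N isT; have D1 := hD 1%N isT; have D2 := hD 2%N isT.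
rewrite /det3 -D0 -D1 -D2; move: (dbar _ _) => X.
rewrite wedge_form3l !wedge_form3l /= !addn0 /=.
ring.
Qed.

(** The cut-off depends on zeta only, so the sigma term has no component along d(bar z_j). *)
Lemma kernel_coef_z chi x j : (j < 3)%N ->
  kernel_coef chi x (9 + j) =
  (chi x.1)%:C%C * det3 (hcoef x) (fun a => scoef a x) (fun a => - dbar_z (inord j) (scoef a) x).
Proof.
move=> j3; have j12 : (9 + j < 12)%N by rewrite -[12%N]/(9 + 3)%N ltn_add2l.
pose t := [seq (9 + j == i)%N | i <- iota 3 9].
have ht : size t = 9%N by [].
have par : foldr addb false t by rewrite /t; case: j j3 {j12 t ht} => [|[|[|//]]].
have e1 : [seq (i < 3)%N || (9 + j == i)%N | i <- iota 0 12] = [:: true, true, true & t] by [].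
have e0 : [seq (9 + j == i)%N | i <- iota 0 12] = [:: false, false, false & t] by [].
have Z := dbar_chiform_z chi x j3; rewrite e0 in Z.
have D k : (k < 3)%N -> dbar (@sform R) x (setb 12 [:: 0 == k, 1 == k, 2 == k & t])
    = - dbar_z (inord j) (scoef k) x.
  move=> k3; rewrite -(dbar_sform_zbar x k3 j3); congr (dbar _ _ (setb _ _)).
  by case: k k3 => [|[|[|//]]].
rewrite /kernel_coef (etasU_setb j12) e1 (kernel_rhs_setb ht par Z D).
by rewrite (mul0r (det3 _ _ _)) subr0.
Qed.

Lemma kernel_coef_zeta chi x j : (j < 3)%N ->
  kernel_coef chi x (6 + j) =
  (chi x.1)%:C%C * det3 (hcoef x) (fun a => scoef a x)
    (fun a => - dbar_zeta (inord j) (scoef a) x)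
  - dchi chi j x.1 * det3 (hcoef x) (fun a => sigcoef a x) (fun a => scoef a x).
Proof.
move=> j3; have j12 : (6 + j < 12)%N.
  by rewrite -[12%N]/(6 + 6)%N ltn_add2l (leq_trans j3).
pose t := [seq (6 + j == i)%N | i <- iota 3 9].
have ht : size t = 9%N by [].
have par : foldr addb false t by rewrite /t; case: j j3 {j12 t ht} => [|[|[|//]]].
have e1 : [seq (i < 3)%N || (6 + j == i)%N | i <- iota 0 12] = [:: true, true, true & t] by [].
have e0 : [seq (6 + j == i)%N | i <- iota 0 12] = [:: false, false, false & t] by [].
have Z := dbar_chiform_zeta chi x j3; rewrite e0 in Z.
have D k : (k < 3)%N -> dbar (@sform R) x (setb 12 [:: 0 == k, 1 == k, 2 == k & t])
    = - dbar_zeta (inord j) (scoef k) x.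
  move=> k3; rewrite -(dbar_sform_zetabar x k3 j3); congr (dbar _ _ (setb _ _)).
  by case: k k3 => [|[|[|//]]].
rewrite /kernel_coef (etasU_setb j12) e1 (kernel_rhs_setb ht par Z D).
by [].
Qed.

End KernelFormulas.

(** * The modulus of complex numbers *)

Section ComplexModulus.
Variable R : realType.
Local Notation C := (complex R).
Implicit Types (a b c : C).

(** A modulus with values in [R], fit for real integrals; the norm of [R[i]] as a numeric field
    takes its values in [R[i]]. *)
Definition cnorm c : R := Num.sqrt (cabs2 c).

Lemma cnormE c : cnorm c = Normc.normc c.
Proof. by case: c. Qed.

Lemma cnorm_ge0 c : 0 <= cnorm c.
Proof. exact: sqrtr_ge0. Qed.

Lemma cabs2_ge0 c : 0 <= cabs2 c.
Proof. by rewrite addr_ge0 ?sqr_ge0. Qed.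

Lemma cnorm_sqr c : cnorm c ^+ 2 = cabs2 c.
Proof. by rewrite sqr_sqrtr ?cabs2_ge0. Qed.

Lemma cnorm0 : cnorm 0 = 0.
Proof. by rewrite cnormE Normc.normc0. Qed.

Lemma cnorm1 : cnorm 1 = 1.
Proof. by rewrite cnormE Normc.normc1. Qed.

Lemma cnormM a b : cnorm (a * b) = cnorm a * cnorm b.
Proof. by rewrite !cnormE Normc.normcM. Qed.

Lemma cnormV a : cnorm a^-1 = (cnorm a)^-1.
Proof. by rewrite !cnormE Normc.normcV. Qed.

Lemma cnormD a b : cnorm (a + b) <= cnorm a + cnorm b.
Proof. by rewrite !cnormE; exact: le_normcD. Qed.

Lemma cnormN a : cnorm (- a) = cnorm a.
Proof. by rewrite !cnormE normcN. Qed.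

Lemma cnormB a b : cnorm (a - b) <= cnorm a + cnorm b.
Proof. by rewrite -(cnormN b); exact: cnormD. Qed.

Lemma cnormJ a : cnorm (conjc a) = cnorm a.
Proof. by case: a => x y; rewrite /cnorm /cabs2 /= sqrrN. Qed.

Lemma cnorm_real (x : R) : cnorm x%:C%C = `|x|.
Proof. by rewrite /cnorm /cabs2 /= expr0n addr0 sqrtr_sqr. Qed.

Lemma cnorm_Re a : `|complex.Re a| <= cnorm a.
Proof.
by rewrite -sqrtr_sqr ler_wsqrtr // lerDl sqr_ge0.
Qed.

Lemma cnorm_Im a : `|complex.Im a| <= cnorm a.
Proof.
by rewrite -sqrtr_sqr ler_wsqrtr // lerDr sqr_ge0.
Qed.

Lemma cnorm_ReIm a : cnorm a <= `|complex.Re a| + `|complex.Im a|.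
Proof.
rewrite -[leRHS]ger0_norm ?addr_ge0 // -sqrtr_sqr ler_wsqrtr // /cabs2.
rewrite sqrrD !real_normK ?num_real // -addrA lerD2l lerDr.
by rewrite mulrn_wge0 // mulr_ge0.
Qed.

Lemma cnorm_eq0 a : (cnorm a == 0) = (a == 0).
Proof.
apply/eqP/eqP => [|->]; last exact: cnorm0.
by rewrite cnormE => /Normc.eq0_normc.
Qed.

Lemma cnorm_sum (I : Type) (r : seq I) (F : I -> C) :
  cnorm (\sum_(i <- r) F i) <= \sum_(i <- r) cnorm (F i).
Proof.
elim: r => [|i r IH]; first by rewrite !big_nil cnorm0.
by rewrite !big_cons (le_trans (cnormD _ _)) // lerD2l.
Qed.

Lemma mulcJ c : c * conjc c = (cabs2 c)%:C%C.
Proof. by case: c => x y; rewrite /cabs2 /=; congr (_ +i* _)%C; ring. Qed.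

End ComplexModulus.

(** * Directional derivatives of the coefficients of s *)

Section DerivativeOfS.
Variable R : realType.
Local Notation C := (complex R).
Implicit Types (x y : C3 R * C3 R).

(** Along a real line the real and imaginary parts of a coefficient of s are an affine function
    divided by a quadratic polynomial, namely |eta|^2 up to a constant. *)
Lemma is_derive_frac (p q k A b c : R) : k != 0 -> A != 0 ->
  is_derive (0 : R) (1 : R)
    (fun t : R => (p + t * q) / (k * (A + 2 * b * t + c * t ^+ 2)))
    ((q * A - 2 * b * p) / (k * A ^+ 2)).
Proof.
move=> k0 A0.
have nu : is_derive (0 : R) (1 : R) (fun t : R => p + t * q) q.
  by apply: is_derive_eq; rewrite /GRing.scale /=; ring.
have de : is_derive (0 : R) (1 : R) (fun t : R => k * (A + 2 * b * t + c * t ^+ 2)) (k * 2 * b).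
  by apply: is_derive_eq; rewrite /GRing.scale /=; ring.
have d0 : k * (A + 2 * b * 0 + c * 0 ^+ 2) != 0.
  by rewrite mulr0 expr0n mulr0 !addr0 mulf_neq0.
have dV := @is_deriveV R (fun t : R => k * (A + 2 * b * t + c * t ^+ 2)) _ _ _ d0 de.
apply: (is_derive_eq (is_deriveM nu dV)).
by rewrite /GRing.scale /=; field; rewrite k0 A0.
Qed.

Lemma derive_line (F : C3 R * C3 R -> R) x (V : C3 R * C3 R) (G : R -> R) (d : R) :
  (forall h, F (h *: V + x) = G h) -> is_derive (0 : R) (1 : R) G d ->
  'D_V F x = d.
Proof.
move=> FG [_ <-]; rewrite /derive.
have F0 : F x = G 0 by rewrite -(FG 0) scale0r add0r.
suff -> : (fun h : R => h^-1 *: (F (h *: V + x) - F x)) =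
          (fun h : R => h^-1 *: (G (h *: 1 + 0) - G 0)) by [].
apply/funext => h; rewrite FG F0.
by rewrite addr0 [h *: 1]mulr1.
Qed.

Definition enorm2 x : R := \sum_j cabs2 (eta x j).

Lemma eta2E x : eta2 x = (enorm2 x)%:C%C.
Proof.
rewrite /eta2 /enorm2 rmorph_sum; apply: eq_bigr => j _; exact: mulcJ.
Qed.

Lemma twopiiE c : (twopii R)^-1 * c = ((complex.Im c / (2 * pi)) +i* (- (complex.Re c / (2 * pi))))%C.
Proof.
have pi0 : (pi : R) != 0 by rewrite gt_eqF // pi_gt0.
have p2 : (2 * pi : R) != 0 by rewrite mulf_neq0.
have t0 : twopii R != 0 by rewrite /twopii eq_complex /= eqxx.
apply: (mulfI t0); rewrite mulVKf // /twopii.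
case: c => a b /=; congr (_ +i* _)%C; rewrite ?mul0r ?sub0r ?add0r.
  by rewrite mulrN opprK mulrC divfK.
by rewrite mulrC divfK.
Qed.

Lemma divcR (c : C) (r : R) : c / r%:C%C = ((complex.Re c / r) +i* (complex.Im c / r))%C.
Proof.
rewrite -fmorphV /=; case: c => a b /=; congr (_ +i* _)%C; ring.
Qed.

Lemma scoefE a x : scoef a x =
  ((complex.Im (conjc (etan x a)) / (2 * pi * enorm2 x)) +i*
   (- complex.Re (conjc (etan x a)) / (2 * pi * enorm2 x)))%C.
Proof.
rewrite /scoef eta2E.
have -> (u v w : C) : (u * v)^-1 * w = u^-1 * (w / v).
  by rewrite [(u * v)^-1]invfM -mulrA [v^-1 * w]mulrC.
rewrite divcR twopiiE; move: (2 * pi) (enorm2 x) => p N.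
by congr (_ +i* _)%C; rewrite [(p * N)^-1]invfM /=; move: p^-1 N^-1 => p' N'; ring.
Qed.

(** Stated for any direction [V] that moves eta_j alone, with velocity [u]. The four cases 1, i, -1,
    -i of [u] cover the real and imaginary directions in zeta_j and in z_j. *)
Lemma real_deriv_scoef a j x (V : C3 R * C3 R) (u : C) : (a < 3)%N -> (j < 3)%N -> enorm2 x != 0 ->
  (forall h i, eta (h *: V + x) i = eta x i + (if i == inord j then h%:C%C * u else 0)) ->
  real_deriv (scoef a) x V =
  (twopii R)^-1 * ((if a == j then conjc u else 0) / eta2 x
    - conjc (etan x a) * (2 * complex.Re (conjc u * etan x j))%:C%C / eta2 x ^+ 2).
Proof.
move=> a3 j3 N0 hV.
have p2 : (2 * pi : R) != 0 by rewrite mulf_neq0 // gt_eqF // pi_gt0.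
have aj : (inord a == inord j :> 'I_3) = (a == j) by rewrite -val_eqE /= !inordK.
(* Along the line the squared distance is a quadratic polynomial in [h], as [is_derive_frac]
   requires. *)
have EN h : enorm2 (h *: V + x) = enorm2 x + 2 * complex.Re (conjc u * etan x j) * h
    + cabs2 u * h ^+ 2.
  rewrite /enorm2 (bigD1 (inord j)) // [X in _ = X + _ + _](bigD1 (inord j)) //=.
  under [X in _ + X = _]eq_bigr => i /negPf ij do rewrite hV ij addr0.
  rewrite hV eqxx /etan; move: (\sum_(i < 3 | _) _) => S.
  by case: u {hV} (eta x (inord j)) => u1 u2 [e1 e2]; rewrite /cabs2 /=; ring.
have Ea h : etan (h *: V + x) a = etan x a + (if a == j then h%:C%C * u else 0).
  by rewrite /etan hV aj.
pose du : C := if a == j then conjc u else 0.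
have JE h : conjc (etan (h *: V + x) a) = conjc (etan x a) + h%:C%C * du.
  rewrite Ea rmorphD /du; case: ifP => _; last by rewrite rmorph0 mulr0.
  by rewrite rmorphM /=; congr (_ + _ * _); case: (h%:C%C) / (erefl (h%:C%C)) => //=; rewrite oppr0.
set b := complex.Re _ in EN *.
rewrite /real_deriv -/du.
have -> : 'D_V (fun y => complex.Re (scoef a y)) x =
   (complex.Im du * enorm2 x - 2 * b * complex.Im (conjc (etan x a))) / (2 * pi * enorm2 x ^+ 2).
  apply: derive_line (is_derive_frac (complex.Im (conjc (etan x a))) (complex.Im du) b (cabs2 u) p2 N0).
  move=> h; rewrite scoefE EN JE [complex.Re _]/=; congr (_ / _).
  by clear JE; move: du (conjc (etan x a)) => [d1 d2] [e1 e2] /=; ring.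
have -> : 'D_V (fun y => complex.Im (scoef a y)) x =
   (- complex.Re du * enorm2 x - 2 * b * - complex.Re (conjc (etan x a))) / (2 * pi * enorm2 x ^+ 2).
  apply: derive_line (is_derive_frac (- complex.Re (conjc (etan x a))) (- complex.Re du) b (cabs2 u) p2 N0).
  move=> h; rewrite scoefE EN JE [complex.Im _]/=; congr (_ / _).
  by clear JE; move: du (conjc (etan x a)) => [d1 d2] [e1 e2] /=; ring.
rewrite twopiiE eta2E -rmorphXn !divcR.
have N2 : enorm2 x ^+ 2 != 0 by rewrite expf_neq0.
move: (pi : R) p2 => PI p2; have pi0 : PI != 0 by move: p2; rewrite mulf_eq0 negb_or => /andP[].
clear JE; move: du (conjc (etan x a)) => [d1 d2] [e1 e2] /=; congr (_ +i* _)%C; field; by rewrite ?N0 ?pi0.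
Qed.

End DerivativeOfS.

(** * Convergence and measurability of complex functions *)

Section ComplexLimits.
Variable R : realType.
Local Notation C := (complex R).

Lemma invcE (c : C) : c^-1 = ((complex.Re c / cabs2 c) +i* (- complex.Im c / cabs2 c))%C.
Proof. by case: c => a b; rewrite /cabs2 /= mulNr. Qed.

(** Convergence of real and imaginary parts, the shape in which continuity of forms is defined and
    dominated convergence is applied; [cmeas] plays the same role for measurability. *)
Definition ccvg (T : Type) (F : set_system T) (f : T -> C) (l : C) : Prop :=
  ((fun t => complex.Re (f t) : R) @ F --> (complex.Re l : R)) /\
  ((fun t => complex.Im (f t) : R) @ F --> (complex.Im l : R)).

Section Closure.
Context {T : Type} {F : set_system T} {FF : Filter F}.
Implicit Types (f g : T -> C) (a b : C).

Lemma ccvg_cst a : ccvg F (fun=> a) a.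
Proof. by split; exact: cvg_cst. Qed.

Lemma ccvgD f g a b : ccvg F f a -> ccvg F g b -> ccvg F (fun t => f t + g t) (a + b).
Proof.
move=> [f1 f2] [g1 g2]; split.
  rewrite (_ : complex.Re (a + b) = complex.Re a + complex.Re b); last by case: (a) (b) => ? ? [].
  rewrite (_ : (fun t => _) = (fun t => complex.Re (f t) + complex.Re (g t))); first exact: cvgD.
  by apply/funext => t; case: (f t) (g t) => ? ? [].
rewrite (_ : complex.Im (a + b) = complex.Im a + complex.Im b); last by case: (a) (b) => ? ? [].
rewrite (_ : (fun t => _) = (fun t => complex.Im (f t) + complex.Im (g t))); first exact: cvgD.
by apply/funext => t; case: (f t) (g t) => ? ? [].
Qed.

Lemma ccvgM f g a b : ccvg F f a -> ccvg F g b -> ccvg F (fun t => f t * g t) (a * b).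
Proof.
move=> [f1 f2] [g1 g2]; split.
  rewrite (_ : complex.Re (a * b) = complex.Re a * complex.Re b - complex.Im a * complex.Im b);
    last by case: (a) (b) => ? ? [].
  rewrite (_ : (fun t => _) = (fun t => complex.Re (f t) * complex.Re (g t)
      - complex.Im (f t) * complex.Im (g t))).
    by apply: cvgB; exact: cvgM.
  by apply/funext => t; case: (f t) (g t) => ? ? [].
rewrite (_ : complex.Im (a * b) = complex.Re a * complex.Im b + complex.Im a * complex.Re b);
  last by case: (a) (b) => ? ? [].
rewrite (_ : (fun t => _) = (fun t => complex.Re (f t) * complex.Im (g t)
      + complex.Im (f t) * complex.Re (g t))).
  by apply: cvgD; exact: cvgM.
by apply/funext => t; case: (f t) (g t) => ? ? [].
Qed.

Lemma ccvgN f a : ccvg F f a -> ccvg F (fun t => - f t) (- a).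
Proof.
move=> fa; rewrite -mulN1r (_ : (fun t => _) = (fun t => -1 * f t)).
  by apply: ccvgM => //; exact: ccvg_cst.
by apply/funext => t; rewrite mulN1r.
Qed.

Lemma ccvgB f g a b : ccvg F f a -> ccvg F g b -> ccvg F (fun t => f t - g t) (a - b).
Proof. by move=> fa gb; apply: ccvgD => //; exact: ccvgN. Qed.

Lemma ccvgJ f a : ccvg F f a -> ccvg F (fun t => conjc (f t)) (conjc a).
Proof.
move=> [f1 f2]; split.
  rewrite (_ : complex.Re (conjc a) = complex.Re a); last by case: (a).
  by rewrite (_ : (fun t => _) = (fun t => complex.Re (f t))) //; apply/funext => t; case: (f t).
rewrite (_ : complex.Im (conjc a) = - complex.Im a); last by case: (a).
rewrite (_ : (fun t => _) = (fun t => - complex.Im (f t))); first exact: cvgN.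
by apply/funext => t; case: (f t).
Qed.

Lemma cvg_cabs2 f a : ccvg F f a -> (fun t => cabs2 (f t) : R) @ F --> (cabs2 a : R).
Proof.
move=> [f1 f2]; rewrite /cabs2 !expr2.
rewrite (_ : (fun t => _) = (fun t => complex.Re (f t) * complex.Re (f t)
   + complex.Im (f t) * complex.Im (f t))) //.
by apply: cvgD; exact: cvgM.
Qed.

Lemma ccvgV f a : a != 0 -> ccvg F f a -> ccvg F (fun t => (f t)^-1) a^-1.
Proof.
move=> a0 fa; have [f1 f2] := fa.
have n0 : cabs2 a != 0 by rewrite -cnorm_sqr expf_neq0 // cnorm_eq0.
have nV : (fun t => (cabs2 (f t))^-1 : R) @ F --> ((cabs2 a)^-1 : R).
  by apply: cvgV => //; exact: cvg_cabs2.
rewrite invcE; split => /=.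
  rewrite (_ : (fun t => _) = (fun t => complex.Re (f t) * (cabs2 (f t))^-1)); first exact: cvgM.
  by apply/funext => t; rewrite invcE.
rewrite (_ : (fun t => _) = (fun t => - complex.Im (f t) * (cabs2 (f t))^-1)).
  by apply: cvgM => //; exact: cvgN.
by apply/funext => t; rewrite invcE.
Qed.

Lemma ccvg_sum (I : Type) (r : seq I) (f : I -> T -> C) (a : I -> C) :
  (forall i, ccvg F (f i) (a i)) ->
  ccvg F (fun t => \sum_(i <- r) f i t) (\sum_(i <- r) a i).
Proof.
move=> fa; elim: r => [|i r IH].
  rewrite big_nil (_ : (fun t => _) = fun=> 0); first exact: ccvg_cst.
  by apply/funext => t; rewrite big_nil.
rewrite big_cons (_ : (fun t => _) = (fun t => f i t + \sum_(j <- r) f j t)).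
  exact: ccvgD.
by apply/funext => t; rewrite big_cons.
Qed.

End Closure.

Section Measurability.
Context {d : measure_display} {T : measurableType d}.
Implicit Types (D : set T) (f g : T -> C) (a b : C).

Definition cmeas D f : Prop :=
  measurable_fun D (fun t => complex.Re (f t)) /\
  measurable_fun D (fun t => complex.Im (f t)).

Lemma cmeas_cst D a : cmeas D (fun=> a).
Proof. by split; exact: measurable_cst. Qed.

Lemma cmeasD D f g : cmeas D f -> cmeas D g -> cmeas D (fun t => f t + g t).
Proof.
move=> [f1 f2] [g1 g2]; split.
  rewrite (_ : (fun t => _) = (fun t => complex.Re (f t) + complex.Re (g t))).
    exact: measurable_funD.
  by apply/funext => t; case: (f t) (g t) => ? ? [].
rewrite (_ : (fun t => _) = (fun t => complex.Im (f t) + complex.Im (g t))).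
  exact: measurable_funD.
by apply/funext => t; case: (f t) (g t) => ? ? [].
Qed.

Lemma cmeasM D f g : cmeas D f -> cmeas D g -> cmeas D (fun t => f t * g t).
Proof.
move=> [f1 f2] [g1 g2]; split.
  rewrite (_ : (fun t => _) = (fun t => complex.Re (f t) * complex.Re (g t)
      - complex.Im (f t) * complex.Im (g t))).
    by apply: measurable_funB; exact: measurable_funM.
  by apply/funext => t; case: (f t) (g t) => ? ? [].
rewrite (_ : (fun t => _) = (fun t => complex.Re (f t) * complex.Im (g t)
      + complex.Im (f t) * complex.Re (g t))).
  by apply: measurable_funD; exact: measurable_funM.
by apply/funext => t; case: (f t) (g t) => ? ? [].
Qed.

Lemma cmeasN D f : cmeas D f -> cmeas D (fun t => - f t).
Proof.
move=> fa; rewrite (_ : (fun t => _) = (fun t => -1 * f t)).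
  by apply: cmeasM => //; exact: cmeas_cst.
by apply/funext => t; rewrite mulN1r.
Qed.

Lemma cmeasB D f g : cmeas D f -> cmeas D g -> cmeas D (fun t => f t - g t).
Proof. by move=> ? ?; apply: cmeasD => //; exact: cmeasN. Qed.

Lemma cmeasJ D f : cmeas D f -> cmeas D (fun t => conjc (f t)).
Proof.
move=> [f1 f2]; split.
  by rewrite (_ : (fun t => _) = (fun t => complex.Re (f t))) //; apply/funext => t; case: (f t).
rewrite (_ : (fun t => _) = (fun t => - complex.Im (f t))); first exact: measurable_funN.
by apply/funext => t; case: (f t).
Qed.

Lemma measurable_cabs2 D f : cmeas D f -> measurable_fun D (fun t => cabs2 (f t)).
Proof. by move=> [f1 f2]; apply: measurable_funD; exact: measurable_funX. Qed.

(** On nonnegative reals the inverse is the real power with exponent -1, including at 0, where both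
    are 0. *)
Lemma measurable_ge0_inv D (f : T -> R) : (forall t, 0 <= f t) ->
  measurable_fun D f -> measurable_fun D (fun t => (f t)^-1).
Proof.
move=> f0 mf; rewrite (_ : (fun t => _) = (@powR R ^~ (-1)) \o f).
  by apply: measurableT_comp => //; exact: measurable_powR.
by apply/funext => t /=; rewrite powR_inv1.
Qed.

Lemma measurable_ge0_sqrt D (f : T -> R) : (forall t, 0 <= f t) ->
  measurable_fun D f -> measurable_fun D (fun t => Num.sqrt (f t)).
Proof.
move=> f0 mf; rewrite (_ : (fun t => _) = (@powR R ^~ (2^-1)) \o f).
  by apply: measurableT_comp => //; exact: measurable_powR.
by apply/funext => t /=; rewrite powR12_sqrt.
Qed.

Lemma cmeasV D f : cmeas D f -> cmeas D (fun t => (f t)^-1).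
Proof.
move=> mf; have [f1 f2] := mf.
have mV := measurable_ge0_inv (fun t => cabs2_ge0 (f t)) (measurable_cabs2 mf).
split.
  rewrite (_ : (fun t => _) = (fun t => complex.Re (f t) * (cabs2 (f t))^-1)).
    exact: measurable_funM.
  by apply/funext => t; rewrite invcE.
rewrite (_ : (fun t => _) = (fun t => - complex.Im (f t) * (cabs2 (f t))^-1)).
  by apply: measurable_funM => //; exact: measurable_funN.
by apply/funext => t; rewrite invcE.
Qed.

Lemma cmeas_real D (f : T -> R) : measurable_fun D f -> cmeas D (fun t => (f t)%:C%C).
Proof. by move=> mf; split => //=; exact: measurable_cst. Qed.

Lemma cmeas_sum D (I : Type) (r : seq I) (f : I -> T -> C) :
  (forall i, cmeas D (f i)) -> cmeas D (fun t => \sum_(i <- r) f i t).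
Proof.
move=> fa; elim: r => [|i r IH].
  rewrite (_ : (fun t => _) = fun=> 0); first exact: cmeas_cst.
  by apply/funext => t; rewrite big_nil.
rewrite (_ : (fun t => _) = (fun t => f i t + \sum_(j <- r) f j t)).
  exact: cmeasD.
by apply/funext => t; rewrite big_cons.
Qed.

End Measurability.
End ComplexLimits.

(** * Closed form of dbar s *)

Section ExplicitKernel.
Variable R : realType.
Local Notation C := (complex R).
Implicit Types (x y : C3 R * C3 R).

Lemma crd_line (h : R) (u v : C3 R) i : crd (h *: u + v) i = h%:C%C * crd u i + crd v i.
Proof.
case: u v => [[[a1 a2] [b1 b2]] [c1 c2]] [[[a1' a2'] [b1' b2']] [c1' c2']].
rewrite /crd /toC.
by case: i => -[|[|[|//]]] hi /=; congr (_ +i* _)%C; rewrite !mul0r ?subr0 ?addr0.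
Qed.

Lemma crd_axis j (p : plane R) i : crd (axis j p) i = if i == j then toC p else 0.
Proof.
rewrite /crd /axis.
case: j i => -[|[|[|//]]] hj [] -[|[|[|//]]] hi //=.
Qed.

Lemma crd0 i : crd (0 : C3 R) i = 0.
Proof. by case: i => -[|[|[|//]]]. Qed.

Lemma eta_line_zeta (h : R) x j p i :
  eta (h *: ((axis j p, 0) : C3 R * C3 R) + x) i =
  eta x i + (if i == j then h%:C%C * toC p else 0).
Proof.
rewrite /eta /= !crd_line crd_axis crd0 mulr0 add0r.
by case: ifP => _; ring.
Qed.

Lemma eta_line_z (h : R) x j p i :
  eta (h *: ((0, axis j p) : C3 R * C3 R) + x) i =
  eta x i + (if i == j then h%:C%C * - toC p else 0).
Proof.
rewrite /eta /= !crd_line crd_axis crd0 mulr0 add0r.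
by case: ifP => _; ring.
Qed.

(** The derivative of bar(eta_a) / (2 pi i |eta|^2) with respect to bar(zeta_j), by the quotient
    rule. *)
Definition dscoef (j a : nat) x : C :=
  (twopii R)^-1 * ((if a == j then 1 else 0) / eta2 x
    - conjc (etan x a) * etan x j / eta2 x ^+ 2).

Lemma dbar_zeta_scoef a j x : (a < 3)%N -> (j < 3)%N -> enorm2 x != 0 ->
  dbar_zeta (inord j) (scoef a) x = dscoef j a x.
Proof.
move=> a3 j3 N0; rewrite /dbar_zeta.
rewrite (real_deriv_scoef a3 j3 N0 (fun h i => eta_line_zeta h x (inord j) (1, 0) i)).
rewrite (real_deriv_scoef a3 j3 N0 (fun h i => eta_line_zeta h x (inord j) (0, 1) i)).
rewrite /dscoef; move: (twopii R)^-1 (eta2 x ^+ 2)^-1 (eta2 x)^-1 => t N2 N1.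
have I2 : (0 +i* 1)%C * (0 +i* 1)%C = -1 :> C by rewrite /=; congr (_ +i* _)%C; ring.
(* The directions 1 and i give the real and the imaginary part of eta_j, so the combination d/dx + i
   d/dy reassembles eta_j. *)
have E : (2 * complex.Re (conjc (toC (1, 0)) * etan x j))%:C%C
  + (0 +i* 1)%C * (2 * complex.Re (conjc (toC (0, 1)) * etan x j))%:C%C = 2 * etan x j :> C.
  by case: (etan x j) => e1 e2 /=; congr (_ +i* _)%C; ring.
have two : (2 : C) != 0 by rewrite pnatr_eq0.
apply: (mulfI two); rewrite [LHS]mulrA mulfV // mul1r.
have -> : 2 * (t * ((if a == j then 1 else 0) * N1 - conjc (etan x a) * etan x j * N2)) =
  t * (2 * (if a == j then 1 else 0) * N1 - conjc (etan x a) * (2 * etan x j) * N2) by ring.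
rewrite -E; case: (a == j); last by rewrite !mul0r; ring.
have -> : conjc (toC (1, 0)) = 1 :> C by rewrite /=; congr (_ +i* _)%C; rewrite oppr0.
have -> : conjc (toC (0, 1)) = - (0 +i* 1)%C :> C by rewrite /=; congr (_ +i* _)%C; rewrite oppr0.
have -> : (2 : C) * 1 = 1 + (0 +i* 1)%C * - (0 +i* 1)%C by rewrite mulrN I2 opprK mulr1.
move: (0 +i* 1)%C => I.
ring.
Qed.

(** The form s depends on (zeta, z) only through eta = zeta - z, so the derivatives in bar z_j are
    the opposite ones. *)
Lemma dbar_z_scoef a j x : (a < 3)%N -> (j < 3)%N -> enorm2 x != 0 ->
  dbar_z (inord j) (scoef a) x = - dscoef j a x.
Proof.
move=> a3 j3 N0; rewrite -dbar_zeta_scoef // /dbar_z /dbar_zeta.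
rewrite (real_deriv_scoef a3 j3 N0 (fun h i => eta_line_zeta h x (inord j) (1, 0) i)).
rewrite (real_deriv_scoef a3 j3 N0 (fun h i => eta_line_zeta h x (inord j) (0, 1) i)).
rewrite (real_deriv_scoef a3 j3 N0 (fun h i => eta_line_z h x (inord j) (1, 0) i)).
rewrite (real_deriv_scoef a3 j3 N0 (fun h i => eta_line_z h x (inord j) (0, 1) i)).
have E p : (2 * complex.Re (conjc (- toC p) * etan x j))%:C%C
     = - (2 * complex.Re (conjc (toC p) * etan x j))%:C%C :> C.
  by case: p => p1 p2; case: (etan x j) => e1 e2; congr (_ +i* _)%C; rewrite /=; [ring|rewrite oppr0].
have E' p : (if a == j then conjc (- toC p) else 0) =
     - (if a == j then conjc (toC p) else 0) :> C.
  by case: ifP => _; rewrite ?rmorphN ?oppr0.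
rewrite !E !E'; move: (twopii R)^-1 (eta2 x ^+ 2)^-1 (eta2 x)^-1 => t N2 N1.
ring.
Qed.

End ExplicitKernel.

(** * Borel structure of C^3 and cut-off functions *)

Section BorelC3.
Variable R : realType.

Lemma C3_ballE (x y : C3 R) (e : R) : ball x e y <->
  [/\ `|x.1.1.1 - y.1.1.1| < e, `|x.1.1.2 - y.1.1.2| < e,
      `|x.1.2.1 - y.1.2.1| < e & `|x.1.2.2 - y.1.2.2| < e] /\
  `|x.2.1 - y.2.1| < e /\ `|x.2.2 - y.2.2| < e.
Proof.
split => [[[[? ?] [? ?]] [? ?]]|[[? ? ? ?] [? ?]]]; first by [].
by split; [split; split|split].
Qed.

(** The sigma-algebra of [C3 R] is a product, so open sets are reached through a countable base:
    cubes with rational centre and radius. *)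
Lemma open_measurable_C3 (U : set (C3 R)) : open U -> measurable U.
Proof.
move=> oU.
pose I : Type := (rat * rat * rat * rat * rat * rat * rat)%type.
pose B (p : I) : set (C3 R) := let: (a, b, c, d, e, f, r) := p in
  (((ball (ratr a : R) (ratr r)) `*` (ball (ratr b : R) (ratr r))) `*`
   ((ball (ratr c : R) (ratr r)) `*` (ball (ratr d : R) (ratr r)))) `*`
   ((ball (ratr e : R) (ratr r)) `*` (ball (ratr f : R) (ratr r))).
have mB p : measurable (B p).
  move: p => [[[[[[a b] c] d] e] f] r] /=.
  do !apply: measurableX; exact: measurable_ball.
have -> : U = \bigcup_p (if `[< B p `<=` U >] then B p else set0).
  apply/seteqP; split => [x Ux|x [p _]]; last by case: asboolP => // h; exact: h.
  have /nbhs_ballP[e /= e0 he] : nbhs x U by exact: open_nbhs_nbhs.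
  (* A cube of radius below e/2 whose centre is within that radius of [x] stays inside the ball of
     radius [e] around [x]. *)
  have [r /= r0] := @rat_in_itvoo R 0 (e / 2) (divr_gt0 e0 (ltr0Sn _ _)).
  move: r0; rewrite in_itv /= => /andP[r0 re].
  have Q (t : R) : exists q : rat, `|ratr q - t| < ratr r.
    have lt : t - ratr r < t + ratr r by rewrite ltrD2l gtrN.
    have [q] := rat_in_itvoo lt.
    rewrite in_itv /= => /andP[h1 h2]; exists q.
    by rewrite ltr_norml; apply/andP; move: h1 h2; move: (ratr q) (ratr r) => Q1 R1 h1 h2; split; lra.
  have [a ha] := Q x.1.1.1; have [b hb] := Q x.1.1.2.
  have [c hc] := Q x.1.2.1; have [d hd] := Q x.1.2.2.
  have [f hf] := Q x.2.1; have [g hg] := Q x.2.2.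
  exists (a, b, c, d, f, g, r) => //.
  have -> : `[< B (a, b, c, d, f, g, r) `<=` U >].
    apply/asboolP => y [[[/= h1 h2] [h3 h4]] [h5 h6]]; apply: he; apply/C3_ballE.
    have T (q s t : R) : `|q - s| < ratr r -> `|q - t| < ratr r -> `|s - t| < e.
      move=> k1 k2; rewrite [e]splitr -(subrK q s) -addrA.
      rewrite (le_lt_trans (ler_normD _ _)) // ltrD //; last exact: lt_trans re.
      by rewrite distrC; exact: lt_trans re.
    by split; [split|split]; apply: T; eassumption.
  by split; [split; split|split].
apply: countable_bigcupT_measurable => [|p]; first exact: countableP.
by case: ifP.
Qed.

Lemma continuous_measurable_C3 (f : C3 R -> R) :
  continuous f -> measurable_fun [set: C3 R] f.
Proof.
move=> /continuousP cf; apply: (measurability _ (RGenOpens.measurableE R)).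
move=> _ [_ [a [b ->] <-]]; rewrite setTI; apply: open_measurable_C3.
exact/cf/interval_open.
Qed.

Definition normC3 (z : C3 R) : R := Num.sqrt (norm2 z).

Lemma norm2_ge0 (z : C3 R) : 0 <= norm2 z.
Proof. by apply: sumr_ge0 => i _; exact: cabs2_ge0. Qed.

Lemma normC3_ge0 (z : C3 R) : 0 <= normC3 z.
Proof. exact: sqrtr_ge0. Qed.

Lemma norm2E (z : C3 R) : norm2 z = z.1.1.1 ^+ 2 + z.1.1.2 ^+ 2 + (z.1.2.1 ^+ 2 + z.1.2.2 ^+ 2)
  + (z.2.1 ^+ 2 + z.2.2 ^+ 2).
Proof. by rewrite /norm2 sum_ord3 /crd !inordK. Qed.

Lemma normC3_coord (z : C3 R) (r : R) : normC3 z <= r ->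
  [/\ `|z.1.1.1| <= r, `|z.1.1.2| <= r, `|z.1.2.1| <= r & `|z.1.2.2| <= r] /\
  `|z.2.1| <= r /\ `|z.2.2| <= r.
Proof.
move=> h; rewrite -!sqrtr_sqr; do !split; apply: le_trans h; rewrite ler_wsqrtr // norm2E;
 move: z => [[[a b] [c d]] [e f]] /=;
 have := sqr_ge0 a; have := sqr_ge0 b; have := sqr_ge0 c; have := sqr_ge0 d;
 have := sqr_ge0 e; have := sqr_ge0 f;
 move: (a ^+ 2) (b ^+ 2) (c ^+ 2) (d ^+ 2) (e ^+ 2) (f ^+ 2) => *; lra.
Qed.

Lemma continuous_normC3 : continuous normC3.
Proof.
have -> : normC3 = Num.sqrt \o (fun z : C3 R => z.1.1.1 * z.1.1.1 + z.1.1.2 * z.1.1.2 +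
   (z.1.2.1 * z.1.2.1 + z.1.2.2 * z.1.2.2) + (z.2.1 * z.2.1 + z.2.2 * z.2.2)).
  by apply/funext => z /=; rewrite /normC3 norm2E !expr2.
move=> z; apply: continuous_comp; last exact: sqrt_continuous.
have c11 : (fun z : C3 R => z.1.1) @ z --> z.1.1.
  apply: (@cvg_comp _ _ _ (@fst (C2 R) (plane R)) (@fst (plane R) (plane R))); exact: cvg_fst.
have c12 : (fun z : C3 R => z.1.2) @ z --> z.1.2.
  apply: (@cvg_comp _ _ _ (@fst (C2 R) (plane R)) (@snd (plane R) (plane R)));
    [exact: cvg_fst|exact: cvg_snd].
have c2 : (fun z : C3 R => z.2) @ z --> z.2 by exact: cvg_snd.
have f1 (g : C3 R -> plane R) : g @ z --> g z -> (fun z => (g z).1 : R) @ z --> ((g z).1 : R).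
  by move=> cg; apply: cvg_comp cg _; exact: cvg_fst.
have f2 (g : C3 R -> plane R) : g @ z --> g z -> (fun z => (g z).2 : R) @ z --> ((g z).2 : R).
  by move=> cg; apply: cvg_comp cg _; exact: cvg_snd.
by apply: cvgD; [apply: cvgD; apply: cvgD|apply: cvgD]; apply: cvgM;
  (exact: f1 || exact: f2).
Qed.

(** The points (1 - t) z lie in the open ball, and each real coordinate moves by at most t because
    it is at most 1 in absolute value. *)
Lemma closure_ball0 (z : C3 R) : normC3 z <= 1 -> closure (Defs.ball0 (1 : R)) z.
Proof.
move=> hz B /nbhs_ballP[e /= e0 he].
pose t : R := Num.min (1 / 2) (e / 2).
have t0 : 0 < t by rewrite lt_min !divr_gt0.
have t1 : t <= 1 / 2 by rewrite ge_min lexx.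
have te : t <= e / 2 by rewrite ge_min lexx orbT.
exists ((1 - t) *: z); split.
  rewrite /Defs.ball0 /=.
  have -> : norm2 ((1 - t) *: z) = (1 - t) ^+ 2 * norm2 z.
    by rewrite !norm2E /= /GRing.scale /= !exprMn; ring.
  rewrite sqrtrM ?sqr_ge0 // sqrtr_sqr ger0_norm; last lra.
  rewrite -/(normC3 z); have := normC3_ge0 z; nra.
apply: he; apply/C3_ballE.
have [[h1 h2 h3 h4] [h5 h6]] := normC3_coord hz.
have T (s : R) : `|s| <= 1 -> `|s - (1 - t) * s| < e.
  move=> s1; have -> : s - (1 - t) * s = t * s by ring.
  rewrite normrM gtr0_norm //; have := normr_ge0 s; nra.
by do !split; apply: T.
Qed.

Lemma compact_cube (r : R) : compact ((((`[-r, r] `*` `[-r, r]) `*` (`[-r, r] `*` `[-r, r])) `*`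
    (`[-r, r] `*` `[-r, r])) : set (C3 R)).
Proof. by do !apply: compact_setX; exact: segment_compact. Qed.

(** The norms attained on the compact set of points of norm at most 2 outside [U] form a closed set
    avoiding 1, hence avoiding a neighbourhood of 1. This gives the collar on which the derivatives
    of chi vanish. *)
Lemma open_collar (U : set (C3 R)) : open U -> closure (Defs.ball0 (1 : R)) `<=` U ->
  exists2 c : R, 0 < c & forall z, normC3 z < 1 + c -> U z.
Proof.
move=> oU hU.
pose K : set (C3 R) := [set z | normC3 z <= 2] `&` ~` U.
have cK : compact K.
  apply: (subclosed_compact _ (@compact_cube 2)).
    apply: closedI; last by rewrite closedC.
    rewrite (_ : [set z | normC3 z <= 2] = normC3 @^-1` [set x | x <= 2]) //.
    apply: closed_comp => [z _|]; first exact: continuous_normC3.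
    exact: closed_le.
  move=> z [/normC3_coord[[h1 h2 h3 h4] [h5 h6]] _].
  by do !split => /=; rewrite in_itv /= -ler_norml.
have cI : closed (normC3 @` K).
  apply: compact_closed; first exact: Rhausdorff.
  apply: continuous_compact => //; apply: continuous_subspaceT; exact: continuous_normC3.
have n1 : nbhs (1 : R) (~` (normC3 @` K)).
  apply: open_nbhs_nbhs; split; first by rewrite openC.
  move=> [z [_ nUz] zz]; apply: nUz; apply: hU; apply: closure_ball0; by rewrite zz.
move/nbhs_ballP: n1 => [e /= e0 he].
exists (Num.min e 1); first by rewrite lt_min e0 ltr01.
move=> z; rewrite -ltrBlDl lt_min => /andP[ze z1].
have [z1'|z1'] := leP (normC3 z) 1; first by apply: hU; exact: closure_ball0.
apply: contrapT => nU; apply: (he (normC3 z)).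
  by rewrite /ball /= ltr_norml; apply/andP; split; lra.
by exists z => //; split => //=; lra.
Qed.

Lemma compact_support_bounded (f : C3 R -> R) (A : set (C3 R)) : continuous f ->
  compact A -> (forall z, ~ A z -> f z = 0) -> exists2 M : R, 0 <= M & forall z, `|f z| <= M.
Proof.
move=> cf cA f0.
have : bounded_set (f @` A).
  apply: compact_bounded; apply: continuous_compact => //.
  exact: continuous_subspaceT.
move=> [M [Mr hM]]; exists (`|M| + 1); first by rewrite addr_ge0.
move=> z; have [Az|nAz] := pselect (A z); last by rewrite f0 // normr0 addr_ge0.
apply: (hM (`|M| + 1)); last by exists z.
by rewrite (le_lt_trans (ler_norm _)) // ltrDl.
Qed.

Lemma derive_near_cst (f : C3 R -> R) (z v : C3 R) (k : R) :
  (\forall y \near z, f y = k) -> 'D_v f z = 0.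
Proof.
move=> h; rewrite (@near_eq_derive _ _ _ _ (cst k)) //; exact: derive_cst.
Qed.

Lemma cutoff_bounds eps (chi : C3 R -> R) : cutoff eps chi ->
  exists c M : R, [/\ 0 < c, 0 <= M, forall z, `|chi z| <= M,
     forall j z, cnorm (dchi chi j z) <= M &
     forall j z, normC3 z < 1 + c -> dchi chi j z = 0].
Proof.
move=> [sm cA sA [U [oU hU U1]]].
set A := closure _ in cA.
have cchi : continuous chi := sm 0%N.
have cD v : continuous ('D_v chi) by have [_] := sm 1%N; exact.
have nA z : ~ A z -> \forall y \near z, chi y = 0.
  move=> nAz; have : nbhs z (~` A).
    by apply: open_nbhs_nbhs; split => //; rewrite openC; exact: closed_closure.
  apply: filterS => y nAy; apply: contrapT => /eqP c0; apply: nAy; exact: subset_closure.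
have [M1 M10 hM1] : exists2 M : R, 0 <= M & forall z, `|chi z| <= M.
  by apply: (compact_support_bounded cchi cA) => z /nA; exact: nbhs_singleton.
have hD v : exists2 M : R, 0 <= M & forall z, `|'D_v chi z| <= M.
  apply: (compact_support_bounded (cD v) cA) => z /nA; exact: derive_near_cst.
have hd j : exists2 M : R, 0 <= M & forall z, cnorm (dchi chi j z) <= M.
  have [Ma Ma0 hMa] := hD (axis (inord j) (1, 0)).
  have [Mb Mb0 hMb] := hD (axis (inord j) (0, 1)).
  exists (Ma + Mb) => [|z]; first exact: addr_ge0.
  rewrite /dchi cnormM.
  have -> : cnorm (2^-1 : R[i]) = 2^-1.
    have -> : (2 : R[i]) = (2%:R : R)%:C%C by rewrite rmorph_nat.
    by rewrite cnormV cnorm_real ger0_norm.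
  have : cnorm (('D_(axis (inord j) (1, 0)) chi z : R)%:C%C +
     (0 +i* 1)%C * ('D_(axis (inord j) (0, 1)) chi z : R)%:C%C) <= Ma + Mb.
    apply: le_trans (cnormD _ _) _; rewrite lerD ?cnormM ?cnorm_real //.
    have -> : cnorm (0 +i* 1)%C = 1 :> R by rewrite /cnorm /cabs2 /= expr0n expr1n add0r sqrtr1.
    by rewrite mul1r.
  set t := cnorm _; have : 0 <= t by exact: cnorm_ge0.
  lra.
have [M2 M20 hM2] : exists2 M : R, 0 <= M & forall j z, (j < 3)%N -> cnorm (dchi chi j z) <= M.
  have [a a0 ha] := hd 0%N; have [b b0 hb] := hd 1%N; have [d d0 hd2] := hd 2%N.
  exists (a + b + d); first by rewrite !addr_ge0.
  move=> [|[|[|//]]] z _; [have := ha z|have := hb z|have := hd2 z]; lra.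
have [c c0 hc] := open_collar oU hU.
exists c, (M1 + M2); split => //; first exact: addr_ge0.
- by move=> z; rewrite (le_trans (hM1 z)) // lerDl.
(* [inord] sends every index below 3, so the three bounds serve for all [j]. *)
- move=> j z; have -> : dchi chi j z = dchi chi (inord j : 'I_3) z by rewrite /dchi inord_val.
  by rewrite (le_trans (hM2 _ z (ltn_ord _))) // lerDr.
- move=> j z hz.
  have dz v : 'D_v chi z = 0.
    apply: (@derive_near_cst _ _ _ 1); have : nbhs z U by apply: open_nbhs_nbhs; split => //; exact: hc.
    by apply: filterS => y /U1.
  by rewrite /dchi !dz mulr0 addr0 mulr0.
Qed.

Lemma measurable_cutoff eps (chi : C3 R -> R) : cutoff eps chi ->
  measurable_fun setT chi /\ forall j, cmeas setT (dchi chi j).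
Proof.
move=> [sm _ _ _]; split; first by apply: continuous_measurable_C3; exact: (sm 0%N).
have mD v : measurable_fun setT ('D_v chi : C3 R -> R).
  by apply: continuous_measurable_C3; have [_] := sm 1%N; exact.
move=> j; apply: cmeasM; first exact: cmeas_cst.
apply: cmeasD; first exact: cmeas_real.
by apply: cmeasM; [exact: cmeas_cst|exact: cmeas_real].
Qed.

End BorelC3.

(** * Bounds and regularity of the kernel coefficients *)

Section KernelBounds.
Variable R : realType.
Local Notation C := (complex R).
Implicit Types (x : C3 R * C3 R).

Lemma cnorm_crd (z : C3 R) j : cnorm (crd z j) <= normC3 z.
Proof.
rewrite /cnorm /normC3 ler_wsqrtr // /norm2 (bigD1 j) //= lerDl.
by apply: sumr_ge0 => i _; exact: cabs2_ge0.
Qed.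

Definition distC3 x : R := Num.sqrt (enorm2 x).

Lemma enorm2_ge0 x : 0 <= enorm2 x.
Proof. by apply: sumr_ge0 => i _; exact: cabs2_ge0. Qed.

Lemma distC3_ge0 x : 0 <= distC3 x.
Proof. exact: sqrtr_ge0. Qed.

Lemma distC3_sqr x : distC3 x ^+ 2 = enorm2 x.
Proof. by rewrite sqr_sqrtr // enorm2_ge0. Qed.

Lemma distC3_eq0 x : (distC3 x == 0) = (enorm2 x == 0).
Proof. by rewrite -distC3_sqr sqrf_eq0. Qed.

Lemma distC3_eq0P x : (distC3 x == 0) <-> x.1 = x.2.
Proof.
rewrite distC3_eq0; split => [|e]; last first.
  apply/eqP; rewrite /enorm2 big1 // => j _; rewrite /eta e subrr.
  by rewrite /cabs2 /= expr0n addr0.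
rewrite psumr_eq0 => [/allP h|i _]; last exact: cabs2_ge0.
have E j : crd x.1 j = crd x.2 j.
  apply/eqP; rewrite -subr_eq0 -cnorm_eq0 -sqrf_eq0 cnorm_sqr.
  by apply: h; rewrite mem_index_enum.
have := E (inord 0); have := E (inord 1); have := E (inord 2).
rewrite /crd !inordK //=.
case: x {E h} => -[[[a1 a2] [b1 b2]] [c1 c2]] [[[a1' a2'] [b1' b2']] [c1' c2']] /=.
by rewrite /toC /= => -[-> ->] [-> ->] [-> ->].
Qed.

Lemma cnorm_eta x j : cnorm (eta x j) <= distC3 x.
Proof.
rewrite /cnorm /distC3 ler_wsqrtr // /enorm2 (bigD1 j) //= lerDl.
by apply: sumr_ge0 => i _; exact: cabs2_ge0.
Qed.

(** Cauchy-Schwarz in the form of Lagrange's identity. Bounding [u] by a sum of nonnegative numbers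
    lets the triangle inequality for moduli be used in each coordinate. *)
Lemma minkowski3 (a b u : 'I_3 -> R) : (forall j, 0 <= a j) -> (forall j, 0 <= b j) ->
  (forall j, 0 <= u j <= a j + b j) ->
  Num.sqrt (\sum_j u j ^+ 2) <= Num.sqrt (\sum_j a j ^+ 2) + Num.sqrt (\sum_j b j ^+ 2).
Proof.
move=> a0 b0 hu.
have A0 : 0 <= \sum_j a j ^+ 2 by apply: sumr_ge0 => j _; exact: sqr_ge0.
have B0 : 0 <= \sum_j b j ^+ 2 by apply: sumr_ge0 => j _; exact: sqr_ge0.
rewrite -[leRHS]ger0_norm ?addr_ge0 ?sqrtr_ge0 // -sqrtr_sqr ler_wsqrtr //.
rewrite sqrrD !sqr_sqrtr // -sqrtrM //.
have CS : \sum_j a j * b j <= Num.sqrt ((\sum_j a j ^+ 2) * (\sum_j b j ^+ 2)).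
  have P0 : 0 <= \sum_j a j * b j by apply: sumr_ge0 => j _; exact: mulr_ge0.
  rewrite -[leLHS]ger0_norm // -sqrtr_sqr ler_wsqrtr //.
  rewrite !sum_ord3 -subr_ge0.
  move: (a (inord 0)) (a (inord 1)) (a (inord 2)) (b (inord 0)) (b (inord 1)) (b (inord 2)).
  move=> a1 a2 a3 b1 b2 b3.
  have -> : (a1 ^+ 2 + a2 ^+ 2 + a3 ^+ 2) * (b1 ^+ 2 + b2 ^+ 2 + b3 ^+ 2)
    - (a1 * b1 + a2 * b2 + a3 * b3) ^+ 2 =
    (a1 * b2 - a2 * b1) ^+ 2 + (a1 * b3 - a3 * b1) ^+ 2 + (a2 * b3 - a3 * b2) ^+ 2 by ring.
  by rewrite !addr_ge0 ?sqr_ge0.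
apply: (@le_trans _ _ (\sum_j (a j + b j) ^+ 2)).
  apply: ler_sum => j _; have /andP[u0 u1] := hu j.
  by rewrite ler_sqr // nnegrE // (le_trans u0).
have -> : \sum_j (a j + b j) ^+ 2 =
    \sum_j a j ^+ 2 + (\sum_j a j * b j) *+ 2 + \sum_j b j ^+ 2.
  by rewrite -sumrMnl -!big_split /=; apply: eq_bigr => j _; rewrite sqrrD.
by rewrite lerD2r lerD2l lerMn2r CS orbT.
Qed.

Lemma normC3_cnorm (z : C3 R) : normC3 z = Num.sqrt (\sum_j cnorm (crd z j) ^+ 2).
Proof. by rewrite /normC3 /norm2; under [in RHS]eq_bigr do rewrite cnorm_sqr. Qed.

Lemma distC3_cnorm x : distC3 x = Num.sqrt (\sum_j cnorm (eta x j) ^+ 2).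
Proof. by rewrite /distC3 /enorm2; under [in RHS]eq_bigr do rewrite cnorm_sqr. Qed.

Lemma distC3_le x : distC3 x <= normC3 x.1 + normC3 x.2.
Proof.
rewrite distC3_cnorm !normC3_cnorm; apply: minkowski3 => j; rewrite ?cnorm_ge0 //=.
exact: cnormB.
Qed.

Lemma normC3_le_distC3 x : normC3 x.1 <= distC3 x + normC3 x.2.
Proof.
rewrite distC3_cnorm !normC3_cnorm; apply: minkowski3 => j; rewrite ?cnorm_ge0 //=.
rewrite -[X in cnorm X <= _](subrK (crd x.2 j)); exact: cnormD.
Qed.

Lemma cnorm_hcoef x a : cnorm (hcoef x a) <= normC3 x.1 + normC3 x.2.
Proof.
have z0 := normC3_ge0 x.1; have z0' := normC3_ge0 x.2.
have h (u v : C) : cnorm u <= normC3 x.1 -> cnorm v <= normC3 x.2 ->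
    cnorm (2^-1 * (u + v)) <= normC3 x.1 + normC3 x.2.
  move=> hu hv; rewrite cnormM.
  have -> : cnorm (2^-1 : C) = 2^-1.
    have -> : (2 : C) = (2%:R : R)%:C%C by rewrite rmorph_nat.
    by rewrite cnormV cnorm_real ger0_norm.
  have := cnormD u v; have := cnorm_ge0 (u + v); lra.
rewrite /hcoef; case: a => [|[|[|a]]] /=.
- by apply: h; [have := cnorm_crd x.1 (inord 1)|have := cnorm_crd x.2 (inord 1)];
    rewrite /crd inordK.
- by apply: h; [have := cnorm_crd x.1 (inord 0)|have := cnorm_crd x.2 (inord 0)];
    rewrite /crd inordK.
- rewrite cnormN (le_trans (cnormD _ _)) // lerD //.
    by have := cnorm_crd x.1 (inord 2); rewrite /crd inordK.
  by have := cnorm_crd x.2 (inord 2); rewrite /crd inordK.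
- by rewrite nth_nil cnorm0 addr_ge0.
Qed.

Lemma cnorm_twopii : cnorm ((twopii R)^-1) <= 1.
Proof.
rewrite cnormV /twopii.
have -> : cnorm (0 +i* (2 * pi))%C = 2 * pi :> R.
  by rewrite /cnorm /cabs2 /= expr0n add0r sqrtr_sqr ger0_norm // mulr_ge0 // pi_ge0.
have p1 : 1 <= 2 * pi :> R by have := @pi_ge2 R; lra.
by rewrite invf_le1 // (lt_le_trans ltr01).
Qed.

Lemma cnorm_eta2 x : cnorm (eta2 x) = distC3 x ^+ 2.
Proof. by rewrite eta2E cnorm_real ger0_norm ?enorm2_ge0 // distC3_sqr. Qed.

(** The constant 1/(2 pi) is absorbed by 1. On the diagonal both sides are 0 because the inverse of
    0 is 0, so this and the later bounds hold without excluding it. *)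
Lemma cnorm_scoef a x : cnorm (scoef a x) <= (distC3 x)^-1.
Proof.
rewrite /scoef cnormM cnormJ cnormV cnormM invfM cnorm_eta2 -cnormV.
have e0 := distC3_ge0 x; have t0 := cnorm_ge0 ((twopii R)^-1).
have [z|nz] := eqVneq (distC3 x) 0.
  have := cnorm_eta x (inord a); rewrite z => h.
  have -> : cnorm (etan x a) = 0 by apply/eqP; rewrite eq_le h cnorm_ge0.
  by rewrite mulr0 invr0.
rewrite [leRHS](_ : _ = 1 * (distC3 x ^+ 2)^-1 * distC3 x); last by field.
apply: ler_pM; rewrite ?mulr_ge0 ?cnorm_ge0 ?invr_ge0 ?sqr_ge0 //.
  by apply: ler_pM; rewrite ?invr_ge0 ?sqr_ge0 // cnorm_twopii.
exact: cnorm_eta.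
Qed.

Lemma cnorm_dscoef j a x : cnorm (dscoef j a x) <= 2 * (distC3 x ^+ 2)^-1.
Proof.
rewrite /dscoef cnormM -[leRHS]mul1r.
apply: ler_pM; rewrite ?cnorm_ge0 ?cnorm_twopii // mulr_natl mulr2n.
apply: le_trans (cnormB _ _) _.
have e0 := distC3_ge0 x.
have v0 : 0 <= (distC3 x ^+ 2)^-1 by rewrite invr_ge0 sqr_ge0.
apply: lerD.
  rewrite cnormM cnormV cnorm_eta2; case: ifP; rewrite ?cnorm1 ?cnorm0 ?mul1r ?mul0r //.
rewrite !cnormM cnormV expr2 cnormM cnorm_eta2 cnormJ.
have [z|nz] := eqVneq (distC3 x) 0; first by rewrite z expr0n mulr0 invr0 mulr0.
have -> : (distC3 x ^+ 2)^-1 = distC3 x * distC3 x * (distC3 x ^+ 2 * distC3 x ^+ 2)^-1 by field.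
rewrite ler_wpM2r ?invr_ge0 ?mulr_ge0 ?sqr_ge0 //.
by apply: ler_pM; rewrite ?cnorm_ge0 ?cnorm_eta.
Qed.

Lemma cnorm_det3 (h s t : nat -> C) (H S T : R) :
  (forall a, cnorm (h a) <= H) -> (forall a, cnorm (s a) <= S) ->
  (forall a, cnorm (t a) <= T) -> cnorm (det3 h s t) <= 6 * H * S * T.
Proof.
move=> hh hs ht.
have m (i j k : nat) : cnorm (h i * (s j * t k - s k * t j)) <= 2 * (H * S * T).
  have H0 : 0 <= H by exact: le_trans (cnorm_ge0 _) (hh i).
  have st p q : cnorm (s p * t q) <= S * T.
    by rewrite cnormM ler_pM ?cnorm_ge0.
  rewrite cnormM -mulrA mulrCA; apply: ler_pM; rewrite ?cnorm_ge0 //.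
  by rewrite (le_trans (cnormB _ _)) // mulr_natl mulr2n lerD.
rewrite /det3 (le_trans (cnormD _ _)) //.
have -> : 6 * H * S * T = 2 * (H * S * T) + 2 * (H * S * T) + 2 * (H * S * T) by ring.
by rewrite lerD // (le_trans (cnormB _ _)) // lerD.
Qed.

Definition kmain (j : nat) x : C :=
  det3 (hcoef x) (fun a => scoef a x) (fun a => dscoef j a x).

Definition ksig x : C :=
  det3 (hcoef x) (fun a => sigcoef a x) (fun a => scoef a x).

(** The kernel coefficients with the derivatives of s replaced by their closed form. One formula
    serves on all of C^3 x C^3, from which joint measurability and continuity in z are read off. *)
Definition ecoef (chi : C3 R -> R) (k : nat) x : C :=
  if (k < 9)%N then - ((chi x.1)%:C%C * kmain (k - 6) x) - dchi chi (k - 6) x.1 * ksig x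
  else (chi x.1)%:C%C * kmain (k - 9) x.

Lemma kernel_coefE chi x k : (6 <= k < 12)%N -> enorm2 x != 0 ->
  kernel_coef chi x k = ecoef chi k x.
Proof.
move=> /andP[k6 k12] nz; rewrite /ecoef; case: ltnP => k9.
  have k3 : (k - 6 < 3)%N by rewrite ltn_subLR.
  rewrite -{1}(subnKC k6) kernel_coef_zeta //; congr (_ - _).
  rewrite /kmain /det3 !dbar_zeta_scoef //; ring.
have k3 : (k - 9 < 3)%N by rewrite ltn_subLR.
rewrite -{1}(subnKC k9) kernel_coef_z // /kmain /det3 !dbar_z_scoef // !opprK.
by [].
Qed.

Lemma kmain_bound j x : cnorm (kmain j x) <= 12 * ((normC3 x.1 + normC3 x.2) * (distC3 x ^+ 3)^-1).
Proof.
apply: le_trans (cnorm_det3 (cnorm_hcoef x) (fun a => cnorm_scoef a x)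
  (fun a => cnorm_dscoef j a x)) _.
have [z|nz] := eqVneq (distC3 x) 0.
  by rewrite z !expr0n /= invr0 !mulr0.
by rewrite le_eqVlt; apply/orP; left; apply/eqP; field.
Qed.

Lemma cauchy_crd (u v : C3 R) : cnorm (\sum_j conjc (crd u j) * crd v j) <= normC3 u * normC3 v.
Proof.
apply: le_trans (cnorm_sum _ _) _.
under eq_bigr do rewrite cnormM cnormJ.
rewrite !normC3_cnorm -sqrtrM; last by apply: sumr_ge0 => j _; exact: sqr_ge0.
have P0 : 0 <= \sum_j cnorm (crd u j) * cnorm (crd v j).
  by apply: sumr_ge0 => j _; rewrite mulr_ge0 ?cnorm_ge0.
rewrite -[leLHS]ger0_norm // -sqrtr_sqr ler_wsqrtr // !sum_ord3 -subr_ge0.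
move: (cnorm (crd u (inord 0))) (cnorm (crd u (inord 1))) (cnorm (crd u (inord 2))).
move: (cnorm (crd v (inord 0))) (cnorm (crd v (inord 1))) (cnorm (crd v (inord 2))).
move=> a1 a2 a3 b1 b2 b3.
rewrite (_ : _ - _ =
  (a1 * b2 - a2 * b1) ^+ 2 + (a1 * b3 - a3 * b1) ^+ 2 + (a2 * b3 - a3 * b2) ^+ 2); last by ring.
by rewrite !addr_ge0 ?sqr_ge0.
Qed.

Definition sigden x : C := \sum_j crd x.1 j * conjc (crd x.1 j)
             - \sum_j conjc (crd x.1 j) * crd x.2 j.

(** Cauchy-Schwarz. In particular the denominator of sigma cannot vanish when |zeta| > |z|, which
    holds on the support of dbar chi. *)
Lemma sigden_bound x : normC3 x.1 * (normC3 x.1 - normC3 x.2) <= cnorm (sigden x).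
Proof.
have -> : normC3 x.1 * (normC3 x.1 - normC3 x.2) = normC3 x.1 ^+ 2 - normC3 x.1 * normC3 x.2 by ring.
rewrite lerBlDr.
have -> : normC3 x.1 ^+ 2 = cnorm (\sum_j crd x.1 j * conjc (crd x.1 j)).
  under eq_bigr do rewrite mulcJ.
  rewrite -rmorph_sum cnorm_real ger0_norm ?norm2_ge0 // sqr_sqrtr // norm2_ge0.
  by [].
have -> : \sum_j crd x.1 j * conjc (crd x.1 j) =
    sigden x + \sum_j conjc (crd x.1 j) * crd x.2 j by rewrite subrK.
by rewrite (le_trans (cnormD _ _)) // lerD2l cauchy_crd.
Qed.

Lemma ksig_bound x c : 0 < c -> 1 + c <= normC3 x.1 -> normC3 x.2 <= 1 ->
  cnorm (ksig x) <= 6 * c^-1 * ((normC3 x.1 + normC3 x.2) * (distC3 x)^-1).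
Proof.
move=> c0 h1 h2.
have hs a : cnorm (sigcoef a x) <= c^-1.
  have z0 : 0 < normC3 x.1 by lra.
  have d0 : 0 < normC3 x.1 * (normC3 x.1 - normC3 x.2) by rewrite mulr_gt0 //; lra.
  have dd := sigden_bound x; have D0 := lt_le_trans d0 dd.
  rewrite /sigcoef -/(sigden x) cnormM cnormJ cnormV cnormM invfM -[in X in X * _ * _]cnormV.
  have E : (cnorm (sigden x))^-1 * normC3 x.1 <= c^-1.
    rewrite mulrC ler_pdivrMr // -ler_pdivrMl ?invr_gt0 // invrK.
    apply: le_trans dd; rewrite mulrC ler_pM2l //; lra.
  apply: le_trans E; apply: ler_pM; rewrite ?mulr_ge0 ?cnorm_ge0 ?invr_ge0 ?cnorm_ge0 //.
    by rewrite -[leRHS]mul1r; apply: ler_pM; rewrite ?cnorm_ge0 ?invr_ge0 ?cnorm_ge0 ?cnorm_twopii.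
  exact: cnorm_crd.
apply: le_trans (cnorm_det3 (cnorm_hcoef x) hs (fun a => cnorm_scoef a x)) _.
by rewrite le_eqVlt; apply/orP; left; apply/eqP; ring.
Qed.

(** The sigma term has only the singularity 1/|eta| and is present only for |zeta| >= 1 + c. It is
    brought to the common shape |eta|^(-3) at the cost of the factor |eta|^2 <= (2 + eps)^2. *)
Lemma ecoef_bound eps (chi : C3 R -> R) : cutoff eps chi -> 0 < eps ->
  exists2 M : R, 0 <= M & forall k x, normC3 x.1 < 1 + eps -> normC3 x.2 < 1 ->
    cnorm (ecoef chi k x) <= M * ((normC3 x.1 + normC3 x.2) * (distC3 x ^+ 3)^-1).
Proof.
move=> /cutoff_bounds[c [M [c0 M0 hM hd hd0]]] e0.
pose B := (2 + eps) ^+ 2.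
have B0 : 0 <= B by exact: sqr_ge0.
have ci0 : 0 <= c^-1 by rewrite invr_ge0 ltW.
have S0 : 0 <= M * (6 * c^-1) * B by apply: mulr_ge0 => //; apply: mulr_ge0 => //; apply: mulr_ge0 => //; exact: ler0n.
exists (12 * M + M * (6 * c^-1) * B).
  by apply: addr_ge0 => //; apply: mulr_ge0 => //; exact: ler0n.
move=> k x hx1 hx2.
have z1 := normC3_ge0 x.1; have z2 := normC3_ge0 x.2; have e1 := distC3_ge0 x.
set K := (normC3 x.1 + normC3 x.2) * (distC3 x ^+ 3)^-1.
have K0 : 0 <= K by rewrite mulr_ge0 ?addr_ge0 // invr_ge0 exprn_ge0.
have main j : cnorm ((chi x.1)%:C%C * kmain j x) <= 12 * M * K.
  rewrite cnormM cnorm_real [12 * M]mulrC -mulrA.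
  by apply: ler_pM; rewrite ?normr_ge0 ?cnorm_ge0 // kmain_bound.
have sig j : cnorm (dchi chi j x.1 * ksig x) <= M * (6 * c^-1) * B * K.
  have [h|h] := ltP (normC3 x.1) (1 + c).
    by rewrite hd0 // mul0r cnorm0 mulr_ge0.
  rewrite cnormM -2!mulrA; apply: ler_pM; rewrite ?cnorm_ge0 //.
  have /le_trans -> // := ksig_bound c0 h (ltW hx2).
  rewrite ler_wpM2l ?mulr_ge0 // /K mulrCA ler_wpM2l ?addr_ge0 //.
  (* Here |zeta| >= 1 + c while |z| < 1. *)
  have ep : 0 < distC3 x.
    by have := normC3_le_distC3 x; lra.
  have -> : (distC3 x)^-1 = distC3 x ^+ 2 * (distC3 x ^+ 3)^-1 by field; rewrite gt_eqF.
  rewrite ler_wpM2r ?invr_ge0 ?exprn_ge0 // /B ler_sqr ?nnegrE //; last lra.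
  by have := distC3_le x; lra.
rewrite /ecoef; case: ifP => _.
  rewrite (le_trans (cnormB _ _)) // cnormN mulrDl lerD //.
by rewrite (le_trans (main _)) // ler_wpM2r // lerDl.
Qed.

End KernelBounds.

(** * Measurability of the kernel coefficients and their continuity in z *)

Section KernelRegularity.
Variable R : realType.
Local Notation C := (complex R).

Section Meas.
Context {d : measure_display} {T : measurableType d}.
Variables g1 g2 : T -> C3 R.
Hypothesis mg1 : measurable_fun setT g1.
Hypothesis mg2 : measurable_fun setT g2.

Lemma cmeas_crd (g : T -> C3 R) j : measurable_fun setT g -> cmeas setT (fun t => crd (g t) j).
Proof.
move=> mg.
have m1 : measurable_fun setT (fun t => (g t).1) by exact: (measurableT_comp measurable_fst mg).
have m2 : measurable_fun setT (fun t => (g t).2) by exact: (measurableT_comp measurable_snd mg).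
have m11 : measurable_fun setT (fun t => (g t).1.1) by exact: (measurableT_comp measurable_fst m1).
have m12 : measurable_fun setT (fun t => (g t).1.2) by exact: (measurableT_comp measurable_snd m1).
have P (h : T -> plane R) : measurable_fun setT h -> cmeas setT (fun t => toC (h t)).
  by move=> mh; split;
    [exact: (measurableT_comp measurable_fst mh)|exact: (measurableT_comp measurable_snd mh)].
rewrite /crd; case: j => -[|[|[|//]]] hj /=; exact: P.
Qed.

Let x t := (g1 t, g2 t).

Lemma cmeas_eta j : cmeas setT (fun t => eta (x t) j).
Proof. by apply: cmeasB; exact: cmeas_crd. Qed.

Lemma cmeas_eta2 : cmeas setT (fun t => eta2 (x t)).
Proof.
apply: cmeas_sum => j; apply: cmeasM; first exact: cmeas_eta.
by apply: cmeasJ; exact: cmeas_eta.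
Qed.

Lemma cmeas_hcoef a : cmeas setT (fun t => hcoef (x t) a).
Proof.
have Z k : (k < 3)%N -> forall g : T -> C3 R, measurable_fun setT g ->
    cmeas setT (fun t => [:: z1 (g t); z2 (g t); z3 (g t)]`_k).
  move=> k3 g mg; rewrite (_ : (fun t => _) = (fun t => crd (g t) (inord k))).
    exact: cmeas_crd.
  by apply/funext => t; rewrite /crd inordK.
have c0 := cmeas_cst.
rewrite /hcoef; case: a => [|[|[|a]]] /=.
- by apply: cmeasM => //; apply: cmeasD; [exact: (Z 1%N isT g1)|exact: (Z 1%N isT g2)].
- by apply: cmeasM => //; apply: cmeasD; [exact: (Z 0%N isT g1)|exact: (Z 0%N isT g2)].
- by apply: cmeasN; apply: cmeasD; [exact: (Z 2%N isT g1)|exact: (Z 2%N isT g2)].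
- by rewrite (_ : (fun t => _) = fun=> 0) //; apply/funext => t; rewrite nth_nil.
Qed.

Lemma cmeas_scoef a : cmeas setT (fun t => scoef a (x t)).
Proof.
apply: cmeasM; last by apply: cmeasJ; exact: cmeas_eta.
by apply: cmeasV; apply: cmeasM; [exact: cmeas_cst|exact: cmeas_eta2].
Qed.

Lemma cmeas_dscoef j a : cmeas setT (fun t => dscoef j a (x t)).
Proof.
apply: cmeasM; first exact: cmeas_cst.
apply: cmeasB.
  by apply: cmeasM; [exact: cmeas_cst|apply: cmeasV; exact: cmeas_eta2].
apply: cmeasM; last first.
  by apply: cmeasV; rewrite (_ : (fun t => _) = (fun t => eta2 (x t) * eta2 (x t)));
    [apply: cmeasM; exact: cmeas_eta2|apply/funext => t; rewrite expr2].
by apply: cmeasM; [apply: cmeasJ; exact: cmeas_eta|exact: cmeas_eta].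
Qed.

Lemma cmeas_sigcoef a : cmeas setT (fun t => sigcoef a (x t)).
Proof.
apply: cmeasM; last by apply: cmeasJ; exact: cmeas_crd.
apply: cmeasV; apply: cmeasM; first exact: cmeas_cst.
apply: cmeasB; apply: cmeas_sum => j; apply: cmeasM; try apply: cmeasJ; exact: cmeas_crd.
Qed.

Lemma cmeas_det3 (h s u : T -> nat -> C) : (forall a, cmeas setT (h^~ a)) ->
  (forall a, cmeas setT (s^~ a)) -> (forall a, cmeas setT (u^~ a)) ->
  cmeas setT (fun t => det3 (h t) (s t) (u t)).
Proof.
move=> mh ms mu; rewrite /det3.
have m i j k : cmeas setT (fun t => h t i * (s t j * u t k - s t k * u t j)).
  by apply: cmeasM => //; apply: cmeasB; exact: cmeasM.
by apply: cmeasD => //; exact: cmeasB.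
Qed.

Lemma cmeas_ecoef eps (chi : C3 R -> R) k : cutoff eps chi ->
  cmeas setT (fun t => ecoef chi k (x t)).
Proof.
move=> /measurable_cutoff[mchi mdchi].
have mc : cmeas setT (fun t => (chi (g1 t))%:C%C).
  by apply: cmeas_real; exact: measurableT_comp.
have md j : cmeas setT (fun t => dchi chi j (g1 t)).
  have [h1 h2] := mdchi j; split.
    exact: (measurableT_comp h1 mg1).
  exact: (measurableT_comp h2 mg1).
have mk j : cmeas setT (fun t => kmain j (x t)).
  by apply: cmeas_det3 => a; [exact: cmeas_hcoef|exact: cmeas_scoef|exact: cmeas_dscoef].
have ms : cmeas setT (fun t => ksig (x t)).
  by apply: cmeas_det3 => a; [exact: cmeas_hcoef|exact: cmeas_sigcoef|exact: cmeas_scoef].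
rewrite /ecoef; case: (k < 9)%N.
  by apply: cmeasB; [apply: cmeasN; exact: cmeasM|exact: cmeasM].
exact: cmeasM.
Qed.

Lemma measurable_distC3 : measurable_fun setT (fun t => distC3 (x t)).
Proof.
apply: measurable_ge0_sqrt => [t|]; first exact: enorm2_ge0.
rewrite (_ : (fun t => _) = (fun t => complex.Re (eta2 (x t)))).
  by have [] := cmeas_eta2.
by apply/funext => t; rewrite eta2E.
Qed.

Lemma measurable_normC3 (g : T -> C3 R) : measurable_fun setT g ->
  measurable_fun setT (fun t => normC3 (g t)).
Proof.
move=> mg; apply: (measurableT_comp (f := @normC3 R)) => //.
apply: continuous_measurable_C3; exact: continuous_normC3.
Qed.

End Meas.

Section Limits.
Context {T : Type} {F : set_system T} {FF : Filter F}.
Variables (zeta z : C3 R) (g : T -> C3 R).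
Hypothesis cg : g @ F --> z.

Lemma ccvg_crd j : ccvg F (fun t => crd (g t) j) (crd z j).
Proof.
have c1 : (fun t => (g t).1) @ F --> z.1 by apply: cvg_comp cg _; exact: cvg_fst.
have c2 : (fun t => (g t).2) @ F --> z.2 by apply: cvg_comp cg _; exact: cvg_snd.
have c11 : (fun t => (g t).1.1) @ F --> z.1.1.
  by apply: cvg_comp c1 _; exact: cvg_fst.
have c12 : (fun t => (g t).1.2) @ F --> z.1.2.
  by apply: cvg_comp c1 _; exact: cvg_snd.
have P (h : T -> plane R) l : h @ F --> l -> ccvg F (fun t => toC (h t)) (toC l).
  move=> ch; split => /=.
    by apply: cvg_comp ch _; exact: cvg_fst.
  by apply: cvg_comp ch _; exact: cvg_snd.
rewrite /crd; case: j => -[|[|[|//]]] hj /=; exact: P.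
Qed.

Let x t := (zeta, g t).

Lemma ccvg_eta j : ccvg F (fun t => eta (x t) j) (eta (zeta, z) j).
Proof. by apply: ccvgB; [exact: ccvg_cst|exact: ccvg_crd]. Qed.

Lemma ccvg_eta2 : ccvg F (fun t => eta2 (x t)) (eta2 (zeta, z)).
Proof.
apply: ccvg_sum => j; apply: ccvgM; first exact: ccvg_eta.
by apply: ccvgJ; exact: ccvg_eta.
Qed.

Lemma ccvg_hcoef a : ccvg F (fun t => hcoef (x t) a) (hcoef (zeta, z) a).
Proof.
have Z k : (k < 3)%N -> ccvg F (fun t => [:: z1 (g t); z2 (g t); z3 (g t)]`_k)
    [:: z1 z; z2 z; z3 z]`_k.
  move=> k3; rewrite (_ : (fun t => _) = (fun t => crd (g t) (inord k))).
    rewrite (_ : _`_k = crd z (inord k)); first exact: ccvg_crd.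
    by rewrite /crd inordK.
  by apply/funext => t; rewrite /crd inordK.
have c0 (a0 : C) : ccvg F (fun=> a0) a0 by exact: ccvg_cst.
rewrite /hcoef; case: a => [|[|[|a]]] /=.
- by apply: ccvgM; [exact: c0|apply: ccvgD; [exact: c0|exact: (Z 1%N isT)]].
- by apply: ccvgM; [exact: c0|apply: ccvgD; [exact: c0|exact: (Z 0%N isT)]].
- by apply: ccvgN; apply: ccvgD; [exact: c0|exact: (Z 2%N isT)].
- exact: c0.
Qed.

Lemma twopii_neq0 : twopii R != 0.
Proof.
by rewrite /twopii eq_complex /= eqxx mulf_neq0 // gt_eqF // pi_gt0.
Qed.

Lemma ccvg_det3 (h s u : T -> nat -> C) h' s' u' :
  (forall a, ccvg F (h^~ a) (h' a)) ->
  (forall a, ccvg F (s^~ a) (s' a)) -> (forall a, ccvg F (u^~ a) (u' a)) ->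
  ccvg F (fun t => det3 (h t) (s t) (u t)) (det3 h' s' u').
Proof.
move=> mh ms mu; rewrite /det3.
have m i j k : ccvg F (fun t => h t i * (s t j * u t k - s t k * u t j))
    (h' i * (s' j * u' k - s' k * u' j)).
  by apply: ccvgM => //; apply: ccvgB; exact: ccvgM.
by apply: ccvgD => //; exact: ccvgB.
Qed.

Hypothesis nz : zeta <> z.

Let e0 : eta2 (zeta, z) != 0.
Proof.
rewrite -cnorm_eq0 cnorm_eta2 sqrf_eq0; apply/negP => /(distC3_eq0P _); exact: nz.
Qed.

Lemma ccvg_scoef a : ccvg F (fun t => scoef a (x t)) (scoef a (zeta, z)).
Proof.
apply: ccvgM; last by apply: ccvgJ; exact: ccvg_eta.
apply: ccvgV; first by rewrite mulf_neq0 // twopii_neq0.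
by apply: ccvgM; [exact: ccvg_cst|exact: ccvg_eta2].
Qed.

Lemma ccvg_dscoef j a : ccvg F (fun t => dscoef j a (x t)) (dscoef j a (zeta, z)).
Proof.
apply: ccvgM; first exact: ccvg_cst.
apply: ccvgB.
  by apply: ccvgM; [exact: ccvg_cst|apply: ccvgV => //; exact: ccvg_eta2].
apply: ccvgM; last first.
  apply: ccvgV; first by rewrite expf_neq0.
  rewrite expr2 (_ : (fun t => _) = (fun t => eta2 (x t) * eta2 (x t))).
    by apply: ccvgM; exact: ccvg_eta2.
  by apply/funext => t; rewrite expr2.
by apply: ccvgM; [apply: ccvgJ; exact: ccvg_eta|exact: ccvg_eta].
Qed.

Lemma ccvg_sigcoef a : normC3 z < normC3 zeta ->
  ccvg F (fun t => sigcoef a (x t)) (sigcoef a (zeta, z)).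
Proof.
move=> h; apply: ccvgM; last by apply: ccvgJ; exact: ccvg_cst.
apply: ccvgV.
  rewrite mulf_neq0 ?twopii_neq0 // -/(sigden (zeta, z)) -cnorm_eq0 gt_eqF //.
  apply: lt_le_trans (sigden_bound _); rewrite mulr_gt0 ?subr_gt0 //.
  by rewrite (le_lt_trans _ h) // normC3_ge0.
apply: ccvgM; first exact: ccvg_cst.
apply: ccvgB; apply: ccvg_sum => j; apply: ccvgM; try apply: ccvgJ; try exact: ccvg_cst.
exact: ccvg_crd.
Qed.

Lemma ccvg_ecoef eps (chi : C3 R -> R) k : cutoff eps chi -> normC3 z < 1 ->
  ccvg F (fun t => ecoef chi k (x t)) (ecoef chi k (zeta, z)).
Proof.
move=> /cutoff_bounds[c [M [c0 M0 _ _ hd0]]] hz.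
have mk j : ccvg F (fun t => kmain j (x t)) (kmain j (zeta, z)).
  by apply: ccvg_det3 => a; [exact: ccvg_hcoef|exact: ccvg_scoef|exact: ccvg_dscoef].
have ms j : ccvg F (fun t => dchi chi j zeta * ksig (x t)) (dchi chi j zeta * ksig (zeta, z)).
  (* Inside the collar the derivatives of chi vanish identically; outside it |zeta| > |z|, so the
     denominator of sigma is nonzero. *)
  have [h|h] := ltP (normC3 zeta) (1 + c).
    rewrite hd0 // mul0r (_ : (fun t => _) = fun=> 0); first exact: ccvg_cst.
    by apply/funext => t; rewrite mul0r.
  apply: ccvgM; first exact: ccvg_cst.
  apply: ccvg_det3 => a; [exact: ccvg_hcoef| |exact: ccvg_scoef].
  by apply: ccvg_sigcoef; lra.
rewrite /ecoef; case: (k < 9)%N.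
  by apply: ccvgB => //; apply: ccvgN; apply: ccvgM => //; exact: ccvg_cst.
by apply: ccvgM => //; exact: ccvg_cst.
Qed.

Lemma cvg_distC3 : (fun t => distC3 (x t) : R) @ F --> (distC3 (zeta, z) : R).
Proof.
rewrite /distC3 (_ : (fun t => _) = (fun t => Num.sqrt (complex.Re (eta2 (x t))))); last first.
  by apply/funext => t; rewrite eta2E.
rewrite (_ : enorm2 _ = complex.Re (eta2 (zeta, z))); last by rewrite eta2E.
have [h _] := ccvg_eta2.
by apply: (continuous_cvg _ _ h); exact: sqrt_continuous.
Qed.

End Limits.
End KernelRegularity.

(** * Tangent frames and norms of forms *)

Section Frames.
Variable R : realType.
Local Notation C := (complex R).

Definition coef1 (f : ext R 3) (j : nat) : C :=
  f (setb 3 [:: j == 0; j == 1; j == 2]%N).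

(** The (0,1)-part of [f] evaluated on the conjugate of the vector [t]. *)
Definition eval1 (f : ext R 3) (t : nat -> C) : C := \sum_(j <- iota 0 3) coef1 f j * conjc (t j).

Definition colv (V : 'M[C]_(3, 2)) (k : nat) (j : nat) : C := V (inord j) (inord k).

Lemma restrict_form_const (V : 'M[C]_(3, 2)) (a : ext R 3) :
  restrict_form V a (setb 2 [:: false; false]) = a (setb 3 [:: false; false; false]).
Proof. rewrite restrict_formE // sum_bool3 /=; ring. Qed.

Lemma restrict_form_first (V : 'M[C]_(3, 2)) (a : ext R 3) :
  restrict_form V a (setb 2 [:: true; false]) = eval1 a (colv V 0).
Proof.
rewrite restrict_formE // sum_bool3 /eval1 /colv /coef1 /= !big_cons big_nil /=; ring.
Qed.

Lemma restrict_form_second (V : 'M[C]_(3, 2)) (a : ext R 3) :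
  restrict_form V a (setb 2 [:: false; true]) = eval1 a (colv V 1).
Proof.
rewrite restrict_formE // sum_bool3 /eval1 /colv /coef1 /= !big_cons big_nil /=; ring.
Qed.

Lemma sum_set2 (W : nmodType) (F : {set 'I_2} -> W) : \sum_I F I =
  F (setb 2 [:: true; true]) + F (setb 2 [:: true; false]) +
  (F (setb 2 [:: false; true]) + F (setb 2 [:: false; false])).
Proof.
rewrite (reindex (fun t : bool * bool => setb 2 [:: t.1; t.2])) /=.
  have -> : \sum_t F (setb 2 [:: t.1; t.2]) = \sum_a \sum_b F (setb 2 [:: a; b]).
    by rewrite pair_bigA; apply: eq_bigr => -[].
  by rewrite !big_bool.
apply: onW_bij; exists (fun A : {set 'I_2} => (ord0 \in A, inord 1 \in A)).
  by case=> a b; rewrite !in_setb /= !inordK.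
move=> A /=; rewrite [RHS]setb_eta; congr setb.
have -> : inord 1 = lift ord0 ord0 :> 'I_2 by apply: val_inj; rewrite /= inordK.
by rewrite !enum_ordSl (size0nil (size_enum_ord 0)).
Qed.

Definition frame_norm (V : 'M[C]_(3, 2)) (a : ext R 3) : R :=
  Num.sqrt (\sum_J cabs2 (restrict_form V a J)).

Lemma cnorm_restrict_le (V : 'M[C]_(3, 2)) (a : ext R 3) J :
  cnorm (restrict_form V a J) <= frame_norm V a.
Proof.
rewrite ler_wsqrtr // (bigD1 J) //= lerDl; apply: sumr_ge0 => K _; exact: cabs2_ge0.
Qed.

Lemma cnorm_orthonormal (V : 'M[C]_(3, 2)) i k : Defs.orthonormal V -> cnorm (V i k) <= 1.
Proof.
move=> /matrixP/(_ k k); rewrite !mxE eqxx => E.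
have : (\sum_j cabs2 (V j k) : R) = 1.
  apply: (@complexI R); rewrite rmorph_sum rmorph1; transitivity (true%:R : C) => //; rewrite -E; apply: eq_bigr => j _.
  by rewrite !mxE mulrC mulcJ.
rewrite (bigD1 i) //= => e.
rewrite /cnorm -[leRHS]sqrtr1 ler_wsqrtr // -e lerDl; apply: sumr_ge0 => j _; exact: cabs2_ge0.
Qed.

Definition total (a : ext R 3) : R := \sum_I cnorm (a I).

Lemma coef_total (a : ext R 3) I : cnorm (a I) <= total a.
Proof.
rewrite /total (bigD1 I) //= lerDl; apply: sumr_ge0 => K _; exact: cnorm_ge0.
Qed.

Lemma total_ge0 (a : ext R 3) : 0 <= total a.
Proof. by apply: sumr_ge0 => I _; exact: cnorm_ge0. Qed.

(** The entries of [V] have modulus at most 1 and its minors at most 2, so each of the four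
    components is at most 6 [total a]; the square root of 4 times 36 is 12. *)
Lemma frame_norm_total (V : 'M[C]_(3, 2)) (a : ext R 3) : Defs.orthonormal V ->
  frame_norm V a <= 12 * total a.
Proof.
move=> oV; have v1 i k := @cnorm_orthonormal V i k oV.
have t0 := total_ge0 a.
have cv (u : C) : cnorm u <= 1 -> cnorm (conjc u) <= 1 by rewrite cnormJ.
have b J : cnorm (restrict_form V a J) <= 6 * total a.
  have m i j : cnorm (minor V i j) <= 2.
    rewrite /minor (le_trans (cnormB _ _)) // !cnormM !cnormJ.
    have := v1 (inord i) (inord 0); have := v1 (inord j) (inord 1).
    have := v1 (inord i) (inord 1); have := v1 (inord j) (inord 0).
    have p u : 0 <= cnorm u :> R := cnorm_ge0 u.
    have q (s t : R) : 0 <= s -> 0 <= t -> s <= 1 -> t <= 1 -> s * t <= 1.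
      by move=> *; rewrite mulr_ile1.
    move=> h1 h2 h3 h4; have := q _ _ (p _) (p _) h4 h3; have := q _ _ (p _) (p _) h2 h1.
    lra.
  have e k : cnorm (eval1 a (colv V k)) <= 6 * total a.
    rewrite /eval1 (le_trans (cnorm_sum _ _)) // !big_cons big_nil addr0.
    have s j : cnorm (coef1 a j * conjc (colv V k j)) <= total a.
      rewrite cnormM cnormJ -[leRHS]mulr1 ler_pM ?cnorm_ge0 ?coef_total //; exact: v1.
    have := s 0%N; have := s 1%N; have := s 2%N; lra.
  have s I i j : cnorm (a I * minor V i j) <= 2 * total a.
    by rewrite cnormM mulrC ler_pM ?cnorm_ge0 ?coef_total.
  rewrite [J]setb_eta !enum_ordSl (size0nil (size_enum_ord 0)) /=.
  case: (_ \in J); case: (_ \in J).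
  - rewrite -(setT_setb 2) restrict_form_top (le_trans (cnormD _ _)) //.
    have := s (setb 3 [:: true; true; false]) 0%N 1%N.
    have := s (setb 3 [:: true; false; true]) 0%N 2%N.
    have := s (setb 3 [:: false; true; true]) 1%N 2%N.
    have := cnormD (a (setb 3 [:: true; true; false]) * minor V 0 1)
      (a (setb 3 [:: true; false; true]) * minor V 0 2).
    lra.
  - by rewrite restrict_form_first.
  - by rewrite restrict_form_second.
  - rewrite restrict_form_const; have := coef_total a (setb 3 [:: false; false; false]); lra.
have c J : cabs2 (restrict_form V a J) <= 36 * total a ^+ 2.
  rewrite -cnorm_sqr (_ : 36 * total a ^+ 2 = (6 * total a) ^+ 2); last by ring.
  by rewrite ler_sqr ?nnegrE ?cnorm_ge0 ?mulr_ge0.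
rewrite -[leRHS]ger0_norm ?mulr_ge0 // -sqrtr_sqr ler_wsqrtr // sum_set2.
have := c (setb 2 [:: true; true]); have := c (setb 2 [:: true; false]).
have := c (setb 2 [:: false; true]); have := c (setb 2 [:: false; false]).
rewrite exprMn; move: (total a ^+ 2) => T; lra.
Qed.

Lemma form_norm_le (z : C3 R) (a : ext R 3) : form_norm z a <= 12 * total a.
Proof.
rewrite /form_norm; have [->|/set0P ne] := eqVneq [set r : R | exists V : 'M[C]_(3, 2),
    [/\ tangent z V, Defs.orthonormal V & r = frame_norm V a]] set0.
  by rewrite sup0 mulr_ge0 // total_ge0.
by apply: ge_sup => // r [V [_ oV ->]]; exact: frame_norm_total.
Qed.

Lemma frame_norm_le (z : C3 R) (V : 'M[C]_(3, 2)) (a : ext R 3) :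
  tangent z V -> Defs.orthonormal V -> frame_norm V a <= form_norm z a.
Proof.
move=> tV oV; apply: ub_le_sup; last by exists V.
by exists (12 * total a) => r [W [_ oW ->]]; exact: frame_norm_total.
Qed.

Lemma form_norm_ge0 (z : C3 R) (a : ext R 3) : 0 <= form_norm z a.
Proof.
rewrite /form_norm; have [->|/set0P[r [V [tV oV e]]]] := eqVneq [set r : R | exists V : 'M[C]_(3, 2),
    [/\ tangent z V, Defs.orthonormal V & r = frame_norm V a]] set0.
  by rewrite sup0.
apply: (@le_trans _ _ (frame_norm V a)); first exact: sqrtr_ge0.
exact: frame_norm_le.
Qed.

(* The normal covector of the cone at [z], and the cross product with [conj z],
   which together with [z] spans the tangent plane orthogonally. *)
Definition conormal (z : C3 R) (j : nat) : C := [:: z2 z; z1 z; - (2 * z3 z)]`_j.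

Definition zc (z : C3 R) (j : nat) : C := crd z (inord j).

Definition conormal_cross (z : C3 R) (j : nat) : C :=
  let N := conormal z in let b k := conjc (zc z k) in
  [:: N 1%N * b 2%N - N 2%N * b 1%N; N 2%N * b 0%N - N 0%N * b 2%N; N 0%N * b 1%N - N 1%N * b 0%N]`_j.

Definition conormal_norm2 (z : C3 R) : R := \sum_(j <- iota 0 3) cabs2 (conormal z j).

(** On the cone z itself is tangent, by Euler's relation, and [conormal_cross] completes it
    orthogonally. Its length is |N| |z| with N the conormal, by Lagrange's identity. An explicit
    frame makes the norm of a form measurable in z. *)
Definition frame (z : C3 R) : 'M[C]_(3, 2) :=
  \matrix_(i, k) (if k == inord 0 then zc z i / (normC3 z)%:C%C
                  else conormal_cross z i / (Num.sqrt (conormal_norm2 z * norm2 z))%:C%C).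

Lemma norm2_zc (z : C3 R) : norm2 z = \sum_(j <- iota 0 3) cabs2 (zc z j).
Proof. by rewrite /norm2 sum_ord3 !big_cons big_nil addr0 -[LHS]addrA. Qed.

(** Expansion of a product of two cross products. It expresses the component of [t] along
    [conormal_cross] through those along z and the conjugate normal, and is the algebra behind
    [frame_decomp]. *)
Lemma conormal_cross_identity (z : C3 R) (t : nat -> C) j : (j < 3)%N ->
  let dot (u v : nat -> C) := \sum_(k <- iota 0 3) u k * v k in
  let zb k := conjc (zc z k) in let Nb k := conjc (conormal z k) in
  conormal_cross z j * dot (fun k => conjc (conormal_cross z k)) t =
  t j * (dot (conormal z) Nb * dot zb (zc z) - dot (conormal z) (zc z) * dot zb Nb)
  - Nb j * (dot (conormal z) t * dot zb (zc z) - dot (conormal z) (zc z) * dot zb t)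
  + zc z j * (dot (conormal z) t * dot zb Nb - dot (conormal z) Nb * dot zb t).
Proof.
move=> j3 /=; rewrite !big_cons !big_nil !addr0.
have cb k : conjc (conormal_cross z k) = [:: conjc (conormal z 1%N) * zc z 2%N - conjc (conormal z 2%N) * zc z 1%N;
   conjc (conormal z 2%N) * zc z 0%N - conjc (conormal z 0%N) * zc z 2%N;
   conjc (conormal z 0%N) * zc z 1%N - conjc (conormal z 1%N) * zc z 0%N]`_k.
  rewrite /conormal_cross; case: k => [|[|[|k]]] /=; rewrite ?nth_nil ?rmorph0 //;
  by rewrite rmorphB !rmorphM /= !conjcK.
rewrite !cb /conormal_cross; move: {cb} (conormal z) (zc z) => N Z.
case: j j3 => [|[|[|//]]] _ /=; ring.
Qed.

Lemma tangentP (z : C3 R) m (V : 'M[C]_(3, m)) : tangent z V <->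
  forall k, \sum_(j <- iota 0 3) conormal z j * V (inord j) k = 0.
Proof.
have i0 : (0 : 'I_3) = inord 0 by apply: val_inj; rewrite /= inordK.
have i1 : (1 : 'I_3) = inord 1 by apply: val_inj; rewrite /= inordK.
have i2 : (2 : 'I_3) = inord 2 by apply: val_inj; rewrite /= inordK.
rewrite /tangent i2 i0 i1; split => h k; have := h k;
  rewrite !big_cons big_nil /conormal /= addr0 mulNr addrA //.
Qed.

Lemma zcE (z : C3 R) : (zc z 0%N = z1 z) * (zc z 1%N = z2 z) * (zc z 2%N = z3 z).
Proof. by rewrite /zc /crd !inordK. Qed.

(** Euler's relation for the homogeneous equation of degree two defining the cone. *)
Lemma conormal_zc (z : C3 R) : cone z -> \sum_(j <- iota 0 3) conormal z j * zc z j = 0.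
Proof.
rewrite /cone /= => h; rewrite !big_cons big_nil /conormal /= !zcE addr0.
have -> : z2 z * z1 z + (z1 z * z2 z + - (2 * z3 z) * z3 z) =
  2 * (z1 z * z2 z - z3 z ^+ 2) by ring.
by rewrite h mulr0.
Qed.

Lemma norm2_eq0 (z : C3 R) : norm2 z = 0 -> z = 0.
Proof.
move=> h; have : distC3 (z, 0) == 0.
  rewrite distC3_eq0 /enorm2; apply/eqP; rewrite -[RHS]h; apply: eq_bigr => j _.
  by rewrite /eta crd0 subr0.
by move/distC3_eq0P.
Qed.

Lemma norm2_gt0 (z : C3 R) : z <> 0 -> 0 < norm2 z.
Proof.
move=> z0; rewrite lt0r norm2_ge0 andbT; apply/eqP => /norm2_eq0; exact: z0.
Qed.

Lemma conormal_norm2_ge (z : C3 R) : norm2 z <= conormal_norm2 z.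
Proof.
rewrite norm2_zc /conormal_norm2 !big_cons !big_nil !zcE /conormal /= !addr0.
have -> : cabs2 (- (2 * z3 z)) = 4 * cabs2 (z3 z).
  rewrite -!cnorm_sqr cnormN cnormM.
  have -> : (2 : C) = (2%:R : R)%:C%C by rewrite rmorph_nat.
  by rewrite cnorm_real ger0_norm // exprMn; ring.
have := cabs2_ge0 (z3 z); lra.
Qed.

End Frames.

(** * Pointwise bound of the pulled-back density by the norm of the form *)

Section DensityBound.
Variable R : realType.
Local Notation C := (complex R).

Lemma sum_iota3 (V : nmodType) (F : nat -> V) :
  \sum_(j <- iota 0 3) F j = F 0%N + (F 1%N + F 2%N).
Proof. by rewrite !big_cons big_nil addr0. Qed.

Lemma mulJc (c : C) : conjc c * c = (cabs2 c)%:C%C.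
Proof. by rewrite mulrC mulcJ. Qed.

Lemma frame0 (z : C3 R) i : frame z i (inord 0) = zc z i / (normC3 z)%:C%C.
Proof. by rewrite mxE eqxx. Qed.

Lemma frame1 (z : C3 R) i :
  frame z i (inord 1) = conormal_cross z i / (Num.sqrt (conormal_norm2 z * norm2 z))%:C%C.
Proof. by rewrite mxE -val_eqE /= !inordK. Qed.

Lemma I2P (P : 'I_2 -> Prop) : P (inord 0) -> P (inord 1) -> forall k, P k.
Proof.
move=> h0 h1 k; have -> : k = inord k by rewrite inord_val.
by case: k => -[|[|//]].
Qed.

Lemma conormal_conormal_cross (z : C3 R) : \sum_(j <- iota 0 3) conormal z j * conormal_cross z j = 0.
Proof. by rewrite sum_iota3 /conormal_cross /=; move: (conormal z) (zc z) => N Z; ring. Qed.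

Lemma frame_tangent (z : C3 R) : cone z -> tangent z (frame z).
Proof.
move=> cz; apply/tangentP; apply: I2P.
  under eq_bigr => j _ do rewrite frame0 mulrA.
  rewrite -mulr_suml (_ : \sum_(j <- _) _ = 0) ?mul0r // -[RHS](conormal_zc cz).
  by rewrite !sum_iota3 !inordK.
under eq_bigr => j _ do rewrite frame1 mulrA.
rewrite -mulr_suml (_ : \sum_(j <- _) _ = 0) ?mul0r // -[RHS](conormal_conormal_cross z).
by rewrite !sum_iota3 !inordK.
Qed.

Lemma conjc_div_real (c : C) (r : R) : conjc (c / r%:C%C) = conjc c / r%:C%C.
Proof.
by rewrite !divcR; case: c => a b /=; rewrite mulNr.
Qed.

Lemma frame_orthonormal (z : C3 R) : cone z -> z <> 0 -> Defs.orthonormal (frame z).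
Proof.
move=> cz z0; have n0 := norm2_gt0 z0.
have N0 : 0 < conormal_norm2 z := lt_le_trans n0 (conormal_norm2_ge z).
have NN0 : 0 < conormal_norm2 z * norm2 z by exact: mulr_gt0.
have S (F : 'I_3 -> C) : \sum_j F j = \sum_(j <- iota 0 3) F (inord j).
  by rewrite sum_ord3 sum_iota3 addrA.
have zz : \sum_(j <- iota 0 3) conjc (zc z j) * zc z j = (norm2 z)%:C%C.
  by rewrite norm2_zc rmorph_sum; apply: eq_bigr => j _; rewrite mulJc.
have NNb : \sum_(j <- iota 0 3) conormal z j * conjc (conormal z j) = (conormal_norm2 z)%:C%C.
  by rewrite rmorph_sum; apply: eq_bigr => j _; rewrite mulcJ.
have cb k : conjc (conormal_cross z k) = [:: conjc (conormal z 1%N) * zc z 2%N - conjc (conormal z 2%N) * zc z 1%N;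
   conjc (conormal z 2%N) * zc z 0%N - conjc (conormal z 0%N) * zc z 2%N;
   conjc (conormal z 0%N) * zc z 1%N - conjc (conormal z 1%N) * zc z 0%N]`_k.
  rewrite /conormal_cross; case: k => [|[|[|k]]] /=; rewrite ?nth_nil ?rmorph0 //;
  by rewrite rmorphB !rmorphM /= !conjcK.
have nz := conormal_zc cz.
have cc : \sum_(j <- iota 0 3) conjc (conormal_cross z j) * conormal_cross z j = (conormal_norm2 z * norm2 z)%:C%C.
  have -> : (conormal_norm2 z * norm2 z)%:C%C = (conormal_norm2 z)%:C%C * (norm2 z)%:C%C :> C by rewrite rmorphM.
  rewrite -zz -NNb.
  (* Lagrange's identity for |N x conj z|^2; the subtracted product vanishes because z is
     tangent. *)
  transitivity ((\sum_(j <- iota 0 3) conormal z j * conjc (conormal z j))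
     * (\sum_(j <- iota 0 3) conjc (zc z j) * zc z j)
     - (\sum_(j <- iota 0 3) conormal z j * zc z j) *
       (\sum_(j <- iota 0 3) conjc (conormal z j) * conjc (zc z j))).
    rewrite !sum_iota3 !cb /conormal_cross; move: (conormal z) (zc z) => N Z /=; ring.
  by rewrite nz mul0r subr0.
have zcr : \sum_(j <- iota 0 3) conjc (zc z j) * conormal_cross z j = 0.
  rewrite !sum_iota3 /conormal_cross; move: (conormal z) (zc z) => N Z /=; ring.
have crz : \sum_(j <- iota 0 3) conjc (conormal_cross z j) * zc z j = 0.
  rewrite !sum_iota3 !cb; move: (conormal z) (zc z) => N Z /=; ring.
have D (a b : nat -> C) (r s : R) (v : C) :
    \sum_(j <- iota 0 3) conjc (a j) * b j = v ->
    \sum_(j <- iota 0 3) conjc (a (inord j : 'I_3) / r%:C%C) * (b (inord j : 'I_3) / s%:C%C)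
      = v / (r * s)%:C%C.
  move=> <-; have -> : (r * s)%:C%C = r%:C%C * s%:C%C :> C by rewrite rmorphM.
  rewrite !sum_iota3 !inordK // !conjc_div_real [(_ * _)^-1]invfM.
  by move: (_^-1) (_^-1) => u1 u2; ring.
have zn2 : normC3 z * normC3 z = norm2 z by rewrite -expr2 sqr_sqrtr // norm2_ge0.
have sq2 : Num.sqrt (conormal_norm2 z * norm2 z) * Num.sqrt (conormal_norm2 z * norm2 z) = conormal_norm2 z * norm2 z.
  by rewrite -expr2 sqr_sqrtr // ltW.
have n01 : (inord 0 == inord 1 :> 'I_2) = false by rewrite -val_eqE /= !inordK.
have n10 : (inord 1 == inord 0 :> 'I_2) = false by rewrite -val_eqE /= !inordK.
have E k l : ((map_mx conjc (frame z))^T *m frame z) k l =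
  \sum_(j <- iota 0 3) conjc (frame z (inord j) k) * frame z (inord j) l.
  by rewrite mxE S; apply: eq_bigr => j _; rewrite !mxE.
apply/matrixP; apply: I2P; apply: I2P; rewrite E [RHS]mxE ?eqxx ?n01 ?n10.
- under eq_bigr => j _ do rewrite frame0.
  by rewrite (D _ _ _ _ _ zz) zn2 divff // eq_complex /= negb_and gt_eqF.
- under eq_bigr => j _ do rewrite frame0 frame1.
  by rewrite (D _ _ _ _ _ zcr) mul0r.
- under eq_bigr => j _ do rewrite frame1 frame0.
  by rewrite (D _ _ _ _ _ crz) mul0r.
- under eq_bigr => j _ do rewrite frame1.
  by rewrite (D _ _ _ _ _ cc) sq2 divff // eq_complex /= negb_and gt_eqF.
Qed.

Definition fdot (z : C3 R) (k : nat) (t : nat -> C) : C :=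
  \sum_(i <- iota 0 3) conjc (frame z (inord i) (inord k)) * t i.

(** The directions z, [conormal_cross] and the conjugate of [conormal] are mutually orthogonal, so a
    vector annihilated by the conormal has no component along the third. *)
Lemma frame_decomp (z : C3 R) (t : nat -> C) j : cone z -> z <> 0 -> (j < 3)%N ->
  \sum_(i <- iota 0 3) conormal z i * t i = 0 ->
  t j = fdot z 0 t * frame z (inord j) (inord 0) + fdot z 1 t * frame z (inord j) (inord 1).
Proof.
move=> cz z0 j3 Nt; have n0 := norm2_gt0 z0.
have N0 : 0 < conormal_norm2 z := lt_le_trans n0 (conormal_norm2_ge z).
have NN0 : 0 < conormal_norm2 z * norm2 z by exact: mulr_gt0.
have zz : \sum_(j <- iota 0 3) conjc (zc z j) * zc z j = (norm2 z)%:C%C.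
  by rewrite norm2_zc rmorph_sum; apply: eq_bigr => i _; rewrite mulJc.
have NNb : \sum_(j <- iota 0 3) conormal z j * conjc (conormal z j) = (conormal_norm2 z)%:C%C.
  by rewrite rmorph_sum; apply: eq_bigr => i _; rewrite mulcJ.
have id : conormal_cross z j * (\sum_(i <- iota 0 3) conjc (conormal_cross z i) * t i) =
    t j * ((conormal_norm2 z)%:C%C * (norm2 z)%:C%C)
    - zc z j * ((conormal_norm2 z)%:C%C * (\sum_(i <- iota 0 3) conjc (zc z i) * t i)).
  rewrite (conormal_cross_identity z t j3) NNb zz Nt (conormal_zc cz); ring.
rewrite /fdot frame0 frame1 inordK //.
have -> : \sum_(i <- iota 0 3) conjc (frame z (inord i) (inord 0)) * t i =
   (\sum_(i <- iota 0 3) conjc (zc z i) * t i) / (normC3 z)%:C%C.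
  rewrite mulr_suml !sum_iota3 !frame0 !inordK // !conjc_div_real.
  by move: (_^-1) => u; ring.
have -> : \sum_(i <- iota 0 3) conjc (frame z (inord i) (inord 1)) * t i =
   (\sum_(i <- iota 0 3) conjc (conormal_cross z i) * t i) / (Num.sqrt (conormal_norm2 z * norm2 z))%:C%C.
  rewrite mulr_suml !sum_iota3 !frame1 !inordK // !conjc_div_real.
  by move: (_^-1) => u; ring.
set a := \sum_(i <- _) _; set b := \sum_(i <- _) _ in id *.
rewrite !mulf_div -!rmorphM /= -!expr2 (sqr_sqrtr (ltW NN0)) (sqr_sqrtr (ltW n0)).
have nzn : (norm2 z)%:C%C != 0 :> C by rewrite eq_complex /= negb_and gt_eqF.
have nzN : (conormal_norm2 z)%:C%C != 0 :> C by rewrite eq_complex /= negb_and gt_eqF.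
have -> : (conormal_norm2 z * norm2 z)%:C%C = (conormal_norm2 z)%:C%C * (norm2 z)%:C%C :> C by rewrite rmorphM.
have -> : b * conormal_cross z j = conormal_cross z j * b by rewrite mulrC.
rewrite id -/a; move: (norm2 z)%:C%C (conormal_norm2 z)%:C%C nzn nzN => n N nzn nzN.
by field; rewrite ?nzn ?nzN.
Qed.

Definition normC2 (w : C2 R) : R := Num.sqrt (cabs2 (w1 w) + cabs2 (w2 w)).

Lemma normC2_ge0 w : 0 <= normC2 w. Proof. exact: sqrtr_ge0. Qed.

Lemma cnorm_w1 w : cnorm (w1 w) <= normC2 w.
Proof. by rewrite ler_wsqrtr // lerDl cabs2_ge0. Qed.

Lemma cnorm_w2 w : cnorm (w2 w) <= normC2 w.
Proof. by rewrite ler_wsqrtr // lerDr cabs2_ge0. Qed.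

Lemma cnorm_2 : cnorm (2 : C) = 2.
Proof.
have -> : (2 : C) = (2%:R : R)%:C%C by rewrite rmorph_nat.
by rewrite cnorm_real ger0_norm.
Qed.

Lemma cnorm_jac w i k : cnorm (cover_jac w i k) <= 2 * normC2 w.
Proof.
have h0 := normC2_ge0 w; have h1 := cnorm_w1 w; have h2 := cnorm_w2 w.
rewrite mxE; case: i => -[|[|[|//]]] hi; case: k => -[|[|//]] hk /=;
  rewrite ?cnormM ?cnorm_2 ?cnorm0; lra.
Qed.

Lemma cover_neq0 (w : C2 R) : w <> 0 -> cover w <> 0.
Proof.
move=> w0 e; have e0 : cover (0 : C2 R) = 0.
  by rewrite /cover /w1 /w2 /fromC /toC /= !mul0r subr0 addr0.
have := cover_fiber w (0 : C2 R); rewrite e e0 => -[/(_ erefl) [h|h] _]; apply: w0 => //.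
by rewrite -[w]opprK -h oppr0.
Qed.

Definition jcol (w : C2 R) (k : nat) : nat -> C := colv (cover_jac w) k.

Lemma jcol_decomp (w : C2 R) k j : w <> 0 -> (j < 3)%N ->
  jcol w k j = fdot (cover w) 0 (jcol w k) * frame (cover w) (inord j) (inord 0)
             + fdot (cover w) 1 (jcol w k) * frame (cover w) (inord j) (inord 1).
Proof.
move=> w0 j3; apply: frame_decomp => //; [exact: cover_cone|exact: cover_neq0|].
exact: ((tangentP _ _).1 (cover_jac_tangent w) (inord k)).
Qed.

Lemma fdot_bound (w : C2 R) k l : w <> 0 -> cnorm (fdot (cover w) l (jcol w k)) <= 6 * normC2 w.
Proof.
move=> w0; have o := frame_orthonormal (cover_cone w) (cover_neq0 w0).
rewrite /fdot (le_trans (cnorm_sum _ _)) // sum_iota3.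
have h j : cnorm (conjc (frame (cover w) (inord j) (inord l)) * jcol w k j) <= 2 * normC2 w.
  rewrite cnormM cnormJ -[leRHS]mul1r; apply: ler_pM; rewrite ?cnorm_ge0 //.
    exact: cnorm_orthonormal.
  exact: cnorm_jac.
have := h 0%N; have := h 1%N; have := h 2%N; lra.
Qed.

(** A measurable substitute for [form_norm]. Only the bound of [std_frame_norm_le] by [form_norm] is
    used, since the form enters the estimates on the right-hand side. *)
Definition std_frame_norm (z : C3 R) (a : ext R 3) : R := frame_norm (frame z) a.

Lemma std_frame_norm_ge0 z a : 0 <= std_frame_norm z a. Proof. exact: sqrtr_ge0. Qed.

Lemma eval1_jcol (w : C2 R) f k : w <> 0 -> cnorm (eval1 f (jcol w k)) <= 12 * normC2 w * std_frame_norm (cover w) f.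
Proof.
move=> w0; have wn0 := normC2_ge0 w; have fn0 := std_frame_norm_ge0 (cover w) f.
set a := fdot (cover w) 0 (jcol w k); set b := fdot (cover w) 1 (jcol w k).
have -> : eval1 f (jcol w k) = conjc a * eval1 f (colv (frame (cover w)) 0)
   + conjc b * eval1 f (colv (frame (cover w)) 1).
  rewrite /eval1 !sum_iota3 !(jcol_decomp k w0) // -/a -/b /colv !rmorphD !rmorphM /=.
  ring.
have e0 := cnorm_restrict_le (frame (cover w)) f (setb 2 [:: true; false]).
have e1 := cnorm_restrict_le (frame (cover w)) f (setb 2 [:: false; true]).
rewrite restrict_form_first in e0; rewrite restrict_form_second in e1.
have ha := fdot_bound k 0 w0; have hb := fdot_bound k 1 w0.
rewrite (le_trans (cnormD _ _)) // !cnormM !cnormJ.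
have -> : 12 * normC2 w * std_frame_norm (cover w) f =
  6 * normC2 w * std_frame_norm (cover w) f + 6 * normC2 w * std_frame_norm (cover w) f by ring.
by apply: lerD; apply: ler_pM; rewrite ?cnorm_ge0.
Qed.

Lemma restrict_form_top_scale (V W : 'M[C]_(3, 2)) (D : C) f :
  (forall i j, (i < 3)%N -> (j < 3)%N -> minor W i j = D * minor V i j) ->
  restrict_form W f finset.setT = D * restrict_form V f finset.setT.
Proof.
move=> m; rewrite [LHS]restrict_form_top [restrict_form V f _]restrict_form_top.
rewrite (m 0%N 1%N isT isT) (m 0%N 2%N isT isT) (m 1%N 2%N isT isT).
move: (minor _ 0%N 1%N) (minor _ 0%N 2%N) (minor _ 1%N 2%N) => m1 m2 m3.
move: (f _) (f _) (f _) => f1 f2 f3.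
ring.
Qed.

(** Writing the columns of the Jacobian in the orthonormal frame multiplies all minors by one
    conjugated 2 by 2 determinant, whose entries are at most 6 |w|; 72 is twice 36. *)
Lemma top_jac (w : C2 R) f : w <> 0 ->
  cnorm (restrict_form (cover_jac w) f finset.setT) <= 72 * normC2 w ^+ 2 * std_frame_norm (cover w) f.
Proof.
move=> w0; have wn0 := normC2_ge0 w; have fn0 := std_frame_norm_ge0 (cover w) f.
pose al k l := fdot (cover w) l (jcol w k).
have m i j : (i < 3)%N -> (j < 3)%N -> minor (cover_jac w) i j =
  conjc (al 0%N 0%N * al 1%N 1%N - al 0%N 1%N * al 1%N 0%N) * minor (frame (cover w)) i j.
  move=> i3 j3; rewrite /minor.
  have E k l : (l < 3)%N -> cover_jac w (inord l) (inord k) =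
     al k 0%N * frame (cover w) (inord l) (inord 0) + al k 1%N * frame (cover w) (inord l) (inord 1).
    by move=> l3; rewrite -(jcol_decomp k w0).
  rewrite !E // !rmorphB !rmorphD !rmorphM /=; ring.
have -> : restrict_form (cover_jac w) f finset.setT =
   conjc (al 0%N 0%N * al 1%N 1%N - al 0%N 1%N * al 1%N 0%N)
   * restrict_form (frame (cover w)) f finset.setT.
  exact: restrict_form_top_scale.
rewrite cnormM cnormJ; apply: ler_pM; rewrite ?cnorm_ge0 //; last exact: cnorm_restrict_le.
rewrite (le_trans (cnormB _ _)) // !cnormM.
have b k l : cnorm (al k l) <= 6 * normC2 w by exact: fdot_bound.
have -> : 72 * normC2 w ^+ 2 = 6 * normC2 w * (6 * normC2 w) + 6 * normC2 w * (6 * normC2 w) by ring.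
by apply: lerD; apply: ler_pM; rewrite ?cnorm_ge0.
Qed.

Lemma unitfactor_bound (w : C2 R) : cnorm (unitfactor w) <= 8.
Proof.
rewrite /unitfactor; have [->|nz] := eqVneq (w1 w * w2 w) 0.
  by rewrite mulr0 mul0r cnorm0.
have two : (2 : C) != 0 by rewrite pnatr_eq0.
have -> : 16 * (w1 w * w2 w) / (-2 * (w1 w * w2 w)) = - (8%:R : R)%:C%C :> C.
  have -> : (8%:R : R)%:C%C = 8 :> C by rewrite rmorph_nat.
  have d : -2 * (w1 w * w2 w) != 0 :> C by rewrite mulf_neq0 // oppr_eq0.
  by apply: (mulIf d); rewrite divfK //; ring.
by rewrite cnormN cnorm_real ger0_norm.
Qed.

Lemma setb3_eta (J : {set 'I_3}) :
  J = setb 3 [:: ord0 \in J; inord 1 \in J; inord 2 \in J].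
Proof.
rewrite [LHS]setb_eta; congr setb.
have -> : inord 1 = lift ord0 ord0 :> 'I_3 by apply: val_inj; rewrite /= inordK.
have -> : inord 2 = lift ord0 (lift ord0 ord0) :> 'I_3.
  by apply: val_inj; rewrite /= inordK.
by rewrite !enum_ordSl (size0nil (size_enum_ord 0)).
Qed.

(** Abstracts the kernel coefficients [c] and the value [f] of the form, so that [ecoef] may replace
    [kernel_coef] and linearity in [f] is visible. For empty [J] the difference is the product of
    two pulled-back (0,1)-forms. *)
Definition dens (c : nat -> C) (f : ext R 3) (w : C2 R) (J : {set 'I_3}) : C :=
  unitfactor w *
  match ord0 \in J, inord 1 \in J, inord 2 \in J with
  | false, false, false =>
      eval1 f (jcol w 1) * (\sum_(j <- iota 0 3) c (6 + j)%N * conjc (jcol w 0 j)) -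
      eval1 f (jcol w 0) * (\sum_(j <- iota 0 3) c (6 + j)%N * conjc (jcol w 1 j))
  | true, false, false => c 9%N * restrict_form (cover_jac w) f finset.setT
  | false, true, false => c 10%N * restrict_form (cover_jac w) f finset.setT
  | false, false, true => c 11%N * restrict_form (cover_jac w) f finset.setT
  | _, _, _ => 0
  end.

Lemma density_dens chi phi z J (w : C2 R) :
  density chi phi z J w = dens (kernel_coef chi (cover w, z)) (phi (cover w)) w J.
Proof.
rewrite {1}(setb3_eta J) densityE /dens.
move: (ord0 \in J) (inord 1 \in J) (inord 2 \in J) => b0 b1 b2.
case: b0; case: b1; case: b2 => //=.
congr (_ * _); rewrite /eval1 !sum_iota3 /jcol /colv /minor /coef1 /=.
rewrite -[(6 + 0)%N]/6%N -[(6 + 1)%N]/7%N -[(6 + 2)%N]/8%N.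
rewrite !eqxx -![0%N == _]/false -![1%N == _]/false -![2%N == _]/false.
set c := kernel_coef _ _; set f := phi _.
by move: (c 6%N) (c 7%N) (c 8%N) (f _) (f _) (f _) => c6 c7 c8 f1 f2 f3; ring.
Qed.

(** One factor |w| for each of the two barred differentials pulled back. 1152 is 8, from
    [unitfactor], times 144 = 2 x 12 x 6, from two products of an [eval1] with a sum of kernel
    coefficients. *)
Lemma dens_bound c f (w : C2 R) J (B : R) : w <> 0 -> (forall k, (6 <= k < 12)%N -> cnorm (c k) <= B) ->
  cnorm (dens c f w J) <= 1152 * (normC2 w ^+ 2 * B * std_frame_norm (cover w) f).
Proof.
move=> w0 hc; have wn0 := normC2_ge0 w; have fn0 := std_frame_norm_ge0 (cover w) f.
have B0 : 0 <= B := le_trans (cnorm_ge0 _) (hc 6%N isT).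
set F := std_frame_norm _ _ in fn0 *.
have T0 : 0 <= normC2 w ^+ 2 * B * F by rewrite !mulr_ge0 ?sqr_ge0.
have top k : (6 <= k < 12)%N ->
    cnorm (c k * restrict_form (cover_jac w) f finset.setT) <= 144 * (normC2 w ^+ 2 * B * F).
  move=> /hc h; rewrite cnormM.
  have := ler_pM (cnorm_ge0 _) (cnorm_ge0 _) h (top_jac f w0).
  rewrite -/F (_ : B * (72 * normC2 w ^+ 2 * F) = 72 * (normC2 w ^+ 2 * B * F)); last by ring.
  lra.
have cs k : cnorm (\sum_(j <- iota 0 3) c (6 + j)%N * conjc (jcol w k j)) <= 6 * normC2 w * B.
  rewrite (le_trans (cnorm_sum _ _)) // sum_iota3.
  have h j : (j < 3)%N -> cnorm (c (6 + j)%N * conjc (jcol w k j)) <= B * (2 * normC2 w).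
    move=> j3; rewrite cnormM cnormJ ler_pM ?cnorm_ge0 ?hc //; last exact: cnorm_jac.
    by rewrite leq_addr -[12%N]/(6 + 6)%N ltn_add2l (leq_trans j3).
  have := h 0%N isT; have := h 1%N isT; have := h 2%N isT; lra.
have first : cnorm (eval1 f (jcol w 1) * (\sum_(j <- iota 0 3) c (6 + j)%N * conjc (jcol w 0 j)) -
      eval1 f (jcol w 0) * (\sum_(j <- iota 0 3) c (6 + j)%N * conjc (jcol w 1 j)))
    <= 144 * (normC2 w ^+ 2 * B * F).
  rewrite (le_trans (cnormB _ _)) // !cnormM.
  have -> : 144 * (normC2 w ^+ 2 * B * F) =
    12 * normC2 w * F * (6 * normC2 w * B) + 12 * normC2 w * F * (6 * normC2 w * B) by ring.
  by apply: lerD; apply: ler_pM; rewrite ?cnorm_ge0 ?cs // eval1_jcol.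
rewrite /dens cnormM (_ : 1152 * _ = 8 * (144 * (normC2 w ^+ 2 * B * F))); last by ring.
apply: ler_pM; rewrite ?cnorm_ge0 ?unitfactor_bound //.
move: (ord0 \in J) (inord 1 \in J) (inord 2 \in J) => b0 b1 b2.
by case: b0; case: b1; case: b2 => //;
  rewrite ?cnorm0 ?mulr_ge0 //; exact: top.
Qed.

Lemma eval1D (a : C) (f g : ext R 3) t : eval1 (a *: f + g) t = a * eval1 f t + eval1 g t.
Proof. by rewrite /eval1 !sum_iota3 /coef1 !ext_addE !ext_scaleE; ring. Qed.

Lemma dens_linear c (a : C) (f g : ext R 3) (w : C2 R) J : dens c (a *: f + g) w J = a * dens c f w J + dens c g w J.
Proof.
have t : restrict_form (cover_jac w) (a *: f + g) finset.setT =
   a * restrict_form (cover_jac w) f finset.setT + restrict_form (cover_jac w) g finset.setT.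
  rewrite [LHS]restrict_form_top !ext_addE !ext_scaleE.
  rewrite [restrict_form _ f _]restrict_form_top [restrict_form _ g _]restrict_form_top.
  move: (minor _ 0%N 1%N) (minor _ 0%N 2%N) (minor _ 1%N 2%N) => m1 m2 m3.
  ring.
rewrite /dens !eval1D t.
move: (eval1 f) (eval1 g) (restrict_form _ _ _) (restrict_form _ _ _) => ef eg rf rg.
move: (ord0 \in J) (inord 1 \in J) (inord 2 \in J) => b0 b1 b2.
by case: b0; case: b1; case: b2; ring.
Qed.

End DensityBound.

(** * Regularity of the density and geometry of the covering *)

Section DensityRegularity.
Variable R : realType.
Local Notation C := (complex R).

Section Meas.
Context {d : measure_display} {T : measurableType d}.

Lemma cmeas_toC (h : T -> plane R) : measurable_fun setT h -> cmeas setT (fun t => toC (h t)).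
Proof.
by move=> mh; split;
  [exact: (measurableT_comp measurable_fst mh)|exact: (measurableT_comp measurable_snd mh)].
Qed.

Lemma cmeas_w1 (w : T -> C2 R) : measurable_fun setT w -> cmeas setT (fun t => w1 (w t)).
Proof. by move=> mw; apply: cmeas_toC; exact: (measurableT_comp measurable_fst mw). Qed.

Lemma cmeas_w2 (w : T -> C2 R) : measurable_fun setT w -> cmeas setT (fun t => w2 (w t)).
Proof. by move=> mw; apply: cmeas_toC; exact: (measurableT_comp measurable_snd mw). Qed.

Lemma cmeas_jac (w : T -> C2 R) i k : measurable_fun setT w ->
  cmeas setT (fun t => cover_jac (w t) i k).
Proof.
move=> mw; have m1 := cmeas_w1 mw; have m2 := cmeas_w2 mw.
have c0 (a : C) : cmeas setT (fun _ : T => a) by exact: cmeas_cst.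
have E e : (forall t, cover_jac (w t) i k = e t) -> cmeas setT e ->
    cmeas setT (fun t => cover_jac (w t) i k) by move=> /funext ->.
case: i E => -[|[|[|//]]] hi; case: k => -[|[|//]] hk E;
  (apply: E; first by move=> t; rewrite mxE);
  by [exact: m1|exact: m2|exact: c0|apply: cmeasM].
Qed.

Lemma cmeas_minor (V : T -> 'M[C]_(3, 2)) i j : (forall i k, cmeas setT (fun t => V t i k)) ->
  cmeas setT (fun t => minor (V t) i j).
Proof.
by move=> mV; apply: cmeasB; apply: cmeasM; apply: cmeasJ.
Qed.

Lemma cmeas_eval1 (f : T -> ext R 3) (v : T -> nat -> C) :
  (forall I, cmeas setT (fun t => f t I)) -> (forall j, cmeas setT (fun t => v t j)) ->
  cmeas setT (fun t => eval1 (f t) (v t)).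
Proof.
by move=> mf mv; apply: cmeas_sum => j; apply: cmeasM; [exact: mf|exact: cmeasJ].
Qed.

Lemma cmeas_restrict_top (V : T -> 'M[C]_(3, 2)) (f : T -> ext R 3) :
  (forall i k, cmeas setT (fun t => V t i k)) -> (forall I, cmeas setT (fun t => f t I)) ->
  cmeas setT (fun t => restrict_form (V t) (f t) finset.setT).
Proof.
move=> mV mf; rewrite (funext (fun t => restrict_form_top (V t) (f t))).
by apply: cmeasD; [apply: cmeasD|]; apply: cmeasM => //; exact: cmeas_minor.
Qed.

Lemma cmeas_dens (c : T -> nat -> C) (f : T -> ext R 3) (w : T -> C2 R) J :
  (forall k, cmeas setT (fun t => c t k)) ->
  (forall I, cmeas setT (fun t => f t I)) -> measurable_fun setT w ->
  cmeas setT (fun t => dens (c t) (f t) (w t) J).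
Proof.
move=> mc mf mw.
have c0 (a : C) : cmeas setT (fun _ : T => a) by exact: cmeas_cst.
have mj i k : cmeas setT (fun t => cover_jac (w t) i k) by exact: cmeas_jac.
have mt : cmeas setT (fun t => restrict_form (cover_jac (w t)) (f t) finset.setT).
  exact: cmeas_restrict_top.
have mm := cmeasM (cmeas_w1 mw) (cmeas_w2 mw).
have jc k j : cmeas setT (fun t => jcol (w t) k j) by exact: mj.
have me k : cmeas setT (fun t => eval1 (f t) (jcol (w t) k)) by exact: cmeas_eval1.
have ms k : cmeas setT (fun t => \sum_(j <- iota 0 3) c t (6 + j)%N * conjc (jcol (w t) k j)).
  by apply: cmeas_sum => j; apply: cmeasM => //; exact: cmeasJ.
apply: cmeasM.
  by apply: cmeasM; [exact: cmeasM|apply: cmeasV; exact: cmeasM].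
move: (ord0 \in J) (inord 1 \in J) (inord 2 \in J) => b0 b1 b2.
case: b0; case: b1; case: b2 => //; try exact: cmeasM.
by apply: cmeasB; exact: cmeasM.
Qed.

Lemma measurable_std_frame_norm (g : T -> C3 R) (f : T -> ext R 3) : measurable_fun setT g ->
  (forall I, cmeas setT (fun t => f t I)) -> measurable_fun setT (fun t => std_frame_norm (g t) (f t)).
Proof.
move=> mg mf.
have mz j : cmeas setT (fun t => zc (g t) j) by exact: cmeas_crd.
have mN j : cmeas setT (fun t => conormal (g t) j).
  rewrite (_ : (fun t => _) = (fun t => [:: zc (g t) 1; zc (g t) 0; - (2 * zc (g t) 2)]`_j)).
    case: j => [|[|[|j]]] /=; try exact: mz; last first.
      by rewrite (_ : (fun t => _) = fun=> [::]`_j) //; exact: cmeas_cst.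
    by apply: cmeasN; apply: cmeasM => //; exact: cmeas_cst.
  by apply/funext => t; rewrite /conormal !zcE.
have mc j : cmeas setT (fun t => conormal_cross (g t) j).
  rewrite /conormal_cross; case: j => [|[|[|j]]] /=;
    try by (apply: cmeasB; apply: cmeasM => //; exact: cmeasJ).
  by rewrite (_ : (fun t => _) = fun=> [::]`_j) //; exact: cmeas_cst.
have mzn : measurable_fun setT (fun t => normC3 (g t)) by exact: measurable_normC3.
have mn2 : measurable_fun setT (fun t => norm2 (g t)).
  rewrite (_ : (fun t => _) = (fun t => normC3 (g t) ^+ 2)); first exact: measurable_funX.
  by apply/funext => t; rewrite sqr_sqrtr // norm2_ge0.
have mnn : measurable_fun setT (fun t => conormal_norm2 (g t)).
  rewrite (_ : (fun t => _) = (fun t => cabs2 (conormal (g t) 0%N) +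
      (cabs2 (conormal (g t) 1%N) + cabs2 (conormal (g t) 2%N)))).
    by apply: measurable_funD; [|apply: measurable_funD]; exact: measurable_cabs2.
  by apply/funext => t; rewrite /conormal_norm2 sum_iota3.
have nn20 t : 0 <= conormal_norm2 (g t) by apply: sumr_ge0 => j _; exact: cabs2_ge0.
have mV i k : cmeas setT (fun t => frame (g t) i k).
  move: k; apply: I2P.
    rewrite (funext (fun t => frame0 (g t) i)); apply: cmeasM => //.
    by apply: cmeasV; exact: cmeas_real.
  rewrite (funext (fun t => frame1 (g t) i)); apply: cmeasM => //.
  apply: cmeasV; apply: cmeas_real; apply: measurable_ge0_sqrt => [t|].
    by rewrite mulr_ge0 // norm2_ge0.
  exact: measurable_funM.
have mr J : cmeas setT (fun t => restrict_form (frame (g t)) (f t) J).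
  have -> : J = setb 2 [:: ord0 \in J; inord 1 \in J].
    rewrite [LHS]setb_eta; congr setb.
    have -> : inord 1 = lift ord0 ord0 :> 'I_2 by apply: val_inj; rewrite /= inordK.
    by rewrite !enum_ordSl (size0nil (size_enum_ord 0)).
  case: (_ \in J); case: (_ \in J).
  - by rewrite -(setT_setb 2); exact: cmeas_restrict_top.
  - rewrite (funext (fun t => restrict_form_first (frame (g t)) (f t))).
    by apply: cmeas_eval1 => // j; exact: mV.
  - rewrite (funext (fun t => restrict_form_second (frame (g t)) (f t))).
    by apply: cmeas_eval1 => // j; exact: mV.
  - by rewrite (funext (fun t => restrict_form_const (frame (g t)) (f t))).
apply: measurable_ge0_sqrt => [t|]; first by apply: sumr_ge0 => J _; exact: cabs2_ge0.
rewrite (funext (fun t => sum_set2 (fun J => cabs2 (restrict_form (frame (g t)) (f t) J)))).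
by apply: measurable_funD; apply: measurable_funD; exact: measurable_cabs2.
Qed.

End Meas.

Lemma ccvg_dens (T : Type) (F : set_system T) {FF : Filter F} (c : T -> nat -> C) (c' : nat -> C)
    f (w : C2 R) J :
  (forall k, (6 <= k < 12)%N -> ccvg F (c^~ k) (c' k)) ->
  ccvg F (fun t => dens (c t) f w J) (dens c' f w J).
Proof.
move=> hc; have c0 (a : C) : ccvg F (fun=> a) a by exact: ccvg_cst.
apply: ccvgM; first exact: c0.
have s k : ccvg F (fun t => \sum_(j <- iota 0 3) c t (6 + j)%N * conjc (jcol w k j))
    (\sum_(j <- iota 0 3) c' (6 + j)%N * conjc (jcol w k j)).
  rewrite sum_iota3 (funext (fun t => sum_iota3 (fun j => c t (6 + j)%N * conjc (jcol w k j)))).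
  by apply: ccvgD; [|apply: ccvgD]; apply: ccvgM; try exact: c0; exact: hc.
move: (ord0 \in J) (inord 1 \in J) (inord 2 \in J) => b0 b1 b2.
have top k (Q : C) : (6 <= k < 12)%N -> ccvg F (fun t => c t k * Q) (c' k * Q).
  by move=> hk; apply: ccvgM; [exact: hc|exact: c0].
case: b0; case: b1; case: b2; [exact: c0|exact: c0|exact: c0|exact: top|exact: c0
  |exact: top|exact: top|].
by apply: ccvgB; apply: ccvgM; [exact: c0|exact: s|exact: c0|exact: s].
Qed.

Implicit Types (w v : C2 R).

Lemma norm2_cover w : norm2 (cover w) =
  cabs2 (w1 w) ^+ 2 + cabs2 (w2 w) ^+ 2 + cabs2 (w1 w) * cabs2 (w2 w).
Proof.
rewrite /norm2 sum_ord3 /crd !inordK //= !fromCK -!cnorm_sqr !expr2 !cnormM.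
by move: (cnorm _) (cnorm _) => a b; ring.
Qed.

Lemma normC2_sqr w : normC2 w ^+ 2 = cabs2 (w1 w) + cabs2 (w2 w).
Proof. by rewrite sqr_sqrtr // addr_ge0 ?cabs2_ge0. Qed.

Lemma normC2_eq0 w : normC2 w = 0 -> w = 0.
Proof.
move=> wn0; have := normC2_sqr w; rewrite wn0 expr0n /= => /esym/eqP.
rewrite paddr_eq0 ?cabs2_ge0 // -!cnorm_sqr !sqrf_eq0 !cnorm_eq0 => /andP[/eqP e1 /eqP e2].
by rewrite [w]surjective_pairing -[w.1]toCK -[w.2]toCK -/(w1 w) -/(w2 w) e1 e2.
Qed.

Lemma normC3_cover_le w : normC3 (cover w) <= normC2 w ^+ 2.
Proof.
rewrite -[leRHS]ger0_norm ?sqr_ge0 // -sqrtr_sqr ler_wsqrtr // norm2_cover normC2_sqr.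
have := cabs2_ge0 (w1 w); have := cabs2_ge0 (w2 w).
move: (cabs2 _) (cabs2 _) => a b; nra.
Qed.

Lemma normC3_cover_ge w : normC2 w ^+ 2 <= 2 * normC3 (cover w).
Proof.
have -> : 2 * normC3 (cover w) = Num.sqrt (4 * norm2 (cover w)).
  rewrite sqrtrM //; congr (_ * _).
  by rewrite (_ : 4 = 2 ^+ 2) ?sqrtr_sqr ?ger0_norm //; ring.
rewrite -[leLHS]ger0_norm ?sqr_ge0 // -sqrtr_sqr ler_wsqrtr // norm2_cover normC2_sqr.
have := cabs2_ge0 (w1 w); have := cabs2_ge0 (w2 w).
move: (cabs2 _) (cabs2 _) => a b; nra.
Qed.

Lemma gram_le w : gram w <= 8 * normC2 w ^+ 4.
Proof.
rewrite gramE (_ : normC2 w ^+ 4 = (normC2 w ^+ 2) ^+ 2); last by rewrite -exprM.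
rewrite normC2_sqr; have := cabs2_ge0 (w1 w); have := cabs2_ge0 (w2 w).
move: (cabs2 _) (cabs2 _) => a b; nra.
Qed.

Lemma gram_ge w : 4 * normC2 w ^+ 4 <= gram w.
Proof.
rewrite gramE (_ : normC2 w ^+ 4 = (normC2 w ^+ 2) ^+ 2); last by rewrite -exprM.
rewrite normC2_sqr; have := cabs2_ge0 (w1 w); have := cabs2_ge0 (w2 w).
move: (cabs2 _) (cabs2 _) => a b; nra.
Qed.

Lemma w1B w v : w1 (w - v) = w1 w - w1 v. Proof. by []. Qed.
Lemma w2B w v : w2 (w - v) = w2 w - w2 v. Proof. by []. Qed.
Lemma w1D w v : w1 (w + v) = w1 w + w1 v. Proof. by []. Qed.
Lemma w2D w v : w2 (w + v) = w2 w + w2 v. Proof. by []. Qed.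

(* In the coordinates a = w - v and b = w + v, the difference of [cover w] and
   [cover v] is the symmetric product of a and b. *)
Lemma distC3_cover_ge w v : normC2 (w - v) * normC2 (w + v) <= 2 * distC3 (cover w, cover v).
Proof.
pose a1 := w1 w - w1 v; pose a2 := w2 w - w2 v.
pose b1 := w1 w + w1 v; pose b2 := w2 w + w2 v.
have two : (2 : C) != 0 by rewrite pnatr_eq0.
have E : enorm2 (cover w, cover v) =
    cabs2 (a1 * b1) + cabs2 (a2 * b2) + cabs2 (a1 * b2 + a2 * b1) / 4.
  rewrite /enorm2 sum_ord3 /eta /crd !inordK //= !fromCK; congr (cabs2 _ + cabs2 _ + _).
  - by rewrite /a1 /b1; ring.
  - by rewrite /a2 /b2; ring.
  have -> : a1 * b2 + a2 * b1 = 2 * (w1 w * w2 w - w1 v * w2 v).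
    by rewrite /a1 /a2 /b1 /b2; ring.
  rewrite -!cnorm_sqr cnormM cnorm_2 exprMn; by field.
have -> : 2 * distC3 (cover w, cover v) = Num.sqrt (4 * enorm2 (cover w, cover v)).
  rewrite sqrtrM //; congr (_ * _).
  by rewrite (_ : 4 = 2 ^+ 2) ?sqrtr_sqr ?ger0_norm //; ring.
rewrite /normC2 -sqrtrM; last by rewrite addr_ge0 ?cabs2_ge0.
apply: ler_wsqrtr; rewrite E.
rewrite w1B w2B w1D w2D -/a1 -/a2 -/b1 -/b2.
(* The reverse triangle inequality, squared. *)
have tri : cnorm (a1 * b2) ^+ 2 + cnorm (a2 * b1) ^+ 2 <=
    cabs2 (a1 * b2 + a2 * b1) + 2 * (cnorm (a1 * b2) * cnorm (a2 * b1)).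
  have := cnormB (a1 * b2 + a2 * b1) (a2 * b1); rewrite addrK.
  have := cnormB (a1 * b2 + a2 * b1) (a1 * b2); rewrite addrAC subrr add0r.
  have := cnorm_ge0 (a1 * b2 + a2 * b1).
  rewrite -cnorm_sqr; move: (cnorm (a1 * b2 + a2 * b1)) (cnorm_ge0 (a1 * b2)) (cnorm_ge0 (a2 * b1)).
  move: (cnorm (a1 * b2)) (cnorm (a2 * b1)) => p q s p0 q0 s0 h1 h2.
  have [pq|pq] := leP p q; nra.
move: tri; rewrite -!cnorm_sqr !cnormM.
move: (cnorm (a1 * b2 + a2 * b1)) (cnorm a1) (cnorm a2) (cnorm b1) (cnorm b2) => s x1 x2 y1 y2 tri.
(* The mixed term 2 |a1 b2| |a2 b1| equals 2 |a1 b1| |a2 b2| and is absorbed by the squares of a1 b1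
   and a2 b2. *)
have := sqr_ge0 (x1 * y1 - x2 * y2); rewrite !exprMn in tri *; nra.
Qed.

End DensityRegularity.

(** * Integration on the cone *)

Section MeasureTheory.
Local Open Scope ereal_scope.

Section NonMeasurableMonotone.
Context d (T : measurableType d) (R : realType) (mu : {measure set T -> \bar R}).

(** The integral of a nonnegative function is a supremum over the simple functions below it, so
    monotonicity requires no measurability. This matters for [form_norm], a supremum over frames. *)
Lemma ge0_le_integralW (D : set T) (f g : T -> \bar R) :
  (forall x, D x -> 0 <= f x) -> (forall x, D x -> f x <= g x) ->
  \int[mu]_(x in D) f x <= \int[mu]_(x in D) g x.
Proof.
move=> f0 fg; have g0 x : D x -> 0 <= g x by move=> Dx; exact: le_trans (f0 _ Dx) (fg _ Dx).
rewrite !ge0_integralE //; apply: le_ereal_sup => _ [h hf <-]; exists h => // x.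
apply: le_trans (hf x) _; rewrite !patchE; case: ifPn => // /[!inE] Dx; exact: fg.
Qed.

End NonMeasurableMonotone.

Section Density.
Context d1 d2 (X : measurableType d1) (Y : measurableType d2) (R : realType).
Context (mu : {measure set X -> \bar R}) (nu : {measure set Y -> \bar R}).
Context (phi : X -> Y) (h : X -> R).
Hypothesis mphi : measurable_fun setT phi.
Hypothesis mh : measurable_fun setT h.
Hypothesis h0 : forall x, (0 <= h x)%R.
Hypothesis nuE : forall E, measurable E -> nu E = \int[mu]_(x in phi @^-1` E) (h x)%:E.

Import HBNNSimple.

(** Here [nu] is the image under [phi] of the measure with density [h]. Monotone convergence along
    simple functions reduces the formula to indicators, where it is the hypothesis [nuE]. *)
Lemma ge0_integral_density (f : Y -> \bar R) :
  (forall y, 0 <= f y) -> measurable_fun setT f ->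
  \int[nu]_y f y = \int[mu]_x (f (phi x) * (h x)%:E).
Proof.
move=> f0 mf; pose s := nnsfun_approx measurableT mf.
have meh : measurable_fun setT (EFin \o h) by exact/measurable_EFinP.
have he0 x : 0 <= (h x)%:E by rewrite lee_fin.
have pre E : measurable E -> measurable (phi @^-1` E).
  by move=> mE; rewrite -[X in measurable X]setTI; exact: mphi.
have mg (g : Y -> R) : measurable_fun setT g ->
    measurable_fun setT (fun x => (g (phi x))%:E).
  by move=> m; apply/measurable_EFinP; exact: measurableT_comp m mphi.
have -> : \int[nu]_y f y = limn (fun n => \int[nu]_y (s n y)%:E).
  rewrite -monotone_convergence//.
  - apply: eq_integral => y _; apply/esym/cvg_lim => //.
    by apply: cvg_nnsfun_approx=> // *; exact: f0.
  - by move=> n; exact/measurable_EFinP/measurable_funP.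
  - by move=> n y _; rewrite lee_fin.
  - by move=> y _ m n mn; rewrite lee_fin; exact/lefP/nd_nnsfun_approx.
have -> : \int[mu]_x (f (phi x) * (h x)%:E) =
    limn (fun n => \int[mu]_x ((s n (phi x))%:E * (h x)%:E)).
  rewrite -monotone_convergence//.
  - apply: eq_integral => x _; apply/esym/cvg_lim => //; apply: cvgeZr => //.
    by apply: cvg_nnsfun_approx=> // *; exact: f0.
  - by move=> n; apply: emeasurable_funM => //; apply: mg; exact: measurable_funP.
  - by move=> n y _; rewrite mule_ge0 ?lee_fin.
  - move=> y _ m n mn; rewrite lee_wpmul2r ?lee_fin ?h0 //.
    exact/lefP/nd_nnsfun_approx.
suff E n : \int[nu]_y (s n y)%:E = \int[mu]_x ((s n (phi x))%:E * (h x)%:E).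
  by congr (limn _); apply/funext.
have mi r : measurable (s n @^-1` [set r]) by exact: measurable_sfunP.
transitivity (\sum_(r \in range (s n))
    \int[nu]_y (r * \1_(s n @^-1` [set r]) y)%:E).
  under eq_integral do rewrite fimfunE -fsumEFin//.
  rewrite ge0_integral_fsum// => [r|r y _]; last exact: nnfun_muleindic_ge0.
  exact/measurable_EFinP/measurable_funM.
transitivity (\sum_(r \in range (s n))
    \int[mu]_x ((r * \1_(s n @^-1` [set r]) (phi x))%:E * (h x)%:E)); last first.
  rewrite -ge0_integral_fsum//.
  - apply: eq_integral => x _; rewrite -ge0_mule_fsuml => [|r]; last exact: nnfun_muleindic_ge0.
    by rewrite fsumEFin // -(fimfunE _ (phi x)).
  - move=> r; apply: emeasurable_funM => //.
    by apply: (mg (fun y => r * \1_(s n @^-1` [set r]) y)%R); exact: measurable_funM.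
  - by move=> r x _; rewrite mule_ge0 // nnfun_muleindic_ge0.
apply: eq_fsbigr => r; rewrite inE => -[y _ <-{r}].
under eq_integral do rewrite EFinM.
under [RHS]eq_integral do rewrite EFinM -muleA.
set A := s n @^-1` [set s n y].
have n1 x : [set: X] x -> 0 <= (\1_A (phi x))%:E * (h x)%:E.
  by move=> _; rewrite mule_ge0 // lee_fin.
have mA' : measurable A by exact: mi.
have mA : measurable_fun setT (\1_A : Y -> R).
  by apply: measurable_indic; exact: mi.
have n2 : measurable_fun setT (EFin \o (\1_A : Y -> R)) by exact/measurable_EFinP.
have n3 : measurable_fun setT (fun x => (\1_A (phi x))%:E * (h x)%:E).
  by apply: emeasurable_funM => //; exact: (mg \1_A).
rewrite !ge0_integralZl ?lee_fin //.
congr (_ * _); rewrite integral_indic // setIT nuE // integral_mkcond.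
apply: eq_integral => x _; rewrite patchE indicE.
have -> : (x \in phi @^-1` A) = (phi x \in A) by [].
by case: ifPn => _; rewrite ?mul1e ?mul0e.
Qed.

End Density.

End MeasureTheory.

(** * The volume of the cone through the covering *)

Section VolumeMeasure.
Variable R : realType.
Local Notation leb4 := (@leb4 R).
Local Notation vol := (@vol R).
Local Open Scope ereal_scope.

Lemma ge0_integral_vol (f : C3 R -> \bar R) : (forall z, 0 <= f z) ->
  measurable_fun setT f ->
  \int[vol]_z f z = \int[leb4]_w (f (cover w) * (2^-1 * gram w)%:E).
Proof.
move=> f0 mf; apply: ge0_integral_density => //.
- exact: Defs.measurable_cover.
- by apply: measurable_funM => //; exact: measurable_gram.
- by move=> w; rewrite mulr_ge0 ?invr_ge0 ?ler0n ?gram_ge0.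
Qed.

Lemma leb2_set1 (a : plane R) : @leb2 R [set a] = 0.
Proof.
case: a => a b; have -> : [set (a, b)] = [set a] `*` [set b].
  by apply/seteqP; split => -[x y] /=; [case=> -> ->|case=> -> ->].
have ma := measurable_set1 a; have mb := measurable_set1 b.
transitivity (lebesgue_measure [set a] * lebesgue_measure [set b] : \bar R).
  exact: product_measure1E.
by rewrite lebesgue_measure_set1 mul0e.
Qed.

Lemma measurable_set1_plane (a : plane R) : measurable [set a].
Proof.
case: a => a b; have -> : [set (a, b)] = [set a] `*` [set b].
  by apply/seteqP; split => -[x y] /=; [case=> -> ->|case=> -> ->].
by apply: measurableX; exact: measurable_set1.
Qed.

Lemma set1_C2 (v : C2 R) : [set v] = [set v.1] `*` [set v.2].
Proof.
by case: v => a b; apply/seteqP; split => -[x y] /=; [case=> -> ->|case=> -> ->].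
Qed.

Lemma measurable_set1_C2 (v : C2 R) : measurable [set v].
Proof. by rewrite set1_C2; apply: measurableX; exact: measurable_set1_plane. Qed.

Lemma leb4_set1 (v : C2 R) : leb4 [set v] = 0.
Proof.
have m1 := measurable_set1_plane v.1; have m2 := measurable_set1_plane v.2.
rewrite set1_C2; transitivity (@leb2 R [set v.1] * @leb2 R [set v.2]).
  exact: product_measure1E.
by rewrite leb2_set1 mul0e.
Qed.

Lemma gram_gt0 (w : C2 R) : w <> 0%R -> (0 < gram w)%R.
Proof.
move=> w0; apply: lt_le_trans (gram_ge w); rewrite mulr_gt0 // exprn_gt0 //.
by rewrite lt_neqAle normC2_ge0 andbT eq_sym; apply/eqP => /normC2_eq0.
Qed.

(** The density [gram] is positive except at w = 0, and a point is a null set of C^2. *)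
Lemma vol_negligible_preimage (N : set (C3 R)) :
  vol.-negligible N -> leb4.-negligible (@Defs.cover R @^-1` N).
Proof.
move=> [A [mA A0 NA]]; have mcA : measurable (@Defs.cover R @^-1` A).
  by rewrite -[X in measurable X]setTI; exact: Defs.measurable_cover.
pose f (w : C2 R) := (2^-1 * gram w)%R.
have mf : measurable_fun (@Defs.cover R @^-1` A) (EFin \o f).
  apply/measurable_EFinP; apply: measurable_funTS.
  by apply: measurable_funM => //; exact: measurable_gram.
have f0 w : (0 <= f w)%R by rewrite mulr_ge0 ?invr_ge0 ?ler0n ?gram_ge0.
have : \int[leb4]_(w in @Defs.cover R @^-1` A) `|(EFin \o f) w| = 0.
  rewrite -[RHS]A0; apply: eq_integral => w _; by rewrite [LHS]gee0_abs // lee_fin.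
move/(ae_eq_integral_abs _ mcA mf) => negB.
have neg0 : leb4.-negligible [set (0%R : C2 R)].
  by exists [set 0%R]; split => //; [exact: measurable_set1_C2|exact: leb4_set1].
apply: negligibleS (negligibleU negB neg0).
move=> w Nw; have [->|/eqP w0] := eqVneq w 0%R; first by right.
left => /= /(_ (NA _ Nw)) [] /eqP.
by rewrite mulf_eq0 invr_eq0 pnatr_eq0 /= gt_eqF // gram_gt0.
Qed.

Lemma measurable_norm2 : measurable_fun setT (@norm2 R).
Proof.
rewrite (_ : @norm2 R = (fun z => normC3 z ^+ 2)%R); last first.
  by apply/funext => z; rewrite sqr_sqrtr // norm2_ge0.
by apply: measurable_funX; exact: measurable_normC3.
Qed.

Lemma measurable_Xball (r : R) : measurable (Xball r).
Proof.
apply: measurableI.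
  rewrite (_ : Defs.ball0 r = [set z | normC3 z < r]%R) //.
  have -> : [set z | normC3 z < r]%R = [set z | (normC3 z < r)%R = true].
    by apply/seteqP; split => z.
  have m : measurable_fun setT (fun z : C3 R => (normC3 z < r)%R).
    by apply: measurable_fun_ltr; [exact: measurable_normC3|exact: measurable_cst].
  by rewrite -[X in measurable X]setTI; exact: (m measurableT [set true]).
have h : cmeas setT (fun z : C3 R => z1 z * z2 z - z3 z ^+ 2)%R.
  have m j : cmeas setT (fun z : C3 R => zc z j) by exact: cmeas_crd.
  have := cmeasB (cmeasM (m 0%N) (m 1%N)) (cmeasM (m 2%N) (m 2%N)).
  by rewrite /zc /crd !inordK.
rewrite (_ : @cone R = (fun z : C3 R => cabs2 (z1 z * z2 z - z3 z ^+ 2))%R @^-1` [set 0%R]).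
  by rewrite -[X in measurable X]setTI; apply: (measurable_cabs2 h) => //; exact: measurable_set1.
apply/seteqP; split => z /=; rewrite /cone /=.
  by move=> ->; rewrite -cnorm_sqr cnorm0 expr0n.
by rewrite -cnorm_sqr => /eqP; rewrite sqrf_eq0 cnorm_eq0 => /eqP.
Qed.

End VolumeMeasure.

(** * Singular integrals on C^2 *)

Section SingularIntegrals.
Variable R : realType.
Local Notation leb4 := (@leb4 R).
Implicit Types (w v : C2 R).

Lemma normC2_coord w : [/\ `|w.1.1 : R| <= normC2 w, `|w.1.2 : R| <= normC2 w,
  `|w.2.1 : R| <= normC2 w & `|w.2.2 : R| <= normC2 w].
Proof.
have E : normC2 w = Num.sqrt ((w.1.1 : R) ^+ 2 + (w.1.2 : R) ^+ 2 + ((w.2.1 : R) ^+ 2 + (w.2.2 : R) ^+ 2)).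
  by [].
have h (x : R) : x ^+ 2 <= normC2 w ^+ 2 -> `|x| <= normC2 w.
  move=> hx; rewrite -(ger0_norm (normC2_ge0 w)) -!sqrtr_sqr; exact: ler_wsqrtr.
have e2 : normC2 w ^+ 2 = (w.1.1 : R) ^+ 2 + (w.1.2 : R) ^+ 2 + ((w.2.1 : R) ^+ 2 + (w.2.2 : R) ^+ 2).
  by rewrite E sqr_sqrtr // !addr_ge0 ?sqr_ge0.
have p1 := sqr_ge0 (w.1.1 : R); have p2 := sqr_ge0 (w.1.2 : R).
have p3 := sqr_ge0 (w.2.1 : R); have p4 := sqr_ge0 (w.2.2 : R).
split; apply: h; rewrite e2.
- by rewrite -addrA lerDl addr_ge0 // addr_ge0.
- by rewrite addrAC lerDr !addr_ge0.
- by rewrite addrCA lerDl !addr_ge0.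
- by rewrite addrA lerDr !addr_ge0.
Qed.

Lemma measurable_normC2_fun d (T : measurableType d) (g : T -> C2 R) :
  measurable_fun setT g -> measurable_fun setT (fun t => normC2 (g t)).
Proof.
move=> mg; apply: measurable_ge0_sqrt => [t|]; first by rewrite addr_ge0 ?cabs2_ge0.
by apply: measurable_funD; apply: measurable_cabs2; [exact: cmeas_w1|exact: cmeas_w2].
Qed.

Section Translation.
Context d (T : measurableType d) (g h : T -> C2 R).
Hypotheses (mg : measurable_fun setT g) (mh : measurable_fun setT h).

Let m11 (f : T -> C2 R) : measurable_fun setT f -> measurable_fun setT (fun t => (f t).1.1 : R).
Proof. by move=> mf; exact: measurableT_comp measurable_fst (measurableT_comp measurable_fst mf). Qed.
Let m12 (f : T -> C2 R) : measurable_fun setT f -> measurable_fun setT (fun t => (f t).1.2 : R).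
Proof. by move=> mf; exact: measurableT_comp measurable_snd (measurableT_comp measurable_fst mf). Qed.
Let m21 (f : T -> C2 R) : measurable_fun setT f -> measurable_fun setT (fun t => (f t).2.1 : R).
Proof. by move=> mf; exact: measurableT_comp measurable_fst (measurableT_comp measurable_snd mf). Qed.
Let m22 (f : T -> C2 R) : measurable_fun setT f -> measurable_fun setT (fun t => (f t).2.2 : R).
Proof. by move=> mf; exact: measurableT_comp measurable_snd (measurableT_comp measurable_snd mf). Qed.

Lemma measurable_funB_C2 : measurable_fun setT (fun t => g t - h t : C2 R).
Proof.
rewrite (_ : (fun t => _) = (fun t =>
   (((g t).1.1 - (h t).1.1 : R, (g t).1.2 - (h t).1.2 : R),
    ((g t).2.1 - (h t).2.1 : R, (g t).2.2 - (h t).2.2 : R)))) //.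
apply: measurable_fun_pair; apply: measurable_fun_pair; apply: measurable_funB;
  by [exact: m11|exact: m12|exact: m21|exact: m22].
Qed.

End Translation.

Definition citv (c r : R) : set R := `[c - r, c + r]%classic.

Definition box v (r : R) : set (C2 R) :=
  (citv v.1.1 r `*` citv v.1.2 r) `*` (citv v.2.1 r `*` citv v.2.2 r).

Lemma measurable_box v r : measurable (box v r).
Proof. by apply: measurableX; apply: measurableX; exact: measurable_itv. Qed.

Lemma leb4_box v (r : R) : 0 <= r -> leb4 (box v r) = ((2 * r) ^+ 4)%:E.
Proof.
move=> r0.
have l (c : R) : lebesgue_measure (citv c r) = (2 * r)%:E.
  rewrite lebesgue_measure_itv /= lte_fin; case: ltP => h.
    by rewrite -EFinB; congr EFin; ring.
  by congr EFin; lra.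
have l2 (p : plane R) : @leb2 R (citv p.1 r `*` citv p.2 r) = ((2 * r) ^+ 2)%:E.
  transitivity (lebesgue_measure (citv p.1 r) * lebesgue_measure (citv p.2 r))%E.
    by apply: product_measure1E; exact: measurable_itv.
  by rewrite !l -EFinM expr2.
transitivity (@leb2 R (citv v.1.1 r `*` citv v.1.2 r) * @leb2 R (citv v.2.1 r `*` citv v.2.2 r))%E.
  by apply: product_measure1E; apply: measurableX; exact: measurable_itv.
by rewrite !l2 -EFinM -exprD.
Qed.

Lemma box_normC2 w v (r : R) : normC2 (w - v) <= r -> box v r w.
Proof.
move=> h; have [h1 h2 h3 h4] := normC2_coord (w - v).
have k (x c : R) : `|x - c| <= normC2 (w - v) -> citv c r x.
  by move=> hx; rewrite /citv /= in_itv /=; move: (le_trans hx h); rewrite ler_norml; lra.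
by split; split => /=; apply: k.
Qed.

Lemma powR_expn (x t : R) n : 0 <= x -> (x ^+ n) `^ t = (x `^ t) ^+ n.
Proof. by move=> x0; rewrite -powR_mulrn // -powRrM mulrC powRrM powR_mulrn // powR_ge0. Qed.

Lemma sum_geometric_le (a q : R) n : 0 <= a -> 0 <= q < 1 ->
  \sum_(0 <= k < n) a * q ^+ k <= a / (1 - q).
Proof.
move=> a0 /andP[q0 q1]; have q1' : q != 1 by rewrite lt_eqF.
have := congr1 (fun f => f n) (geometric_seriesE a q1').
rewrite /series /= => ->.
by rewrite ler_pM2r ?invr_gt0 ?subr_gt0 // ler_piMr // gerBl exprn_ge0.
Qed.

Lemma dyadic_scale (r t : R) : 0 < t <= r ->
  exists n, r * 2^-1 ^+ n.+1 < t <= r * 2^-1 ^+ n.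
Proof.
move=> /andP[t0 tr]; have r0 : 0 < r by exact: lt_le_trans tr.
have ex : exists n, r * 2^-1 ^+ n.+1 < t.
  have h : `|2^-1 : R| < 1 by rewrite ger0_norm // invf_lt1 // ltr1n.
  have /cvgrPdist_lt /(_ t t0) [N _ /(_ N.+1 (leqnSn N))] := cvg_geometric r h.
  rewrite /= sub0r normrN ger0_norm ?mulr_ge0 ?exprn_ge0 ?invr_ge0 ?(ltW r0) //.
  by exists N.
case: (ex_minnP ex) => n hn hm; exists n; rewrite hn /=.
case: n hn hm => [|n] hn hm; first by rewrite expr0 mulr1.
by rewrite leNgt; apply/negP => /hm; rewrite ltnn.
Qed.

Local Open Scope ereal_scope.

(** Dyadic shells: at distance between rho(n+1) and rho(n) the integrand is at most rho(n+1)^(-s),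
    on a box of volume (2 rho(n))^4. The resulting series is geometric with ratio 2^(s-4), below 1
    as s < 4, and its sum does not depend on [v] or [D]. *)
Lemma singular_integral (s r : R) : (0 < s < 4)%R -> (0 < r)%R ->
  exists2 C : R, (0 <= C)%R & forall v (D : set (C2 R)), (forall w, D w -> normC2 (w - v) <= r)%R ->
    \int[leb4]_(w in D) (normC2 (w - v) `^ (- s))%:E <= C%:E.
Proof.
move=> /andP[s0 s4] r0; pose rho n := (r * 2^-1 ^+ n)%R.
have rho0 n : (0 < rho n)%R by rewrite mulr_gt0 // exprn_gt0 // invr_gt0.
pose q := (2^-1 `^ (4 - s))%R; pose a := ((r * 2^-1) `^ (- s) * (2 * r) ^+ 4)%R.
have q0 : (0 <= q)%R by exact: powR_ge0.
have q1 : (q < 1)%R.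
  have -> : (1 = 1 `^ (4 - s) :> R)%R by rewrite powR1.
  have h : (2^-1 < 1 :> R)%R by rewrite invf_lt1 // ltr1n.
  by apply: gt0_ltr_powR => //; rewrite ?subr_gt0 ?nnegrE ?invr_ge0.
have a0 : (0 <= a)%R by rewrite mulr_ge0 ?powR_ge0 ?exprn_ge0 ?mulr_ge0 ?(ltW r0).
have aq n : (rho n.+1 `^ (- s) * (2 * rho n) ^+ 4 = a * q ^+ n)%R.
  have h2 : (0 <= 2^-1 :> R)%R by rewrite invr_ge0.
  have rr : (0 <= r * 2^-1)%R by rewrite mulr_ge0 ?(ltW r0).
  have -> : rho n.+1 = (r * 2^-1 * 2^-1 ^+ n)%R by rewrite /rho exprS mulrA.
  rewrite (powRM _ rr (exprn_ge0 n h2)) powR_expn // /rho.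
  have -> : (2 * (r * 2^-1 ^+ n) = 2 * r * 2^-1 ^+ n)%R by rewrite mulrA.
  rewrite [X in (_ * X)%R]exprMn -exprM mulnC exprM /a /q.
  have -> : (2^-1 `^ (4 - s) = 2^-1 `^ (- s) * 2^-1 ^+ 4 :> R)%R.
    have i2 : ((- s + 4%:R == 0) ==> (2^-1 != 0 :> R))%R by apply/implyP => _; rewrite invr_neq0.
    by rewrite -(powR_mulrn 4 h2) -(powRD i2) addrC.
  by rewrite [in RHS](exprMn n (2^-1 `^ (- s))%R) mulrACA.
exists (a / (1 - q))%R; first by rewrite divr_ge0 // subr_ge0 ltW.
move=> v D Dr.
pose f n w := ((rho n.+1 `^ (- s))%:E * (\1_(box v (rho n)) w)%:E : \bar R).
have f0 n w : 0 <= f n w by rewrite mule_ge0 ?lee_fin ?powR_ge0.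
have mf n : measurable_fun setT (f n).
  apply: emeasurable_funM; first exact: measurable_cst.
  by apply/measurable_EFinP; apply: measurable_indic; exact: measurable_box.
have If n : \int[leb4]_w f n w = (a * q ^+ n)%:E.
  have mB : measurable (box v (rho n)) by exact: measurable_box.
  have mI : measurable_fun setT (EFin \o (\1_(box v (rho n)) : C2 R -> R)).
    by apply/measurable_EFinP; exact: measurable_indic.
  transitivity ((rho n.+1 `^ (- s))%:E * \int[leb4]_w (\1_(box v (rho n)) w)%:E).
    by apply: ge0_integralZl; rewrite ?lee_fin ?powR_ge0 // => w _; rewrite lee_fin.
  transitivity ((rho n.+1 `^ (- s))%:E * leb4 (box v (rho n))).
    congr (_ * _); transitivity (leb4 (box v (rho n) `&` setT)); last by rewrite setIT.
    exact: integral_indic.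
  by rewrite leb4_box ?ltW // -EFinM aq.
apply: (@le_trans _ _ (\int[leb4]_w \sum_(0 <= n <oo) f n w)); last first.
  rewrite integral_nneseries //; under eq_eseriesr do rewrite If.
  apply: lime_le; first by apply: is_cvg_nneseries => n _ _; rewrite lee_fin mulr_ge0 // exprn_ge0.
  by apply: nearW => n; rewrite sumEFin lee_fin sum_geometric_le // q0.
rewrite integral_mkcond; apply: ge0_le_integralW => w _.
  by rewrite patchE; case: ifP => // _; rewrite lee_fin powR_ge0.
have S0 : 0 <= \sum_(0 <= n <oo) f n w by apply: nneseries_ge0 => n _ _.
rewrite patchE; case: ifPn => // /[!inE] Dw.
(* At the singular point itself the integrand is 0, since 0 to a nonzero power is 0. *)
have [->|wv] := eqVneq (normC2 (w - v)%R) 0%R; first by rewrite powR0 // oppr_eq0 gt_eqF.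
have t0 : (0 < normC2 (w - v) <= r)%R by rewrite lt_neqAle eq_sym wv normC2_ge0 Dr.
have [n /andP[n1 n2]] := dyadic_scale t0.
apply: (@le_trans _ _ (f n w)).
  rewrite /f indicE mem_set ?mule1; last exact: box_normC2.
  rewrite lee_fin !powRN lef_pV2 ?posrE ?powR_gt0 //; last by case/andP: t0.
  by rewrite ge0_ler_powR ?nnegrE ?normC2_ge0 ?(ltW s0) ?(ltW n1) ?(ltW (rho0 _)).
rewrite (@nneseriesD1 _ _ n) //.
by rewrite leeDl // nneseries_ge0.
Qed.

End SingularIntegrals.

(** * Pointwise estimates of the majorant *)

Section KernelEstimates.
Variable R : realType.
Local Notation leb4 := (@leb4 R).
Implicit Types (w v : C2 R) (z : C3 R).

Lemma normC2_triangle w v : normC2 (w + v) <= normC2 w + normC2 v.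
Proof.
have h0 := normC2_ge0 w; have h1 := normC2_ge0 v; have h2 := normC2_ge0 (w + v).
have e0 := normC2_sqr w; have e1 := normC2_sqr v; have e2 := normC2_sqr (w + v).
rewrite w1D w2D in e2.
have k1 := cnormD (w1 w) (w1 v); have k2 := cnormD (w2 w) (w2 v).
rewrite -!cnorm_sqr in e0 e1 e2.
move: (cnorm_ge0 (w1 w)) (cnorm_ge0 (w1 v)) (cnorm_ge0 (w2 w)) (cnorm_ge0 (w2 v))
  (cnorm_ge0 (w1 w + w1 v)) (cnorm_ge0 (w2 w + w2 v)) e0 e1 e2 k1 k2.
move: (cnorm (w1 w)) (cnorm (w1 v)) (cnorm (w2 w)) (cnorm (w2 v))
  (cnorm (w1 w + w1 v)) (cnorm (w2 w + w2 v)) => p1 q1 p2 q2 r1 r2.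
move: (normC2 w) (normC2 v) (normC2 (w + v)) h0 h1 h2 => x y t h0 h1 h2 P1 Q1 P2 Q2 R1 R2 e0 e1 e2 k1 k2.
have cs : (p1 * q1 + p2 * q2) ^+ 2 <= (x * y) ^+ 2.
  by rewrite exprMn e0 e1; have := sqr_ge0 (p1 * q2 - p2 * q1); nra.
have cs' : p1 * q1 + p2 * q2 <= x * y.
  by rewrite -(@ler_pXn2r _ 2) ?nnegrE // ?mulr_ge0 ?addr_ge0 ?mulr_ge0.
rewrite -(@ler_pXn2r _ 2) ?nnegrE ?addr_ge0 // e2.
have : r1 ^+ 2 <= (p1 + q1) ^+ 2 by rewrite ler_pXn2r ?nnegrE ?addr_ge0.
have : r2 ^+ 2 <= (p2 + q2) ^+ 2 by rewrite ler_pXn2r ?nnegrE ?addr_ge0.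
rewrite !sqrrD; nra.
Qed.

Lemma wnN w : normC2 (- w) = normC2 w.
Proof.
have nC (x : plane R) : cabs2 (toC (- x)) = cabs2 (toC x).
  by rewrite /cabs2 /= !sqrrN.
by rewrite /normC2 /w1 /w2 !nC.
Qed.

Lemma normC2_parallelogram w v :
  normC2 (w - v) ^+ 2 + normC2 (w + v) ^+ 2 = 2 * (normC2 w ^+ 2 + normC2 v ^+ 2).
Proof.
rewrite !normC2_sqr w1B w2B w1D w2D.
have p (x y : complex R) : cabs2 (x - y) + cabs2 (x + y) = 2 * (cabs2 x + cabs2 y).
  by case: x => x1 x2; case: y => y1 y2; rewrite /cabs2 /=; ring.
have := p (w1 w) (w1 v); have := p (w2 w) (w2 v); lra.
Qed.

Definition majorant w z : R := normC2 w ^+ 2 * (normC3 (cover w) + normC3 z) * (distC3 (cover w, z) ^+ 3)^-1.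

Lemma majorant_ge0 w z : 0 <= majorant w z.
Proof.
by rewrite !mulr_ge0 ?exprn_ge0 ?normC2_ge0 ?addr_ge0 ?normC3_ge0 ?invr_ge0 ?exprn_ge0 ?distC3_ge0.
Qed.

Lemma distC3_sym z z' : distC3 (z, z') = distC3 (z', z).
Proof.
congr Num.sqrt; apply: eq_bigr => j _; rewrite /eta /= -opprB.
by rewrite -!cnorm_sqr cnormN.
Qed.

Lemma majorant_sym w v : normC2 v ^+ 2 * majorant w (cover v) = normC2 w ^+ 2 * majorant v (cover w).
Proof.
rewrite /majorant [in RHS]distC3_sym [in RHS](addrC (normC3 (cover v))).
by move: (_^-1) => u; ring.
Qed.

Lemma ler_pinv (x y : R) : 0 < x -> x <= y -> y^-1 <= x^-1.
Proof. by move=> x0 xy; rewrite lef_pV2 ?posrE //; exact: lt_le_trans xy. Qed.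

Lemma distC3_cover_eq0 w v : normC2 (w - v) * normC2 (w + v) = 0 -> distC3 (cover w, cover v) = 0.
Proof.
move/eqP; rewrite mulf_eq0 => /orP[] /eqP /normC2_eq0 h; apply/eqP; apply/distC3_eq0P => /=;
  apply/cover_fiber; [left|right].
  by apply/eqP; rewrite eq_sym -subr_eq0 h.
by apply/eqP; rewrite -addr_eq0 addrC h.
Qed.

Section Pointwise.
Variables (w v : C2 R).
Local Notation x := (normC2 w).
Local Notation y := (normC2 v).
Local Notation a := (normC2 (w - v)).
Local Notation b := (normC2 (w + v)).

(** Triangle inequalities for 2w = (w - v) + (w + v), 2v = (w + v) - (w - v), v = w - (w - v) and v
    = -w + (w + v). *)
Lemma normC2_geom : [/\ 2 * x <= a + b, 2 * y <= a + b, y <= x + a & y <= x + b].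
Proof.
have t2 (u : C2 R) : normC2 (u + u) = 2 * normC2 u.
  have e := normC2_parallelogram u u; rewrite subrr in e.
  have z0 : normC2 (0 : C2 R) = 0.
    by rewrite /normC2 /w1 /w2 /cabs2 /= !expr0n /= !addr0 sqrtr0.
  rewrite z0 in e; have h := normC2_ge0 (u + u); have h' := normC2_ge0 u.
  apply/eqP; rewrite -(@eqrXn2 _ 2) // ?mulr_ge0 //; apply/eqP.
  by rewrite exprMn; lra.
have e1 : w - v + (w + v) = w + w by rewrite addrACA [- v + v]addrC subrr addr0.
have e2 : w + v - (w - v) = v + v by rewrite opprB addrC addrA subrK.
split.
- by rewrite -t2 -e1 normC2_triangle.
- by rewrite -t2 -e2 addrC -[normC2 (w - v)]wnN normC2_triangle.
- have := normC2_triangle w (- (w - v)); rewrite wnN opprB addrCA subrr addr0; exact.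
- have := normC2_triangle (- w) (w + v); rewrite wnN addrA [- w + w]addrC subrr add0r; exact.
Qed.

(** By the parallelogram law |zeta| + |z| <= |w|^2 + |v|^2 = (a^2 + b^2)/2, and [distC3_cover_ge]
    gives |eta| >= ab/2. If ab = 0 then eta = 0, and both sides are 0. *)
Lemma majorant_le_ab : majorant w (cover v) <= 4 * x ^+ 2 * (a ^+ 2 + b ^+ 2) * ((a * b) ^+ 3)^-1.
Proof.
have := normC2_parallelogram w v; have := distC3_cover_ge w v; have := @distC3_cover_eq0 w v.
have zw := normC3_cover_le w; have zv := normC3_cover_le v.
have zw0 := normC3_ge0 (cover w); have zv0 := normC3_ge0 (cover v).
have e0 := distC3_ge0 (cover w, cover v); rewrite /majorant.
have x0 := normC2_ge0 w; have y0 := normC2_ge0 v; have a0 := normC2_ge0 (w - v); have b0 := normC2_ge0 (w + v).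
move: (normC3 _) (normC3 _) (distC3 _) zw zv zw0 zv0 e0 => s t e zw zv zw0 zv0 e0 ez he par.
have ab0 : 0 <= a * b by exact: mulr_ge0.
have [ab|ab] := eqVneq (a * b) 0.
  by rewrite (ez ab) ab expr0n /= invr0 !mulr0.
have abp : 0 < a * b by rewrite lt_neqAle eq_sym ab.
have ep : 0 < e by lra.
have h : (e ^+ 3)^-1 <= 8 * ((a * b) ^+ 3)^-1.
  have -> : 8 * ((a * b) ^+ 3)^-1 = ((a * b / 2) ^+ 3)^-1.
    by rewrite expr_div_n invf_div; congr (_ * _); ring.
  apply: ler_pinv; first by rewrite exprn_gt0 // divr_gt0.
  by rewrite lerXn2r ?nnegrE ?divr_ge0 //; lra.
have -> : 4 * x ^+ 2 * (a ^+ 2 + b ^+ 2) * ((a * b) ^+ 3)^-1 =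
   x ^+ 2 * (x ^+ 2 + y ^+ 2) * (8 * ((a * b) ^+ 3)^-1) by rewrite par; ring.
apply: ler_pM => //; rewrite ?invr_ge0 ?exprn_ge0 ?mulr_ge0 ?addr_ge0 ?sqr_ge0 //.
by rewrite ler_wpM2l ?sqr_ge0 // lerD.
Qed.

(** With m <= M the two numbers a and b in order, x^2 (m^2 + M^2) / (m M)^3 is at most 2 x^2 / (M
    m^3), and x <= M removes one factor x. So only the nearer of the points v and -v is felt. *)
Lemma majorant_le_min (m M : R) : 0 <= m <= M -> a * b = m * M -> a ^+ 2 + b ^+ 2 = m ^+ 2 + M ^+ 2 ->
  x <= M -> majorant w (cover v) <= 8 * x * m `^ (- 3).
Proof.
move=> /andP[m0 mM] eP eS xM; apply: le_trans majorant_le_ab _; rewrite eP eS.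
have x0 := normC2_ge0 w; have M0 : 0 <= M by exact: le_trans mM.
rewrite powRN (powR_mulrn 3 m0) exprMn.
have [->|Mn] := eqVneq M 0.
  by rewrite !expr0n /= mulr0 invr0 mulr0; apply: mulr_ge0; rewrite ?invr_ge0 ?exprn_ge0 ?mulr_ge0.
rewrite invfM [X in _ * X]mulrC mulrA ler_wpM2r ?invr_ge0 ?exprn_ge0 //.
rewrite ler_pdivrMr ?exprn_gt0 ?lt_neqAle ?(eq_sym 0) ?Mn //.
have : x * (m ^+ 2 + M ^+ 2) <= M * (2 * M ^+ 2).
  apply: ler_pM => //; first by rewrite addr_ge0 ?sqr_ge0.
  have : m ^+ 2 <= M ^+ 2 by rewrite ler_pXn2r.
  lra.
by move=> h; have := ler_wpM2l x0 h; nra.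
Qed.

Lemma majorant_le_near : majorant w (cover v) <= 8 * x * (a `^ (- 3) + b `^ (- 3)).
Proof.
have [h1 h2 h3 h4] := normC2_geom; have a0 := normC2_ge0 (w - v); have b0 := normC2_ge0 (w + v).
have x0 := normC2_ge0 w; rewrite mulrDr.
have pa := powR_ge0 a (- 3); have pb := powR_ge0 b (- 3).
have [ab|ab] := leP a b.
  apply: le_trans (_ : _ <= 8 * x * a `^ (- 3)) _; last by rewrite lerDl !mulr_ge0.
  by apply: (@majorant_le_min a b); rewrite ?a0 //; lra.
apply: le_trans (_ : _ <= 8 * x * b `^ (- 3)) _; last by rewrite lerDr !mulr_ge0.
apply: (@majorant_le_min b a); rewrite ?b0 ?(ltW ab) //; [by rewrite mulrC|by rewrite addrC|lra].
Qed.

(** If |v| > 2 |w| then a and b are both at least |v|/2, so nothing is singular and the factor |w|^2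
    is retained. *)
Lemma majorant_le_far : 2 * x < y -> majorant w (cover v) <= 128 * x ^+ 2 * (y ^+ 4)^-1.
Proof.
have [h1 h2 h3 h4] := normC2_geom; have a0 := normC2_ge0 (w - v); have b0 := normC2_ge0 (w + v).
have x0 := normC2_ge0 w; move=> xy; apply: le_trans majorant_le_ab _.
have y0 : 0 < y by lra.
have ya : y / 2 <= a by lra.
have yb : y / 2 <= b by lra.
have h0 : 0 < y / 2 by lra.
have ap : 0 < a by lra.
have bp : 0 < b by lra.
have hi (p q : R) : y / 2 <= p -> y / 2 <= q -> (p ^+ 3 * q)^-1 <= 16 * (y ^+ 4)^-1.
  move=> hp hq.
  have -> : 16 * (y ^+ 4)^-1 = ((y / 2) ^+ 3 * (y / 2))^-1.
    by rewrite -exprSr expr_div_n invf_div; congr (_ * _); ring.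
  apply: ler_pinv; first by rewrite mulr_gt0 // exprn_gt0.
  have h0' := ltW h0.
  apply: ler_pM => //; rewrite ?exprn_ge0 ?lerXn2r ?nnegrE //; lra.
have -> : 4 * x ^+ 2 * (a ^+ 2 + b ^+ 2) * ((a * b) ^+ 3)^-1 =
   4 * x ^+ 2 * ((b ^+ 3 * a)^-1 + (a ^+ 3 * b)^-1).
  field; by rewrite !gt_eqF.
have -> : 128 * x ^+ 2 * (y ^+ 4)^-1 = 4 * x ^+ 2 * (16 * (y ^+ 4)^-1 + 16 * (y ^+ 4)^-1) by ring.
by rewrite ler_wpM2l ?mulr_ge0 ?sqr_ge0 // lerD // hi.
Qed.

(** The hypothesis gives ab < d^2, so the smaller of a and b is below d. Then m^(-3) <= d^(1/2)
    m^(-7/2): the exponent 7/2 is still integrable in R^4, and d^(1/2) is the gain. *)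
Lemma majorant_le_diag (d : R) : 0 < d -> 2 * distC3 (cover w, cover v) < d ^+ 2 ->
  majorant w (cover v) <= 8 * x * d `^ (2^-1) * (a `^ (- (7 / 2)) + b `^ (- (7 / 2))).
Proof.
have [h1 h2 h3 h4] := normC2_geom; have a0 := normC2_ge0 (w - v); have b0 := normC2_ge0 (w + v).
have x0 := normC2_ge0 w => d0 hd; have := le_lt_trans (distC3_cover_ge w v) hd => abd.
have pa := powR_ge0 a (- (7 / 2)); have pb := powR_ge0 b (- (7 / 2)).
have pd := powR_ge0 d (2^-1).
have shift (t : R) : 0 <= t -> t < d -> t `^ (- 3) <= d `^ (2^-1) * t `^ (- (7 / 2)).
  move=> t0 td; have [->|tn] := eqVneq t 0.
    by rewrite !powR0 ?mulr0 // oppr_eq0 ?pnatr_eq0 // gt_eqF // divr_gt0.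
  have -> : - 3 = 2^-1 + - (7 / 2) :> R by field.
  rewrite powRD ?tn ?implybT // ler_wpM2r ?powR_ge0 //.
  by apply: ge0_ler_powR; rewrite ?nnegrE ?invr_ge0 // ltW.
rewrite mulrDr.
have [ab|ab] := leP a b.
  apply: le_trans (_ : _ <= 8 * x * d `^ (2^-1) * a `^ (- (7 / 2))) _; last by rewrite lerDl !mulr_ge0.
  rewrite -[leRHS]mulrA; apply: (@le_trans _ _ (8 * x * a `^ (- 3))).
    by apply: (@majorant_le_min a b); rewrite ?a0 //; lra.
  by rewrite ler_wpM2l ?mulr_ge0 // shift //; nra.
apply: le_trans (_ : _ <= 8 * x * d `^ (2^-1) * b `^ (- (7 / 2))) _; last by rewrite lerDr !mulr_ge0.
rewrite -[leRHS]mulrA; apply: (@le_trans _ _ (8 * x * b `^ (- 3))).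
  apply: (@majorant_le_min b a); rewrite ?b0 ?(ltW ab) //; [by rewrite mulrC|by rewrite addrC|lra].
by rewrite ler_wpM2l ?mulr_ge0 // shift //; nra.
Qed.

End Pointwise.

End KernelEstimates.

Section IntegralSum.
Context d (T : measurableType d) (R : realType) (mu : {measure set T -> \bar R}).
Local Open Scope ereal_scope.

Lemma integral_sum3_le (D : set T) (f1 f2 f3 : T -> \bar R) (c a1 a2 a3 : R) :
  measurable D -> (0 <= c)%R ->
  measurable_fun D f1 -> measurable_fun D f2 -> measurable_fun D f3 ->
  (forall x, D x -> 0 <= f1 x) -> (forall x, D x -> 0 <= f2 x) ->
  (forall x, D x -> 0 <= f3 x) ->
  \int[mu]_(x in D) f1 x <= a1%:E -> \int[mu]_(x in D) f2 x <= a2%:E ->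
  \int[mu]_(x in D) f3 x <= a3%:E ->
  \int[mu]_(x in D) (c%:E * (f1 x + f2 x + f3 x)) <= (c * (a1 + a2 + a3))%:E.
Proof.
move=> mD c0 m1 m2 m3 g1 g2 g3 i1 i2 i3.
have g12 x : D x -> 0 <= f1 x + f2 x by move=> Dx; rewrite adde_ge0 ?g1 ?g2.
have m12 : measurable_fun D (fun x => f1 x + f2 x) by exact: emeasurable_funD.
rewrite ge0_integralZl //; last 2 first.
- exact: emeasurable_funD.
- by move=> x Dx; rewrite adde_ge0 ?g12 ?g3.
rewrite EFinM lee_wpmul2l // ge0_integralD // ge0_integralD // !EFinD.
by apply: leeD => //; exact: leeD.
Qed.

End IntegralSum.

(** * Uniform bounds for integrals of the majorant *)

Section KernelIntegrals.
Variable R : realType.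
Local Notation leb4 := (@leb4 R).
Implicit Types (w v : C2 R) (z : C3 R).
Local Open Scope ereal_scope.

Lemma measurable_normC2_powR v (t : R) :
  measurable_fun setT (fun w => (normC2 (w - v)%R `^ t)%:E).
Proof.
apply/measurable_EFinP; apply: (measurableT_comp (measurable_powR t)).
by apply: measurable_normC2_fun; apply: measurable_funB_C2 => //; exact: measurable_cst.
Qed.

(** The domain lies in the balls of twice the radius about v and -v, so each of the three
    singularities is bounded by a constant independent of [v] and [D]. *)
Lemma singular_bound (radius s t : R) : (0 < radius)%R -> (0 < s < 4)%R -> (0 < t < 4)%R ->
  exists2 C : R, (0 <= C)%R & forall v (D : set (C2 R)) (f : C2 R -> R) (c : R),
    (normC2 v <= radius)%R -> measurable D -> (forall w, D w -> (normC2 w <= radius)%R) -> (0 <= c)%R ->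
    (forall w, D w -> (0 <= f w <=
       c * (normC2 (w - v) `^ (- s) + normC2 (w + v) `^ (- s) + normC2 w `^ (- t)))%R) ->
    \int[leb4]_(w in D) (f w)%:E <= (c * C)%:E.
Proof.
move=> r0 hs ht; have r2 : (0 < 2 * radius)%R by rewrite mulr_gt0.
have [C1 C10 h1] := singular_integral hs r2.
have [C2 C20 h2] := singular_integral ht r0.
exists (C1 + C1 + C2)%R; first by rewrite !addr_ge0.
move=> v D f c vr mD Dr c0 hf.
pose p1 w := (normC2 (w - v)%R `^ (- s))%:E.
pose p2 w := (normC2 (w - - v)%R `^ (- s))%:E.
pose p3 w := (normC2 (w - 0)%R `^ (- t))%:E.
have m1 : measurable_fun D p1 by apply: measurable_funTS; exact: measurable_normC2_powR.
have m2 : measurable_fun D p2 by apply: measurable_funTS; exact: measurable_normC2_powR.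
have m3 : measurable_fun D p3 by apply: measurable_funTS; exact: measurable_normC2_powR.
have g1 w : D w -> 0 <= p1 w by rewrite lee_fin powR_ge0.
have g2 w : D w -> 0 <= p2 w by rewrite lee_fin powR_ge0.
have g3 w : D w -> 0 <= p3 w by rewrite lee_fin powR_ge0.
have i1 : \int[leb4]_(w in D) p1 w <= C1%:E.
  apply: h1 => w Dw; apply: le_trans (normC2_triangle _ _) _; rewrite wnN.
  by rewrite mulr_natl mulr2n lerD // Dr.
have i2 : \int[leb4]_(w in D) p2 w <= C1%:E.
  apply: h1 => w Dw; apply: le_trans (normC2_triangle _ _) _; rewrite !wnN.
  by rewrite mulr_natl mulr2n lerD // Dr.
have i3 : \int[leb4]_(w in D) p3 w <= C2%:E.
  by apply: h2 => w Dw; rewrite subr0 Dr.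
apply: (@le_trans _ _ (\int[leb4]_(w in D) (c%:E * (p1 w + p2 w + p3 w)))).
  apply: ge0_le_integralW => w Dw; first by rewrite lee_fin; case/andP: (hf _ Dw).
  by rewrite lee_fin opprK subr0; case/andP: (hf _ Dw).
clearbody p1 p2 p3.
exact: (integral_sum3_le mD c0 m1 m2 m3 g1 g2 g3 i1 i2 i3).
Qed.

Local Open Scope ring_scope.

Lemma measurable_normC2_le (radius : R) : measurable [set w : C2 R | (normC2 w <= radius)%R].
Proof.
have -> : [set w : C2 R | (normC2 w <= radius)%R] = [set w : C2 R | (normC2 w <= radius)%R = true].
  by apply/seteqP; split => z.
have m : measurable_fun setT (fun w : C2 R => (normC2 w <= radius)%R).
  by apply: measurable_fun_ler; [exact: measurable_normC2_fun|exact: measurable_cst].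
by rewrite -[X in measurable X]setTI; exact: (m measurableT [set true]).
Qed.

Lemma majorant_integral (radius : R) : (0 < radius)%R ->
  exists2 C : R, (0 <= C)%R & forall v, (normC2 v <= radius)%R ->
    (\int[leb4]_(w in [set w | (normC2 w <= radius)%R]) (majorant w (cover v))%:E <= C%:E)%E.
Proof.
move=> r0; have h3 : (0 < (3 : R) < 4)%R by lra.
have [C C0 h] := singular_bound r0 h3 h3.
exists (8 * radius * C)%R; first by rewrite !mulr_ge0 // ltW.
move=> v vr; apply: (h v _ _ (8 * radius)%R vr (measurable_normC2_le radius)) => //.
  by rewrite mulr_ge0 // ltW.
move=> w wr; rewrite majorant_ge0; apply: le_trans (majorant_le_near w v) _.
have k1 := powR_ge0 (normC2 (w - v)) (- 3); have k2 := powR_ge0 (normC2 (w + v)) (- 3).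
apply: ler_pM; rewrite ?mulr_ge0 ?normC2_ge0 ?addr_ge0 //; last by rewrite lerDl powR_ge0.
by rewrite ler_wpM2l.
Qed.

Lemma majorant_integral_diag (radius e : R) : (0 < radius)%R -> (0 < e)%R ->
  exists2 d : R, (0 < d)%R & forall v (D : set (C2 R)), (normC2 v <= radius)%R -> measurable D ->
    (forall w, D w -> (normC2 w <= radius)%R /\ (distC3 (cover w, cover v) < d)%R) ->
    (\int[leb4]_(w in D) (majorant w (cover v))%:E <= e%:E)%E.
Proof.
move=> r0 e0; have h7 : (0 < (7 / 2 : R) < 4)%R by lra.
have [C C0 h] := singular_bound r0 h7 h7.
(* Chosen so that 8 radius q C <= e, with C + 1 for C to avoid dividing by 0. With d = q^2 the gain
   d^(1/2) of [majorant_le_diag] is q; the distance returned is d^2/2 because that estimate asks for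
   2 |eta| < d^2. *)
pose q := (e / (8 * radius * (C + 1)))%R.
have C1 : (0 < C + 1)%R by lra.
have r8 : (0 < 8 * radius)%R by lra.
have q0 : (0 < q)%R by rewrite divr_gt0 // mulr_gt0.
pose d := (q ^+ 2)%R; have d0 : (0 < d)%R by rewrite exprn_gt0.
have dq : (d `^ 2^-1 = q)%R by rewrite powR12_sqrt ?ltW // sqrtr_sqr ger0_norm // ltW.
exists (d ^+ 2 / 2)%R; first by rewrite divr_gt0 // exprn_gt0.
move=> v D vr mD hD.
apply: (@le_trans _ _ (8 * radius * q * C)%:E).
  apply: (h v _ _ (8 * radius * q)%R vr mD) => [w /hD[]//||w].
    by rewrite ltW // mulr_gt0.
  move=> /hD[wr wd]; rewrite majorant_ge0.
  have wd' : (2 * distC3 (cover w, cover v) < d ^+ 2)%R by lra.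
  have := majorant_le_diag d0 wd'; rewrite dq => /le_trans; apply.
  have k1 := powR_ge0 (normC2 (w - v)) (- (7 / 2)); have k2 := powR_ge0 (normC2 (w + v)) (- (7 / 2)).
  have q0' := ltW q0.
  have x0 := normC2_ge0 w; apply: ler_pM.
  - by apply: mulr_ge0 => //; exact: mulr_ge0.
  - exact: addr_ge0.
  - by rewrite ler_wpM2r // ler_wpM2l.
  - by rewrite lerDl powR_ge0.
rewrite lee_fin /q.
have -> : (8 * radius * (e / (8 * radius * (C + 1))) * C = e * (C / (C + 1)))%R.
  by field; rewrite !gt_eqF.
by rewrite ler_piMr ?(ltW e0) // ler_pdivrMr // mul1r lerDl.
Qed.

Lemma powR_le_mono (x y t : R) : 0 <= x -> x <= y -> 0 <= t -> x `^ t <= y `^ t.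
Proof.
move=> x0 xy t0; apply: ge0_ler_powR => //; rewrite nnegrE //; exact: le_trans xy.
Qed.

Lemma powR_weight_near (x y b : R) : 0 < b -> 0 < y -> y <= 2 * x ->
  x `^ (- (2 * b)) <= 2 `^ (2 * b) * y `^ (- (2 * b)).
Proof.
move=> b0 y0 yx; have x0 : 0 < x by lra.
have b2 : 0 <= 2 * b by rewrite mulr_ge0 // ltW.
rewrite !powRN -[leRHS](invf_div (y `^ (2 * b))); apply: ler_pinv.
  by rewrite divr_gt0 // powR_gt0.
rewrite ler_pdivrMr ?powR_gt0 // -powRM ?(ltW x0) //.
by apply: powR_le_mono b2; [exact: ltW|rewrite mulrC].
Qed.

(** As 2 - 2b + t >= 0, the power x^(2-2b+t) is at most that of y; this leaves y^(t-2) <= r^(t-2)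
    and the singularity x^(-t), integrable once t < 4. *)
Lemma powR_weight_far (x y b t r : R) : 0 < x -> x <= y -> y <= r -> 2 <= t -> 2 * b - 2 <= t ->
  x ^+ 2 * (y ^+ 4)^-1 * x `^ (- (2 * b)) <= r `^ (t - 2) * y `^ (- (2 * b)) * x `^ (- t).
Proof.
move=> x0 xy yr t2 tb; have y0 : 0 < y by exact: lt_le_trans xy.
have xn : x != 0 by rewrite gt_eqF.
have yn : y != 0 by rewrite gt_eqF.
have e1 : x ^+ 2 * x `^ (- (2 * b)) = x `^ (2 - 2 * b + t) * x `^ (- t).
  rewrite -(powR_mulrn 2 (ltW x0)) -!powRD ?xn ?implybT //; congr (_ `^ _); ring.
have e2 : y `^ (2 - 2 * b + t) * (y ^+ 4)^-1 = y `^ (t - 2) * y `^ (- (2 * b)).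
  rewrite -(powR_mulrn 4 (ltW y0)) -powRN -!powRD ?yn ?implybT //; congr (_ `^ _); ring.
rewrite mulrAC e1 mulrAC ler_wpM2r ?powR_ge0 //.
apply: (@le_trans _ _ (y `^ (2 - 2 * b + t) * (y ^+ 4)^-1)).
  rewrite ler_wpM2r ?invr_ge0 ?exprn_ge0 ?(ltW y0) //.
  by apply: powR_le_mono => //; [exact: ltW|lra].
rewrite e2 ler_wpM2r ?powR_ge0 //; apply: powR_le_mono => //; [exact: ltW|lra].
Qed.

Lemma majorant_integral_weight (radius b : R) : (0 < radius)%R -> (0 < b < 3)%R ->
  exists2 C : R, (0 <= C)%R & forall v, (0 < normC2 v <= radius)%R ->
    (\int[leb4]_(w in [set w | (normC2 w <= radius)%R])
      (majorant w (cover v) * normC2 w `^ (- (2 * b)))%:E <= (C * normC2 v `^ (- (2 * b)))%:E)%E.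
Proof.
move=> r0 /andP[b0 b3]; have h3 : (0 < (3 : R) < 4)%R by lra.
(* The exponent is the maximum of 2 and 2b - 2; it is below 4 because b < 3. *)
have [t [t2 t4 tb]] : exists t : R, [/\ (2 <= t)%R, (t < 4)%R & (2 * b - 2 <= t)%R].
  by have [h|h] := leP (2 * b - 2)%R 2%R; [exists 2%R|exists (2 * b - 2)%R]; split; lra.
have ht : (0 < t < 4)%R by lra.
have [C C0 h] := singular_bound r0 h3 ht.
have r0' := ltW r0.
have := powR_ge0 2 (2 * b); have := powR_ge0 radius (t - 2).
set P := 2 `^ (2 * b); set Q := radius `^ (t - 2) => Q0 P0.
pose c := 8 * radius * P + 128 * Q.
have c1 : 0 <= 8 * radius * P by apply: mulr_ge0 P0; exact: mulr_ge0.
have c2 : 0 <= 128 * Q by exact: mulr_ge0.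
have c0 : 0 <= c by exact: addr_ge0.
exists (c * C)%R; first exact: mulr_ge0.
move=> v /andP[v0 vr]; have pv := powR_ge0 (normC2 v) (- (2 * b)).
rewrite (mulrAC c C); apply: (h v _ _ _ vr (measurable_normC2_le radius)) => //.
  exact: mulr_ge0.
move=> w /= wr.
have near := @powR_weight_near (normC2 w) (normC2 v) b b0 v0.
have far (w0 : 0 < normC2 w) (wv : normC2 w <= normC2 v) := powR_weight_far w0 wv vr t2 tb.
have kn := majorant_le_near w v; have kf := @majorant_le_far _ w v.
have k0 := majorant_ge0 w (cover v); have x0 := normC2_ge0 w; have px := powR_ge0 (normC2 w) (- (2 * b)).
have z0 : normC2 w = 0 -> normC2 w `^ (- (2 * b)) = 0.
  by move=> ->; rewrite powR0 // oppr_eq0 mulf_neq0 // gt_eqF.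
move: near far kn kf k0 px z0.
move: (powR_ge0 (normC2 (w - v)) (- 3)) (powR_ge0 (normC2 (w + v)) (- 3)) (powR_ge0 (normC2 w) (- t)) pv.
rewrite -/P -/Q; clearbody P Q.
move: (normC2 v `^ _) (normC2 w `^ (- (2 * b))) (normC2 (w - v) `^ _) (normC2 (w + v) `^ _) (normC2 w `^ (- t)) (majorant _ _).
move=> V X A B T K A0 B0 T0 V0 near far kn kf K0 X0 z0.
have AB0 : 0 <= A + B by exact: addr_ge0.
have S0 : 0 <= A + B + T by exact: addr_ge0.
apply/andP; split; first exact: mulr_ge0.
(* For |v| <= 2 |w| the weight is bounded by a constant times the weight at v, and the near bound
   suffices. Otherwise the kernel is O(|w|^2 / |v|^4), and [powR_weight_far] moves the weight onto
   v. *)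
have [yx|xy] := leP (normC2 v) (2 * normC2 w).
  apply: (@le_trans _ _ (8 * radius * (A + B + T) * (P * V))).
    apply: ler_pM (near yx) => //; apply: le_trans kn _.
    by apply: ler_pM; [exact: mulr_ge0|exact: AB0|rewrite ler_wpM2l|rewrite lerDl].
  rewrite (_ : 8 * radius * (A + B + T) * (P * V) = 8 * radius * P * (V * (A + B + T))); last by ring.
  by rewrite -[leRHS]mulrA ler_wpM2r ?mulr_ge0 // /c lerDl.
have [w0|wn0] := eqVneq (normC2 w) 0.
  by rewrite (z0 w0) mulr0; apply: mulr_ge0 S0; exact: mulr_ge0.
have w0 : 0 < normC2 w by rewrite lt_neqAle eq_sym wn0.
have wv : normC2 w <= normC2 v by lra.
apply: (@le_trans _ _ (128 * (normC2 w ^+ 2 * (normC2 v ^+ 4)^-1 * X))).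
  have -> : 128 * (normC2 w ^+ 2 * (normC2 v ^+ 4)^-1 * X) = 128 * normC2 w ^+ 2 * (normC2 v ^+ 4)^-1 * X.
    by rewrite !mulrA.
  by rewrite ler_wpM2r // kf.
apply: (@le_trans _ _ (128 * (Q * V * T))).
  by rewrite ler_wpM2l // far.
rewrite !mulrA; apply: ler_pM => //; first exact: mulr_ge0.
  by rewrite ler_wpM2r // /c lerDr.
by rewrite lerDr.
Qed.

End KernelIntegrals.

(** * The Schur test *)

Section SchurTest.
Context d (T : measurableType d) (R : realType) (mu : {sigma_finite_measure set T -> \bar R}).
Context (k : T -> T -> R) (x : T -> R) (p C0 C1 : R).
Local Notation b := ((p - 1)^-1).
Hypothesis p1 : 1 < p.
Hypothesis C00 : 0 <= C0.
Hypothesis C10 : 0 <= C1.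
Hypothesis mk : measurable_fun setT (fun u : T * T => k u.1 u.2).
Hypothesis mx : measurable_fun setT x.
Hypothesis k0 : forall w v, 0 <= k w v.
Hypothesis x0 : forall w, 0 <= x w.
Hypothesis k00 : forall w v, x w = 0 -> k w v = 0.
Hypothesis k_sym : forall w v, x v ^+ 2 * k w v = x w ^+ 2 * k v w.
Hypothesis k_int : forall v, (\int[mu]_w (k w v)%:E <= C0%:E)%E.
Hypothesis k_weight : forall v, 0 < x v ->
  (\int[mu]_w (k w v * x w `^ (- (2 * b)))%:E <= (C1 * x v `^ (- (2 * b)))%:E)%E.

Lemma poweR_le (a c : \bar R) (r : R) : 0 <= r -> (0 <= a)%E -> (a <= c)%E ->
  (a `^ r <= c `^ r)%E.
Proof.
move=> r0 a0 ac; apply: gt0_ler_poweR => //; rewrite in_itv /= leey andbT //.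
exact: le_trans ac.
Qed.

Lemma measurable_powR_fun d' (S : measurableType d') (f : S -> R) (t : R) :
  measurable_fun setT f -> measurable_fun setT (fun s => f s `^ t).
Proof. by move=> mf; exact: measurableT_comp (measurable_powR t) mf. Qed.

Let mkv v : measurable_fun setT (k^~ v).
Proof.
apply: (measurableT_comp mk (_ : measurable_fun setT (fun w => (w, v)))).
by apply: measurable_fun_pair => //; exact: measurable_cst.
Qed.

Section Pointwise.
Variables (F : T -> R) (v : T).
Hypothesis mF : measurable_fun setT F.
Hypothesis F0 : forall w, 0 <= F w.
Hypothesis xv : 0 < x v.

(** Hoelder's inequality with exponents p and q = p/(p-1) for the splitting of k F into F x^(2/p)
    k^(1/p) and x^(-2/p) k^(1/q): the q-th power of the second factor is k x^(-2b), the integrand of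
    [k_weight]. *)
Lemma schur_hoelder :
  ((\int[mu]_w (k w v * F w)%:E) `^ p * (x v ^+ 4)%:E <=
   (C1 `^ (p - 1))%:E * \int[mu]_w (F w `^ p * x w ^+ 2 * k w v * x v ^+ 2)%:E)%E.
Proof.
have p0 : 0 < p by exact: lt_trans ltr01 p1.
have pm : 0 < p - 1 by rewrite subr_gt0.
have b0 : 0 < b by rewrite invr_gt0.
have pn : p != 0 by rewrite gt_eqF.
have pn1 : p - 1 != 0 by rewrite gt_eqF.
pose q := p * b.
have q0 : 0 < q by exact: mulr_gt0.
have pq : p^-1 + q^-1 = 1 by rewrite /q; field; rewrite ?pn ?pn1.
pose f w := F w * x w `^ (2 / p) * k w v `^ p^-1.
pose g w := x w `^ (- (2 / p)) * k w v `^ q^-1.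
have mf : measurable_fun setT f.
  by apply: measurable_funM; [apply: measurable_funM mF _|]; exact: measurable_powR_fun.
have mg : measurable_fun setT g.
  by apply: measurable_funM; exact: measurable_powR_fun.
have fg w : f w * g w = k w v * F w.
  (* Where x vanishes the powers of x do not cancel, but there the kernel is 0 by [k00]. *)
  rewrite /f /g; have [xw|xw] := eqVneq (x w) 0.
    by rewrite (k00 _ xw) powR0 ?mulr0 ?mul0r // invr_eq0.
  have e1 : x w `^ (2 / p) * x w `^ (- (2 / p)) = 1.
    by rewrite powRN divff // gt_eqF // powR_gt0 // lt_neqAle eq_sym xw x0.
  have e2 : k w v `^ p^-1 * k w v `^ q^-1 = k w v.
    by rewrite -powRD ?pq ?oner_eq0 // powRr1.
  by rewrite mulrACA -[F w * _ * _]mulrA e1 mulr1 e2 mulrC.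
have fp w : `|f w| `^ p = F w `^ p * x w ^+ 2 * k w v.
  rewrite ger0_norm ?mulr_ge0 ?powR_ge0 // /f powRM ?mulr_ge0 ?powR_ge0 //.
  rewrite powRM ?powR_ge0 // -!powRrM divfK // mulVf // powRr1 //.
  by rewrite (powR_mulrn 2).
have gq w : `|g w| `^ q = k w v * x w `^ (- (2 * b)).
  rewrite ger0_norm ?mulr_ge0 ?powR_ge0 // /g powRM ?powR_ge0 //.
  rewrite -!powRrM mulVf ?gt_eqF // powRr1 // mulrC; congr (_ * _ `^ _).
  by rewrite /q mulNr; congr (- _); field; rewrite ?pn ?pn1.
have := hoelder mu mf mg p0 q0 pq; rewrite Lnorm1.
have -> : (\int[mu]_w `|(EFin \o (f \* g)%R) w| = \int[mu]_w (k w v * F w)%:E)%E.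
  by apply: eq_integral => w _ /=; rewrite fg ger0_norm // mulr_ge0.
rewrite unlock.
have -> : (\int[mu]_w `|(EFin \o f) w| `^ p = \int[mu]_w (F w `^ p * x w ^+ 2 * k w v)%:E)%E.
  by apply: eq_integral => w _; rewrite -fp.
have -> : (\int[mu]_w `|(EFin \o g) w| `^ q = \int[mu]_w (k w v * x w `^ (- (2 * b)))%:E)%E.
  by apply: eq_integral => w _; rewrite -gq.
have mH : measurable_fun setT (fun w => (F w `^ p * x w ^+ 2 * k w v)%:E).
  apply/measurable_EFinP; apply: measurable_funM => //; apply: measurable_funM.
    exact: measurable_powR_fun.
  exact: measurable_funX.
have H0 w : [set: T] w -> (0 <= (F w `^ p * x w ^+ 2 * k w v)%:E)%E.
  by move=> _; rewrite lee_fin !mulr_ge0 ?powR_ge0 ?sqr_ge0.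
have -> : (\int[mu]_w (F w `^ p * x w ^+ 2 * k w v * x v ^+ 2)%:E =
    (x v ^+ 2)%:E * \int[mu]_w (F w `^ p * x w ^+ 2 * k w v)%:E)%E.
  rewrite -ge0_integralZl ?lee_fin ?sqr_ge0 //.
  by apply: eq_integral => w _; rewrite -EFinM mulrC.
have G0 : (0 <= \int[mu]_w (k w v * F w)%:E)%E.
  by apply: integral_ge0 => w _; rewrite lee_fin mulr_ge0.
have A0 : (0 <= \int[mu]_w (k w v * x w `^ (- (2 * b)))%:E)%E.
  by apply: integral_ge0 => w _; rewrite lee_fin mulr_ge0 ?powR_ge0.
have HH0 : (0 <= \int[mu]_w (F w `^ p * x w ^+ 2 * k w v)%:E)%E by exact: integral_ge0.
move: (k_weight xv) G0 A0 HH0.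
move: (\int[mu]_w _)%E (\int[mu]_w _)%E (\int[mu]_w _)%E => H G A hA G0 A0 HH0 hG.
set a := C1 * x v `^ (- (2 * b)) in hA.
have a0 : 0 <= a by rewrite mulr_ge0 // powR_ge0.
(* As b (p - 1) = 1, the power x(v)^(-2b) contributes x(v)^(-2), which lowers the weight x(v)^4 to
   x(v)^2. *)
have ea : (a `^ q^-1) `^ p * x v ^+ 4 = C1 `^ (p - 1) * x v ^+ 2.
  rewrite -powRrM (_ : q^-1 * p = p - 1); last by rewrite /q; field; rewrite ?pn ?pn1.
  rewrite /a powRM ?powR_ge0 // -powRrM -mulrA; congr (_ * _).
  rewrite (_ : - (2 * b) * (p - 1) = - 2%:R); last by field; rewrite ?pn1.
  rewrite powRN (powR_mulrn 2 (ltW xv)) (_ : x v ^+ 4 = x v ^+ 2 * x v ^+ 2) ?mulKf //.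
    by rewrite expf_neq0 // gt_eqF.
  by rewrite -exprD.
apply: (@le_trans _ _ ((H `^ p^-1 * (a `^ q^-1)%:E) `^ p * (x v ^+ 4)%:E)%E).
  apply: lee_wpmul2r; first by rewrite lee_fin exprn_ge0.
  apply: poweR_le => //; first exact: ltW.
  apply: (le_trans hG); apply: lee_wpmul2l; first exact: poweR_ge0.
  by rewrite -poweR_EFin; apply: poweR_le => //; rewrite invr_ge0 ltW.
rewrite poweRM ?poweR_ge0 ?lee_fin ?powR_ge0 // -poweRrM mulVf // poweRe1 //.
by rewrite poweR_EFin -muleA -EFinM ea EFinM [leRHS]muleA [leRHS]muleC //.
Qed.

End Pointwise.

Lemma schur_test (F : T -> R) : measurable_fun setT F -> (forall w, 0 <= F w) ->
  (\int[mu]_v ((\int[mu]_w (k w v * F w)%:E) `^ p * (x v ^+ 4)%:E) <=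
   (C1 `^ (p - 1) * C0)%:E * \int[mu]_w (F w `^ p * x w ^+ 4)%:E)%E.
Proof.
move=> mF F0; pose h (u : T * T) : \bar R :=
  (F u.2 `^ p * x u.2 ^+ 2 * k u.2 u.1 * x u.1 ^+ 2)%:E.
have m1 : measurable_fun setT (fun u : T * T => u.1) by exact: measurable_fst.
have m2 : measurable_fun setT (fun u : T * T => u.2) by exact: measurable_snd.
have mh : measurable_fun setT h.
  apply/measurable_EFinP; apply: measurable_funM; last first.
    by apply: measurable_funX; exact: measurableT_comp mx m1.
  apply: measurable_funM; last first.
    exact: (measurableT_comp mk (measurable_fun_pair m2 m1)).
  apply: measurable_funM; last by apply: measurable_funX; exact: measurableT_comp mx m2.
  by apply: measurable_powR_fun; exact: measurableT_comp mF m2.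
have h0 u : (0 <= h u)%E by rewrite lee_fin !mulr_ge0 ?powR_ge0 ?sqr_ge0.
have C1p : (0 <= (C1 `^ (p - 1))%:E)%E by rewrite lee_fin powR_ge0.
apply: (@le_trans _ _ (\int[mu]_v ((C1 `^ (p - 1))%:E * \int[mu]_w h (v, w)))%E).
  apply: ge0_le_integralW => v _; first by rewrite mule_ge0 ?poweR_ge0 // lee_fin exprn_ge0.
  have [xv|xv] := eqVneq (x v) 0.
    by rewrite xv expr0n mule0 mule_ge0 //; apply: integral_ge0.
  by apply: schur_hoelder => //; rewrite lt_neqAle eq_sym xv x0.
rewrite ge0_integralZl //; last 2 first.
- exact: (measurable_fun_fubini_tonelli_F h mh h0).
- by move=> v _; apply: integral_ge0.
rewrite EFinM -muleA; apply: lee_wpmul2l => //.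
rewrite (fubini_tonelli h mh h0).
have mF4 : measurable_fun setT (fun w => (F w `^ p * x w ^+ 4)%:E).
  apply/measurable_EFinP; apply: measurable_funM; first exact: measurable_powR_fun.
  exact: measurable_funX.
rewrite -ge0_integralZl ?lee_fin //; last first.
  by move=> w _; rewrite lee_fin mulr_ge0 ?powR_ge0 ?exprn_ge0.
apply: ge0_le_integralW => w _; first by apply: integral_ge0.
have -> : (\int[mu]_v h (v, w) = (F w `^ p * x w ^+ 4)%:E * \int[mu]_v (k v w)%:E)%E.
  rewrite -ge0_integralZl ?lee_fin ?mulr_ge0 ?powR_ge0 ?exprn_ge0 //; last 2 first.
  - by apply/measurable_EFinP; exact: mkv.
  - by move=> v _; rewrite lee_fin.
  apply: eq_integral => v _; rewrite -EFinM /h /=; congr EFin.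
  (* The symmetry turns x(v)^2 k(w,v) into x(w)^2 k(v,w), so that integrating in v is covered by
     [k_int]. *)
  rewrite -mulrA (mulrC (k w v)) k_sym; ring.
rewrite muleC; apply: lee_wpmul2r => //.
by rewrite lee_fin mulr_ge0 ?powR_ge0 ?exprn_ge0.
Qed.

End SchurTest.

(** * Complex integrals and classes of forms *)

Section ComplexIntegral.
Context d (T : measurableType d) (R : realType) (mu : {measure set T -> \bar R}).
Local Notation C := (complex R).
Implicit Types f g : T -> C.

Definition cint f : C := ((\int[mu]_x complex.Re (f x)) +i* (\int[mu]_x complex.Im (f x)))%C.

Definition cintegrable f : Prop :=
  mu.-integrable setT (EFin \o (fun x => complex.Re (f x))) /\
  mu.-integrable setT (EFin \o (fun x => complex.Im (f x))).

Lemma Rintegral_le (h g : T -> R) : measurable_fun setT h -> (forall x, `|h x| <= g x) ->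
  (`| \int[mu]_x h x |%:E <= \int[mu]_x (g x)%:E)%E.
Proof.
move=> mh hg; have mh' : measurable_fun setT (EFin \o h) by exact/measurable_EFinP.
apply: (@le_trans _ _ `| \int[mu]_x (h x)%:E |%E).
  (* An infinite integral is sent to 0 by [fine], so the bound holds in that case too. *)
  by rewrite /Rintegral; case: (\int[mu]_x _)%E => //= *; rewrite normr0 ?leey.
apply: le_trans (le_abse_integral mu measurableT mh') _.
by apply: ge0_le_integralW => x _; rewrite ?abse_ge0 // lee_fin.
Qed.

Lemma cnorm_cint_le f (g : T -> R) : cmeas setT f -> (forall x, cnorm (f x) <= g x) ->
  ((cnorm (cint f))%:E <= 2%:E * \int[mu]_x (g x)%:E)%E.
Proof.
move=> [mr mi] fg.
have hr := Rintegral_le mr (fun x => le_trans (cnorm_Re (f x)) (fg x)).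
have hi := Rintegral_le mi (fun x => le_trans (cnorm_Im (f x)) (fg x)).
apply: (@le_trans _ _ (`| \int[mu]_x complex.Re (f x) |%:E + `| \int[mu]_x complex.Im (f x) |%:E)%E).
  by rewrite -EFinD lee_fin cnorm_ReIm.
by rewrite mule_natl mule2n; exact: leeD.
Qed.

Lemma cintegrable_le f (g : T -> R) : cmeas setT f -> (forall x, cnorm (f x) <= g x) ->
  (\int[mu]_x (g x)%:E < +oo)%E -> cintegrable f.
Proof.
move=> [mr mi] fg gi; split; apply/integrableP; split; try exact/measurable_EFinP.
  apply: le_lt_trans gi; apply: ge0_le_integralW => x _; rewrite ?abse_ge0 // lee_fin.
  exact: le_trans (cnorm_Re _) (fg x).
apply: le_lt_trans gi; apply: ge0_le_integralW => x _; rewrite ?abse_ge0 // lee_fin.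
exact: le_trans (cnorm_Im _) (fg x).
Qed.

Lemma cint_linear (a : C) f g : cintegrable f -> cintegrable g ->
  cint (fun x => a * f x + g x) = a * cint f + cint g.
Proof.
move=> [fr fi] [gr gi]; case: a => a1 a2.
have Z (c : R) (h : T -> R) : mu.-integrable setT (EFin \o h) ->
    mu.-integrable setT (EFin \o (fun x => c * h x)).
  by move=> hi; exact: (integrableZl measurableT c hi).
have D (h1 h2 : T -> R) : mu.-integrable setT (EFin \o h1) -> mu.-integrable setT (EFin \o h2) ->
    mu.-integrable setT (EFin \o (fun x => h1 x + h2 x)).
  by move=> i1 i2; exact: (integrableD measurableT i1 i2).
have B (h1 h2 : T -> R) : mu.-integrable setT (EFin \o h1) -> mu.-integrable setT (EFin \o h2) ->
    mu.-integrable setT (EFin \o (fun x => h1 x - h2 x)).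
  by move=> i1 i2; exact: (integrableB measurableT i1 i2).
rewrite /cint; congr (_ +i* _)%C.
  rewrite (@eq_Rintegral _ _ _ _ _ (fun x => (a1 * complex.Re (f x) - a2 * complex.Im (f x)) + complex.Re (g x))).
    by rewrite RintegralD ?RintegralB ?RintegralZl //; try (by apply: Z); apply: B; apply: Z.
  by move=> x _ /=; case: (f x); case: (g x).
rewrite (@eq_Rintegral _ _ _ _ _ (fun x => (a1 * complex.Im (f x) + a2 * complex.Re (f x)) + complex.Im (g x))).
  by rewrite RintegralD ?RintegralD ?RintegralZl //; try (by apply: Z); apply: D; apply: Z.
by move=> x _ /=; case: (f x); case: (g x).
Qed.

Lemma cint_ae f g : cmeas setT f -> cmeas setT g ->
  {ae mu, forall x, f x = g x} -> cint f = cint g.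
Proof.
move=> [fr fi] [gr gi] fg; rewrite /cint /Rintegral; congr (fine _ +i* fine _)%C;
  apply: ae_eq_integral => //; try exact/measurable_EFinP;
  by apply: filterS fg => x /= ->.
Qed.

End ComplexIntegral.

Section ComplexIntegralMeasurable.
Context d1 d2 (S : measurableType d1) (T : measurableType d2) (R : realType).
Context (mu : {sigma_finite_measure set T -> \bar R}).

(** Tonelli for the positive and negative parts. No integrability is involved: the extended integral
    is a difference of measurable functions, and [fine] is measurable. *)
Lemma measurable_Rintegral (h : S * T -> R) : measurable_fun setT h ->
  measurable_fun setT (fun s => \int[mu]_x h (s, x)).
Proof.
move=> mh; apply: (measurableT_comp (fine_measurable measurableT)).
have mh' : measurable_fun setT (EFin \o h) by exact/measurable_EFinP.
rewrite (_ : (fun s => _) = (fun s => fubini_F mu ((EFin \o h)^\+)%E s - fubini_F mu ((EFin \o h)^\-)%E s)%E).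
  apply: emeasurable_funB; apply: measurable_fun_fubini_tonelli_F => //.
  - exact: measurable_funepos.
  - exact: measurable_funeneg.
by apply/funext => s; rewrite integralE; congr (_ - _)%E; apply: eq_integral => x _; rewrite ?funeposE ?funenegE.
Qed.

Lemma cmeas_cint (f : S * T -> complex R) : cmeas setT f ->
  cmeas setT (fun s => cint mu (fun x => f (s, x))).
Proof. by move=> [mr mi]; split; [exact: (measurable_Rintegral mr)|exact: (measurable_Rintegral mi)]. Qed.

End ComplexIntegralMeasurable.

(** * Independence of the choice of coefficients *)

Section FormClasses.
Variable R : realType.
Local Notation C := (complex R).
Implicit Types (z : C3 R) (w : C2 R) (f g a : ext R 3).

(** [form_eq] tests forms on 3 by 3 matrices; a frame of two vectors is padded with a zero column,
    which stays tangent. *)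
Lemma restrict_form_extend (V : 'M[C]_(3, 2)) a b0 b1 :
  restrict_form (\matrix_(i < 3, k < 3) (if (k < 2)%N then V i (inord k) else 0) : 'M[C]_3)
    a (setb 3 [:: b0; b1; false]) = restrict_form V a (setb 2 [:: b0; b1]).
Proof.
set V' := \matrix_(_, _) _.
have E i j : (j < 2)%N -> V' i (inord j) = V i (inord j).
  by move=> j2; rewrite mxE inordK ?j2 // (leq_trans j2).
rewrite restrict_formE // [RHS]restrict_formE //; apply: eq_bigr => -[[t0 t1] t2] _.
congr (_ * _); clear a.
case: t0; case: t1; case: t2; case: b0; case: b1; rewrite /= ?E //; ring.
Qed.

Lemma form_eq_restrict z f g (V : 'M[C]_(3, 2)) : form_eq z f g -> tangent z V ->
  restrict_form V f = restrict_form V g.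
Proof.
move=> fg tV; pose V' : 'M[C]_3 := \matrix_(i < 3, k < 3) (if (k < 2)%N then V i (inord k) else 0).
have tV' : tangent z V'.
  move=> k; rewrite !mxE; case: ifP => _; first exact: tV.
  by rewrite !mulr0 subr0 addr0.
have {}fg := fg V' tV'.
apply/ffunP => J; have -> : J = setb 2 [:: ord0 \in J; inord 1 \in J].
  rewrite [LHS]setb_eta; congr setb.
  have -> : inord 1 = lift ord0 ord0 :> 'I_2 by apply: val_inj; rewrite /= inordK.
  by rewrite !enum_ordSl (size0nil (size_enum_ord 0)).
by rewrite -!restrict_form_extend -/V' fg.
Qed.

Lemma form_eq_norm z f g : form_eq z f g -> form_norm z f = form_norm z g.
Proof.
move=> fg; rewrite /form_norm; congr (reals.sup _); apply/seteqP; split => r [V [tV oV ->]];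
  exists V; split => //; congr (Num.sqrt _); apply: eq_bigr => J _;
  by rewrite (form_eq_restrict fg tV).
Qed.

Lemma std_frame_norm_le z f : cone z -> z <> 0 -> std_frame_norm z f <= form_norm z f.
Proof.
by move=> cz z0; apply: frame_norm_le; [exact: frame_tangent|exact: frame_orthonormal].
Qed.

(** The density sees the form only through its restriction to the columns of the Jacobian, and these
    are tangent to the cone. *)
Lemma dens_form_eq c f g w J : form_eq (cover w) f g -> dens c f w J = dens c g w J.
Proof.
move=> /form_eq_restrict /(_ (cover_jac_tangent w)) fg.
have e k : (k < 2)%N -> eval1 f (jcol w k) = eval1 g (jcol w k).
  case: k => [|[|//]] _.
    by rewrite /jcol -!restrict_form_first fg.
  by rewrite /jcol -!restrict_form_second fg.
by rewrite /dens !e // fg.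
Qed.

Lemma dens_w0 c f w J : w = 0 -> dens c f w J = 0.
Proof.
move=> ->; rewrite /dens /unitfactor.
have -> : w1 (0 : C2 R) = 0 by [].
by rewrite mul0r mulr0 mul0r mul0r.
Qed.

Lemma dens_0 c w J : dens c 0 w J = 0.
Proof.
have := dens_linear c (-1) 0 0 w J; rewrite scaler0 add0r mulN1r addNr; exact.
Qed.

(** On the diagonal the normalising inverse in s is 0, so s = 0; both terms of the kernel contain s
    as a factor. *)
Lemma kernel_coef_singular chi x k : enorm2 x = 0 -> kernel_coef chi x k = 0 :> C.
Proof.
move=> e0; rewrite /kernel_coef /kernel_rhs.
have -> : sform x = 0.
  by rewrite /sform -/(eta2 x) eta2E e0 mulr0 invr0 scale0r.
have w0l n (b : ext R n) : wedge 0 b = 0 by rewrite -(scale0r (0 : ext R n)) wedgeZl !scale0r.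
have w0r n (b : ext R n) : wedge b 0 = 0 by rewrite -(scale0r (0 : ext R n)) wedgeZr !scale0r.
by rewrite w0l scaler0 w0r subr0 w0r ffunE.
Qed.

End FormClasses.

(** * The operator on representatives *)

Section Operator.
Variable R : realType.
Local Notation C := (complex R).
Local Notation leb4 := (@leb4 R).
Implicit Types (z : C3 R) (w : C2 R) (phi psi : C3 R -> ext R 3).

Lemma card_setb3 b0 b1 b2 : #|setb 3 [:: b0; b1; b2]| = (b0 + b1 + b2)%N.
Proof. by rewrite cardE enum_setb size_map; case: b0; case: b1; case: b2. Qed.

(** For empty [J] only the (0,1)-part of the form enters, for a singleton only the (0,2)-part: the
    operator lowers the degree by exactly one. *)
Lemma dens_homogeneous c q (f : ext R 3) w (J : {set 'I_3}) : (0 < q <= 2)%N -> homogeneous q f ->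
  #|J| != q.-1 -> dens c f w J = 0.
Proof.
move=> hq hf; have -> : #|J| = ((ord0 \in J) + (inord 1 \in J) + (inord 2 \in J))%N.
  by rewrite -card_setb3 -setb3_eta.
rewrite /dens.
have top : q = 1%N -> restrict_form (cover_jac w) f finset.setT = 0.
  by move=> q1; rewrite restrict_form_top !hf ?mul0r ?addr0 // card_setb3 q1.
have first t : q = 2%N -> eval1 f t = 0.
  by move=> q2; rewrite /eval1 sum_iota3 /coef1 !hf ?mul0r ?addr0 // card_setb3 q2.
have q12 : q = 1%N \/ q = 2%N by move: hq; lia.
move: (ord0 \in J) (inord 1 \in J) (inord 2 \in J) => j0 j1 j2.
case: q12 => qE; rewrite qE /=; case: j0; case: j1; case: j2 => // _;
  by rewrite ?(top qE) ?(first _ qE) ?mul0r ?subr0 ?mulr0.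
Qed.

Lemma eq_dens (c c' : nat -> C) f w J : (forall k, (6 <= k < 12)%N -> c k = c' k) ->
  dens c f w J = dens c' f w J.
Proof.
move=> cc; rewrite /dens !cc //.
have s k : \sum_(j <- iota 0 3) c (6 + j)%N * conjc (jcol w k j) =
           \sum_(j <- iota 0 3) c' (6 + j)%N * conjc (jcol w k j).
  by rewrite !sum_iota3 !cc.
by rewrite !s.
Qed.

Lemma restrict_form_linear m (V : 'M[C]_(3, m)) (a : C) (f g : ext R 3) :
  restrict_form V (a *: f + g) = a *: restrict_form V f + restrict_form V g.
Proof.
rewrite /restrict_form /ext_subst scaler_sumr -big_split; apply: eq_bigr => I _ /=.
by rewrite ext_addE ext_scaleE scalerDl scalerA.
Qed.

Lemma form_eq_linear z (a : C) (f f' g g' : ext R 3) : form_eq z f f' -> form_eq z g g' ->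
  form_eq z (a *: f + g) (a *: f' + g').
Proof. by move=> h h' V tV; rewrite !restrict_form_linear h // h'. Qed.

Variables (eps : R) (chi : C3 R -> R).
Hypothesis eps0 : 0 < eps.
Hypothesis hchi : cutoff eps chi.
Local Notation A := (@Xball R (1 + eps)).
Local Notation B := (@Xball R 1).

Definition rep_density psi z J w : C := dens (fun k => ecoef chi k (cover w, z)) (psi (cover w)) w J.

(** The factor 1/2 accounts for the two sheets of the covering. *)
Definition koppelman_coef psi z J : C := 2^-1 * cint leb4 (rep_density psi z J).

Definition pulled_norm psi w : R := std_frame_norm (cover w) (psi (cover w)).

Definition potential psi z : \bar R := (\int[leb4]_w (majorant w z * pulled_norm psi w)%:E)%E.

(** A choice of measurable coefficients. Vanishing off X' lets all integrals run over the whole of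
    C^2; the origin is left out because forms live on the regular part. *)
Definition representative phi psi : Prop :=
  [/\ forall I, cmeas setT (fun z => psi z I),
      forall z, A z -> z <> 0 -> form_eq z (phi z) (psi z) &
      forall z, ~ A z -> psi z = 0].

Lemma representative_exists phi : measurable_form A phi -> exists psi, representative phi psi.
Proof.
move=> [psi [hp mp]]; have mA := measurable_Xball (1 + eps).
exists (fun z => if z \in A then psi z else 0); split.
- move=> I; have [mr mi] := mp I; split.
    rewrite (_ : (fun z => _) = (fun z => complex.Re (psi z I)) \_ A).
      exact/(measurable_restrictT _ mA).
    by apply/funext => z; rewrite patchE; case: ifP => // _; rewrite ffunE.
  rewrite (_ : (fun z => _) = (fun z => complex.Im (psi z I)) \_ A).
    exact/(measurable_restrictT _ mA).
  by apply/funext => z; rewrite patchE; case: ifP => // _; rewrite ffunE.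
- by move=> z Az z0; rewrite mem_set //; exact: hp.
- by move=> z Az; rewrite memNset.
Qed.

Lemma representative_linear (a : C) phi1 phi2 psi1 psi2 :
  representative phi1 psi1 -> representative phi2 psi2 ->
  representative (fun z => a *: phi1 z + phi2 z) (fun z => a *: psi1 z + psi2 z).
Proof.
move=> [m1 e1 n1] [m2 e2 n2]; split.
- move=> I; rewrite (_ : (fun z => _) = (fun z => a * psi1 z I + psi2 z I)); last first.
    by apply/funext => z; rewrite ext_addE ext_scaleE.
  by apply: cmeasD; [apply: cmeasM; [exact: cmeas_cst|exact: m1]|exact: m2].
- by move=> z Az z0; apply: form_eq_linear; [exact: e1|exact: e2].
- by move=> z Az; rewrite n1 // n2 // scaler0 addr0.
Qed.

Lemma Xball_normC3 (r : R) z : Xball r z -> normC3 z < r. Proof. by case. Qed.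

(** Off the diagonal this is the computation of dbar s. On the diagonal the kernel coefficient
    vanishes, and so does [ecoef], since its bound degenerates to 0 there. *)
Lemma kernel_coef_ecoef z w k : B z -> A (cover w) -> (6 <= k < 12)%N ->
  kernel_coef chi (cover w, z) k = ecoef chi k (cover w, z).
Proof.
move=> /Xball_normC3 Bz /Xball_normC3 Aw hk; have [e0|] := eqVneq (enorm2 (cover w, z)) 0; last first.
  exact: kernel_coefE.
rewrite kernel_coef_singular //; have [M M0 hM] := ecoef_bound hchi eps0.
have := hM k (cover w, z) Aw Bz; move/eqP: e0; rewrite -distC3_eq0 => /eqP ->.
rewrite expr0n /= invr0 !mulr0 => h; apply/esym/eqP; rewrite -cnorm_eq0.
by rewrite eq_le h cnorm_ge0.
Qed.

Lemma density_rep_density phi psi z J w : representative phi psi -> B z -> A (cover w) ->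
  density chi phi z J w = rep_density psi z J w.
Proof.
move=> [_ hp _] Bz Aw; rewrite density_dens /rep_density.
have [->|/eqP w0] := eqVneq w 0; first by rewrite !dens_w0.
rewrite (eq_dens (c' := fun k => ecoef chi k (cover w, z))); last first.
  by move=> k; exact: kernel_coef_ecoef.
apply: dens_form_eq; apply: hp => //; exact: cover_neq0.
Qed.

Lemma koppelmanE phi psi z J : representative phi psi -> B z ->
  koppelman eps chi phi z J = koppelman_coef psi z J.
Proof.
move=> rp Bz; have [_ _ np] := rp; rewrite ffunE /form_integral /koppelman_coef /cint; congr (_ * (_ +i* _)%C);
  rewrite Rintegral_mkcond; apply: eq_Rintegral => w _; rewrite patchE; case: ifPn => [|/negP].
- by move=> /set_mem Aw; rewrite -(density_rep_density J rp Bz Aw).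
- by move=> Aw; rewrite /rep_density np ?dens_0 // => /mem_set.
- by move=> /set_mem Aw; rewrite -(density_rep_density J rp Bz Aw).
- by move=> Aw; rewrite /rep_density np ?dens_0 // => /mem_set.
Qed.

Lemma koppelman_homogeneous phi q z : (0 < q <= 2)%N ->
  (forall z, A z -> z <> 0 -> homogeneous q (phi z)) -> homogeneous q.-1 (koppelman eps chi phi z).
Proof.
move=> hq hom J hJ; rewrite ffunE /form_integral.
have h w : A (cover w) -> pulled_density (integrand chi phi z J) w = 0.
  move=> Aw; rewrite -/(density chi phi z J w) density_dens.
  have [->|/eqP w0] := eqVneq w 0; first by rewrite dens_w0.
  by rewrite (dens_homogeneous _ _ hq _ hJ) //; apply: hom => //; exact: cover_neq0.
have i0 (f : C2 R -> R) : (forall w, A (cover w) -> f w = 0) ->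
    (\int[leb4]_(w in Defs.cover (R:=R) @^-1` A) f w = 0)%R.
  by move=> f0; rewrite /Rintegral integral0_eq // => w Aw; rewrite f0.
rewrite (i0 _ (fun w Aw => congr1 (@complex.Re R) (h w Aw))).
by rewrite (i0 _ (fun w Aw => congr1 (@complex.Im R) (h w Aw))) [LHS]mulr0.
Qed.

Section Bounds.
Variable psi : C3 R -> ext R 3.
Hypothesis mpsi : forall I, cmeas setT (fun z => psi z I).

Lemma measurable_pulled_norm : measurable_fun setT (pulled_norm psi).
Proof.
apply: measurable_std_frame_norm; first exact: Defs.measurable_cover.
by move=> I; have [mr mi] := mpsi I; split;
  [exact: measurableT_comp mr (@Defs.measurable_cover R)|
   exact: measurableT_comp mi (@Defs.measurable_cover R)].
Qed.

Lemma pulled_norm_ge0 w : 0 <= pulled_norm psi w. Proof. exact: std_frame_norm_ge0. Qed.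

Lemma cmeas_rep_density_pair J : cmeas setT (fun u : C3 R * C2 R => rep_density psi u.1 J u.2).
Proof.
have m1 : measurable_fun setT (fun u : C3 R * C2 R => u.1) by exact: measurable_fst.
have m2 : measurable_fun setT (fun u : C3 R * C2 R => u.2) by exact: measurable_snd.
have mc := measurableT_comp (@Defs.measurable_cover R) m2.
apply: cmeas_dens => //.
  by move=> k; exact: (cmeas_ecoef mc m1 k hchi).
by move=> I; have [mr mi] := mpsi I; split; [exact: measurableT_comp mr mc|exact: measurableT_comp mi mc].
Qed.

Lemma cmeas_rep_density z J : cmeas setT (rep_density psi z J).
Proof.
have m : measurable_fun setT (fun w : C2 R => (z, w)).
  by apply: measurable_fun_pair => //; exact: measurable_cst.
by have [mr mi] := cmeas_rep_density_pair J; split; [exact: measurableT_comp mr m|exact: measurableT_comp mi m].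
Qed.

Lemma cmeas_koppelman_coef J : cmeas setT (fun z => koppelman_coef psi z J).
Proof.
apply: cmeasM; first exact: cmeas_cst.
exact: (cmeas_cint leb4 (cmeas_rep_density_pair J)).
Qed.

Lemma measurable_majorant_pair : measurable_fun setT (fun u : C3 R * C2 R => majorant u.2 u.1).
Proof.
have m1 : measurable_fun setT (fun u : C3 R * C2 R => u.1) by exact: measurable_fst.
have m2 : measurable_fun setT (fun u : C3 R * C2 R => u.2) by exact: measurable_snd.
have mc := measurableT_comp (@Defs.measurable_cover R) m2.
apply: measurable_funM; first apply: measurable_funM.
- by apply: measurable_funX; exact: measurable_normC2_fun.
- by apply: measurable_funD; exact: measurable_normC3.
apply: measurable_ge0_inv => [t|]; first by rewrite exprn_ge0 // distC3_ge0.
by apply: measurable_funX; exact: measurable_distC3.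
Qed.

Lemma measurable_potential_pair : measurable_fun setT
  (fun u : C3 R * C2 R => (majorant u.2 u.1 * pulled_norm psi u.2)%:E).
Proof.
apply/measurable_EFinP; apply: measurable_funM; first exact: measurable_majorant_pair.
exact: measurableT_comp measurable_pulled_norm measurable_snd.
Qed.

Lemma measurable_potential : measurable_fun setT (potential psi).
Proof.
apply: (measurable_fun_fubini_tonelli_F _ measurable_potential_pair) => u.
by rewrite lee_fin mulr_ge0 ?majorant_ge0 ?pulled_norm_ge0.
Qed.

Lemma measurable_potential_integrand z : measurable_fun setT (fun w => (majorant w z * pulled_norm psi w)%:E).
Proof.
have m : measurable_fun setT (fun w : C2 R => (z, w)).
  by apply: measurable_fun_pair => //; exact: measurable_cst.
exact: measurableT_comp measurable_potential_pair m.
Qed.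

Lemma potential_ge0 z : (0 <= potential psi z)%E.
Proof. by apply: integral_ge0 => w _; rewrite lee_fin mulr_ge0 ?majorant_ge0 ?pulled_norm_ge0. Qed.

End Bounds.

Lemma rep_density_bound : exists2 c : R, 0 < c & forall psi z J w,
  (forall z, ~ A z -> psi z = 0) -> B z ->
  cnorm (rep_density psi z J w) <= c * (majorant w z * pulled_norm psi w).
Proof.
have [M M0 hM] := ecoef_bound hchi eps0.
have K0 : 0 <= 1152 * M by exact: mulr_ge0 (ler0n R 1152) M0.
(* The summand 1 makes the constant positive even if M = 0. *)
exists (1152 * M + 1); first exact: ltr_wpDl K0 ltr01.
move=> psi z J w np Bz.
have k0 : 0 <= majorant w z * pulled_norm psi w by exact: mulr_ge0 (majorant_ge0 _ _) (pulled_norm_ge0 _ _).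
have rhs0 : 0 <= (1152 * M + 1) * (majorant w z * pulled_norm psi w).
  by apply: mulr_ge0 k0; exact: addr_ge0 K0 ler01.
have [Aw|Aw] := pselect (A (cover w)); last by rewrite /rep_density np // dens_0 cnorm0.
have [w0|/eqP w0] := eqVneq w 0; first by rewrite /rep_density dens_w0 // cnorm0.
pose b := M * ((normC3 (cover w) + normC3 z) * (distC3 (cover w, z) ^+ 3)^-1).
have hb k : (6 <= k < 12)%N -> cnorm (ecoef chi k (cover w, z)) <= b.
  by move=> _; apply: (hM k (cover w, z)) => /=; exact: Xball_normC3.
apply: le_trans (dens_bound (psi (cover w)) J w0 hb) _.
have -> : 1152 * (normC2 w ^+ 2 * b * std_frame_norm (cover w) (psi (cover w))) =
  1152 * M * (majorant w z * pulled_norm psi w).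
  rewrite /b /majorant /pulled_norm; move: (std_frame_norm _ _) (_^-1) => F u.
  move: (1152 : R) (normC2 w ^+ 2) (normC3 _ + normC3 _) => l p q; ring.
by rewrite [leRHS]mulrDl mul1r lerDl.
Qed.

Lemma potential_integrable psi z J : representative psi psi -> B z -> (potential psi z < +oo)%E ->
  cintegrable leb4 (rep_density psi z J).
Proof.
move=> [mp _ np] Bz pf; have [c c0 hc] := rep_density_bound.
apply: (cintegrable_le (cmeas_rep_density mp z J) (fun w => hc psi z J w np Bz)).
under eq_integral do rewrite EFinM.
rewrite ge0_integralZl ?lte_mul_pinfty ?lee_fin ?(ltW c0) //.
  exact: measurable_potential_integrand.
by move=> w _; rewrite lee_fin mulr_ge0 ?majorant_ge0 ?pulled_norm_ge0.
Qed.

Lemma koppelman_coef_linear (a : C) psi1 psi2 z J : representative psi1 psi1 -> representative psi2 psi2 ->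
  B z -> (potential psi1 z < +oo)%E -> (potential psi2 z < +oo)%E ->
  koppelman_coef (fun z => a *: psi1 z + psi2 z) z J = a * koppelman_coef psi1 z J + koppelman_coef psi2 z J.
Proof.
move=> r1 r2 Bz f1 f2; rewrite /koppelman_coef mulrCA -mulrDr; congr (_ * _).
rewrite -(cint_linear a (potential_integrable J r1 Bz f1) (potential_integrable J r2 Bz f2)).
by congr (cint _ _); apply/funext => w; rewrite /rep_density dens_linear.
Qed.

(** The factor 2 of [cnorm_cint_le], from real and imaginary parts, cancels the 1/2 of the
    two-sheeted covering. *)
Lemma koppelman_coef_bound : exists2 c : R, 0 < c & forall psi z J,
  representative psi psi -> B z -> ((cnorm (koppelman_coef psi z J))%:E <= c%:E * potential psi z)%E.
Proof.
have [c c0 hc] := rep_density_bound; exists c => // psi z J [mp _ np] Bz.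
have := cnorm_cint_le leb4 (cmeas_rep_density mp z J) (fun w => hc psi z J w np Bz).
under eq_integral do rewrite EFinM.
rewrite ge0_integralZl ?lee_fin ?(ltW c0) //; last 2 first.
- exact: measurable_potential_integrand.
- by move=> w _; rewrite lee_fin mulr_ge0 ?majorant_ge0 ?pulled_norm_ge0.
rewrite -/(potential psi z) => h.
have -> : cnorm (koppelman_coef psi z J) = 2^-1 * cnorm (cint leb4 (rep_density psi z J)).
  rewrite /koppelman_coef cnormM; congr (_ * _).
  have -> : (2^-1 : C) = (2^-1 : R)%:C%C by rewrite fmorphV rmorph_nat.
  by rewrite cnorm_real ger0_norm.
rewrite EFinM; apply: le_trans (lee_wpmul2l _ h) _; first by rewrite lee_fin.
by rewrite muleA -EFinM mulVf // mul1e.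
Qed.

(** 96 = 12 x 8: the norm is at most 12 times the sum of the moduli of the eight coefficients. If
    the potential is infinite there is nothing to bound. *)
Lemma koppelman_form_norm : exists2 c : R, 0 < c & forall phi psi z,
  representative phi psi -> B z ->
  ((form_norm z (koppelman eps chi phi z))%:E <= c%:E * potential psi z)%E.
Proof.
have [c c0 hc] := koppelman_coef_bound; exists (96 * c); first by rewrite mulr_gt0.
move=> phi psi z rp Bz; have [mp _ np] := rp.
have rr : representative psi psi by split.
apply: (@le_trans _ _ (12 * total (koppelman eps chi phi z))%:E); first by rewrite lee_fin form_norm_le.
have p0 := potential_ge0 psi z; have hJ J := hc psi z J rr Bz.
case: (potential psi z) p0 hJ => [r| |] //; last first.
  by move=> _ _; rewrite gt0_muley ?leey // lte_fin mulr_gt0.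
rewrite lee_fin => r0 hJ; rewrite -EFinM lee_fin.
have {}hJ J : cnorm (koppelman eps chi phi z J) <= c * r.
  by rewrite (koppelmanE J rp Bz); have := hJ J; rewrite -EFinM lee_fin.
have -> : 96 * c * r = 12 * (8 * (c * r)) by ring.
rewrite ler_wpM2l // /total sum_set3 sum_bool3.
have -> : 8 * (c * r) = c * r + c * r + c * r + c * r + c * r + c * r + c * r + c * r by ring.
by do 7 (apply: lerD; last exact: hJ); exact: hJ.
Qed.

(** A null set of the cone pulls back to a null set of C^2, off which the two densities agree. *)
Lemma koppelman_coef_ae phi1 phi2 psi1 psi2 z J : representative phi1 psi1 -> representative phi2 psi2 ->
  ae_form_eq A phi1 phi2 -> B z -> koppelman_coef psi1 z J = koppelman_coef psi2 z J.
Proof.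
move=> [m1 e1 n1] [m2 e2 n2] ae Bz; rewrite /koppelman_coef; congr (_ * _).
apply: cint_ae; [exact: cmeas_rep_density|exact: cmeas_rep_density|].
apply: negligibleS (vol_negligible_preimage ae) => w /= nw; apply: contra_not nw => hw.
rewrite /rep_density; have [->|/eqP w0] := eqVneq w 0; first by rewrite !dens_w0.
have [Aw|Aw] := pselect (A (cover w)); last by rewrite n1 // n2.
apply: dens_form_eq => V tV; have c0 := cover_neq0 w0.
by rewrite -(e1 _ Aw c0 V tV) -(e2 _ Aw c0 V tV) hw.
Qed.

End Operator.

(** * Potential estimates *)

Section PotentialEstimates.
Variable R : realType.
Local Notation leb4 := (@leb4 R).
Local Notation vol := (@vol R).
Implicit Types (z : C3 R) (w v : C2 R) (phi psi : C3 R -> ext R 3).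
Variable eps : R.
Hypothesis eps0 : 0 < eps.
Local Notation A := (@Xball R (1 + eps)).
Local Notation B := (@Xball R 1).

(** Over X' one has |w|^2 <= 2 |zeta| < 2 (1 + eps), which is at most the square of this number. *)
Definition radius : R := 2 * (1 + eps).

Lemma radius_gt0 : 0 < radius. Proof. by rewrite mulr_gt0 // addr_gt0. Qed.

Lemma Xball_rad w : A (cover w) -> normC2 w <= radius.
Proof.
move=> /Xball_normC3 Aw; have h := normC3_cover_ge w; have w0 := normC2_ge0 w.
have e1 : 1 <= 1 + eps by rewrite lerDl ltW.
rewrite -(@ler_pXn2r _ 2) ?nnegrE ?(ltW radius_gt0) //; apply: le_trans h _.
rewrite /radius; have := eps0; nra.
Qed.

Lemma Xball_sub z : B z -> A z.
Proof.
by move=> [bz cz]; split => //; apply: lt_trans bz _; rewrite ltrDl.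
Qed.

Definition wdisc : set (C2 R) := [set w | normC2 w <= radius].

Lemma measurable_wdisc : measurable wdisc. Proof. exact: measurable_normC2_le. Qed.

(** Cut off in both variables, so that the symmetry survives and the hypotheses of the Schur test
    hold on the whole of C^2. *)
Definition cut_majorant w v : R := majorant w (cover v) * \1_wdisc w * \1_wdisc v.

Lemma cut_majorant_ge0 w v : 0 <= cut_majorant w v.
Proof.
rewrite /cut_majorant !indicE; apply: mulr_ge0 (ler0n _ _); apply: mulr_ge0 (ler0n _ _).
exact: majorant_ge0.
Qed.

Lemma cut_majorant_sym w v : normC2 v ^+ 2 * cut_majorant w v = normC2 w ^+ 2 * cut_majorant v w.
Proof.
rewrite /cut_majorant mulrA [in RHS]mulrA [in LHS]mulrA majorant_sym; ring.
Qed.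

Lemma measurable_indic_wdisc d (T : measurableType d) (g : T -> C2 R) :
  measurable_fun setT g -> measurable_fun setT (fun t => \1_wdisc (g t) : R).
Proof.
move=> mg; have m : measurable_fun setT (\1_wdisc : C2 R -> R).
  by apply: measurable_indic; exact: measurable_wdisc.
exact: measurableT_comp m mg.
Qed.

Lemma measurable_cut_majorant : measurable_fun setT (fun u : C2 R * C2 R => cut_majorant u.1 u.2).
Proof.
have m1 : measurable_fun setT (fun u : C2 R * C2 R => u.1) by exact: measurable_fst.
have m2 : measurable_fun setT (fun u : C2 R * C2 R => u.2) by exact: measurable_snd.
apply: measurable_funM; last exact: measurable_indic_wdisc.
apply: measurable_funM; last exact: measurable_indic_wdisc.
have m := measurable_fun_pair (measurableT_comp (@Defs.measurable_cover R) m2) m1.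
exact: measurableT_comp (@measurable_majorant_pair R) m.
Qed.

Lemma integral_wdisc v (f : C2 R -> R) : wdisc v ->
  (\int[leb4]_w (cut_majorant w v * f w)%:E = \int[leb4]_(w in wdisc) (majorant w (cover v) * f w)%:E)%E.
Proof.
move=> hv; rewrite [RHS]integral_mkcond; apply: eq_integral => w _.
rewrite patchE /cut_majorant !indicE (mem_set hv) mulr1.
by case: ifP => _; rewrite ?mulr1 // mulr0 mul0r.
Qed.

Lemma cut_majorant_out v (f : C2 R -> R) : ~ wdisc v -> (\int[leb4]_w (cut_majorant w v * f w)%:E = 0)%E.
Proof.
move=> hv; apply: integral0_eq => w _.
by rewrite /cut_majorant [\1_wdisc v]indicE memNset // mulr0 mul0r.
Qed.

Lemma cut_majorant_integral : exists2 C : R, 0 <= C &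
  forall v, (\int[leb4]_w (cut_majorant w v)%:E <= C%:E)%E.
Proof.
have [C C0 h] := majorant_integral radius_gt0; exists C => // v.
under eq_integral do rewrite -[cut_majorant _ _]mulr1.
have [hv|hv] := pselect (wdisc v); last by rewrite (cut_majorant_out (fun=> 1)) // lee_fin.
rewrite (integral_wdisc (fun=> 1)) //; under eq_integral do rewrite mulr1.
exact: h.
Qed.

Lemma cut_majorant_weight (b : R) : 0 < b < 3 -> exists2 C : R, 0 <= C & forall v, 0 < normC2 v ->
  (\int[leb4]_w (cut_majorant w v * normC2 w `^ (- (2 * b)))%:E <= (C * normC2 v `^ (- (2 * b)))%:E)%E.
Proof.
move=> hb; have [C C0 h] := majorant_integral_weight radius_gt0 hb; exists C => // v v0.
have [hv|hv] := pselect (wdisc v); last by rewrite cut_majorant_out // lee_fin mulr_ge0 ?powR_ge0.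
by rewrite integral_wdisc //; apply: h; rewrite v0.
Qed.

Lemma cut_majorant_w0 w v : normC2 w = 0 -> cut_majorant w v = 0.
Proof. by move=> w0; rewrite /cut_majorant /majorant w0 expr0n /= !mul0r. Qed.

Lemma std_frame_norm_0 z : std_frame_norm z 0 = 0.
Proof.
have r0 : restrict_form (frame z) (0 : ext R 3) = 0.
  have := restrict_form_linear (frame z) (-1) 0 0.
  by rewrite scaler0 add0r scaleN1r addNr.
rewrite /std_frame_norm /frame_norm r0 big1 ?sqrtr0 // => J _.
by rewrite ffunE -cnorm_sqr cnorm0 expr0n.
Qed.

Lemma pulled_norm_out psi w : (forall z, ~ A z -> psi z = 0) -> ~ wdisc w -> pulled_norm psi w = 0.
Proof.
move=> np hw; rewrite /pulled_norm np => [|Aw]; last by apply: hw; exact: Xball_rad.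
exact: std_frame_norm_0.
Qed.

Lemma potential_cut_majorant psi v : (forall z, ~ A z -> psi z = 0) -> B (cover v) ->
  potential psi (cover v) = (\int[leb4]_w (cut_majorant w v * pulled_norm psi w)%:E)%E.
Proof.
move=> np /Xball_sub /Xball_rad hv; rewrite integral_wdisc // [RHS]integral_mkcond.
apply: eq_integral => w _; rewrite patchE; case: ifPn => // /negP hw.
by rewrite pulled_norm_out ?mulr0 // => /mem_set.
Qed.

Lemma potential_normC2_Lp (p : R) : 4 / 3 < p -> exists2 C : R, 0 <= C & forall psi,
  (forall I, cmeas setT (fun z => psi z I)) -> (forall z, ~ A z -> psi z = 0) ->
  (\int[leb4]_(v in Defs.cover (R:=R) @^-1` B) ((potential psi (cover v)) `^ p * (normC2 v ^+ 4)%:E)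
    <= C%:E * \int[leb4]_w (pulled_norm psi w `^ p * normC2 w ^+ 4)%:E)%E.
Proof.
move=> hp; have p1 : 1 < p by lra.
(* The condition p > 4/3 in the form b = 1/(p-1) < 3, as required by the weighted integral. *)
have hb : 0 < (p - 1)^-1 < 3.
  have p3 : 3^-1 < p - 1 by lra.
  have p0 : 0 < p - 1 by lra.
  by rewrite invr_gt0 p0 -[ltRHS]invrK ltf_pV2 ?posrE // invr_gt0.
have [C0 C00 h0] := cut_majorant_integral; have [C1 C10 h1] := cut_majorant_weight hb.
exists (C1 `^ (p - 1) * C0); first by rewrite mulr_ge0 ?powR_ge0.
move=> psi mp np.
have mwn : measurable_fun setT (@normC2 R) by exact: measurable_normC2_fun.
have := schur_test p1 C00 C10 measurable_cut_majorant mwn cut_majorant_ge0 (@normC2_ge0 R) cut_majorant_w0 cut_majorant_sym h0 h1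
  (measurable_pulled_norm mp) (pulled_norm_ge0 psi).
apply: le_trans; rewrite integral_mkcond; apply: ge0_le_integralW => v _.
  by rewrite patchE; case: ifP => // _; rewrite mule_ge0 ?poweR_ge0 // lee_fin exprn_ge0 // normC2_ge0.
rewrite patchE; case: ifP => [/set_mem Bv|_]; first by rewrite (potential_cut_majorant np Bv).
by rewrite mule_ge0 ?poweR_ge0 // lee_fin exprn_ge0 // normC2_ge0.
Qed.

Lemma gram_half_le w : 2^-1 * gram w <= 4 * normC2 w ^+ 4.
Proof. by have := gram_le w; lra. Qed.

Lemma gram_half_ge w : normC2 w ^+ 4 <= 2^-1 * gram w.
Proof. by have := gram_ge w; have : 0 <= normC2 w ^+ 4 by [rewrite exprn_ge0 // normC2_ge0]; lra. Qed.

Definition vol_power (D : set (C3 R)) (p : R) phi : \bar R :=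
  (\int[vol]_z (`| ((fun z => (form_norm z (phi z))%:E) \_ D) z | `^ p))%E.

(** The origin is removed, as the representative is unconstrained there, and the change of variables
    is applied to the norm in the explicit frame, which is measurable, before it is compared with
    [form_norm]. *)
Lemma pulled_norm_vol (p : R) phi psi : 0 < p -> representative eps phi psi ->
  (\int[leb4]_w (pulled_norm psi w `^ p * normC2 w ^+ 4)%:E <= vol_power A p phi)%E.
Proof.
move=> p0 [mp ep np]; pose N := ~` (@norm2 R @^-1` [set 0]).
have mN : measurable N.
  apply: measurableC; rewrite -[X in measurable X]setTI.
  by apply: measurable_norm2 => //; exact: measurable_set1.
pose g z : \bar R := (std_frame_norm z (psi z) `^ p * \1_N z)%:E.
have mg : measurable_fun setT g.
  apply/measurable_EFinP; apply: measurable_funM; last exact: measurable_indic.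
  apply: measurable_powR_fun; apply: measurable_std_frame_norm => //.
have g0 z : (0 <= g z)%E by rewrite lee_fin mulr_ge0 ?powR_ge0.
have N0 z : N z -> z <> 0.
  move=> Nz z0; apply: Nz; rewrite /= z0; have -> : norm2 (0 : C3 R) = 0 by rewrite norm2E /= !expr0n /= !addr0.
  by [].
apply: (@le_trans _ _ (\int[vol]_z g z)%E).
  rewrite ge0_integral_vol //; apply: ge0_le_integralW => w _.
    by rewrite lee_fin mulr_ge0 ?powR_ge0 ?exprn_ge0 ?normC2_ge0.
  rewrite /g -EFinM lee_fin; have [->|/eqP w0] := eqVneq w 0.
    have -> : normC2 (0 : C2 R) = 0 by rewrite /normC2 /w1 /w2 /cabs2 /= !expr0n /= !addr0 sqrtr0.
    by rewrite expr0n mulr0 !mulr_ge0 ?powR_ge0 ?gram_ge0.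
  rewrite indicE mem_set ?mulr1; last first.
    by move=> /= /norm2_eq0; exact: cover_neq0.
  by rewrite ler_wpM2l ?powR_ge0 // gram_half_ge.
apply: ge0_le_integralW => z _ //; rewrite /g indicE.
have [Nz|Nz] := pselect (N z); last by rewrite memNset // mulr0 poweR_ge0.
rewrite (mem_set Nz) mulr1 patchE; case: ifP => Az.
  have {}Az := set_mem Az; have z0 := N0 z Nz.
  rewrite -poweR_EFin; apply: poweR_le; rewrite ?(ltW p0) ?lee_fin ?std_frame_norm_ge0 //=.
  rewrite ger0_norm ?form_norm_ge0 // (form_eq_norm (ep z Az z0)).
  by apply: std_frame_norm_le => //; case: Az.
rewrite np => [|/mem_set]; last by rewrite Az.
rewrite std_frame_norm_0.
by rewrite powR0 ?gt_eqF // poweR_ge0.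
Qed.

Lemma potential_Lp (p : R) : 4 / 3 < p -> exists2 C : R, 0 <= C & forall phi psi,
  representative eps phi psi ->
  (\int[vol]_z (((fun z => potential psi z `^ p) \_ B) z) <= C%:E * vol_power A p phi)%E.
Proof.
move=> hp; have [C C0 h] := potential_normC2_Lp hp; have p0 : 0 < p by lra.
exists (4 * C); first by rewrite mulr_ge0.
move=> phi psi rp; have [mp _ np] := rp.
have mB := measurable_Xball (1 : R).
have mf : measurable_fun setT ((fun z => potential psi z `^ p) \_ B)%E.
  apply/(measurable_restrictT _ mB); apply: measurable_funTS.
  exact: measurableT_comp (measurable_poweR p) (measurable_potential mp).
rewrite ge0_integral_vol //; last by move=> z; rewrite patchE; case: ifP => // _; exact: poweR_ge0.
have mcB : measurable (Defs.cover (R:=R) @^-1` B).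
  by rewrite -[X in measurable X]setTI; exact: Defs.measurable_cover.
apply: (@le_trans _ _ (4%:E *
   \int[leb4]_(v in Defs.cover (R:=R) @^-1` B) ((potential psi (cover v)) `^ p * (normC2 v ^+ 4)%:E))%E).
  rewrite -ge0_integralZl ?lee_fin //; last 2 first.
  - apply: emeasurable_funM.
      apply: measurable_funTS; apply: measurableT_comp (measurable_poweR p) _.
      exact: measurableT_comp (measurable_potential mp) (@Defs.measurable_cover R).
    apply/measurable_EFinP; apply: measurable_funTS; apply: measurable_funX.
    exact: measurable_normC2_fun.
  - by move=> w _; rewrite mule_ge0 ?poweR_ge0 // lee_fin exprn_ge0 // normC2_ge0.
  rewrite [leRHS]integral_mkcond; apply: ge0_le_integralW => w _.
    rewrite mule_ge0 ?lee_fin ?mulr_ge0 ?invr_ge0 ?gram_ge0 ?ler0n // patchE.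
    by case: ifP => // _; exact: poweR_ge0.
  rewrite !patchE; have -> : (w \in Defs.cover (R:=R) @^-1` B) = (cover w \in B) by [].
  case: ifP => _; last by rewrite mul0e.
  rewrite muleCA; apply: lee_wpmul2l; first exact: poweR_ge0.
  by rewrite -EFinM lee_fin gram_half_le.
rewrite EFinM -muleA; apply: lee_wpmul2l; first by rewrite lee_fin.
apply: le_trans (h psi mp np) _; apply: lee_wpmul2l; first by rewrite lee_fin.
exact: pulled_norm_vol.
Qed.

Lemma Lp_norm_oo_ae phi (L : R) (D : set (C3 R)) : (Lp_norm D +oo%E phi <= L%:E)%E ->
  {ae vol, forall z, D z -> form_norm z (phi z) <= L}.
Proof.
rewrite /Lp_norm unlock; case: ifP => [_|/negbT v0 _].
  move=> /ess_sup_inf.ess_supP; apply: filterS => z /= hz Dz.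
  by move: hz; rewrite patchE mem_set //= lee_fin ger0_norm ?form_norm_ge0.
(* When the whole space is null the norm is 0 by definition and says nothing, but then every
   property holds almost everywhere. *)
have nT : vol.-negligible [set: C3 R].
  by exists setT; split => //; apply/eqP; rewrite eq_le measure_ge0 andbT leNgt.
exact: negligibleS nT.
Qed.

Lemma Lp_norm_oo_le phi (L : R) (D : set (C3 R)) : 0 <= L ->
  (forall z, D z -> form_norm z (phi z) <= L) -> (Lp_norm D +oo%E phi <= L%:E)%E.
Proof.
move=> L0 hD; rewrite /Lp_norm unlock; case: ifP => _; last by rewrite lee_fin.
apply/ess_sup_inf.ess_supP; apply: aeW => z /=; rewrite patchE; case: ifP => [/set_mem Dz|_].
  by rewrite /= lee_fin ger0_norm ?form_norm_ge0 // hD.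
by rewrite abse0 lee_fin.
Qed.

(** The bound by L on the pulled-back norm holds off a null set that does not depend on z, so the
    potential is bounded at every z and not only almost everywhere. *)
Lemma potential_Linfty : exists2 C : R, 0 <= C & forall phi psi L, representative eps phi psi ->
  0 <= L -> (Lp_norm A +oo%E phi <= L%:E)%E ->
  {ae leb4, forall w, pulled_norm psi w <= L} /\
  forall z, B z -> (potential psi z <= (C * L)%:E)%E.
Proof.
have [C C0 h] := cut_majorant_integral; exists C => // phi psi L [mp ep np] L0 /Lp_norm_oo_ae hL.
have wL : {ae leb4, forall w, w <> 0 -> pulled_norm psi w <= L}.
  apply: negligibleS (vol_negligible_preimage hL) => w /= nw; apply: contra_not nw => hw w0.
  have [Aw|Aw] := pselect (A (cover w)); last first.
    by rewrite /pulled_norm np // std_frame_norm_0.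
  have c0 := cover_neq0 w0; rewrite /pulled_norm; apply: le_trans (hw Aw).
  by rewrite (form_eq_norm (ep _ Aw c0)); apply: std_frame_norm_le => //; case: Aw.
have {}wL : {ae leb4, forall w, pulled_norm psi w <= L}.
  have n0 : leb4.-negligible [set (0 : C2 R)].
    by exists [set 0]; split => //; [exact: measurable_set1_C2|exact: leb4_set1].
  apply: negligibleS (negligibleU wL n0) => w /= nw.
  have [->|/eqP w0] := eqVneq w 0; [by right|left => /(_ w0)]; exact: nw.
split=> // z Bz; have [v vz] := cover_surj (Bz.2); rewrite -vz in Bz *.
rewrite (potential_cut_majorant np Bz).
have mk : measurable_fun setT (fun w => cut_majorant w v).
  have m : measurable_fun setT (fun w : C2 R => (w, v)).
    by apply: measurable_fun_pair => //; exact: measurable_cst.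
  exact: measurableT_comp measurable_cut_majorant m.
apply: (@le_trans _ _ (\int[leb4]_w (L%:E * (cut_majorant w v)%:E))%E).
  apply: ae_ge0_le_integral => //.
  - by move=> w _; rewrite lee_fin mulr_ge0 ?cut_majorant_ge0 ?pulled_norm_ge0.
  - by apply/measurable_EFinP; apply: measurable_funM => //; exact: measurable_pulled_norm.
  - by move=> w _; rewrite mule_ge0 ?lee_fin ?cut_majorant_ge0.
  - by apply: emeasurable_funM; [exact: measurable_cst|exact/measurable_EFinP].
  - apply: filterS wL => w /= hw _; rewrite -EFinM lee_fin [leRHS]mulrC.
    by rewrite ler_wpM2l ?cut_majorant_ge0.
rewrite ge0_integralZl ?lee_fin //; last 2 first.
- exact/measurable_EFinP.
- by move=> w _; rewrite lee_fin cut_majorant_ge0.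
by rewrite mulrC EFinM; apply: lee_wpmul2l; [rewrite lee_fin|exact: h].
Qed.

End PotentialEstimates.

(** * Boundedness on L^p *)

Section LpBoundedness.
Variable R : realType.
Local Notation C := (complex R).
Local Notation leb4 := (@leb4 R).
Local Notation vol := (@vol R).
Implicit Types (z : C3 R) (w v : C2 R) (phi psi : C3 R -> ext R 3).
Variables (eps : R) (chi : C3 R -> R).
Hypothesis eps0 : 0 < eps.
Hypothesis hchi : cutoff eps chi.
Local Notation A := (@Xball R (1 + eps)).
Local Notation B := (@Xball R 1).
Local Notation K := (koppelman eps chi).
Local Notation rep := (@representative R eps).

Lemma representative_self phi psi : rep phi psi -> rep psi psi.
Proof. by move=> [m _ n]; split. Qed.

Lemma koppelman_koppelman_coef phi psi z : rep phi psi -> B z -> K phi z = [ffun J => koppelman_coef chi psi z J].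
Proof. by move=> rp Bz; apply/ffunP => J; rewrite (koppelmanE eps0 hchi J rp Bz) ffunE. Qed.

Lemma koppelman_measurable phi psi : rep phi psi -> measurable_form B (K phi).
Proof.
move=> rp; have [mp _ np] := rp; exists (fun z => [ffun J => koppelman_coef chi psi z J]); split.
  by move=> z Bz _ V _; rewrite (koppelman_koppelman_coef rp Bz).
move=> J; rewrite (_ : (fun z => _) = (fun z => complex.Re (koppelman_coef chi psi z J))); last first.
  by apply/funext => z; rewrite ffunE.
rewrite (_ : (fun z => complex.Im _) = (fun z => complex.Im (koppelman_coef chi psi z J))); last first.
  by apply/funext => z; rewrite ffunE.
by have [mr mi] := cmeas_koppelman_coef hchi mp J; split; exact: measurable_funTS.
Qed.

Lemma koppelman_ae phi1 phi2 psi1 psi2 z : rep phi1 psi1 -> rep phi2 psi2 ->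
  ae_form_eq A phi1 phi2 -> B z -> K phi1 z = K phi2 z.
Proof.
move=> r1 r2 ae Bz; rewrite (koppelman_koppelman_coef r1 Bz) (koppelman_koppelman_coef r2 Bz).
by apply: eq_ffun => J; exact: (koppelman_coef_ae hchi J r1 r2 ae Bz).
Qed.

Lemma koppelman_linear (a : C) phi1 phi2 psi1 psi2 z : rep phi1 psi1 -> rep phi2 psi2 ->
  B z -> (potential psi1 z < +oo)%E -> (potential psi2 z < +oo)%E ->
  K (fun z => a *: phi1 z + phi2 z) z = a *: K phi1 z + K phi2 z.
Proof.
move=> r1 r2 Bz f1 f2.
have E (f g : {set 'I_3} -> C) J : (a *: [ffun J => f J] + [ffun J => g J] : ext R 3) J = a * f J + g J.
  by rewrite ext_addE ext_scaleE !ffunE.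
rewrite (koppelman_koppelman_coef (representative_linear a r1 r2) Bz) (koppelman_koppelman_coef r1 Bz).
rewrite (koppelman_koppelman_coef r2 Bz); apply/ffunP => J; rewrite [RHS]E [LHS]ffunE.
by apply: (koppelman_coef_linear eps0 hchi a J _ _ Bz f1 f2);
  [exact: representative_self r1|exact: representative_self r2].
Qed.

Lemma koppelman_integrable_potential phi psi z : rep phi psi -> B z -> (potential psi z < +oo)%E ->
  koppelman_integrable eps chi phi z.
Proof.
move=> rp Bz f J.
have mW : measurable (Defs.cover (R:=R) @^-1` A).
  rewrite -[X in measurable X]setTI; apply: Defs.measurable_cover => //.
  exact: measurable_Xball.
have [ir ii] := potential_integrable eps0 hchi J (representative_self rp) Bz f.
split; [move: ir|move: ii] => /(integrableS measurableT mW (@subsetT _ _));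
  apply: eq_integrable => // w /set_mem Aw /=;
  by rewrite -(density_rep_density eps0 hchi J rp Bz Aw).
Qed.

Lemma Lp_norm_vol_power D (p : R) phi : Lp_norm D p%:E phi = (vol_power D p phi `^ p^-1)%E.
Proof. by rewrite /Lp_norm unlock. Qed.

Lemma vol_power_lty (p : R) phi : 0 < p -> (Lp_norm A p%:E phi < +oo)%E ->
  (vol_power A p phi < +oo)%E.
Proof.
move=> p0; rewrite Lp_norm_vol_power => h.
rewrite ltey; apply: contraTneq h => ->.
by rewrite /= invr_eq0 gt_eqF.
Qed.

(** For finite p the p-th power of the potential is integrable, hence finite almost everywhere; for
    p = +oo the uniform bound makes it finite on all of X. This gives convergence of the integrals
    and linearity. *)
Lemma potential_ae_lty (p : \bar R) phi psi : ((4 / 3)%:E < p)%E -> rep phi psi ->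
  (Lp_norm A p phi < +oo)%E -> {ae vol, forall z, B z -> (potential psi z < +oo)%E}.
Proof.
case: p => [p| |] // hp rp; last first.
  move=> hn; apply: aeW => z Bz; have [C0 C00 h] := potential_Linfty eps0.
  have n0 : (0 <= Lp_norm A +oo phi)%E by rewrite Lnorm_ge0.
  have fn : Lp_norm A +oo phi \is a fin_num by rewrite ge0_fin_numE.
  have fL : (Lp_norm A +oo phi <= (fine (Lp_norm A +oo phi))%:E)%E by rewrite fineK.
  have [_ hz] := h phi psi _ rp (fine_ge0 n0) fL.
  exact: le_lt_trans (hz z Bz) (ltry _).
rewrite lte_fin in hp; have p0 : 0 < p by lra.
move=> /(vol_power_lty p0) hn; have [C0 C00 h] := potential_Lp eps0 hp.
have [mp _ np] := rp.
have mf : measurable_fun setT ((fun z => potential psi z `^ p) \_ B)%E.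
  apply/(measurable_restrictT _ (measurable_Xball (1 : R))); apply: measurable_funTS.
  exact: measurableT_comp (measurable_poweR p) (measurable_potential mp).
have fi : vol.-integrable setT ((fun z => potential psi z `^ p) \_ B)%E.
  apply/integrableP; split=> //; apply: le_lt_trans (_ : C0%:E * vol_power A p phi < +oo)%E.
    apply: le_trans (h phi psi rp); apply: ge0_le_integralW => z _; first exact: abse_ge0.
    by rewrite gee0_abs // patchE; case: ifP => // _; exact: poweR_ge0.
  by rewrite lte_mul_pinfty // lee_fin.
apply: filterS (integrable_ae measurableT fi) => z /= hz Bz; have := hz Logic.I.
rewrite patchE mem_set // => fz; rewrite ltey; apply: contraTneq fz => ->.
by rewrite /= gt_eqF.
Qed.

Lemma koppelman_Lp_bound (p : \bar R) : ((4 / 3)%:E < p)%E -> exists2 M : R, 0 <= M &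
  forall phi psi, rep phi psi -> (Lp_norm A p phi < +oo)%E ->
  (Lp_norm B p (K phi) <= M%:E * Lp_norm A p phi)%E.
Proof.
have [c c0 hc] := koppelman_form_norm eps0 hchi.
case: p => [p| |] // hp; last first.
  have [C0 C00 h] := potential_Linfty eps0; exists (c * C0); first by rewrite mulr_ge0 // ltW.
  move=> phi psi rp hn.
  have n0 : (0 <= Lp_norm A +oo phi)%E by rewrite Lnorm_ge0.
  have fn : Lp_norm A +oo phi \is a fin_num by rewrite ge0_fin_numE.
  have fL : (Lp_norm A +oo phi <= (fine (Lp_norm A +oo phi))%:E)%E by rewrite fineK.
  have [_ hz] := h phi psi _ rp (fine_ge0 n0) fL.
  rewrite -[X in (_ * X)%E](fineK fn); move: (fine _) (fine_ge0 n0) hz => L L0 hz.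
  rewrite -EFinM; apply: Lp_norm_oo_le => [|z Bz]; first by rewrite !mulr_ge0 // ltW.
  rewrite -lee_fin; apply: le_trans (hc phi psi z rp Bz) _.
  by rewrite -mulrA EFinM; apply: lee_wpmul2l; [rewrite lee_fin ltW|exact: hz].
rewrite lte_fin in hp; have p0 : 0 < p by lra.
have [C0 C00 h] := potential_Lp eps0 hp.
have M0 : 0 <= c `^ p * C0 by rewrite mulr_ge0 ?powR_ge0.
exists ((c `^ p * C0) `^ p^-1); first exact: powR_ge0.
move=> phi psi rp _; rewrite !Lp_norm_vol_power.
have vA0 : (0 <= vol_power A p phi)%E by apply: integral_ge0 => z _; exact: poweR_ge0.
have [mp _ np] := rp.
rewrite -poweR_EFin -poweRM ?lee_fin //; apply: poweR_le; first by rewrite invr_ge0 ltW.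
  by apply: integral_ge0 => z _; exact: poweR_ge0.
(* The pointwise bound passes from [form_norm], a supremum over frames, to the measurable
   potential. *)
apply: (@le_trans _ _ (\int[vol]_z ((c `^ p)%:E * (((fun z => potential psi z `^ p) \_ B) z)))%E).
  apply: ge0_le_integralW => z _; first exact: poweR_ge0.
  rewrite !patchE; case: ifP => [/set_mem Bz|_]; last first.
    by rewrite mule0 abse0 poweR_EFin powR0 ?gt_eqF.
  rewrite -poweR_EFin -poweRM ?lee_fin ?(ltW c0) ?potential_ge0 //.
  apply: poweR_le; rewrite ?abse_ge0 ?(ltW p0) //.
  by rewrite gee0_abs ?lee_fin ?form_norm_ge0 //; exact: hc.
rewrite ge0_integralZl ?lee_fin ?powR_ge0 //; last 2 first.
- apply/(measurable_restrictT _ (measurable_Xball (1 : R))); apply: measurable_funTS.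
  exact: measurableT_comp (measurable_poweR p) (measurable_potential mp).
- by move=> z _; rewrite patchE; case: ifP => // _; exact: poweR_ge0.
rewrite EFinM -muleA; apply: lee_wpmul2l; first by rewrite lee_fin powR_ge0.
exact: h.
Qed.

Lemma koppelman_bounded_linear (p : \bar R) q : ((4 / 3)%:E < p)%E -> (0 < q <= 2)%N ->
  bounded_linear_Lp A B p q q.-1 K.
Proof.
move=> hp hq; have [M M0 hM] := koppelman_Lp_bound hp; split.
- move=> phi [hom mf nf]; have [psi rp] := representative_exists mf; split.
  + by move=> z Bz _; exact: koppelman_homogeneous.
  + exact: koppelman_measurable rp.
  + by apply: le_lt_trans (hM phi psi rp nf) _; rewrite lte_mul_pinfty // lee_fin.
- move=> phi1 phi2 [_ m1 _] [_ m2 _] ae; have [psi1 r1] := representative_exists m1.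
  have [psi2 r2] := representative_exists m2.
  by apply: aeW => z Bz; rewrite (koppelman_ae r1 r2 ae Bz).
- move=> a phi1 phi2 [_ m1 n1] [_ m2 n2]; have [psi1 r1] := representative_exists m1.
  have [psi2 r2] := representative_exists m2.
  apply: filterS2 (potential_ae_lty hp r1 n1) (potential_ae_lty hp r2 n2) => z h1 h2 Bz.
  by rewrite (koppelman_linear a r1 r2 Bz (h1 Bz) (h2 Bz)).
- exists M => phi [_ mf nf]; have [psi rp] := representative_exists mf; exact: hM rp nf.
Qed.

End LpBoundedness.

(** * Continuity *)

Section ComplexDominated.
Context d (T : measurableType d) (R : realType) (mu : {measure set T -> \bar R}).
Local Notation C := (complex R).

Lemma Rintegral_dominated (h_ : nat -> T -> R) (h g : T -> R) :
  (forall n, measurable_fun setT (h_ n)) -> measurable_fun setT h ->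
  {ae mu, forall x, (fun n => h_ n x) @ \oo --> h x} ->
  mu.-integrable setT (EFin \o g) -> (forall n x, `|h_ n x| <= g x) ->
  (fun n => \int[mu]_x h_ n x) @ \oo --> \int[mu]_x h x.
Proof.
move=> mh_ mh cv ig hg.
have m_ n : measurable_fun setT (EFin \o h_ n) by exact/measurable_EFinP.
have m : measurable_fun setT (EFin \o h) by exact/measurable_EFinP.
have cv' : {ae mu, forall x, [set: T] x -> (EFin \o h_ n) x @[n --> \oo] --> (EFin \o h) x}.
  by apply: filterS cv => x hx _; exact: cvg_EFin (nearW _ _) hx.
have dom : {ae mu, forall x n, [set: T] x -> (`|(EFin \o h_ n) x| <= (EFin \o g) x)%E}.
  by apply: aeW => x n _; rewrite lee_fin.
have [ih _ lim] := dominated_convergence measurableT m_ m cv' ig dom.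
have fi : (\int[mu]_x (h x)%:E)%E \is a fin_num by exact: integrable_fin_num ih.
by apply: fine_cvg; rewrite fineK.
Qed.

Lemma cint_dominated (f_ : nat -> T -> C) (f : T -> C) (g : T -> R) :
  (forall n, cmeas setT (f_ n)) -> cmeas setT f ->
  {ae mu, forall x, ccvg \oo (fun n => f_ n x) (f x)} ->
  mu.-integrable setT (EFin \o g) -> (forall n x, cnorm (f_ n x) <= g x) ->
  ccvg \oo (fun n => cint mu (f_ n)) (cint mu f).
Proof.
move=> mf_ [mr mi] cv ig hg; split; apply: Rintegral_dominated ig _ => //.
- by move=> n; have [] := mf_ n.
- by apply: filterS cv => x [].
- by move=> n x; exact: le_trans (cnorm_Re _) (hg n x).
- by move=> n; have [] := mf_ n.
- by apply: filterS cv => x [].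
- by move=> n x; exact: le_trans (cnorm_Im _) (hg n x).
Qed.

End ComplexDominated.

(** * Truncated kernels and continuity of the image of a bounded form *)

Section Continuity.
Variable R : realType.
Local Notation C := (complex R).
Local Notation leb4 := (@leb4 R).
Implicit Types (z : C3 R) (w v : C2 R) (phi psi : C3 R -> ext R 3).

Lemma ccvg_cnorm (f : nat -> C) (l : C) (e : R) : ccvg \oo f l -> 0 < e ->
  \forall n \near \oo, cnorm (f n - l) < e.
Proof.
move=> [/cvgrPdist_lt fr /cvgrPdist_lt fi] e0.
have e2 : 0 < e / 2 by rewrite divr_gt0.
near=> n; apply: le_lt_trans (cnorm_ReIm _) _.
have er : `|complex.Re l - complex.Re (f n)| < e / 2 by near: n; exact: fr.
have ei : `|complex.Im l - complex.Im (f n)| < e / 2 by near: n; exact: fi.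
have -> : complex.Re (f n - l) = complex.Re (f n) - complex.Re l by case: (f n) (l) => ? ? [].
have -> : complex.Im (f n - l) = complex.Im (f n) - complex.Im l by case: (f n) (l) => ? ? [].
by rewrite distrC [`|complex.Im _ - _|]distrC; lra.
Unshelve. all: by end_near.
Qed.

Lemma cnorm_ReB (a b : C) : `|complex.Re a - complex.Re b| <= cnorm (a - b).
Proof. by apply: le_trans (cnorm_Re _); case: a; case: b. Qed.

Lemma cnorm_ImB (a b : C) : `|complex.Im a - complex.Im b| <= cnorm (a - b).
Proof. by apply: le_trans (cnorm_Im _); case: a; case: b. Qed.

Lemma cnorm_triangle3 (a b s t : C) (e : R) : 0 < e -> cnorm (a - s) <= e / 4 ->
  cnorm (s - t) < e / 4 -> cnorm (b - t) <= e / 4 -> cnorm (a - b) < e.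
Proof.
move=> e0 i1 i2 i3; have -> : a - b = (a - s) + (s - t) - (b - t) by ring.
apply: le_lt_trans (cnormB _ _) _.
apply: le_lt_trans (lerD (cnormD _ _) (lexx _)) _.
apply: le_lt_trans (lerD (lerD i1 (ltW i2)) i3) _; lra.
Qed.

(** By contraposition: if the limit failed, a sequence in [D] converging to [x] could be chosen with
    all its values at least e away from f x. One term close to f x refutes this, hence the
    existential in the hypothesis. *)
Lemma within_cvg_seq (D : set (C3 R)) (f : C3 R -> R) (x : C3 R) :
  (forall u : nat -> C3 R, (forall n, D (u n)) -> u @ \oo --> x ->
     forall e, 0 < e -> exists n, `|f (u n) - f x| < e) ->
  f @ within D (nbhs x) --> f x.
Proof.
move=> hf; apply/cvgrPdist_lt => e e0; apply: contrapT => nh.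
have H n : exists z, [/\ ball x (n.+1%:R^-1 : R) z, D z & e <= `|f z - f x|].
  apply: contrapT => nz; apply: nh; rewrite /within /=.
  have : nbhs x (ball x (n.+1%:R^-1 : R)) by apply: nbhsx_ballx; rewrite invr_gt0.
  apply: filterS => z bz Dz; rewrite distrC ltNge; apply/negP => ez.
  by apply: nz; exists z.
have [u hu] := choice H.
have ux : u @ \oo --> x.
  apply/cvg_ballP => r r0; near=> n; have [bu _ _] := hu n.
  apply: le_ball bu; apply: ltW; near: n; exact: near_infty_natSinv_lt (PosNum r0).
have [n] := hf u (fun n => let: And3 _ Du _ := hu n in Du) ux e e0.
by have [_ _] := hu n; rewrite leNgt => /negP.
Unshelve. all: by end_near.
Qed.

(** The factor t^3 cancels the singularity |eta|^(-3), so the truncated kernel is bounded; for c =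
    r^(-3) nothing changes at distance r or more. Being continuous, it preserves convergence of the
    kernel in z. *)
Definition trunc (c t : R) : R := Num.min 1 (t ^+ 3 * c).

Lemma continuous_trunc c : continuous (trunc c).
Proof.
move=> t.
have h1 : {for t, continuous (fun _ : R => 1 : R^o)} by exact: cvg_cst.
have h2 : {for t, continuous (fun t : R => t ^+ 3 * c : R^o)}.
  by apply: cvgM; [exact: exprn_continuous|exact: cvg_cst].
exact: (continuous_min h1 h2).
Qed.

Lemma trunc_ge0 c t : 0 <= c -> 0 <= t -> 0 <= trunc c t.
Proof. by move=> c0 t0; rewrite le_min ler01 mulr_ge0 ?exprn_ge0. Qed.

Lemma trunc_le1 c t : trunc c t <= 1.
Proof. by rewrite ge_min lexx. Qed.

Lemma trunc_le c t : trunc c t <= t ^+ 3 * c.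
Proof. by rewrite ge_min lexx orbT. Qed.

Lemma trunc_eq1 (r t : R) : 0 < r -> r <= t -> trunc (r ^- 3) t = 1.
Proof.
move=> r0 rt; apply/min_idPl; rewrite ler_pdivlMr ?exprn_gt0 // mul1r.
by rewrite lerXn2r ?nnegrE ?(ltW r0) // (le_trans (ltW r0)).
Qed.

Variables (eps : R) (chi : C3 R -> R).
Hypothesis eps0 : 0 < eps.
Hypothesis hchi : cutoff eps chi.
Local Notation A := (@Xball R (1 + eps)).
Local Notation B := (@Xball R 1).
Local Notation K := (koppelman eps chi).
Local Notation rep := (@representative R eps).

(** Setting the representative to 0 where its norm exceeds L turns the almost everywhere bound into
    one at every point. The change is null after pull-back, so all coefficients of the operator stay
    the same. *)
Lemma representative_truncate psi (L : R) : rep psi psi -> 0 <= L ->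
  {ae leb4, forall w, pulled_norm psi w <= L} ->
  exists psi', [/\ rep psi' psi', forall w, pulled_norm psi' w <= L &
    forall z J, koppelman_coef chi psi z J = koppelman_coef chi psi' z J].
Proof.
move=> [mp ep np] L0 hL; pose N := [set z | std_frame_norm z (psi z) <= L].
have mf : measurable_fun setT (fun z => std_frame_norm z (psi z)) by exact: measurable_std_frame_norm.
have mN : measurable N.
  have -> : N = [set z | (std_frame_norm z (psi z) <= L) = true] by apply/seteqP; split => z.
  have m : measurable_fun setT (fun z => std_frame_norm z (psi z) <= L).
    by apply: measurable_fun_ler => //; exact: measurable_cst.
  by rewrite -[X in measurable X]setTI; exact: (m measurableT [set true]).
pose psi' z := if z \in N then psi z else 0.
have mp' I : cmeas setT (fun z => psi' z I).
  have [mr mi] := mp I; split.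
    rewrite (_ : (fun z => _) = (fun z => complex.Re (psi z I)) \_ N).
      by apply/(measurable_restrictT _ mN); exact: measurable_funTS.
    by apply/funext => z; rewrite /psi' patchE; case: ifP => // _; rewrite ffunE.
  rewrite (_ : (fun z => _) = (fun z => complex.Im (psi z I)) \_ N).
    by apply/(measurable_restrictT _ mN); exact: measurable_funTS.
  by apply/funext => z; rewrite /psi' patchE; case: ifP => // _; rewrite ffunE.
have np' z : ~ A z -> psi' z = 0 by move=> Az; rewrite /psi' np // if_same.
exists psi'; split; first by split.
  by move=> w; rewrite /pulled_norm /psi'; case: ifP => [/set_mem //|_]; rewrite std_frame_norm_0.
move=> z J; rewrite /koppelman_coef; congr (_ * _).
apply: cint_ae; [exact: (cmeas_rep_density hchi)|exact: (cmeas_rep_density hchi)|].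
apply: filterS hL => w hw; rewrite /rep_density; congr (dens _ _ _ _).
by rewrite /psi' mem_set.
Qed.

Section Bounded.
Variables (psi : C3 R -> ext R 3) (L : R) (J : {set 'I_3}).
Hypothesis rp : rep psi psi.
Hypothesis L0 : 0 <= L.
Hypothesis hL : forall w, pulled_norm psi w <= L.

Definition tdens (c : R) z w : C := (trunc c (distC3 (cover w, z)))%:C%C * rep_density chi psi z J w.

Let mp : forall I, cmeas setT (fun z => psi z I). Proof. by case: rp. Qed.
Let np : forall z, ~ A z -> psi z = 0. Proof. by case: rp. Qed.

Lemma measurable_distC3_cover z : measurable_fun setT (fun w : C2 R => distC3 (cover w, z)).
Proof.
apply: measurable_distC3; [exact: Defs.measurable_cover|exact: measurable_cst].
Qed.

Lemma cmeas_tdens c z : cmeas setT (tdens c z).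
Proof.
apply: cmeasM; last exact: (cmeas_rep_density hchi).
apply: cmeas_real; apply: measurableT_comp (measurable_distC3_cover z).
by apply: continuous_measurable_fun; exact: continuous_trunc.
Qed.

Lemma tdens_bound : exists2 M : R, 0 <= M & forall c z w, 0 <= c -> B z ->
  cnorm (tdens c z w) <= M * c * \1_(wdisc eps) w.
Proof.
have [k k0 hk] := rep_density_bound eps0 hchi; have r0 := radius_gt0 eps0.
have [r2 rE] : exists r2, r2 = radius eps ^+ 2 by exists (radius eps ^+ 2).
have r20 : 0 <= r2 by rewrite rE sqr_ge0.
have Q0 : 0 <= r2 * (r2 + 1) by apply: mulr_ge0 => //; exact: addr_ge0 r20 ler01.
exists (k * (r2 * (r2 + 1)) * L).
  by apply: mulr_ge0 L0; exact: mulr_ge0 (ltW k0) Q0.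
move=> c z w c0 Bz; have e0 := distC3_ge0 (cover w, z).
have t0 := trunc_ge0 c0 e0; rewrite /tdens cnormM cnorm_real (ger0_norm t0).
have hp := hk psi z J w np Bz; rewrite indicE.
have [Dw|Dw] := pselect (wdisc eps w); last first.
  have hp0 : cnorm (rep_density chi psi z J w) <= 0.
    by move: hp; rewrite (pulled_norm_out eps0 np Dw) !mulr0.
  by rewrite memNset // mulr0; exact: mulr_ge0_le0.
rewrite mem_set // mulr1; apply: le_trans (ler_wpM2l t0 hp) _.
have hF := hL w; have F0 := pulled_norm_ge0 psi w; have w0 := normC2_ge0 w.
have zw := normC3_cover_le w; have zw0 := normC3_ge0 (cover w); have z0 := normC3_ge0 z.
have z1 := Xball_normC3 Bz; have w2 : normC2 w ^+ 2 <= r2.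
  by rewrite rE lerXn2r ?nnegrE // ltW.
have tk : trunc c (distC3 (cover w, z)) * majorant w z <= c * (r2 * (r2 + 1)).
  have q0 : 0 <= normC2 w ^+ 2 * (normC3 (cover w) + normC3 z) by rewrite mulr_ge0 ?sqr_ge0 ?addr_ge0.
  have q1 : normC2 w ^+ 2 * (normC3 (cover w) + normC3 z) <= r2 * (r2 + 1).
    by apply: ler_pM; [exact: sqr_ge0|exact: addr_ge0|exact: w2|exact: lerD (le_trans zw w2) (ltW z1)].
  rewrite /majorant; have [->|en0] := eqVneq (distC3 (cover w, z)) 0.
    by rewrite expr0n invr0 !mulr0; apply: mulr_ge0 c0 _; exact: le_trans q1.
  have ep : 0 < distC3 (cover w, z) by rewrite lt_neqAle eq_sym en0.
  apply: le_trans (ler_wpM2r (_ : 0 <= _) (trunc_le c _)) _.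
    by rewrite mulr_ge0 ?invr_ge0 ?exprn_ge0.
  rewrite (_ : _ ^+ 3 * c * _ = c * (normC2 w ^+ 2 * (normC3 (cover w) + normC3 z))); last first.
    by field; rewrite ?en0.
  by rewrite ler_wpM2l.
rewrite (_ : trunc c _ * _ = k * (trunc c (distC3 (cover w, z)) * majorant w z * pulled_norm psi w)); last first.
  by move: (trunc _ _) (majorant _ _) (pulled_norm _ _) => a b d; ring.
rewrite (_ : k * _ * L * c = k * (c * (r2 * (r2 + 1)) * L)); last by ring.
rewrite ler_wpM2l ?(ltW k0) //; apply: ler_pM => //.
by rewrite mulr_ge0 ?majorant_ge0.
Qed.

Lemma leb4_wdisc_lty : (leb4 (wdisc eps) < +oo)%E.
Proof.
have r0 := ltW (radius_gt0 eps0).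
apply: (@le_lt_trans _ _ (leb4 (box 0 (radius eps)))); last by rewrite leb4_box // ltry.
apply: le_measure; rewrite ?inE; [exact: measurable_wdisc|exact: measurable_box|].
by move=> w hw; apply: box_normC2; rewrite subr0.
Qed.

Lemma integrable_wdisc (M : R) : leb4.-integrable setT (EFin \o (fun w => M * \1_(wdisc eps) w)).
Proof.
have mW := @measurable_wdisc R eps.
apply: (integrableZl measurableT M (f := EFin \o \1_(wdisc eps))).
apply/integrableP; split; first by apply/measurable_EFinP; exact: measurable_indic.
have -> : (\int[leb4]_w `|(EFin \o \1_(wdisc eps)) w| = \int[leb4]_w (\1_(wdisc eps) w)%:E)%E.
  by apply: eq_integral => w _; rewrite gee0_abs // lee_fin indicE.
by rewrite integral_indic // setIT; exact: leb4_wdisc_lty.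
Qed.

(** Dominated convergence with a multiple of the indicator of the disc. For x = cover v, pointwise
    convergence is only in doubt at the two preimages v and -v. *)
Lemma cint_tdens_cvg c (u : nat -> C3 R) x : 0 <= c -> B x -> (forall n, B (u n)) ->
  u @ \oo --> x -> ccvg \oo (fun n => cint leb4 (tdens c (u n))) (cint leb4 (tdens c x)).
Proof.
move=> c0 Bx Bu ux; have [M M0 hM] := tdens_bound.
apply: (cint_dominated (g := fun w => M * c * \1_(wdisc eps) w)).
- by move=> n; exact: cmeas_tdens.
- exact: cmeas_tdens.
- have [v vx] := cover_surj Bx.2.
  have n0 : leb4.-negligible ([set v] `|` [set - v]).
    apply: negligibleU; [exists [set v]|exists [set - v]];
      by split => //; [exact: measurable_set1_C2|exact: leb4_set1].
  apply: negligibleS n0 => w /= nw; apply: contrapT => wv; apply: nw.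
  have wx : cover w <> x.
    rewrite -vx => /cover_fiber[e|e]; apply: wv; [left|right].
      by [].
    by rewrite e opprK.
  apply: ccvgM.
    have ce : (fun n => distC3 (cover w, u n)) @ \oo --> distC3 (cover w, x) by exact: cvg_distC3 ux.
    split; last exact: cvg_cst.
    by apply: continuous_cvg ce; exact: continuous_trunc.
  apply: ccvg_dens => k _; apply: (ccvg_ecoef ux wx k hchi); exact: Xball_normC3.
- exact: integrable_wdisc.
- by move=> n w; exact: hM.
Qed.

(** The truncation factor with c = r^(-3) is 1 at distance at least r, so the difference lives where
    |eta| < r, and there [majorant_integral_diag] makes it small uniformly in z. *)
Lemma koppelman_coef_tdens_close : exists2 M : R, 0 <= M & forall e, 0 < e -> exists2 c : R, 0 <= c &
  forall z, B z -> cnorm (koppelman_coef chi psi z J - 2^-1 * cint leb4 (tdens c z)) <= M * e.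
Proof.
have [k k0 hk] := rep_density_bound eps0 hchi; exists (k * L); first by rewrite mulr_ge0 // ltW.
move=> e e0; have [r r0 hr] := majorant_integral_diag (radius_gt0 eps0) e0.
have c0 : 0 <= r ^- 3 by rewrite invr_ge0 exprn_ge0 // ltW.
exists (r ^- 3) => // z Bz; have [v vz] := cover_surj Bz.2.
have pf : (potential psi z < +oo)%E.
  have [C0 C00 hC] := cut_majorant_integral eps0.
  rewrite -vz in Bz *; rewrite (potential_cut_majorant eps0 np Bz).
  apply: (@le_lt_trans _ _ (\int[leb4]_w (L%:E * (cut_majorant eps w v)%:E))%E).
    apply: ge0_le_integralW => w _; first by rewrite lee_fin mulr_ge0 ?cut_majorant_ge0 ?pulled_norm_ge0.
    by rewrite -EFinM lee_fin mulrC ler_wpM2r ?cut_majorant_ge0.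
  have mk : measurable_fun setT (fun w => (cut_majorant eps w v)%:E).
    apply/measurable_EFinP.
    have m : measurable_fun setT (fun w : C2 R => (w, v)).
      by apply: measurable_fun_pair => //; exact: measurable_cst.
    exact: measurableT_comp (@measurable_cut_majorant R eps) m.
  rewrite ge0_integralZl ?lee_fin //; last by move=> w _; rewrite lee_fin cut_majorant_ge0.
  by apply: le_lt_trans (lee_wpmul2l _ (hC v)) _; rewrite ?lee_fin // -EFinM ltry.
have ip := potential_integrable eps0 hchi J rp Bz pf.
have [Mt Mt0 hMt] := tdens_bound.
have it : cintegrable leb4 (tdens (r ^- 3) z).
  apply: (cintegrable_le (cmeas_tdens _ z) (fun w => hMt (r ^- 3) z w c0 Bz)).
  have /integrableP[_] := integrable_wdisc (Mt * r ^- 3).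
  apply: le_lt_trans; apply: ge0_le_integralW => w _; last by rewrite lee_fin ler_norm.
  by rewrite lee_fin mulr_ge0 // mulr_ge0.
rewrite /koppelman_coef -mulrBr cnormM.
have -> : cnorm (2^-1 : C) = 2^-1.
  have -> : (2^-1 : C) = (2^-1 : R)%:C%C by rewrite fmorphV rmorph_nat.
  by rewrite cnorm_real ger0_norm.
have -> : cint leb4 (rep_density chi psi z J) - cint leb4 (tdens (r ^- 3) z) =
    cint leb4 (fun w => -1 * tdens (r ^- 3) z w + rep_density chi psi z J w).
  by rewrite cint_linear // mulN1r addrC.
pose D := wdisc eps `&` [set w | distC3 (cover w, z) < r].
have mD : measurable D.
  apply: measurableI; first exact: measurable_wdisc.
  have -> : [set w : C2 R | distC3 (cover w, z) < r] = [set w | (distC3 (cover w, z) < r) = true].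
    by apply/seteqP; split => w.
  have m : measurable_fun setT (fun w : C2 R => distC3 (cover w, z) < r).
    by apply: measurable_fun_ltr; [exact: measurable_distC3_cover|exact: measurable_cst].
  by rewrite -[X in measurable X]setTI; exact: (m measurableT [set true]).
pose g w : R := k * L * (majorant w z * \1_D w).
have hg w : cnorm (-1 * tdens (r ^- 3) z w + rep_density chi psi z J w) <= g w.
  have e1 := distC3_ge0 (cover w, z).
  have -> : -1 * tdens (r ^- 3) z w + rep_density chi psi z J w =
      (1 - trunc (r ^- 3) (distC3 (cover w, z)))%:C%C * rep_density chi psi z J w.
    by rewrite /tdens rmorphB rmorph1 mulrBl mul1r mulN1r addrC.
  have t1 := trunc_le1 (r ^- 3) (distC3 (cover w, z)); have t0 := trunc_ge0 c0 e1.
  have s0 : 0 <= 1 - trunc (r ^- 3) (distC3 (cover w, z)) by rewrite subr_ge0.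
  rewrite cnormM cnorm_real (ger0_norm s0) /g indicE.
  have hp := hk psi z J w np Bz; have kk := majorant_ge0 w z; have F0 := pulled_norm_ge0 psi w.
  have [Dw|Dw] := pselect (D w).
    rewrite mem_set // mulr1 -[leRHS]mul1r; apply: ler_pM; rewrite ?cnorm_ge0 //.
      by rewrite gerBl.
    apply: le_trans hp _; rewrite -mulrA ler_wpM2l ?(ltW k0) // mulrC.
    by rewrite ler_wpM2r.
  rewrite memNset // !mulr0; have [wd|wd] := pselect (wdisc eps w).
    rewrite trunc_eq1 ?subrr ?mul0r //; rewrite leNgt; apply/negP => lt; apply: Dw.
    by split.
  by move: hp; rewrite (pulled_norm_out eps0 np wd) !mulr0 => hp; apply: mulr_ge0_le0.
have mg : cmeas setT (fun w => -1 * tdens (r ^- 3) z w + rep_density chi psi z J w).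
  apply: cmeasD; last exact: (cmeas_rep_density hchi).
  by apply: cmeasM; [exact: cmeas_cst|exact: cmeas_tdens].
have := cnorm_cint_le leb4 mg hg.
have kL0 : 0 <= k * L by rewrite mulr_ge0 // ltW.
have -> : (\int[leb4]_w (g w)%:E = (k * L)%:E * \int[leb4]_(w in D) (majorant w z)%:E)%E.
  have mkz : measurable_fun setT (fun w => majorant w z).
    have m : measurable_fun setT (fun w : C2 R => (z, w)).
      by apply: measurable_fun_pair => //; exact: measurable_cst.
    exact: measurableT_comp (@measurable_majorant_pair R) m.
  under eq_integral do rewrite /g EFinM.
  rewrite ge0_integralZl ?lee_fin //; last 2 first.
  - apply/measurable_EFinP; apply: measurable_funM => //; exact: measurable_indic.
  - by move=> w _; rewrite lee_fin mulr_ge0 ?majorant_ge0.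
  congr (_ * _)%E; rewrite [RHS]integral_mkcond; apply: eq_integral => w _.
  by rewrite patchE indicE; case: ifP => _; rewrite ?mulr1 ?mulr0.
have hD : (\int[leb4]_(w in D) (majorant w z)%:E <= e%:E)%E.
  rewrite -vz in Bz *; apply: hr => //; first by apply: Xball_rad => //; exact: Xball_sub Bz.
  by move=> w [wd /=]; rewrite -vz.
move=> h; rewrite -lee_fin EFinM.
apply: le_trans (lee_wpmul2l _ h) _; first by rewrite lee_fin.
rewrite muleA -EFinM mulVf // mul1e (EFinM (k * L)).
by apply: lee_wpmul2l; rewrite ?lee_fin.
Qed.

Lemma koppelman_coef_cvg (u : nat -> C3 R) x (e : R) : B x -> (forall n, B (u n)) -> u @ \oo --> x ->
  0 < e -> exists n, cnorm (koppelman_coef chi psi (u n) J - koppelman_coef chi psi x J) < e.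
Proof.
move=> Bx Bu ux e0; have [M M0 hM] := koppelman_coef_tdens_close.
(* With M + 1 for M, so that M times this number is at most e/4 even if M = 0. *)
have e1 : 0 < e / (4 * (M + 1)) by rewrite divr_gt0 // mulr_gt0 // ltr_wpDl.
have [c c0 hc] := hM _ e1.
have Me : M * (e / (4 * (M + 1))) <= e / 4.
  have M1 : 0 < M + 1 by rewrite ltr_wpDl.
  rewrite (_ : M * _ = e / 4 * (M / (M + 1))); last by field; rewrite gt_eqF.
  by rewrite ler_piMr ?divr_ge0 ?(ltW e0) // ler_pdivrMr // mul1r lerDl.
have e4 : 0 < e / 4 by rewrite divr_gt0.
have cc : ccvg \oo (fun n => 2^-1 * cint leb4 (tdens c (u n))) (2^-1 * cint leb4 (tdens c x)).
  by apply: ccvgM; [exact: ccvg_cst|exact: cint_tdens_cvg].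
have [n _ hn] := ccvg_cnorm cc e4; exists n; have {}hn := hn n (leqnn n).
have h1 := le_trans (hc _ (Bu n)) Me; have h2 := le_trans (hc _ Bx) Me.
exact: cnorm_triangle3 e0 h1 hn h2.
Qed.

End Bounded.

Lemma koppelman_continuous phi q : (0 < q <= 2)%N -> Lp_form A +oo%E q phi ->
  C0_form B q.-1 (K phi).
Proof.
move=> hq [hom mf nf] x Bx; have [psi rp] := representative_exists mf.
have n0 : (0 <= Lp_norm A +oo phi)%E by rewrite Lnorm_ge0.
have fn : Lp_norm A +oo phi \is a fin_num by rewrite ge0_fin_numE.
have fL : (Lp_norm A +oo phi <= (fine (Lp_norm A +oo phi))%:E)%E by rewrite fineK.
have [C0 C00 h] := potential_Linfty eps0; have [hL _] := h phi psi _ rp (fine_ge0 n0) fL.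
have [psi' [rp' hL' cE]] := representative_truncate (representative_self rp) (fine_ge0 n0) hL.
have kE z J : B z -> K phi z J = koppelman_coef chi psi' z J.
  by move=> Bz; rewrite (koppelmanE eps0 hchi J rp Bz) cE.
have hK z : B z -> homogeneous q.-1 (K phi z) by move=> _; exact: koppelman_homogeneous.
move: (K phi) kE hK => F kE hK.
(* The operator produces ambient coefficients, so the image serves as its own continuous
   representative. *)
exists F; split; first by move=> z Bz; split; [exact: hK|].
move=> J; have cv := koppelman_coef_cvg J rp' (fine_ge0 n0) hL'.
split; apply: within_cvg_seq => u Bu ux e e0; have [n hn] := cv u x e Bx Bu ux e0;
  exists n; rewrite (kE _ J (Bu n)) (kE _ J Bx).
  exact: le_lt_trans (cnorm_ReB _ _) hn.
exact: le_lt_trans (cnorm_ImB _ _) hn.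
Qed.

End Continuity.

(** * Continuity from L^infinity to C^0 *)

Section LinftyContinuity.
Variable R : realType.
Local Notation C := (complex R).
Variables (eps : R) (chi : C3 R -> R).
Hypothesis eps0 : 0 < eps.
Hypothesis hchi : cutoff eps chi.
Local Notation A := (@Xball R (1 + eps)).
Local Notation B := (@Xball R 1).
Local Notation K := (koppelman eps chi).
Local Notation rep := (@representative R eps).
Implicit Types (z : C3 R) (phi psi : C3 R -> ext R 3).

Lemma potential_lty phi psi z : rep phi psi -> (Lp_norm A +oo phi < +oo)%E -> B z ->
  (potential psi z < +oo)%E.
Proof.
move=> rp hn Bz; have [C0 C00 h] := potential_Linfty eps0.
have n0 : (0 <= Lp_norm A +oo phi)%E by rewrite Lnorm_ge0.
have fn : Lp_norm A +oo phi \is a fin_num by rewrite ge0_fin_numE.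
have fL : (Lp_norm A +oo phi <= (fine (Lp_norm A +oo phi))%:E)%E by rewrite fineK.
have [_ hz] := h phi psi _ rp (fine_ge0 n0) fL.
exact: le_lt_trans (hz z Bz) (ltry _).
Qed.

Lemma koppelman_sup_bound : exists2 M : R, 0 <= M & forall phi psi (L : R), rep phi psi ->
  0 <= L -> (Lp_norm A +oo phi <= L%:E)%E ->
  forall z, B z -> form_norm z (K phi z) <= M * L.
Proof.
have [c c0 hc] := koppelman_form_norm eps0 hchi; have [C0 C00 h] := potential_Linfty eps0.
exists (c * C0); first by rewrite mulr_ge0 // ltW.
move=> phi psi L rp L0 nL z Bz; have [_ hz] := h phi psi L rp L0 nL.
rewrite -lee_fin; apply: le_trans (hc phi psi z rp Bz) _.
by rewrite -mulrA EFinM; apply: lee_wpmul2l; [rewrite lee_fin ltW|exact: hz].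
Qed.

(** By linearity, continuity at [phi] is the uniform bound applied to psi - phi; that bound holds on
    all of X and therefore on every compact subset. *)
Lemma koppelman_continuous_linear q : (0 < q <= 2)%N ->
  continuous_linear_Linfty_C0 A B q q.-1 K.
Proof.
move=> hq; split.
- by move=> phi; exact: koppelman_continuous.
- move=> phi1 phi2 [_ m1 _] [_ m2 _] ae z Bz.
  have [psi1 r1] := representative_exists m1; have [psi2 r2] := representative_exists m2.
  by rewrite (koppelman_ae eps0 hchi r1 r2 ae Bz).
- move=> a phi1 phi2 [_ m1 n1] [_ m2 n2] z Bz.
  have [psi1 r1] := representative_exists m1; have [psi2 r2] := representative_exists m2.
  by rewrite (koppelman_linear eps0 hchi a r1 r2 Bz (potential_lty r1 n1 Bz) (potential_lty r2 n2 Bz)).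
move=> phi [_ m1 n1] D _ DB e e0; have [M M0 hM] := koppelman_sup_bound.
have M1 : 0 < M + 1 by rewrite ltr_wpDl.
exists (e / (M + 1)); first by rewrite divr_gt0.
move=> psi [_ m2 n2] hd; have [phi' r1] := representative_exists m1.
have [psi' r2] := representative_exists m2.
have r := representative_linear (-1) r1 r2.
(* The difference is put into the shape a phi + psi for which the linearity statements are made. *)
have E : (fun z => psi z - phi z) = (fun z => -1 *: phi z + psi z).
  by apply/funext => z; rewrite scaleN1r addrC.
have d0 : 0 <= e / (M + 1) by rewrite divr_ge0 ?ltW.
rewrite E in hd; have hK := hM _ _ _ r d0 (ltW hd).
apply: (@le_lt_trans _ _ (M * (e / (M + 1)))%:E); last first.
  rewrite lte_fin mulrA ltr_pdivrMr // mulrDr mulr1 mulrC ltrDl //.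
apply: Lp_norm_oo_le => [|z Dz]; first exact: mulr_ge0.
have Bz := DB z Dz.
have -> : K psi z - K phi z = K (fun z => -1 *: phi z + psi z) z.
  rewrite (koppelman_linear eps0 hchi (-1) r1 r2 Bz (potential_lty r1 n1 Bz) (potential_lty r2 n2 Bz)).
  by rewrite scaleN1r addrC.
exact: hK.
Qed.

End LinftyContinuity.

(** The integrability clauses ensure that the operator is given by convergent integrals and not by
    the default value of a divergent one: at almost every z for L^p forms, and at every z for
    bounded forms. *)
Theorem theorem1p1 (R : realType) (eps : R) (chi : C3 R -> R)
    (p : \bar R) (q : nat)
    (heps : 0 < eps) (hchi : cutoff eps chi)
    (hp : ((4 / 3)%:E < p)%E) (hq : q = 1%N \/ q = 2%N) :
  ((forall phi, Lp_form (Xball (1 + eps)) p q phi ->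
      {ae @vol R, forall z, Xball (1 : R) z ->
         koppelman_integrable eps chi phi z}) /\
   bounded_linear_Lp (Xball (1 + eps)) (Xball 1) p q q.-1 (koppelman eps chi)) /\
  ((forall phi, Lp_form (Xball (1 + eps)) +oo%E q phi ->
      forall z, Xball (1 : R) z -> koppelman_integrable eps chi phi z) /\
   continuous_linear_Linfty_C0 (Xball (1 + eps)) (Xball 1) q q.-1
     (koppelman eps chi)).
Proof.
have hq2 : (0 < q <= 2)%N by case: hq => ->.
split; split.
- move=> phi [_ mf nf]; have [psi rp] := representative_exists mf.
  apply: filterS (potential_ae_lty heps hp rp nf) => z hz Bz.
  exact: (koppelman_integrable_potential heps hchi rp Bz (hz Bz)).
- exact: koppelman_bounded_linear.
- move=> phi [_ mf nf] z Bz; have [psi rp] := representative_exists mf.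
  exact: (koppelman_integrable_potential heps hchi rp Bz (potential_lty heps rp nf Bz)).
- exact: koppelman_continuous_linear.
Qed.
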